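(* Let $c_n$, $n\ge 0$, have ordinary generating function $\sum_{n\ge 0}c_nz^n=f(z)=\prod_{k=1}^\infty S(a_kz^k)^{b_k}$ with $0<a_k\le 1$ and $b_k\ge 0$ for $k\ge 1$, in the setting described in the context. Suppose that conditions (I), (II) and (III) stated in the context hold (in particular $b_ka_k^{l_0}\ge C_2k^{\rho_r-1}$, $k\ge 1$, for a constant $C_2>0$), and that $$\frac{d^2}{d\delta^2}\log S\left(e^{-\delta}\right)>0,\qquad \delta>0.$$ Then there are constants $H$, $P_l$, $\hat h_l$ and $K_{s,l}$ (not depending on $n$) such that, as $n\to\infty$, $$c_n\sim H\,n^{-\frac{2+\rho_r-2A_0}{2(\rho_r+1)}}\exp\left(\sum_{l=0}^{r}P_l\,n^{\frac{\rho_l}{\rho_r+1}}+\sum_{l=0}^r\hat h_l\sum_{s:\lambda_s\le\rho_l}K_{s,l}\,n^{\frac{\rho_l-\lambda_s}{\rho_r+1}}\right).$$ In particular, if $r=1$, then this holds with $K_{s,l}=0$ for all $s$ and $l$, $P_0=0$, $$P_1=\left(1+\frac1{\rho_1}\right)\big(A_1\Gamma(\rho_1+1)\big)^{1/(\rho_1+1)}$$ and $$H=e^{\Theta-\gamma A_0}\left(2\pi(1+\rho_1)\right)^{-1/2}\big(A_1\Gamma(\rho_1+1)\big)^{\frac{1-2A_0}{2(\rho_1+1)}},$$ where $\Theta:=\lim_{s\to0}\left(D(s)-A_0s^{-1}\right)$ and $\gamma$ is Euler's constant.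
   Context: Notation: $x_n\sim y_n$ means $x_n/y_n\to1$. Setting. $f(z)=\sum_{n\ge0}c_nz^n$ is the generating function of a nonnegative sequence $(c_n)_{n\ge0}$ with $c_0=1$ and radius of convergence $1$, and has the form $f(z)=\prod_{k=1}^\infty S(a_kz^k)^{b_k}$ for given sequences $0<a_k\le1$, $b_k\ge0$ ($k\ge1$) and a given function $S$. It is assumed that $S(z)=\sum_{j\ge0}d_jz^j$ with $d_0=1$, $d_j\ge0$, radius of convergence $\ge1$, and that $\log S(z)=\sum_{j\ge1}\xi_jz^j$ with radius of convergence $1$. Then $\log f(z)=\sum_{k\ge1}\Lambda_kz^k$ (radius of convergence $1$) with $\Lambda_k=\sum_{j\mid k}b_ja_j^{k/j}\xi_{k/j}$. The Dirichlet generating function is $D(s)=\sum_{k\ge1}\Lambda_kk^{-s}$, which equals $\sum_{k\ge1}\sum_{j\ge1}b_k\xi_ja_k^j(jk)^{-s}$ as long as $\Re(s)$ is large enough so that this double series converges absolutely; the same symbol $D$ denotes its meromorphic continuation. Put $l_0:=\min\{j>0:d_j>0\}$. Condition (I): $D(s)$, $s=\sigma+it$, is analytic in the half-plane $\sigma>\rho_r>0$ and has $r\ge1$ simple poles at positions $0<\rho_1<\rho_2<\dots<\rho_r$, with positive residues $A_1,\dots,A_r$ respectively. $D$ may also have a simple pole at $0$ with residue $A_0$ (if $D$ is analytic at $0$, put $A_0=0$). Moreover there is a constant $0<C_0\le1$ such that $D$ has a meromorphic continuation to the half-plane $\mathcal H=\{s:\sigma\ge-C_0\}$ on which it is analytic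 except for the $r$ simple poles at $\rho_1,\dots,\rho_r$ and, possibly, the simple pole at $0$. Condition (II): there is a constant $C_1>0$ such that $D(s)=O(|t|^{C_1})$ as $t\to\infty$, uniformly for $s=\sigma+it\in\mathcal H$. Condition (III): there is a constant $C_2>0$ such that $b_ka_k^{l_0}\ge C_2k^{\rho_r-1}$ for all $k\ge1$. Moreover, if $l_0>1$, then for some fixed $\epsilon>0$ and all small enough $\delta>0$, $$2\sum_{k=1}^\infty\Lambda_ke^{-k\delta}\sin^2(\pi k\alpha)\ge\left(1+\frac{\rho_r}2+\epsilon\right)|\log\delta|,\qquad (2l_0)^{-1}\le|\alpha|\le1/2.$$ Exponents. Put $\rho_0=0$ and let $\mathbb Z_+$ be the set of nonnegative integers. Define $$\tilde\Upsilon_r=\left\{\sum_{k=0}^{r-1}\tilde d_k(\rho_r-\rho_k):\ \tilde d_k\in\mathbb Z_+,\ \sum_{k=0}^{r-1}\tilde d_k\ge2\right\}\cap(0,\rho_r+1],\qquad \Upsilon_r=\tilde\Upsilon_r\cup\{\rho_r-\rho_k:\ k=0,1,\dots,r-1\},$$ and let $0<\lambda_1<\lambda_2<\dots<\lambda_{|\Upsilon_r|}$ be the elements of $\Upsilon_r$ in increasing order. *)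

(* Defs.v *)
From Stdlib Require Export Reals.
From Coquelicot Require Export Coquelicot.
Open Scope R_scope.

(* Sequences indexed by k >= 1 in the mathematics are total functions on nat;
   the values a 0, b 0 are never used. *)

Definition Cexp (z : C) : C :=
  (exp (Re z) * cos (Im z), exp (Re z) * sin (Im z)).

(* x^s with the real logarithm; used for x > 0 only. *)
Definition Rcpow (x : R) (s : C) : C := Cexp (Cmult s (RtoC (ln x))).

Definition Gamma (x : R) : R :=
  RInt_gen (fun t => Rpower t (x - 1) * exp (- t))
           (at_right 0) (Rbar_locally p_infty).

Definition euler_gamma : R :=
  real (Lim_seq (fun n => sum_n_m (fun k => / INR k) 1 n - ln (INR n))).

Definition analytic_at (F : C -> C) (s : C) : Prop :=
  locally s (fun z : C => ex_derive (K := C_AbsRing) (V := C_NormedModule) F z).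

(* F has at p at most a simple pole, with residue A: it is a simple pole if
   A <> 0, and F is analytic at p (up to its value there) if A = 0. *)
Definition simple_pole_residue (F : C -> C) (p A : C) : Prop :=
  exists g : C -> C,
    analytic_at g p /\
    locally' p (fun z : C => F z = Cplus (Cdiv A (Cminus z p)) (g z)).

Definition Lambda (a b xi : nat -> R) (k : nat) : R :=
  sum_n_m (fun j => if Nat.eqb (Nat.modulo k j) 0
                    then b j * a j ^ (Nat.div k j) * xi (Nat.div k j)
                    else 0) 1 k.

(* f and S are the sums of the power series with coefficients c and d.
   The product formula and the expansion of log S are stated on the real
   interval (-1, 1), where S > 0, so that ln and real powers are unambiguous. *)
Record product_setting (a b c d xi : nat -> R) : Prop := {
  c_zero : c 0%nat = 1;
  c_nonneg : forall n, 0 <= c n;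
  c_radius : CV_radius c = Finite 1;
  d_zero : d 0%nat = 1;
  d_nonneg : forall j, 0 <= d j;
  d_radius : Rbar_le (Finite 1) (CV_radius d);
  xi_zero : xi 0%nat = 0;
  xi_radius : CV_radius xi = Finite 1;
  log_S : forall x, Rabs x < 1 ->
    0 < PSeries d x /\ ln (PSeries d x) = PSeries xi x;
  a_range : forall k, (1 <= k)%nat -> 0 < a k <= 1;
  b_nonneg : forall k, (1 <= k)%nat -> 0 <= b k;
  f_product : forall x, Rabs x < 1 ->
    is_lim_seq
      (fun N => prod_f_R0
         (fun i => Rpower (PSeries d (a (S i) * x ^ (S i))) (b (S i))) N)
      (Finite (PSeries c x))
}.

Definition least_positive_index (d : nat -> R) (l0 : nat) : Prop :=
  (0 < l0)%nat /\ 0 < d l0 /\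
  forall j, (0 < j)%nat -> 0 < d j -> (l0 <= j)%nat.

Definition half_plane (C0 : R) (s : C) : Prop := - C0 <= Re s.

(* D agrees with the Dirichlet series of L on some right half-plane. *)
Definition dirichlet_series (L : nat -> R) (D : C -> C) : Prop :=
  exists sigma0 : R, forall s : C, sigma0 < Re s ->
    is_series (V := C_NormedModule)
      (fun i => Cmult (RtoC (L (S i))) (Rcpow (INR (S i)) (Copp s))) (D s).

(* rho 0 = 0 and A 0 describe the possible pole at 0. *)
Record poles_condition (D : C -> C) (r : nat) (rho A : nat -> R) (C0 : R) : Prop := {
  r_pos : (1 <= r)%nat;
  rho_zero : rho 0%nat = 0;
  rho_incr : forall i j, (i < j)%nat -> (j <= r)%nat -> rho i < rho j;
  A_pos : forall k, (1 <= k <= r)%nat -> 0 < A k;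
  C0_range : 0 < C0 <= 1;
  D_poles : forall k, (k <= r)%nat ->
    simple_pole_residue D (RtoC (rho k)) (RtoC (A k));
  D_analytic : forall s : C, half_plane C0 s ->
    (forall k, (k <= r)%nat -> s <> RtoC (rho k)) -> analytic_at D s
}.

Definition vertical_growth_condition (D : C -> C) (C0 : R) : Prop :=
  exists C1 M T : R, 0 < C1 /\ 0 < T /\
    forall s : C, half_plane C0 s -> T <= Rabs (Im s) ->
      Cmod (D s) <= M * Rpower (Rabs (Im s)) C1.

Definition lower_bound_condition (a b L : nat -> R) (l0 : nat) (rhor : R) : Prop :=
  (exists C2 : R, 0 < C2 /\
     forall k, (1 <= k)%nat -> C2 * Rpower (INR k) (rhor - 1) <= b k * a k ^ l0)
  /\
  ((1 < l0)%nat ->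
     exists eps delta0 : R, 0 < eps /\ 0 < delta0 /\
       forall delta alpha : R, 0 < delta < delta0 ->
         / (2 * INR l0) <= Rabs alpha <= 1 / 2 ->
         (1 + rhor / 2 + eps) * Rabs (ln delta) <=
         2 * Series (fun i => L (S i) * exp (- (INR (S i) * delta))
                              * (sin (PI * INR (S i) * alpha)) ^ 2)).

Definition Upsilon_tilde (r : nat) (rho : nat -> R) (x : R) : Prop :=
  (exists m : nat -> nat,
     x = sum_n (fun k => INR (m k) * (rho r - rho k)) (pred r) /\
     2 <= sum_n (fun k => INR (m k)) (pred r)) /\
  0 < x <= rho r + 1.

Definition Upsilon (r : nat) (rho : nat -> R) (x : R) : Prop :=
  Upsilon_tilde r rho x \/ exists k, (k < r)%nat /\ x = rho r - rho k.

(* lambda 1 < ... < lambda N are the elements of the set U. *)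
Definition increasing_enumeration (U : R -> Prop) (N : nat) (lambda : nat -> R) : Prop :=
  (forall i j, (1 <= i)%nat -> (i < j)%nat -> (j <= N)%nat -> lambda i < lambda j) /\
  (forall x, U x <-> exists s, (1 <= s <= N)%nat /\ x = lambda s).

Definition asymp_equiv (u v : nat -> R) : Prop :=
  is_lim_seq (fun n => u n / v n) (Finite 1).

Definition asymptotic_form (r : nat) (rho : nat -> R) (A0 : R)
    (N : nat) (lambda : nat -> R)
    (H : R) (P h : nat -> R) (K : nat -> nat -> R) (n : nat) : R :=
  H * Rpower (INR n) (- ((2 + rho r - 2 * A0) / (2 * (rho r + 1)))) *
  exp (sum_n (fun l => P l * Rpower (INR n) (rho l / (rho r + 1))) r +
       sum_n (fun l => h l *
         sum_n_m (fun s => if Rle_dec (lambda s) (rho l)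
                           then K s l * Rpower (INR n) ((rho l - lambda s) / (rho r + 1))
                           else 0) 1 N) r).

(* Main.v *)
(* Write g(delta) = sum_k Lambda_k e^{-k delta}, so that f(e^{-delta}) = e^{g(delta)}.

   Riesz means of Lambda are computed by Perron's formula: the contour is pushed to the left of 0, where
   condition (II) makes the kernel m!/(s(s+1)...(s+m)) integrable, and the poles of D give main terms. Since
   g is a Laplace transform of these means, g(delta) = sum_l h_l delta^{-rho_l} - A_0 log delta + Theta
   - gamma A_0 + o(1) as delta -> 0 along the reals, with h_l = A_l Gamma(rho_l + 1) / rho_l.

   Give the index m the weight c_m e^{-delta m} / f(e^{-delta}). Real values of g determine the even part of
   the moment generating function of (m - n) delta^{1 + rho_r/2}. It is a power series in t^2 with
   nonnegative coefficients, so its convergence to a Gaussian forces that of the coefficients and hence of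
   the characteristic function: no expansion of g off the real axis is needed. Away from the centre
   |f(e^{-delta + i theta})| is controlled by sum_k Lambda_k e^{-k delta} (1 - cos k theta), which condition
   (III) bounds below. Fourier inversion then gives c_n for every sequence delta_n -> 0 that solves the
   saddle point equation n = sum_l h_l rho_l delta^{-rho_l - 1} up to o(delta_n^{-1 - rho_r/2}).

   Put x = n^{-1/(rho_r + 1)} and delta = x w. The saddle point equation becomes
   w^{rho_r + 1} = sum_l h_l rho_l (x w)^{rho_r - rho_l}, a contraction with factor x^{rho_r - rho_{r-1}}, and
   finitely many iterations from the constant leading term suffice. Finite expansions in powers of x with
   exponents generated by the rho_r - rho_k and error o(x^{rho_r}) are closed under sums, products and real
   powers; expanding n delta + sum_l h_l delta^{-rho_l} in this class produces P_r and the K_{s,r}. All terms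
   can be put on l = r, with P_l = 0 and h^_l = 0 for l < r. *)
Require Import Defs.
From Stdlib Require Import Reals Lra Lia Psatz Classical ClassicalEpsilon Arith Factorial List.
From Coquelicot Require Import Coquelicot.
Open Scope R_scope.

(* Coquelicot states equalities of sums and integrals in abstract groups, where [ring] and [lra] fail. *)
Ltac as_R_eq := match goal with |- @eq _ ?a ?b => change (@eq R a b) end.

(** Condition (II) gives only polynomial growth of [D], so a direct Mellin inversion of g would need
    the vertical decay of the complex Gamma function. The Riesz kernel is rational, its order can be
    taken above the growth exponent, and Gamma then enters at real arguments only. The price is a
    double pole at 0: its residue contains A_0 times [ln x] minus a harmonic number. Subtracting
    A_0/k from Lambda_k removes this logarithm, since the Riesz means and the Abel sum of 1/k are
    explicit; this is where Euler's constant arises.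

    Up to a constant, delta^(1 + rho_r/2) is the inverse standard deviation of the tilted law. An
    error in n that is small against delta^(-1 - rho_r/2) does not move the Gaussian limit, so an
    approximate saddle point is as good as an exact one, and the same approximation may be used in
    the exponential factor. An expansion with precision o(x^(rho_r)) then leaves o(1) in the
    exponent. *)

(** * Real sums and series, interchange of limits *)

Lemma sum_n_succ (a : nat -> R) n : sum_n a (S n) = sum_n a n + a (S n).
Proof. apply (sum_Sn a n). Qed.

Lemma sum_n_nonneg (a : nat -> R) n : (forall k, (k <= n)%nat -> 0 <= a k) -> 0 <= sum_n a n.
Proof.
induction n as [|n IH]; intros H.
- rewrite sum_O. apply H; lia.
- rewrite sum_n_succ. apply Rplus_le_le_0_compat; [apply IH; intros; apply H; lia|apply H; lia].
Qed.

Lemma sum_n_le_compat (a b : nat -> R) n : (forall k, (k <= n)%nat -> a k <= b k) -> sum_n a n <= sum_n b n.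
Proof.
induction n as [|n IH]; intros H.
- rewrite !sum_O. apply H; lia.
- rewrite !sum_n_succ. apply Rplus_le_compat; [apply IH; intros; apply H; lia|apply H; lia].
Qed.

Lemma sum_n_Rabs (a : nat -> R) n : Rabs (sum_n a n) <= sum_n (fun k => Rabs (a k)) n.
Proof.
induction n as [|n IH].
- rewrite !sum_O. lra.
- rewrite !sum_n_succ. eapply Rle_trans; [apply Rabs_triang|]. lra.
Qed.

Lemma sum_n_minus (a b : nat -> R) n : sum_n (fun k => a k - b k) n = sum_n a n - sum_n b n.
Proof.
induction n as [|n IH].
- rewrite !sum_O. lra.
- rewrite !sum_n_succ. lra.
Qed.

Lemma sum_n_scal_l_R (c : R) (a : nat -> R) n : sum_n (fun k => c * a k) n = c * sum_n a n.
Proof.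
induction n as [|n IH].
- rewrite !sum_O. lra.
- rewrite !sum_n_succ. lra.
Qed.

Lemma is_series_lim (a : nat -> R) l : is_series a l <-> is_lim_seq (sum_n a) l.
Proof. reflexivity. Qed.

Lemma ex_series_bounded (a : nat -> R) M : (forall n, 0 <= a n) -> (forall n, sum_n a n <= M) -> ex_series a.
Proof.
intros H1 H2. destruct (ex_finite_lim_seq_incr (sum_n a) M) as [l Hl].
- intros n. rewrite sum_n_succ. generalize (H1 (S n)); lra.
- exact H2.
- exists l. exact Hl.
Qed.

Lemma Series_lim (a : nat -> R) : ex_series a -> is_lim_seq (sum_n a) (Series a).
Proof. intros H. apply is_series_lim, Series_correct, H. Qed.

Lemma sum_n_le_Series (a : nat -> R) n : (forall n, 0 <= a n) -> ex_series a -> sum_n a n <= Series a.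
Proof.
intros H1 H2. apply (is_lim_seq_incr_compare (sum_n a) (Series a) (Series_lim a H2)).
intros k. rewrite sum_n_succ. generalize (H1 (S k)); lra.
Qed.

Lemma Series_le_bound (a : nat -> R) M : ex_series a -> (forall n, sum_n a n <= M) -> Series a <= M.
Proof.
intros H1 H2. apply (is_lim_seq_le (sum_n a) (fun _ => M) (Series a) M).
- exact H2.
- apply Series_lim, H1.
- apply is_lim_seq_const.
Qed.

Lemma Series_nonneg (a : nat -> R) : (forall n, 0 <= a n) -> ex_series a -> 0 <= Series a.
Proof. intros H1 H2. eapply Rle_trans; [|apply (sum_n_le_Series a 0 H1 H2)]. rewrite sum_O. apply H1. Qed.

Lemma ex_series_dom (a b : nat -> R) : (forall n, Rabs (a n) <= b n) -> ex_series b -> ex_series a.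
Proof. intros H1 H2. apply (ex_series_le a b); [exact H1|exact H2]. Qed.

Lemma Series_Rabs_dom (a b : nat -> R) : (forall n, Rabs (a n) <= b n) -> ex_series b -> Rabs (Series a) <= Series b.
Proof.
intros H1 H2. assert (Ha : ex_series a) by (apply ex_series_dom with b; assumption).
assert (Hb : forall n, sum_n b n <= Series b).
{ intros n. apply sum_n_le_Series; [|exact H2]. intros k. eapply Rle_trans; [apply Rabs_pos|apply H1]. }
assert (B : forall n, Rabs (sum_n a n) <= Series b).
{ intros n. eapply Rle_trans; [apply sum_n_Rabs|]. eapply Rle_trans; [apply sum_n_le_compat; intros; apply H1|apply Hb]. }
apply Rabs_le. split.
- apply (is_lim_seq_le (fun _ => - Series b) (sum_n a) (- Series b) (Series a)).
  + intros n. generalize (B n); intros Q; apply Rabs_le_between in Q; lra.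
  + apply is_lim_seq_const.
  + apply Series_lim, Ha.
- apply Series_le_bound; [exact Ha|]. intros n. generalize (B n); intros Q; apply Rabs_le_between in Q; lra.
Qed.

Lemma Series_tail_dom (a b : nat -> R) N : (forall n, Rabs (a n) <= b n) -> ex_series b ->
  Rabs (Series a - sum_n a N) <= Series b - sum_n b N.
Proof.
intros H1 H2. assert (Ha : ex_series a) by (apply ex_series_dom with b; assumption).
rewrite (Series_incr_n a (S N)), (Series_incr_n b (S N)) by (lia || assumption).
simpl pred. rewrite <- !sum_n_Reals.
replace (sum_n a N + Series (fun k => a (S N + k)%nat) - sum_n a N) with (Series (fun k => a (S N + k)%nat)) by ring.
replace (sum_n b N + Series (fun k => b (S N + k)%nat) - sum_n b N) with (Series (fun k => b (S N + k)%nat)) by ring.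
apply Series_Rabs_dom; [intros; apply H1|]. apply ex_series_incr_n, H2.
Qed.

Lemma Series_tail_small (b : nat -> R) eps : ex_series b -> 0 < eps -> exists N, forall n, (N <= n)%nat -> Series b - sum_n b n < eps.
Proof.
intros Hb He. destruct (proj2 (is_lim_seq_spec _ _) (Series_lim b Hb) (mkposreal eps He)) as [N HN].
exists N. intros n Hn. specialize (HN n Hn). simpl in HN. apply Rabs_def2 in HN. lra.
Qed.

Lemma is_lim_seq_eps (u : nat -> R) (l : R) : is_lim_seq u l <->
  forall eps, 0 < eps -> exists N, forall n, (N <= n)%nat -> Rabs (u n - l) < eps.
Proof.
rewrite <- is_lim_seq_spec. split.
- intros H eps He. destruct (H (mkposreal eps He)) as [N HN]. exists N. exact HN.
- intros H eps. destruct (H eps (cond_pos eps)) as [N HN]. exists N. exact HN.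
Qed.

Lemma is_lim_seq_sum_n (u : nat -> nat -> R) (v : nat -> R) N :
  (forall k, (k <= N)%nat -> is_lim_seq (fun n => u n k) (v k)) ->
  is_lim_seq (fun n => sum_n (u n) N) (sum_n v N).
Proof.
induction N as [|N IH]; intros H.
- rewrite sum_O. apply is_lim_seq_ext with (fun n => u n 0%nat); [intros; rewrite sum_O; reflexivity|apply H; lia].
- rewrite sum_n_succ. apply is_lim_seq_ext with (fun n => sum_n (u n) N + u n (S N)).
  + intros; rewrite sum_n_succ; reflexivity.
  + apply is_lim_seq_plus'; [apply IH; intros; apply H; lia|apply H; lia].
Qed.

(** Tannery's theorem, dominated convergence for series. The limits [v] inherit the bound [b], so
    one index [N] makes all tails small at once and the remaining finite sum converges termwise. *)
Lemma tannery (u : nat -> nat -> R) (v b : nat -> R) :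
  (forall n k, Rabs (u n k) <= b k) -> ex_series b ->
  (forall k, is_lim_seq (fun n => u n k) (v k)) ->
  is_lim_seq (fun n => Series (u n)) (Series v).
Proof.
intros H1 Hb H2.
assert (H3 : forall k, Rabs (v k) <= b k).
{ intros k. apply (is_lim_seq_le (fun n => Rabs (u n k)) (fun _ => b k) (Rabs (v k)) (b k)).
  - intros n; apply H1.
  - apply (is_lim_seq_abs (fun n => u n k) (v k)), H2.
  - apply is_lim_seq_const. }
apply is_lim_seq_eps. intros eps He.
destruct (Series_tail_small b (eps / 3) Hb ltac:(lra)) as [N HN]. specialize (HN N (le_n N)).
destruct (proj1 (is_lim_seq_eps _ _) (is_lim_seq_sum_n u v N (fun k _ => H2 k)) (eps / 3) ltac:(lra)) as [M HM].
exists M. intros n Hn. specialize (HM n Hn).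
assert (T1 := Series_tail_dom (u n) b N (H1 n) Hb). assert (T2 := Series_tail_dom v b N H3 Hb).
replace (Series (u n) - Series v) with
  ((Series (u n) - sum_n (u n) N) + (sum_n (u n) N - sum_n v N) + - (Series v - sum_n v N)) by ring.
eapply Rle_lt_trans; [apply Rabs_triang|]. rewrite Rabs_Ropp.
eapply Rle_lt_trans; [apply Rplus_le_compat_r, Rabs_triang|]. lra.
Qed.

Lemma sum_n_Series_swap (t : nat -> nat -> R) M : (forall m, (m <= M)%nat -> ex_series (fun k => t k m)) ->
  ex_series (fun k => sum_n (t k) M) /\ Series (fun k => sum_n (t k) M) = sum_n (fun m => Series (fun k => t k m)) M.
Proof.
induction M as [|M IH]; intros H.
- rewrite sum_O. split.
  + apply ex_series_ext with (fun k => t k 0%nat); [intros; rewrite sum_O; reflexivity|apply H; lia].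
  + apply Series_ext. intros; rewrite sum_O; reflexivity.
- destruct IH as [E1 E2]; [intros; apply H; lia|]. assert (E3 := H (S M) (le_n _)). split.
  + apply ex_series_ext with (fun k => sum_n (t k) M + t k (S M)); [intros; rewrite sum_n_succ; reflexivity|].
    apply (ex_series_plus (V := R_NormedModule) (fun k => sum_n (t k) M) (fun k => t k (S M))); assumption.
  + rewrite sum_n_succ, <- E2, <- Series_plus by assumption.
    apply Series_ext. intros; rewrite sum_n_succ; reflexivity.
Qed.

(** Partial sums over [m] are finite and commute with the series over [k]; they are bounded by [s k]
    uniformly in their length, so Tannery's theorem moves the limit inside. *)
Lemma series_fubini (t : nat -> nat -> R) (s : nat -> R) :
  (forall k, ex_series (fun m => Rabs (t k m))) -> (forall k, Series (fun m => Rabs (t k m)) <= s k) -> ex_series s ->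
  (forall m, ex_series (fun k => Rabs (t k m))) /\
  is_series (fun m => Series (fun k => t k m)) (Series (fun k => Series (t k))) /\
  ex_series (fun m => Series (fun k => Rabs (t k m))).
Proof.
intros H1 H2 Hs.
assert (P : forall k m, Rabs (t k m) <= s k).
{ intros k m. eapply Rle_trans; [|apply H2].
  eapply Rle_trans; [|apply (sum_n_le_Series _ m)].
  - destruct m as [|m]; [rewrite sum_O; lra|]. rewrite sum_n_succ.
    assert (0 <= sum_n (fun m0 => Rabs (t k m0)) m) by (apply sum_n_nonneg; intros; apply Rabs_pos). lra.
  - intros; apply Rabs_pos.
  - apply H1. }
assert (A : forall m, ex_series (fun k => Rabs (t k m))).
{ intros m. apply ex_series_dom with s; [|exact Hs]. intros k. rewrite Rabs_Rabsolu. apply P. }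
split; [exact A|].
assert (A' : forall m, ex_series (fun k => t k m)) by (intros; apply ex_series_Rabs, A).
assert (Q : forall k M, sum_n (fun m => Rabs (t k m)) M <= s k).
{ intros k M. eapply Rle_trans; [|apply H2]. apply sum_n_le_Series; [intros; apply Rabs_pos|apply H1]. }
split.
- apply is_series_lim.
  apply is_lim_seq_ext with (fun M => Series (fun k => sum_n (t k) M)).
  { intros M. apply (sum_n_Series_swap t M). intros; apply A'. }
  apply (tannery (fun M k => sum_n (t k) M) (fun k => Series (t k)) s).
  + intros M k. eapply Rle_trans; [apply sum_n_Rabs|apply Q].
  + exact Hs.
  + intros k. apply Series_lim, ex_series_Rabs, H1.
- apply ex_series_bounded with (Series s).
  + intros m. apply Series_nonneg; [intros; apply Rabs_pos|apply A].
  + intros M. destruct (sum_n_Series_swap (fun k m => Rabs (t k m)) M) as [E1 E2]; [intros; apply A|].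
    rewrite <- E2. apply Series_le; [|exact Hs]. intros k. split; [|apply Q].
    apply sum_n_nonneg; intros; apply Rabs_pos.
Qed.

Lemma ex_series_inv_sqr : ex_series (fun i => / (INR (S i) * INR (S i))).
Proof.
apply ex_series_bounded with 2.
- intros n. assert (P := lt_0_INR (S n) (Nat.lt_0_succ n)). apply Rlt_le, Rinv_0_lt_compat. nra.
(* The subtracted term makes the bound inductive: 1/(y+1)^2 is at most 1/y - 1/(y+1). *)
- assert (B : forall n, sum_n (fun i => / (INR (S i) * INR (S i))) n <= 2 - / INR (S n)).
  { induction n as [|n IH].
    - rewrite sum_O. simpl. lra.
    - rewrite sum_n_succ. rewrite (S_INR (S n)). assert (P := lt_0_INR (S n) (Nat.lt_0_succ n)).
      set (y := INR (S n)) in *.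
      assert (/ ((y + 1) * (y + 1)) <= / y - / (y + 1)); [|lra].
      replace (/ y - / (y + 1)) with (/ (y * (y + 1))) by (field; lra).
      apply Rinv_le_contravar; nra. }
  intros n. eapply Rle_trans; [apply B|]. assert (P := lt_0_INR (S n) (Nat.lt_0_succ n)).
  assert (0 < / INR (S n)) by (apply Rinv_0_lt_compat, P). lra.
Qed.

Lemma Series_zero (a : nat -> R) : (forall n, a n = 0) -> Series a = 0.
Proof.
intros H. rewrite (Series_ext a (fun n => 0 * a n)) by (intros; rewrite H; ring).
rewrite Series_scal_l. ring.
Qed.

Lemma CV_radius_ge_1_of_disk (a : nat -> R) :
  (forall x, 0 <= x < 1 -> CV_disk a x) -> Rbar_le 1 (CV_radius a).
Proof.
intros H. destruct (Rbar_le_lt_dec 1 (CV_radius a)) as [L|L]; [exact L|exfalso].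
assert (P := CV_radius_ge_0 a).
destruct (CV_radius a) as [rr| |] eqn:E; simpl in L, P; try contradiction.
(* At a point outside the disk of convergence the terms do not tend to 0, yet absolute convergence
   is assumed there. *)
set (x := (rr + 1) / 2).
assert (Q : Rbar_lt (CV_radius a) (Rabs x)). { rewrite E. simpl. rewrite Rabs_pos_eq; unfold x; lra. }
apply CV_disk_outside in Q. apply Q, ex_series_lim_0, ex_series_Rabs, H. unfold x; lra.
Qed.

Lemma CV_disk_of_radius_ge_1 (a : nat -> R) x : Rbar_le 1 (CV_radius a) -> Rabs x < 1 -> CV_disk a x.
Proof. intros H Hx. apply CV_disk_inside. eapply Rbar_lt_le_trans; [|exact H]. exact Hx. Qed.

Lemma CV_radius_ge_1_dom (a b : nat -> R) :
  (forall n, Rabs (a n) <= Rabs (b n)) -> Rbar_le 1 (CV_radius b) -> Rbar_le 1 (CV_radius a).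
Proof.
intros H Hb. apply CV_radius_ge_1_of_disk. intros x Hx.
apply ex_series_dom with (fun n => Rabs (b n * x ^ n)).
- intros n. rewrite Rabs_Rabsolu, !Rabs_mult. apply Rmult_le_compat_r; [apply Rabs_pos|apply H].
- apply CV_disk_of_radius_ge_1; [exact Hb|]. rewrite Rabs_pos_eq; lra.
Qed.

Lemma exp_le_compat x y : x <= y -> exp x <= exp y.
Proof. intros [H|H]; [left; apply exp_increasing, H|rewrite H; lra]. Qed.

Lemma exp_neg_range t : 0 < t -> 0 < exp (- t) < 1.
Proof.
intros H. split; [apply exp_pos|].
apply Rlt_le_trans with (exp 0); [apply exp_increasing; lra|rewrite exp_0; lra].
Qed.

(** * Contour integrals and Cauchy's formula *)

Notation is_CInt := (is_RInt (V := C_R_NormedModule)).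
Notation ex_CInt := (ex_RInt (V := C_R_NormedModule)).
Notation CInt := (RInt (V := C_R_CompleteNormedModule)).
Notation is_Cderive := (is_derive (K := C_AbsRing) (V := C_NormedModule)).
Notation ex_Cderive := (ex_derive (K := C_AbsRing) (V := C_NormedModule)).
Notation Ccontinuous := (continuous (T := C_UniformSpace) (U := C_UniformSpace)).

Lemma is_CInt_pair (f : R -> C) (a b : R) (l : C) :
  is_CInt f a b l <->
  is_RInt (fun t => Re (f t)) a b (Re l) /\ is_RInt (fun t => Im (f t)) a b (Im l).
Proof.
split.
- intros H; split.
  + apply (is_RInt_fct_extend_fst (U := R_NormedModule) (V := R_NormedModule) f a b l H).
  + apply (is_RInt_fct_extend_snd (U := R_NormedModule) (V := R_NormedModule) f a b l H).
- intros [H1 H2]; destruct l as [l1 l2].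
  apply (is_RInt_fct_extend_pair (U := R_NormedModule) (V := R_NormedModule) f a b l1 l2 H1 H2).
Qed.

Lemma is_CInt_unique f a b l : is_CInt f a b l -> CInt f a b = l.
Proof. intros H; apply (is_RInt_unique (V := C_R_CompleteNormedModule)), H. Qed.

Lemma CInt_correct f a b : ex_CInt f a b -> is_CInt f a b (CInt f a b).
Proof. intros H; apply (RInt_correct (V := C_R_CompleteNormedModule)), H. Qed.

Lemma is_CInt_plus f g a b l m : is_CInt f a b l -> is_CInt g a b m ->
  is_CInt (fun t => (f t + g t)%C) a b (l + m)%C.
Proof. intros H1 H2; exact (is_RInt_plus (V := C_R_NormedModule) f g a b l m H1 H2). Qed.

Lemma is_CInt_minus f g a b l m : is_CInt f a b l -> is_CInt g a b m ->
  is_CInt (fun t => (f t - g t)%C) a b (l - m)%C.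
Proof. intros H1 H2; exact (is_RInt_minus (V := C_R_NormedModule) f g a b l m H1 H2). Qed.

Lemma is_CInt_mult_l (k : C) f a b l : is_CInt f a b l ->
  is_CInt (fun t => (k * f t)%C) a b (k * l)%C.
Proof.
rewrite !is_CInt_pair; intros [H1 H2]; split.
- replace (Re (k * l)%C) with (Re k * Re l - Im k * Im l) by reflexivity.
  apply (is_RInt_minus (V := R_NormedModule) (fun t => Re k * Re (f t)) (fun t => Im k * Im (f t))).
  + apply (is_RInt_scal (V := R_NormedModule)), H1.
  + apply (is_RInt_scal (V := R_NormedModule)), H2.
- replace (Im (k * l)%C) with (Re k * Im l + Im k * Re l) by reflexivity.
  apply (is_RInt_plus (V := R_NormedModule) (fun t => Re k * Im (f t)) (fun t => Im k * Re (f t))).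
  + apply (is_RInt_scal (V := R_NormedModule)), H2.
  + apply (is_RInt_scal (V := R_NormedModule)), H1.
Qed.

Lemma is_CInt_ext f g a b l : (forall t, Rmin a b < t < Rmax a b -> f t = g t) ->
  is_CInt f a b l -> is_CInt g a b l.
Proof. intros H; apply (is_RInt_ext (V := C_R_NormedModule) f g a b l), H. Qed.

Lemma is_CInt_Chasles f a b c l m :
  is_CInt f a b l -> is_CInt f b c m -> is_CInt f a c (l + m)%C.
Proof. intros H1 H2; exact (is_RInt_Chasles (V := C_R_NormedModule) f a b c l m H1 H2). Qed.

Lemma Cmod_norm_R (z : C) : norm (V := C_R_NormedModule) z = Cmod z.
Proof.
symmetry; apply Cmod_norm.
Qed.

Lemma is_CInt_norm_le f (g : R -> R) a b l m : a <= b ->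
  (forall t, a <= t <= b -> Cmod (f t) <= g t) ->
  is_CInt f a b l -> is_RInt g a b m -> Cmod l <= m.
Proof.
intros Hab Hle H1 H2. rewrite <- Cmod_norm_R.
apply (norm_RInt_le (V := C_R_NormedModule) f g a b l m Hab); auto.
intros t Ht; rewrite Cmod_norm_R; auto.
Qed.

Lemma is_CInt_norm_le_const f a b l M : a <= b ->
  (forall t, a <= t <= b -> Cmod (f t) <= M) ->
  is_CInt f a b l -> Cmod l <= (b - a) * M.
Proof.
intros Hab Hle H1. rewrite <- Cmod_norm_R.
apply (norm_RInt_le_const (V := C_R_NormedModule) f a b l M Hab); auto.
intros t Ht; rewrite Cmod_norm_R; auto.
Qed.

Lemma continuous_pair (f : R -> C) t :
  continuous (fun u => Re (f u)) t -> continuous (fun u => Im (f u)) t ->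
  continuous (U := C_UniformSpace) f t.
Proof.
intros H1 H2 P [eps HP].
assert (H3 : locally t (fun u => ball (Re (f t)) eps (Re (f u)))) by (apply H1; exists eps; auto).
assert (H4 : locally t (fun u => ball (Im (f t)) eps (Im (f u)))) by (apply H2; exists eps; auto).
unfold filtermap. generalize (filter_and _ _ H3 H4). apply filter_imp.
intros u [Hu1 Hu2]; apply HP; split; assumption.
Qed.

Lemma ex_CInt_continuous (f : R -> C) a b :
  (forall t, Rmin a b <= t <= Rmax a b -> continuous (U := C_UniformSpace) f t) ->
  ex_CInt f a b.
Proof. intros H; apply (ex_RInt_continuous (V := C_R_CompleteNormedModule)), H. Qed.

(** Differentiability refers to [Cmod] balls, whereas [C_UniformSpace] uses the product ball of the
    two coordinates; the epsilon form keeps all later remainder estimates in [Cmod]. *)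
Lemma is_Cderive_eps F z l : is_Cderive F z l <->
  forall eps, 0 < eps -> exists eta, 0 < eta /\ forall w, Cmod (w - z) < eta ->
    Cmod (F w - F z - (w - z) * l) <= eps * Cmod (w - z).
Proof.
split.
- intros [_ H] eps Heps.
  assert (Hl : is_filter_lim (locally (T := AbsRing_UniformSpace C_AbsRing) z) z).
  { intros P HP; exact HP. }
  destruct (H z Hl (mkposreal eps Heps)) as [eta Heta].
  exists eta; split; [apply cond_pos|]. intros w Hw.
  specialize (Heta w).
  apply Heta. exact Hw.
- intros H; split.
  + apply is_linear_scal_l.
  + intros x Hx eps.
    assert (Hz : z = x) by (apply (is_filter_lim_locally_unique (K := C_AbsRing) (V := AbsRing_NormedModule C_AbsRing) z x Hx)).
    destruct (H eps (cond_pos eps)) as [eta [He Heta]].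
    exists (mkposreal eta He). intros w Hw. rewrite <- Hz.
    apply (Heta w). exact Hw.
Qed.

Lemma ex_Cderive_continuous F z : ex_Cderive F z -> Ccontinuous F z.
Proof.
intros H P HP. apply locally_C.
apply (ex_derive_continuous (K := C_AbsRing) (V := C_NormedModule) F z H P HP).
Qed.

Lemma Ccontinuous_horizontal F (u y : R) : Ccontinuous F (u, y) ->
  continuous (U := C_UniformSpace) (fun x : R => F (x, y)) u.
Proof.
intros H.
apply (continuous_comp (fun x : R => (x, y)) F); [|exact H].
intros P [eps HP]. exists eps. intros x Hx. apply HP. split; [exact Hx|apply ball_center].
Qed.

Lemma Ccontinuous_vertical F (x v : R) : Ccontinuous F (x, v) ->
  continuous (U := C_UniformSpace) (fun y : R => F (x, y)) v.
Proof.
intros H.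
apply (continuous_comp (fun y : R => (x, y)) F); [|exact H].
intros P [eps HP]. exists eps. intros y Hy. apply HP. split; [apply ball_center|exact Hy].
Qed.

(** The integral of F(z) dz counterclockwise along the boundary; on a vertical side dz = i dv, and
    the top and left sides are traversed backwards. *)
Definition rect_int (F : C -> C) (x0 x1 y0 y1 : R) : C :=
  (CInt (fun u => F (u, y0)) x0 x1 + Ci * CInt (fun v => F (x1, v)) y0 y1
   - CInt (fun u => F (u, y1)) x0 x1 - Ci * CInt (fun v => F (x0, v)) y0 y1)%C.

Definition in_rect (x0 x1 y0 y1 : R) (z : C) : Prop :=
  x0 <= Re z <= x1 /\ y0 <= Im z <= y1.

Lemma is_Cderive_horizontal F (u y : R) l : is_Cderive F (u, y) l ->
  is_derive (V := C_R_NormedModule) (fun x : R => F (x, y)) u l.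
Proof.
rewrite is_Cderive_eps; intros H. split.
- apply is_linear_scal_l.
- intros x Hx eps.
  assert (Hz : u = x) by (apply (is_filter_lim_locally_unique (K := R_AbsRing) (V := R_NormedModule) u x Hx)).
  destruct (H eps (cond_pos eps)) as [eta [He Heta]].
  exists (mkposreal eta He). intros w Hw. rewrite <- Hz.
  rewrite Cmod_norm_R.
  assert (Hm : Cmod ((w, y) - (u, y)) = Rabs (w - u)).
  { rewrite <- Cmod_R. f_equal. unfold Cminus, Cplus, Copp, RtoC; simpl. f_equal; ring. }
  specialize (Heta (w, y)). rewrite Hm in Heta.
  assert (Hw' : Rabs (w - u) < eta) by exact Hw.
  specialize (Heta Hw').
  eapply Rle_trans; [|exact Heta]. apply Req_le. f_equal.
  unfold minus, plus, opp, scal; simpl. unfold prod_plus, prod_opp, prod_scal; simpl.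
  unfold scal, plus, opp; simpl. unfold mult; simpl.
  destruct (F (w, y)), (F (u, y)), l.
  unfold Cminus, Cplus, Copp, Cmult; simpl. f_equal; ring.
Qed.

Lemma is_Cderive_vertical F (x v : R) l : is_Cderive F (x, v) l ->
  is_derive (V := C_R_NormedModule) (fun y : R => F (x, y)) v (Ci * l)%C.
Proof.
rewrite is_Cderive_eps; intros H. split.
- apply is_linear_scal_l.
- intros t Hx eps.
  assert (Hz : v = t) by (apply (is_filter_lim_locally_unique (K := R_AbsRing) (V := R_NormedModule) v t Hx)).
  destruct (H eps (cond_pos eps)) as [eta [He Heta]].
  exists (mkposreal eta He). intros w Hw. rewrite <- Hz.
  rewrite Cmod_norm_R.
  assert (Hm : Cmod ((x, w) - (x, v)) = Rabs (w - v)).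
  { transitivity (Cmod (Ci * RtoC (w - v))).
    - f_equal. unfold Cminus, Cplus, Copp, Cmult, Ci, RtoC; simpl. f_equal; ring.
    - rewrite Cmod_mult, Cmod_R.
      replace (Cmod Ci) with 1; [ring|].
      unfold Cmod, Ci; simpl. replace (0 * (0 * 1) + 1 * (1 * 1)) with 1 by ring. rewrite sqrt_1; reflexivity. }
  specialize (Heta (x, w)). rewrite Hm in Heta.
  assert (Hw' : Rabs (w - v) < eta) by exact Hw.
  specialize (Heta Hw').
  eapply Rle_trans; [|exact Heta]. apply Req_le. f_equal.
  unfold minus, plus, opp, scal; simpl. unfold prod_plus, prod_opp, prod_scal; simpl.
  unfold scal, plus, opp; simpl. unfold mult; simpl.
  destruct (F (x, w)), (F (x, v)), l.
  unfold Cminus, Cplus, Copp, Cmult; simpl. f_equal; ring.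
Qed.

Lemma Ci_sqr : (Ci * Ci = -1)%C.
Proof. unfold Ci, Cmult, RtoC; simpl. unfold Copp; simpl. f_equal; ring. Qed.

Lemma is_CInt_primitive_horizontal P f (a b y : R) : a <= b ->
  (forall u, a <= u <= b -> is_Cderive P (u, y) (f (u, y))) ->
  (forall u, a <= u <= b -> Ccontinuous f (u, y)) ->
  is_CInt (fun u => f (u, y)) a b (P (b, y) - P (a, y))%C.
Proof.
intros Hab H1 H2.
apply (is_RInt_derive (V := C_R_CompleteNormedModule) (fun u => P (u, y)) (fun u => f (u, y)) a b);
  rewrite Rmin_left, Rmax_right by assumption; intros u Hu.
- apply (is_Cderive_horizontal P), H1, Hu.
- apply (Ccontinuous_horizontal f), H2, Hu.
Qed.

Lemma is_CInt_primitive_vertical P f (x a b : R) : a <= b ->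
  (forall v, a <= v <= b -> is_Cderive P (x, v) (f (x, v))) ->
  (forall v, a <= v <= b -> Ccontinuous f (x, v)) ->
  is_CInt (fun v => (Ci * f (x, v))%C) a b (P (x, b) - P (x, a))%C.
Proof.
intros Hab H1 H2.
apply (is_RInt_derive (V := C_R_CompleteNormedModule) (fun v => P (x, v)) (fun v => (Ci * f (x, v))%C) a b);
  rewrite Rmin_left, Rmax_right by assumption; intros v Hv.
- apply (is_Cderive_vertical P), H1, Hv.
- assert (Hc : continuous (U := C_UniformSpace) (fun v => f (x, v)) v)
    by (apply (Ccontinuous_vertical f), H2, Hv).
  apply continuous_pair.
  + apply (continuous_ext (fun u => - Im (f (x, u)))).
    { intros u; unfold Ci, Cmult, Re, Im; simpl; ring. }
    apply (continuous_opp (V := R_NormedModule)).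
    apply (continuous_comp (fun v => f (x, v)) (fun z : C => snd z)); [exact Hc|apply continuous_snd].
  + apply (continuous_ext (fun u => Re (f (x, u)))).
    { intros u; unfold Ci, Cmult, Re, Im; simpl; ring. }
    apply (continuous_comp (fun v => f (x, v)) (fun z : C => fst z)); [exact Hc|apply continuous_fst].
Qed.

(** Only the boundary matters, since the integrands have poles inside the rectangle. *)
Definition cont_edges (F : C -> C) (x0 x1 y0 y1 : R) : Prop :=
  (forall u, x0 <= u <= x1 -> Ccontinuous F (u, y0) /\ Ccontinuous F (u, y1)) /\
  (forall v, y0 <= v <= y1 -> Ccontinuous F (x0, v) /\ Ccontinuous F (x1, v)).

Lemma ex_CInt_horizontal F a b y : a <= b ->
  (forall u, a <= u <= b -> Ccontinuous F (u, y)) -> ex_CInt (fun u => F (u, y)) a b.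
Proof.
intros Hab H; apply ex_CInt_continuous; rewrite Rmin_left, Rmax_right by assumption.
intros u Hu; apply Ccontinuous_horizontal, H, Hu.
Qed.

Lemma ex_CInt_vertical F a b x : a <= b ->
  (forall v, a <= v <= b -> Ccontinuous F (x, v)) -> ex_CInt (fun v => F (x, v)) a b.
Proof.
intros Hab H; apply ex_CInt_continuous; rewrite Rmin_left, Rmax_right by assumption.
intros u Hu; apply Ccontinuous_vertical, H, Hu.
Qed.

Lemma rect_int_intro F x0 x1 y0 y1 l1 l2 l3 l4 :
  is_CInt (fun u => F (u, y0)) x0 x1 l1 -> is_CInt (fun v => F (x1, v)) y0 y1 l2 ->
  is_CInt (fun u => F (u, y1)) x0 x1 l3 -> is_CInt (fun v => F (x0, v)) y0 y1 l4 ->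
  rect_int F x0 x1 y0 y1 = (l1 + Ci * l2 - l3 - Ci * l4)%C.
Proof.
intros H1 H2 H3 H4. unfold rect_int.
rewrite (is_CInt_unique _ _ _ _ H1), (is_CInt_unique _ _ _ _ H2),
  (is_CInt_unique _ _ _ _ H3), (is_CInt_unique _ _ _ _ H4). reflexivity.
Qed.

Lemma rect_int_elim F x0 x1 y0 y1 : x0 <= x1 -> y0 <= y1 -> cont_edges F x0 x1 y0 y1 ->
  exists l1 l2 l3 l4,
  is_CInt (fun u => F (u, y0)) x0 x1 l1 /\ is_CInt (fun v => F (x1, v)) y0 y1 l2 /\
  is_CInt (fun u => F (u, y1)) x0 x1 l3 /\ is_CInt (fun v => F (x0, v)) y0 y1 l4.
Proof.
intros Hx Hy [Hh Hv].
do 4 eexists; repeat split; apply CInt_correct.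
- apply ex_CInt_horizontal; [assumption|]; intros; apply Hh; assumption.
- apply ex_CInt_vertical; [assumption|]; intros; apply Hv; assumption.
- apply ex_CInt_horizontal; [assumption|]; intros; apply Hh; assumption.
- apply ex_CInt_vertical; [assumption|]; intros; apply Hv; assumption.
Qed.

(** The values of [P] cancel at the four corners. [P] is needed on the boundary only, so the
    integrand may have poles inside, as it does for the double-pole residue. *)
Lemma rect_int_primitive P f x0 x1 y0 y1 : x0 <= x1 -> y0 <= y1 ->
  cont_edges f x0 x1 y0 y1 ->
  (forall u, x0 <= u <= x1 -> is_Cderive P (u, y0) (f (u, y0)) /\ is_Cderive P (u, y1) (f (u, y1))) ->
  (forall v, y0 <= v <= y1 -> is_Cderive P (x0, v) (f (x0, v)) /\ is_Cderive P (x1, v) (f (x1, v))) ->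
  rect_int f x0 x1 y0 y1 = 0%C.
Proof.
intros Hx Hy Hc Hh Hv.
destruct (rect_int_elim f x0 x1 y0 y1 Hx Hy Hc) as (l1 & l2 & l3 & l4 & H1 & H2 & H3 & H4).
rewrite (rect_int_intro f x0 x1 y0 y1 l1 l2 l3 l4) by assumption.
destruct Hc as [Ch Cv].
assert (E1 := is_CInt_unique _ _ _ _ (is_CInt_primitive_horizontal P f x0 x1 y0 Hx
   (fun u Hu => proj1 (Hh u Hu)) (fun u Hu => proj1 (Ch u Hu)))).
assert (E3 := is_CInt_unique _ _ _ _ (is_CInt_primitive_horizontal P f x0 x1 y1 Hx
   (fun u Hu => proj2 (Hh u Hu)) (fun u Hu => proj2 (Ch u Hu)))).
assert (E4 := is_CInt_unique _ _ _ _ (is_CInt_primitive_vertical P f x0 y0 y1 Hy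
   (fun u Hu => proj1 (Hv u Hu)) (fun u Hu => proj1 (Cv u Hu)))).
assert (E2 := is_CInt_unique _ _ _ _ (is_CInt_primitive_vertical P f x1 y0 y1 Hy
   (fun u Hu => proj2 (Hv u Hu)) (fun u Hu => proj2 (Cv u Hu)))).
rewrite (is_CInt_unique _ _ _ _ H1) in E1.
rewrite (is_CInt_unique _ _ _ _ H3) in E3.
rewrite (is_CInt_unique _ _ _ _ (is_CInt_mult_l Ci _ _ _ _ H2)) in E2.
rewrite (is_CInt_unique _ _ _ _ (is_CInt_mult_l Ci _ _ _ _ H4)) in E4.
rewrite E1, E2, E3, E4. ring.
Qed.

Lemma rect_int_split_x F x0 xm x1 y0 y1 : x0 <= xm <= x1 ->
  (forall u, x0 <= u <= x1 -> Ccontinuous F (u, y0) /\ Ccontinuous F (u, y1)) ->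
  rect_int F x0 x1 y0 y1 = (rect_int F x0 xm y0 y1 + rect_int F xm x1 y0 y1)%C.
Proof.
intros Hx H. unfold rect_int.
assert (E : forall y, (forall u, x0 <= u <= x1 -> Ccontinuous F (u, y)) ->
   CInt (fun u => F (u, y)) x0 x1 = (CInt (fun u => F (u, y)) x0 xm + CInt (fun u => F (u, y)) xm x1)%C).
{ intros y Hc; apply is_CInt_unique, is_CInt_Chasles with xm;
  apply CInt_correct, ex_CInt_horizontal; try apply Hx; intros u Hu; apply Hc; lra. }
rewrite (E y0), (E y1) by (intros; apply H; assumption). ring.
Qed.

Lemma rect_int_split_y F x0 x1 y0 ym y1 : y0 <= ym <= y1 ->
  (forall v, y0 <= v <= y1 -> Ccontinuous F (x0, v) /\ Ccontinuous F (x1, v)) ->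
  rect_int F x0 x1 y0 y1 = (rect_int F x0 x1 y0 ym + rect_int F x0 x1 ym y1)%C.
Proof.
intros Hy H. unfold rect_int.
assert (E : forall x, (forall v, y0 <= v <= y1 -> Ccontinuous F (x, v)) ->
   CInt (fun v => F (x, v)) y0 y1 = (CInt (fun v => F (x, v)) y0 ym + CInt (fun v => F (x, v)) ym y1)%C).
{ intros x Hc; apply is_CInt_unique, is_CInt_Chasles with ym;
  apply CInt_correct, ex_CInt_vertical; try apply Hy; intros v Hv; apply Hc; lra. }
rewrite (E x0), (E x1) by (intros; apply H; assumption). ring.
Qed.

Lemma Cmod_Ci : Cmod Ci = 1.
Proof.
unfold Cmod, Ci; simpl. replace (0 * (0 * 1) + 1 * (1 * 1)) with 1 by ring.
apply sqrt_1.
Qed.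

Lemma rect_int_norm_le F x0 x1 y0 y1 M : x0 <= x1 -> y0 <= y1 -> cont_edges F x0 x1 y0 y1 ->
  (forall z, in_rect x0 x1 y0 y1 z -> Re z = x0 \/ Re z = x1 \/ Im z = y0 \/ Im z = y1 ->
     Cmod (F z) <= M) ->
  Cmod (rect_int F x0 x1 y0 y1) <= 2 * ((x1 - x0) + (y1 - y0)) * M.
Proof.
intros Hx Hy Hc HM.
destruct (rect_int_elim F x0 x1 y0 y1 Hx Hy Hc) as (l1 & l2 & l3 & l4 & H1 & H2 & H3 & H4).
rewrite (rect_int_intro F x0 x1 y0 y1 l1 l2 l3 l4) by assumption.
assert (B1 : Cmod l1 <= (x1 - x0) * M).
{ apply (is_CInt_norm_le_const _ _ _ _ _ Hx) with (2 := H1); intros t Ht; apply HM; unfold in_rect; simpl; [lra|auto]. }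
assert (B3 : Cmod l3 <= (x1 - x0) * M).
{ apply (is_CInt_norm_le_const _ _ _ _ _ Hx) with (2 := H3); intros t Ht; apply HM; unfold in_rect; simpl; [lra|auto]. }
assert (B2 : Cmod l2 <= (y1 - y0) * M).
{ apply (is_CInt_norm_le_const _ _ _ _ _ Hy) with (2 := H2); intros t Ht; apply HM; unfold in_rect; simpl; [lra|auto]. }
assert (B4 : Cmod l4 <= (y1 - y0) * M).
{ apply (is_CInt_norm_le_const _ _ _ _ _ Hy) with (2 := H4); intros t Ht; apply HM; unfold in_rect; simpl; [lra|auto]. }
assert (T : Cmod (l1 + Ci * l2 - l3 - Ci * l4) <= Cmod l1 + Cmod l2 + Cmod l3 + Cmod l4).
{ replace (Cmod l2) with (Cmod (Ci * l2)) by (rewrite Cmod_mult, Cmod_Ci; ring).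
  replace (Cmod l4) with (Cmod (- (Ci * l4))) by (rewrite Cmod_opp, Cmod_mult, Cmod_Ci; ring).
  rewrite <- (Cmod_opp l3).
  unfold Cminus.
  eapply Rle_trans; [apply Cmod_triangle|]. apply Rplus_le_compat_r.
  eapply Rle_trans; [apply Cmod_triangle|]. apply Rplus_le_compat_r.
  apply Cmod_triangle. }
lra.
Qed.

Lemma rect_int_minus F G x0 x1 y0 y1 : x0 <= x1 -> y0 <= y1 ->
  cont_edges F x0 x1 y0 y1 -> cont_edges G x0 x1 y0 y1 ->
  rect_int (fun z => (F z - G z)%C) x0 x1 y0 y1 = (rect_int F x0 x1 y0 y1 - rect_int G x0 x1 y0 y1)%C.
Proof.
intros Hx Hy HF HG.
destruct (rect_int_elim F x0 x1 y0 y1 Hx Hy HF) as (l1 & l2 & l3 & l4 & H1 & H2 & H3 & H4).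
destruct (rect_int_elim G x0 x1 y0 y1 Hx Hy HG) as (m1 & m2 & m3 & m4 & K1 & K2 & K3 & K4).
rewrite (rect_int_intro F x0 x1 y0 y1 l1 l2 l3 l4), (rect_int_intro G x0 x1 y0 y1 m1 m2 m3 m4) by assumption.
erewrite rect_int_intro; [|apply is_CInt_minus; eassumption ..]. ring.
Qed.

Lemma rect_int_plus F G x0 x1 y0 y1 : x0 <= x1 -> y0 <= y1 ->
  cont_edges F x0 x1 y0 y1 -> cont_edges G x0 x1 y0 y1 ->
  rect_int (fun z => (F z + G z)%C) x0 x1 y0 y1 = (rect_int F x0 x1 y0 y1 + rect_int G x0 x1 y0 y1)%C.
Proof.
intros Hx Hy HF HG.
destruct (rect_int_elim F x0 x1 y0 y1 Hx Hy HF) as (l1 & l2 & l3 & l4 & H1 & H2 & H3 & H4).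
destruct (rect_int_elim G x0 x1 y0 y1 Hx Hy HG) as (m1 & m2 & m3 & m4 & K1 & K2 & K3 & K4).
rewrite (rect_int_intro F x0 x1 y0 y1 l1 l2 l3 l4), (rect_int_intro G x0 x1 y0 y1 m1 m2 m3 m4) by assumption.
erewrite rect_int_intro; [|apply is_CInt_plus; eassumption ..]. ring.
Qed.

Lemma rect_int_mult_l k F x0 x1 y0 y1 : x0 <= x1 -> y0 <= y1 ->
  cont_edges F x0 x1 y0 y1 ->
  rect_int (fun z => (k * F z)%C) x0 x1 y0 y1 = (k * rect_int F x0 x1 y0 y1)%C.
Proof.
intros Hx Hy HF.
destruct (rect_int_elim F x0 x1 y0 y1 Hx Hy HF) as (l1 & l2 & l3 & l4 & H1 & H2 & H3 & H4).
rewrite (rect_int_intro F x0 x1 y0 y1 l1 l2 l3 l4) by assumption.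
erewrite rect_int_intro; [|apply is_CInt_mult_l; eassumption ..]. ring.
Qed.

Lemma rect_int_ext F G x0 x1 y0 y1 : x0 <= x1 -> y0 <= y1 ->
  cont_edges F x0 x1 y0 y1 ->
  (forall z, in_rect x0 x1 y0 y1 z -> Re z = x0 \/ Re z = x1 \/ Im z = y0 \/ Im z = y1 -> F z = G z) ->
  rect_int F x0 x1 y0 y1 = rect_int G x0 x1 y0 y1.
Proof.
intros Hx Hy HF HE.
destruct (rect_int_elim F x0 x1 y0 y1 Hx Hy HF) as (l1 & l2 & l3 & l4 & H1 & H2 & H3 & H4).
rewrite (rect_int_intro F x0 x1 y0 y1 l1 l2 l3 l4) by assumption.
symmetry; apply rect_int_intro.
- eapply is_CInt_ext; [|apply H1]. rewrite Rmin_left, Rmax_right by assumption.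
  intros t Ht; apply HE; unfold in_rect; simpl; [lra|auto].
- eapply is_CInt_ext; [|apply H2]. rewrite Rmin_left, Rmax_right by assumption.
  intros t Ht; apply HE; unfold in_rect; simpl; [lra|auto].
- eapply is_CInt_ext; [|apply H3]. rewrite Rmin_left, Rmax_right by assumption.
  intros t Ht; apply HE; unfold in_rect; simpl; [lra|auto].
- eapply is_CInt_ext; [|apply H4]. rewrite Rmin_left, Rmax_right by assumption.
  intros t Ht; apply HE; unfold in_rect; simpl; [lra|auto].
Qed.

Lemma cont_edges_in_rect (F : C -> C) x0 x1 y0 y1 : x0 <= x1 -> y0 <= y1 ->
  (forall z, in_rect x0 x1 y0 y1 z -> Ccontinuous F z) -> cont_edges F x0 x1 y0 y1.
Proof.
intros Hx Hy H; split; intros t Ht; split; apply H; unfold in_rect; simpl; lra.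
Qed.

(** One bisection step: the lower left corner of the first quarter carrying at least a quarter of
    the integral. The upper right quarter is the default. *)
Definition quadrants (F : C -> C) (w h x y : R) : R * R :=
  let e := Cmod (rect_int F x (x + 2 * w) y (y + 2 * h)) / 4 in
  if Rle_dec e (Cmod (rect_int F x (x + w) y (y + h))) then (x, y)
  else if Rle_dec e (Cmod (rect_int F (x + w) (x + 2 * w) y (y + h))) then (x + w, y)
  else if Rle_dec e (Cmod (rect_int F x (x + w) (y + h) (y + 2 * h))) then (x, y + h)
  else (x + w, y + h).

Lemma quadrants_spec F w h x y : 0 <= w -> 0 <= h ->
  (forall z, in_rect x (x + 2 * w) y (y + 2 * h) z -> Ccontinuous F z) ->
  let p := quadrants F w h x y in
  Cmod (rect_int F x (x + 2 * w) y (y + 2 * h)) / 4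
    <= Cmod (rect_int F (fst p) (fst p + w) (snd p) (snd p + h)) /\
  x <= fst p <= x + w /\ y <= snd p <= y + h.
Proof.
intros Hw Hh Hc p.
assert (S : rect_int F x (x + 2 * w) y (y + 2 * h) =
  (rect_int F x (x + w) y (y + h) + rect_int F (x + w) (x + 2 * w) y (y + h)
  + rect_int F x (x + w) (y + h) (y + 2 * h)
  + rect_int F (x + w) (x + 2 * w) (y + h) (y + 2 * h))%C).
{ rewrite (rect_int_split_x F x (x + w) (x + 2 * w)); [|lra|].
  2:{ intros u Hu; split; apply Hc; unfold in_rect; simpl; lra. }
  rewrite (rect_int_split_y F x (x + w) y (y + h) (y + 2 * h)); [|lra|].
  2:{ intros u Hu; split; apply Hc; unfold in_rect; simpl; lra. }
  rewrite (rect_int_split_y F (x + w) (x + 2 * w) y (y + h) (y + 2 * h)); [|lra|].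
  2:{ intros u Hu; split; apply Hc; unfold in_rect; simpl; lra. }
  ring. }
unfold p, quadrants; clear p.
set (e := Cmod (rect_int F x (x + 2 * w) y (y + 2 * h)) / 4).
destruct Rle_dec as [H1|H1]; simpl; [split; [exact H1|lra]|].
destruct Rle_dec as [H2|H2]; simpl.
{ replace (x + w + w) with (x + 2 * w) by ring. split; [exact H2|lra]. }
destruct Rle_dec as [H3|H3]; simpl.
{ replace (y + h + h) with (y + 2 * h) by ring. split; [exact H3|lra]. }
replace (x + w + w) with (x + 2 * w) by ring. replace (y + h + h) with (y + 2 * h) by ring.
split; [|lra].
(* If the first three quarters are too small, the triangle inequality leaves at least [e] for the
   last. *)
assert (T : 4 * e <= Cmod (rect_int F x (x + w) y (y + h)) + Cmod (rect_int F (x + w) (x + 2 * w) y (y + h))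
  + Cmod (rect_int F x (x + w) (y + h) (y + 2 * h)) + Cmod (rect_int F (x + w) (x + 2 * w) (y + h) (y + 2 * h))).
{ unfold e; rewrite S.
  set (a1 := rect_int F x (x + w) y (y + h)).
  set (a2 := rect_int F (x + w) (x + 2 * w) y (y + h)).
  set (a3 := rect_int F x (x + w) (y + h) (y + 2 * h)).
  set (a4 := rect_int F (x + w) (x + 2 * w) (y + h) (y + 2 * h)).
  generalize (Cmod_triangle (a1 + a2 + a3) a4), (Cmod_triangle (a1 + a2) a3), (Cmod_triangle a1 a2). lra. }
lra.
Qed.

Lemma Cmod_le_Re_Im (z : C) : Cmod z <= Rabs (Re z) + Rabs (Im z).
Proof.
replace z with (RtoC (Re z) + Ci * RtoC (Im z))%C at 1.
- eapply Rle_trans; [apply Cmod_triangle|].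
  rewrite Cmod_mult, Cmod_Ci, !Cmod_R; lra.
- destruct z; unfold Ci, RtoC, Cplus, Cmult; simpl. f_equal; ring.
Qed.

Lemma is_Cderive_quadratic (al be z : C) :
  is_Cderive (fun w => (al * w + be / 2 * (w * w))%C) z (al + be * z)%C.
Proof.
apply is_Cderive_eps; intros eps He.
exists (eps / (Cmod be + 1)). assert (H0 := Cmod_ge_0 be).
split; [apply Rdiv_lt_0_compat; lra|]. intros w Hw.
replace (al * w + be / 2 * (w * w) - (al * z + be / 2 * (z * z)) - (w - z) * (al + be * z))%C
  with (be * / 2 * (w - z) * (w - z))%C by (field; apply C1_nz || (intros E; injection E; lra)).
rewrite !Cmod_mult.
assert (H1 := Cmod_ge_0 (w - z)).
apply Rmult_le_compat_r; [assumption|].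
replace (Cmod (/ 2)) with (/ 2).
2:{ rewrite Cmod_inv by (intros E; injection E; lra). rewrite Cmod_R, Rabs_pos_eq; lra. }
apply Rlt_le, Rle_lt_trans with ((Cmod be + 1) * Cmod (w - z)); [nra|].
apply (Rmult_lt_compat_l (Cmod be + 1)) in Hw; [|lra].
replace ((Cmod be + 1) * (eps / (Cmod be + 1))) with eps in Hw by (field; lra). exact Hw.
Qed.

Lemma Ccontinuous_affine (al be z : C) : Ccontinuous (fun w => (al + be * w)%C) z.
Proof.
apply ex_Cderive_continuous. exists be. apply is_Cderive_eps; intros eps He.
exists 1; split; [lra|]; intros w _.
replace (al + be * w - (al + be * z) - (w - z) * be)%C with (RtoC 0) by ring.
rewrite Cmod_0. apply Rmult_le_pos; [lra|apply Cmod_ge_0].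
Qed.

Lemma rect_int_affine al be x0 x1 y0 y1 : x0 <= x1 -> y0 <= y1 ->
  rect_int (fun w => (al + be * w)%C) x0 x1 y0 y1 = 0%C.
Proof.
intros Hx Hy. apply rect_int_primitive with (fun w => (al * w + be / 2 * (w * w))%C); try assumption.
- apply cont_edges_in_rect; try assumption. intros; apply Ccontinuous_affine.
- intros u _; split; apply is_Cderive_quadratic.
- intros u _; split; apply is_Cderive_quadratic.
Qed.

(* The affine part of [F] at the limit point of the bisection integrates to 0. *)
Theorem goursat (F : C -> C) (x0 x1 y0 y1 : R) : x0 <= x1 -> y0 <= y1 ->
  (forall z, in_rect x0 x1 y0 y1 z -> ex_Cderive F z) -> rect_int F x0 x1 y0 y1 = 0%C.
Proof.
intros Hx Hy HF.
assert (HC : forall z, in_rect x0 x1 y0 y1 z -> Ccontinuous F z).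
{ intros z Hz; apply ex_Cderive_continuous, HF, Hz. }
destruct (Req_dec (Cmod (rect_int F x0 x1 y0 y1)) 0) as [E|E]; [apply Cmod_eq_0, E|exfalso].
set (e := Cmod (rect_int F x0 x1 y0 y1)) in E.
assert (He : 0 < e) by (assert (H := Cmod_ge_0 (rect_int F x0 x1 y0 y1)); unfold e in *; lra).
set (w := fun n => (x1 - x0) / 2 ^ n). set (h := fun n => (y1 - y0) / 2 ^ n).
assert (P2 : forall n, 0 < 2 ^ n) by (intros; apply pow_lt; lra).
assert (Hw : forall n, w n = 2 * w (S n)) by (intros n; unfold w; simpl; field; specialize (P2 n); lra).
assert (Hh : forall n, h n = 2 * h (S n)) by (intros n; unfold h; simpl; field; specialize (P2 n); lra).
assert (Hw0 : forall n, 0 <= w n) by (intros n; unfold w; apply Rdiv_le_0_compat; [lra|apply P2]).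
assert (Hh0 : forall n, 0 <= h n) by (intros n; unfold h; apply Rdiv_le_0_compat; [lra|apply P2]).
set (q := fix q n := match n with O => (x0, y0) | S n => quadrants F (w (S n)) (h (S n)) (fst (q n)) (snd (q n)) end).
assert (Inv : forall n, x0 <= fst (q n) /\ fst (q n) + w n <= x1 /\ y0 <= snd (q n) /\ snd (q n) + h n <= y1
   /\ e / 4 ^ n <= Cmod (rect_int F (fst (q n)) (fst (q n) + w n) (snd (q n)) (snd (q n) + h n))
   /\ fst (q n) <= fst (q (S n)) <= fst (q n) + w (S n) /\ snd (q n) <= snd (q (S n)) <= snd (q n) + h (S n)).
{ assert (Stp : forall n, x0 <= fst (q n) -> fst (q n) + w n <= x1 -> y0 <= snd (q n) -> snd (q n) + h n <= y1 ->
   let p := q (S n) in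
   Cmod (rect_int F (fst (q n)) (fst (q n) + w n) (snd (q n)) (snd (q n) + h n)) / 4
    <= Cmod (rect_int F (fst p) (fst p + w (S n)) (snd p) (snd p + h (S n))) /\
   fst (q n) <= fst p <= fst (q n) + w (S n) /\ snd (q n) <= snd p <= snd (q n) + h (S n)).
  { intros n A1 A2 A3 A4 p. rewrite (Hw n), (Hh n).
    apply quadrants_spec; [apply Hw0|apply Hh0|].
    rewrite <- Hw, <- Hh. intros z [Hz1 Hz2]; apply HC; split; lra. }
  assert (I : forall n, x0 <= fst (q n) /\ fst (q n) + w n <= x1 /\ y0 <= snd (q n) /\ snd (q n) + h n <= y1
   /\ e / 4 ^ n <= Cmod (rect_int F (fst (q n)) (fst (q n) + w n) (snd (q n)) (snd (q n) + h n))).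
  { induction n as [|n (A1 & A2 & A3 & A4 & A5)].
    - change (fst (q 0%nat)) with x0; change (snd (q 0%nat)) with y0. unfold w, h; rewrite !pow_O.
      replace (x0 + (x1 - x0) / 1) with x1 by field. replace (y0 + (y1 - y0) / 1) with y1 by field.
      fold e. repeat split; lra.
    - destruct (Stp n A1 A2 A3 A4) as (B1 & B2 & B3).
      assert (Hwn := Hw n); assert (Hhn := Hh n).
      repeat split; try lra.
      eapply Rle_trans; [|exact B1]. apply Rle_trans with (e / 4 ^ n / 4); [|lra].
      apply Req_le; simpl; field. apply pow_nonzero; lra. }
  intros n; destruct (I n) as (A1 & A2 & A3 & A4 & A5).
  destruct (Stp n A1 A2 A3 A4) as (B1 & B2 & B3). tauto. }
clearbody q.
assert (Lw : forall c, is_lim_seq (fun n => c / 2 ^ n) 0).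
{ intros c. apply is_lim_seq_ext with (fun n => c * (/ 2) ^ n).
  - intros n; unfold Rdiv; rewrite pow_inv; reflexivity.
  - replace (Finite 0) with (Rbar_mult c 0) by (simpl; f_equal; ring).
    apply is_lim_seq_scal_l, is_lim_seq_geom. rewrite Rabs_pos_eq; lra. }
(* Nested intervals: left ends increase, right ends decrease and the widths halve, so a common point
   exists. *)
assert (Lim : forall (u wd : nat -> R) M, (forall n, u n <= u (S n) <= u n + wd (S n)) ->
   (forall n, wd n = 2 * wd (S n)) -> (forall n, u n + wd n <= M) -> (forall n, 0 <= wd n) ->
   is_lim_seq wd 0 -> exists l, forall n, u n <= l <= u n + wd n).
{ intros u wd M U1 U2 U3 U4 U5.
  destruct (ex_finite_lim_seq_incr u M) as [l Hl].
  - intros n; apply U1.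
  - intros n; specialize (U3 n); specialize (U4 n); lra.
  - exists l; intros n; split.
    + apply (is_lim_seq_incr_compare u l Hl). intros k; apply U1.
    + assert (Hl2 : is_lim_seq (fun n => u n + wd n) l).
      { replace (Finite l) with (Rbar_plus l 0) by (simpl; f_equal; ring). apply is_lim_seq_plus'; assumption. }
      apply (is_lim_seq_decr_compare _ l Hl2 ). intros k.
      specialize (U1 k); specialize (U2 k); lra. }
destruct (Lim (fun n => fst (q n)) w x1) as [px Hpx]; try apply Lw; try assumption; try (intros n; apply Inv).
destruct (Lim (fun n => snd (q n)) h y1) as [py Hpy]; try apply Lw; try assumption; try (intros n; apply Inv).
set (p := (px, py) : C).
assert (Hp : in_rect x0 x1 y0 y1 p).
{ generalize (Inv 0%nat), (Hpx 0%nat), (Hpy 0%nat); unfold in_rect, p; simpl; lra. }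
destruct (HF p Hp) as [l Hl]. rewrite is_Cderive_eps in Hl.
set (L := x1 - x0 + (y1 - y0)).
assert (HL0 : 0 <= L) by (unfold L; lra).
(* With this tolerance the remainder on the [n]-th rectangle integrates to at most half of e/4^n,
   against the lower bound obtained by bisection. Using L + 1 allows a degenerate rectangle. *)
destruct (Hl (e / (4 * (L + 1) * (L + 1)))) as [eta [Heta Hd]].
{ apply Rdiv_lt_0_compat; [lra|nra]. }
destruct (Lw (L + 1) (fun y => Rabs y < eta)) as [n Hn].
{ exists (mkposreal eta Heta). intros y Hyy. rewrite <- (Rminus_0_r y). exact Hyy. }
specialize (Hn n (le_n n)). rewrite Rabs_pos_eq in Hn by (apply Rdiv_le_0_compat; [lra|apply P2]).
destruct (Inv n) as (A1 & A2 & A3 & A4 & A5 & _).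
assert (Hdist : forall z, in_rect (fst (q n)) (fst (q n) + w n) (snd (q n)) (snd (q n) + h n) z ->
   Cmod (z - p) <= L / 2 ^ n).
{ intros z [Z1 Z2]. eapply Rle_trans; [apply Cmod_le_Re_Im|].
  specialize (Hpx n); specialize (Hpy n).
  replace (L / 2 ^ n) with (w n + h n) by (unfold w, h, L; field; specialize (P2 n); lra).
  unfold p, Cminus, Cplus, Copp, Re, Im in *; simpl.
  apply Rplus_le_compat; apply Rabs_le; lra. }
set (G := fun z => (F p - p * l + l * z)%C).
assert (EG : rect_int F (fst (q n)) (fst (q n) + w n) (snd (q n)) (snd (q n) + h n) =
  rect_int (fun z => F z - G z)%C (fst (q n)) (fst (q n) + w n) (snd (q n)) (snd (q n) + h n)).
{ specialize (Hw0 n); specialize (Hh0 n). rewrite rect_int_minus; try lra.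
  - unfold G. rewrite rect_int_affine by lra. ring.
  - apply cont_edges_in_rect; try lra. intros z [Z1 Z2]; apply HC; split; lra.
  - apply cont_edges_in_rect; try lra. intros; apply Ccontinuous_affine. }
rewrite EG in A5.
assert (B : Cmod (rect_int (fun z => F z - G z)%C (fst (q n)) (fst (q n) + w n) (snd (q n)) (snd (q n) + h n))
   <= 2 * (w n + h n) * (e / (4 * (L + 1) * (L + 1)) * (L / 2 ^ n))).
{ specialize (Hw0 n); specialize (Hh0 n).
  replace (w n + h n) with (fst (q n) + w n - fst (q n) + (snd (q n) + h n - snd (q n))) by ring.
  apply rect_int_norm_le; try lra.
  - apply cont_edges_in_rect; try lra. intros z [Z1 Z2].
    apply (continuous_minus (K := C_AbsRing) (V := C_NormedModule)).
    + apply HC; split; lra.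
    + apply Ccontinuous_affine.
  - intros z Hz _. unfold G.
    replace (F z - (F p - p * l + l * z))%C with (F z - F p - (z - p) * l)%C by ring.
    eapply Rle_trans; [apply Hd|].
    + eapply Rle_lt_trans; [apply Hdist, Hz|]. eapply Rle_lt_trans; [|exact Hn].
      apply Rmult_le_compat_r; [apply Rlt_le, Rinv_0_lt_compat, P2|lra].
    + apply Rmult_le_compat_l; [|apply Hdist, Hz].
      apply Rdiv_le_0_compat; [lra|nra]. }
assert (E4 : 4 ^ n = 2 ^ n * 2 ^ n) by (rewrite <- Rpow_mult_distr; f_equal; lra).
replace (w n + h n) with (L / 2 ^ n) in B by (unfold w, h, L; field; specialize (P2 n); lra).
assert (F1 : e / 4 ^ n <= e / 4 ^ n * (/ 2 * (L * L / ((L + 1) * (L + 1))))).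
{ eapply Rle_trans; [exact A5|]. eapply Rle_trans; [exact B|]. apply Req_le. rewrite E4. field.
  specialize (P2 n); split; lra. }
assert (F2 : L * L / ((L + 1) * (L + 1)) <= 1).
{ apply Rle_div_l; nra. }
assert (F3 : 0 < e / 4 ^ n) by (apply Rdiv_lt_0_compat; [lra|apply pow_lt; lra]).
nra.
Qed.

Lemma sq_add_sq_pos (a e : R) : 0 < e -> 0 < a * a + e * e.
Proof. intros; nra. Qed.

(** Up to sign, this integral and the next one are the two components of the integral of 1/(z - p)
    along one side of the square of half-width [e] around [p]. The odd component cancels. *)
Lemma is_RInt_odd_kernel c e : 0 < e ->
  is_RInt (fun u => (u - c) / ((u - c) * (u - c) + e * e)) (c - e) (c + e) 0.
Proof.
intros He.
replace 0 with (minus (ln ((c + e - c) * (c + e - c) + e * e) / 2) (ln ((c - e - c) * (c - e - c) + e * e) / 2)).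
2:{ unfold minus, plus, opp; simpl. replace ((c + e - c) * (c + e - c)) with (e * e) by ring.
    replace ((c - e - c) * (c - e - c)) with (e * e) by ring. ring. }
apply (is_RInt_derive (fun u => ln ((u - c) * (u - c) + e * e) / 2)).
- intros u _. assert (Hq := sq_add_sq_pos (u - c) e He).
  auto_derive; [lra|field; lra].
- intros u _. assert (Hq := sq_add_sq_pos (u - c) e He).
  apply continuity_pt_filterlim. apply derivable_continuous_pt. apply ex_derive_Reals_0. auto_derive. lra.
Qed.

Lemma is_RInt_cauchy_kernel c e : 0 < e ->
  is_RInt (fun u => e / ((u - c) * (u - c) + e * e)) (c - e) (c + e) (PI / 2).
Proof.
intros He.
replace (PI / 2) with (minus (atan ((c + e - c) / e)) (atan ((c - e - c) / e))).
2:{ unfold minus, plus, opp; simpl. replace ((c + e - c) / e) with 1 by (field; lra).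
    replace ((c - e - c) / e) with (- (1)) by (field; lra). rewrite atan_opp, atan_1. field. }
apply (is_RInt_derive (fun u => atan ((u - c) / e))).
- intros u _. assert (Hq := sq_add_sq_pos (u - c) e He).
  auto_derive; [exact I|]. unfold Rsqr. field. repeat split; nra.
- intros u _. assert (Hq := sq_add_sq_pos (u - c) e He).
  apply continuity_pt_filterlim. apply derivable_continuous_pt. apply ex_derive_Reals_0. auto_derive. lra.
Qed.

Lemma is_RInt_ext_all (f g : R -> R) a b l : (forall x, f x = g x) -> is_RInt f a b l -> is_RInt g a b l.
Proof. intros H; apply is_RInt_ext; auto. Qed.

(** The sign [s] distinguishes the two opposite sides of the square; it affects only the imaginary
    part. *)
Lemma is_CInt_inv_horizontal (c s e : R) : 0 < e -> s * s = 1 ->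
  is_CInt (fun u : R => Cinv (u - c, s * e)) (c - e) (c + e) (0, - s * (PI / 2))%R.
Proof.
intros He Hs. apply is_CInt_pair; split.
- apply is_RInt_ext_all with (2 := is_RInt_odd_kernel c e He).
  intros u; unfold Cinv, Re; simpl. assert (Hq := sq_add_sq_pos (u - c) e He).
  replace ((u - c) * ((u - c) * 1) + s * e * (s * e * 1)) with ((u - c) * (u - c) + e * e * (s * s)) by ring.
  rewrite Hs, Rmult_1_r. reflexivity.
- apply is_RInt_ext_all with (fun u => scal (- s) (e / ((u - c) * (u - c) + e * e))).
  + intros u; unfold Cinv, Im; simpl. assert (Hq := sq_add_sq_pos (u - c) e He).
    replace ((u - c) * ((u - c) * 1) + s * e * (s * e * 1)) with ((u - c) * (u - c) + e * e * (s * s)) by ring.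
    rewrite Hs, Rmult_1_r. unfold scal; simpl; unfold mult; simpl. field. lra.
  + apply (is_RInt_scal (V := R_NormedModule)), is_RInt_cauchy_kernel, He.
Qed.

Lemma is_CInt_inv_vertical (c s e : R) : 0 < e -> s * s = 1 ->
  is_CInt (fun u : R => Cinv (s * e, u - c)) (c - e) (c + e) (s * (PI / 2), 0)%R.
Proof.
intros He Hs. apply is_CInt_pair; split.
- apply is_RInt_ext_all with (fun u => scal s (e / ((u - c) * (u - c) + e * e))).
  + intros u; unfold Cinv, Re; simpl. assert (Hq := sq_add_sq_pos (u - c) e He).
    replace (s * e * (s * e * 1) + (u - c) * ((u - c) * 1)) with ((u - c) * (u - c) + e * e * (s * s)) by ring.
    rewrite Hs, Rmult_1_r. unfold scal; simpl; unfold mult; simpl. field. lra.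
  + apply (is_RInt_scal (V := R_NormedModule)), is_RInt_cauchy_kernel, He.
- apply is_RInt_ext_all with (fun u => scal (-1) ((u - c) / ((u - c) * (u - c) + e * e))).
  + intros u; unfold Cinv, Im; simpl. assert (Hq := sq_add_sq_pos (u - c) e He).
    replace (s * e * (s * e * 1) + (u - c) * ((u - c) * 1)) with ((u - c) * (u - c) + e * e * (s * s)) by ring.
    rewrite Hs, Rmult_1_r. unfold scal; simpl; unfold mult; simpl. field. lra.
  + replace (Im (s * (PI / 2), 0)) with (scal (-1) 0) by (unfold scal; simpl; unfold mult; simpl; ring).
    apply (is_RInt_scal (V := R_NormedModule)), is_RInt_odd_kernel, He.
Qed.

(** Each side is seen from [p] under a right angle and contributes i times PI/2. *)
Lemma rect_int_inv_small (p : C) e : 0 < e ->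
  rect_int (fun z => / (z - p))%C (Re p - e) (Re p + e) (Im p - e) (Im p + e) = (2 * PI * Ci)%C.
Proof.
intros He.
assert (S1 : -1 * -1 = 1) by ring. assert (S2 : 1 * 1 = 1) by ring.
erewrite (rect_int_intro (fun z => / (z - p))%C).
2:{ eapply is_CInt_ext; [|apply (is_CInt_inv_horizontal (Re p) (-1) e He S1)].
    intros u _; simpl. f_equal. destruct p; unfold Cminus, Cplus, Copp; simpl. f_equal; ring. }
2:{ eapply is_CInt_ext; [|apply (is_CInt_inv_vertical (Im p) 1 e He S2)].
    intros u _; simpl. f_equal. destruct p; unfold Cminus, Cplus, Copp; simpl. f_equal; ring. }
2:{ eapply is_CInt_ext; [|apply (is_CInt_inv_horizontal (Re p) 1 e He S2)].
    intros u _; simpl. f_equal. destruct p; unfold Cminus, Cplus, Copp; simpl. f_equal; ring. }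
2:{ eapply is_CInt_ext; [|apply (is_CInt_inv_vertical (Im p) (-1) e He S1)].
    intros u _; simpl. f_equal. destruct p; unfold Cminus, Cplus, Copp; simpl. f_equal; ring. }
unfold Ci, RtoC, Cmult, Cminus, Cplus, Copp; simpl. f_equal; field.
Qed.

(** The product rule is stated for [C] as a module over itself, which is a different structure from
    [C_NormedModule]; both unfold to the same condition. *)
Lemma is_Cderive_AbsRing F z l :
  is_derive (K := C_AbsRing) (V := AbsRing_NormedModule C_AbsRing) F z l <-> is_Cderive F z l.
Proof.
split; intros [_ H]; (split; [apply is_linear_scal_l|exact H]).
Qed.

Lemma is_Cderive_mult f g z df dg : is_Cderive f z df -> is_Cderive g z dg ->
  is_Cderive (fun w => f w * g w)%C z (df * g z + f z * dg)%C.
Proof.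
rewrite <- !is_Cderive_AbsRing. intros H1 H2.
apply (is_derive_mult (K := C_AbsRing) f g z df dg H1 H2). intros n m; apply Cmult_comm.
Qed.

Lemma is_Cderive_plus f g z df dg : is_Cderive f z df -> is_Cderive g z dg ->
  is_Cderive (fun w => f w + g w)%C z (df + dg)%C.
Proof. intros H1 H2; exact (is_derive_plus (K := C_AbsRing) (V := C_NormedModule) f g z df dg H1 H2). Qed.

Lemma is_Cderive_minus f g z df dg : is_Cderive f z df -> is_Cderive g z dg ->
  is_Cderive (fun w => f w - g w)%C z (df - dg)%C.
Proof. intros H1 H2; exact (is_derive_minus (K := C_AbsRing) (V := C_NormedModule) f g z df dg H1 H2). Qed.

Lemma is_Cderive_const (k z : C) : is_Cderive (fun _ => k) z (RtoC 0).
Proof. exact (is_derive_const (K := C_AbsRing) (V := C_NormedModule) k z). Qed.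

Lemma is_Cderive_inv (p z : C) : (z - p <> 0)%C ->
  is_Cderive (fun w => / (w - p))%C z (- / ((z - p) * (z - p)))%C.
Proof.
intros Hz. apply is_Cderive_eps; intros eps He.
set (d := Cmod (z - p)). assert (Hd : 0 < d) by (apply Cmod_gt_0, Hz).
exists (Rmin (d / 2) (eps * (d * d * d) / 2)). split.
{ apply Rmin_glb_lt; [lra|]. assert (0 < d * d * d) by (repeat apply Rmult_lt_0_compat; lra). nra. }
intros w Hw.
assert (Hw1 : Cmod (w - z) < d / 2) by (eapply Rlt_le_trans; [exact Hw|apply Rmin_l]).
assert (Hw2 : Cmod (w - z) < eps * (d * d * d) / 2) by (eapply Rlt_le_trans; [exact Hw|apply Rmin_r]).
assert (Hwp : d / 2 <= Cmod (w - p)).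
{ assert (T := Cmod_triangle (w - p) (z - w)).
  replace (w - p + (z - w))%C with (z - p)%C in T by ring. fold d in T.
  replace (Cmod (z - w)) with (Cmod (w - z)) in T by (rewrite <- (Cmod_opp (w - z)); f_equal; ring). lra. }
assert (Hwp' : (w - p <> 0)%C) by (intros E; rewrite E, Cmod_0 in Hwp; lra).
replace (/ (w - p) - / (z - p) - (w - z) * - / ((z - p) * (z - p)))%C
  with ((w - z) * / ((w - p) * (z - p) * (z - p)) * (w - z))%C by (field; auto).
rewrite !Cmod_mult. apply Rmult_le_compat_r; [apply Cmod_ge_0|].
rewrite Cmod_inv by (repeat apply Cmult_neq_0; auto).
rewrite !Cmod_mult. fold d. apply Rle_div_l; [apply Rlt_gt; repeat apply Rmult_lt_0_compat; lra|].
assert (eps * (d / 2 * d * d) <= eps * (Cmod (w - p) * d * d)).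
{ apply Rmult_le_compat_l; [lra|]. apply Rmult_le_compat_r; [lra|]. apply Rmult_le_compat_r; lra. }
lra.
Qed.

Lemma ex_Cderive_mult f g z : ex_Cderive f z -> ex_Cderive g z -> ex_Cderive (fun w => f w * g w)%C z.
Proof. intros [df H1] [dg H2]; eexists; apply is_Cderive_mult; eassumption. Qed.

Lemma ex_Cderive_inv (p z : C) : (z - p <> 0)%C -> ex_Cderive (fun w => / (w - p))%C z.
Proof. intros H; eexists; apply is_Cderive_inv, H. Qed.

(** The four strips around the square avoid [p], and Goursat's theorem removes each of them. *)
Lemma goursat_off_square F p x0 x1 y0 y1 e : 0 < e ->
  x0 <= Re p - e -> Re p + e <= x1 -> y0 <= Im p - e -> Im p + e <= y1 ->
  (forall z, in_rect x0 x1 y0 y1 z -> z <> p -> ex_Cderive F z) ->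
  rect_int F x0 x1 y0 y1 = rect_int F (Re p - e) (Re p + e) (Im p - e) (Im p + e).
Proof.
intros He X0 X1 Y0 Y1 HF.
assert (HN : forall z : C, Re z < Re p \/ Re p < Re z \/ Im z < Im p \/ Im p < Im z -> z <> p)
  by (intros z Hz E; subst z; lra).
assert (HC : forall z, in_rect x0 x1 y0 y1 z -> z <> p -> Ccontinuous F z)
  by (intros; apply ex_Cderive_continuous, HF; assumption).
rewrite (rect_int_split_x F x0 (Re p - e) x1); [|lra|].
2:{ intros u Hu; split; apply HC; unfold in_rect; simpl; try lra; apply HN; simpl; lra. }
rewrite (goursat F x0 (Re p - e)); try lra.
2:{ intros z [Z1 Z2]; apply HF; [unfold in_rect; lra|apply HN; lra]. }
rewrite (rect_int_split_x F (Re p - e) (Re p + e) x1); [|lra|].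
2:{ intros u Hu; split; apply HC; unfold in_rect; simpl; try lra; apply HN; simpl; lra. }
rewrite (goursat F (Re p + e) x1); try lra.
2:{ intros z [Z1 Z2]; apply HF; [unfold in_rect; lra|apply HN; lra]. }
rewrite (rect_int_split_y F _ _ y0 (Im p - e) y1); [|lra|].
2:{ intros u Hu; split; apply HC; unfold in_rect; simpl; try lra; apply HN; simpl; lra. }
rewrite (goursat F _ _ y0 (Im p - e)); try lra.
2:{ intros z [Z1 Z2]; apply HF; [unfold in_rect; lra|apply HN; lra]. }
rewrite (rect_int_split_y F _ _ (Im p - e) (Im p + e) y1); [|lra|].
2:{ intros u Hu; split; apply HC; unfold in_rect; simpl; try lra; apply HN; simpl; lra. }
rewrite (goursat F _ _ (Im p + e) y1); try lra.
2:{ intros z [Z1 Z2]; apply HF; [unfold in_rect; lra|apply HN; lra]. }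
ring.
Qed.

(** Subtracting H(p)/(z - p) leaves a difference quotient, bounded near [p] by differentiability,
    whose integral over a square of half-width [e] is O(e). *)
Theorem cauchy_formula (H : C -> C) (p : C) x0 x1 y0 y1 :
  x0 < Re p < x1 -> y0 < Im p < y1 ->
  (forall z, in_rect x0 x1 y0 y1 z -> ex_Cderive H z) ->
  rect_int (fun z => H z * / (z - p))%C x0 x1 y0 y1 = (2 * PI * Ci * H p)%C.
Proof.
intros Hx Hy HD.
assert (Hp : in_rect x0 x1 y0 y1 p) by (unfold in_rect; lra).
destruct (HD p Hp) as [l Hl]. rewrite is_Cderive_eps in Hl.
destruct (Hl 1 Rlt_0_1) as [eta [Heta Hd]].
set (M := Cmod l + 1).
assert (HM : 0 < M) by (unfold M; generalize (Cmod_ge_0 l); lra).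
assert (Nz : forall z, z <> p -> (z - p <> 0)%C).
{ intros z Hz E; apply Hz. replace z with (z - p + p)%C by ring. rewrite E; ring. }
assert (Bd : forall z, z <> p -> Cmod (z - p) < eta -> Cmod ((H z - H p) * / (z - p)) <= M).
{ intros z Hz He. assert (N := Nz z Hz).
  replace ((H z - H p) * / (z - p))%C with ((H z - H p - (z - p) * l) * / (z - p) + l)%C by (field; auto).
  eapply Rle_trans; [apply Cmod_triangle|]. unfold M. rewrite (Rplus_comm (Cmod l)). apply Rplus_le_compat_r.
  rewrite Cmod_mult, Cmod_inv by auto. apply Rle_div_l; [apply Rlt_gt, Cmod_gt_0, N|]. apply Hd, He. }
set (X := (rect_int (fun z => H z * / (z - p)) x0 x1 y0 y1 - 2 * PI * Ci * H p)%C).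
assert (Key : forall e, 0 < e -> e < eta / 2 -> x0 <= Re p - e -> Re p + e <= x1 -> y0 <= Im p - e -> Im p + e <= y1 ->
   Cmod X <= 8 * e * M).
{ intros e He Ee X0 X1 Y0 Y1. unfold X.
  assert (Hd2 : forall z, in_rect x0 x1 y0 y1 z -> z <> p -> ex_Cderive (fun z => H z * / (z - p))%C z).
  { intros z Hz Hzp; apply ex_Cderive_mult; [apply HD, Hz|apply ex_Cderive_inv, Nz, Hzp]. }
  rewrite (goursat_off_square _ p x0 x1 y0 y1 e); try assumption.
  assert (HN : forall z : C, Re z < Re p \/ Re p < Re z \/ Im z < Im p \/ Im p < Im z -> z <> p)
    by (intros z Hz E; subst z; lra).
  assert (C1 : cont_edges (fun z => H z * / (z - p))%C (Re p - e) (Re p + e) (Im p - e) (Im p + e)).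
  { split; intros t Ht; split; apply ex_Cderive_continuous, Hd2; try (unfold in_rect; simpl; lra);
    apply HN; simpl; lra. }
  assert (C2 : cont_edges (fun z => H p * / (z - p))%C (Re p - e) (Re p + e) (Im p - e) (Im p + e)).
  { assert (Q : forall z, z <> p -> Ccontinuous (fun z => H p * / (z - p))%C z).
    { intros z Hz. apply ex_Cderive_continuous.
      apply (ex_Cderive_mult (fun _ => H p) (fun z => / (z - p))%C).
      - exists (RtoC 0). apply is_Cderive_const.
      - apply ex_Cderive_inv, Nz, Hz. }
    split; intros t Ht; split; apply Q, HN; simpl; lra. }
  assert (C3 : cont_edges (fun z => / (z - p))%C (Re p - e) (Re p + e) (Im p - e) (Im p + e)).
  { split; intros t Ht; split; apply ex_Cderive_continuous; apply ex_Cderive_inv, Nz, HN; simpl; lra. }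
  replace (2 * PI * Ci * H p)%C with (rect_int (fun z => H p * / (z - p))%C (Re p - e) (Re p + e) (Im p - e) (Im p + e)).
  2:{ rewrite (rect_int_mult_l (H p) (fun z => / (z - p))%C) by (lra || exact C3).
      rewrite rect_int_inv_small by assumption. ring. }
  rewrite <- rect_int_minus by (lra || assumption).
  replace (8 * e * M) with (2 * ((Re p + e - (Re p - e)) + (Im p + e - (Im p - e))) * M) by ring.
  apply rect_int_norm_le; try lra.
  - assert (Q : forall z, Ccontinuous (fun z => H z * / (z - p))%C z -> Ccontinuous (fun z => H p * / (z - p))%C z ->
      Ccontinuous (fun z => H z * / (z - p) - H p * / (z - p))%C z).
    { intros z. apply (continuous_minus (K := C_AbsRing) (V := C_NormedModule)). }
    split; intros t Ht; split; apply Q.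
    + exact (proj1 (proj1 C1 t Ht)). + exact (proj1 (proj1 C2 t Ht)).
    + exact (proj2 (proj1 C1 t Ht)). + exact (proj2 (proj1 C2 t Ht)).
    + exact (proj1 (proj2 C1 t Ht)). + exact (proj1 (proj2 C2 t Ht)).
    + exact (proj2 (proj2 C1 t Ht)). + exact (proj2 (proj2 C2 t Ht)).
  - intros z Hz Hb. replace (H z * / (z - p) - H p * / (z - p))%C with ((H z - H p) * / (z - p))%C by ring.
    apply Bd; [apply HN; lra|].
    eapply Rle_lt_trans; [apply Cmod_le_Re_Im|].
    destruct Hz as [Z1 Z2].
    assert (Rabs (Re (z - p)) <= e).
    { replace (Re (z - p)) with (Re z - Re p) by (unfold Re, Cminus, Cplus, Copp; simpl; ring). apply Rabs_le; lra. }
    assert (Rabs (Im (z - p)) <= e).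
    { replace (Im (z - p)) with (Im z - Im p) by (unfold Im, Cminus, Cplus, Copp; simpl; ring). apply Rabs_le; lra. }
    lra. }
destruct (Req_dec (Cmod X) 0) as [E|E].
- apply Cmod_eq_0 in E. unfold X in E.
  replace (rect_int (fun z => H z * / (z - p)) x0 x1 y0 y1)%C
    with (rect_int (fun z => H z * / (z - p)) x0 x1 y0 y1 - 2 * PI * Ci * H p + 2 * PI * Ci * H p)%C by ring.
  rewrite E; ring.
- exfalso. assert (HX : 0 < Cmod X) by (generalize (Cmod_ge_0 X); lra).
  set (e1 := Rmin (Rmin (Re p - x0) (x1 - Re p)) (Rmin (Im p - y0) (y1 - Im p))).
  (* Small enough for the square to fit, for the difference quotient to be bounded on it, and for 8
     e M to be at most half of |X|. *)
  set (e := Rmin e1 (Rmin (eta / 4) (Cmod X / (16 * M)))).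
  assert (0 < e1) by (unfold e1; repeat apply Rmin_glb_lt; lra).
  assert (He : 0 < e).
  { unfold e; repeat apply Rmin_glb_lt; try lra. apply Rdiv_lt_0_compat; lra. }
  assert (E1 : e <= e1) by apply Rmin_l.
  assert (E2 : e <= eta / 4) by (eapply Rle_trans; [apply Rmin_r|apply Rmin_l]).
  assert (E3 : e <= Cmod X / (16 * M)) by (eapply Rle_trans; [apply Rmin_r|apply Rmin_r]).
  assert (E4 : e1 <= Re p - x0) by (unfold e1; eapply Rle_trans; [apply Rmin_l|apply Rmin_l]).
  assert (E5 : e1 <= x1 - Re p) by (unfold e1; eapply Rle_trans; [apply Rmin_l|apply Rmin_r]).
  assert (E6 : e1 <= Im p - y0) by (unfold e1; eapply Rle_trans; [apply Rmin_r|apply Rmin_l]).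
  assert (E7 : e1 <= y1 - Im p) by (unfold e1; eapply Rle_trans; [apply Rmin_r|apply Rmin_r]).
  assert (B : Cmod X <= 8 * e * M) by (apply Key; lra).
  assert (8 * e * M <= 8 * (Cmod X / (16 * M)) * M) by (apply Rmult_le_compat_r; lra).
  replace (8 * (Cmod X / (16 * M)) * M) with (Cmod X / 2) in * by (field; lra). lra.
Qed.

(** * Elementary inequalities and the complex exponential *)

Lemma abs_sin_le x : Rabs (sin x) <= Rabs x.
Proof.
assert (P : forall y, 0 <= y -> Rabs (sin y) <= y).
{ intros y Hy. destruct (Rle_or_lt 1 y) as [H1|H1].
  - apply Rle_trans with 1; [|exact H1]. apply Rabs_le; generalize (SIN_bound y); lra.
  - destruct (Req_dec y 0) as [->|N]; [rewrite sin_0, Rabs_R0; lra|].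
    assert (P := PI2_1). rewrite Rabs_pos_eq; [|apply Rlt_le, sin_gt_0; lra].
    apply Rlt_le, sin_lt_x; lra. }
destruct (Rle_dec 0 x) as [H|H].
- rewrite (Rabs_pos_eq x H). apply P, H.
- rewrite <- (Rabs_Ropp (sin x)), <- sin_neg, (Rabs_left x) by lra. apply P; lra.
Qed.

Lemma one_minus_cos_le x : 0 <= 1 - cos x <= x * x / 2.
Proof.
assert (E : 1 - cos x = 2 * (sin (x / 2) * sin (x / 2))).
{ replace x with (2 * (x / 2)) at 1 by field. rewrite cos_2a_sin. ring. }
rewrite E. assert (H := abs_sin_le (x / 2)).
assert (H2 : sin (x / 2) * sin (x / 2) <= (x / 2) * (x / 2)).
{ rewrite <- (Rabs_pos_eq (sin (x / 2) * sin (x / 2))), <- (Rabs_pos_eq (x / 2 * (x / 2))) by nra.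
  rewrite !Rabs_mult. assert (P := Rabs_pos (sin (x / 2))). nra. }
split; [nra|lra].
Qed.

Lemma sin_minus_id_le x : Rabs (sin x - x) <= Rabs x * (x * x / 2).
Proof.
destruct (MVT_gen (fun t => sin t - t) 0 x (fun t => cos t - 1)) as [c [Hc E]].
- intros t _. auto_derive; [exact I|ring].
- intros t _. apply derivable_continuous_pt, ex_derive_Reals_0. auto_derive. exact I.
- rewrite sin_0 in E. replace (sin x - x) with ((cos c - 1) * (x - 0)) by lra.
  rewrite Rminus_0_r, Rabs_mult, Rmult_comm. apply Rmult_le_compat_l; [apply Rabs_pos|].
  assert (H := one_minus_cos_le c). rewrite Rabs_minus_sym, Rabs_pos_eq by lra.
  apply Rle_trans with (c * c / 2); [lra|].
  assert (c * c <= x * x); [|lra].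
  destruct (Rle_dec 0 x).
  + rewrite Rmin_left, Rmax_right in Hc by lra. nra.
  + rewrite Rmin_right, Rmax_left in Hc by lra. nra.
Qed.

(** The upper bound comes from exp(-a) >= 1 - a by inversion. *)
Lemma exp_minus_affine_le a : Rabs a <= 1 / 2 -> 0 <= exp a - 1 - a <= 2 * (a * a).
Proof.
intros H. apply Rabs_le_between in H. split.
- generalize (exp_ineq1_le a); lra.
- assert (H1 := exp_ineq1_le (- a)). rewrite exp_Ropp in H1.
  assert (P := exp_pos a).
  assert (exp a <= / (1 - a)).
  { rewrite <- (Rinv_inv (exp a)). apply Rinv_le_contravar; lra. }
  assert (/ (1 - a) <= 1 + a + 2 * (a * a)).
  { apply (Rmult_le_reg_l (1 - a)); [lra|]. rewrite Rinv_r by lra. nra. }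
  lra.
Qed.

(** A quadratic remainder assembled from the real exponential, sine and cosine: it suffices for the
    derivative of [Cexp], without complex power series. *)
Lemma Cexp_minus_affine_le (h : C) : Cmod h <= 1 / 2 ->
  Cmod (Cexp h - 1 - h) <= 8 * (Cmod h * Cmod h).
Proof.
intros H. destruct h as [a b].
assert (Ha : Rabs a <= Cmod (a, b)) by apply (Rmax_Cmod (a, b)) || (eapply Rle_trans; [apply Rmax_l|apply (Rmax_Cmod (a, b))]).
assert (Hb : Rabs b <= Cmod (a, b)) by (eapply Rle_trans; [apply Rmax_r|apply (Rmax_Cmod (a, b))]).
set (m := Cmod (a, b)) in *.
assert (Pa := Rabs_pos a). assert (Pb := Rabs_pos b).
assert (Qa : a * a <= m * m) by (rewrite <- (Rabs_pos_eq (a * a)) by nra; rewrite Rabs_mult; nra).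
assert (Qb : b * b <= m * m) by (rewrite <- (Rabs_pos_eq (b * b)) by nra; rewrite Rabs_mult; nra).
assert (E1 := exp_minus_affine_le a ltac:(lra)).
assert (C1 := one_minus_cos_le b). assert (S1 := sin_minus_id_le b).
assert (E2 : Rabs (exp a - 1) <= 2 * m).
{ apply Rabs_le. apply Rabs_le_between in Ha. nra. }
assert (E3 : 0 < exp a <= 2).
{ split; [apply exp_pos|]. apply Rabs_le_between in E2. lra. }
eapply Rle_trans; [apply Cmod_le_Re_Im|].
assert (R1 : Rabs (Re (Cexp (a, b) - 1 - (a, b))) <= 4 * (m * m)).
{ replace (Re (Cexp (a, b) - 1 - (a, b))) with (exp a - 1 - a - exp a * (1 - cos b)).
  - apply Rabs_le. assert (0 <= exp a * (1 - cos b) <= 2 * (m * m / 2)).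
    { split; [nra|]. apply Rmult_le_compat; lra. }
    lra.
  - unfold Cexp, Re, Im, Cminus, Cplus, Copp, RtoC; simpl. ring. }
assert (R2 : Rabs (Im (Cexp (a, b) - 1 - (a, b))) <= 4 * (m * m)).
{ replace (Im (Cexp (a, b) - 1 - (a, b))) with ((exp a - 1) * sin b + (sin b - b)).
  - eapply Rle_trans; [apply Rabs_triang|]. rewrite Rabs_mult.
    assert (Rabs (sin b - b) <= m * m).
    { eapply Rle_trans; [exact S1|]. nra. }
    assert (Rabs (sin b) <= 3 / 2 * m).
    { replace (sin b) with (b + (sin b - b)) by ring. eapply Rle_trans; [apply Rabs_triang|].
      assert (Rabs b * (b * b / 2) <= m * (1 / 8)).
      { apply Rmult_le_compat; try lra; nra. }
      lra. }
    assert (Rabs (exp a - 1) * Rabs (sin b) <= 2 * m * (3 / 2 * m)).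
    { apply Rmult_le_compat; try apply Rabs_pos; assumption. }
    lra.
  - unfold Cexp, Re, Im, Cminus, Cplus, Copp, RtoC; simpl. ring. }
lra.
Qed.

Lemma Cexp_plus (z w : C) : Cexp (z + w) = (Cexp z * Cexp w)%C.
Proof.
destruct z as [a b], w as [c d]. unfold Cexp, Cplus, Cmult, Re, Im; simpl.
rewrite exp_plus, cos_plus, sin_plus. f_equal; ring.
Qed.

Lemma Cmod_Cexp (z : C) : Cmod (Cexp z) = exp (Re z).
Proof.
unfold Cmod, Cexp; simpl.
replace (exp (Re z) * cos (Im z) * (exp (Re z) * cos (Im z) * 1) +
   exp (Re z) * sin (Im z) * (exp (Re z) * sin (Im z) * 1))
  with (Rsqr (exp (Re z)) * (Rsqr (sin (Im z)) + Rsqr (cos (Im z)))) by (unfold Rsqr; ring).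
rewrite sin2_cos2, Rmult_1_r. apply sqrt_Rsqr, Rlt_le, exp_pos.
Qed.

Lemma is_Cderive_Cexp_scal (c z : C) :
  is_Cderive (fun w => Cexp (w * c)) z (c * Cexp (z * c))%C.
Proof.
apply is_Cderive_eps; intros eps He.
set (M := exp (Re (z * c))). assert (HM : 0 < M) by apply exp_pos.
set (k := Cmod c). assert (Hk : 0 <= k) by apply Cmod_ge_0.
(* The first bound keeps (w - z) c in the range of the quadratic estimate, the second makes the
   resulting factor 8 M k^2 |w - z| at most [eps]. *)
exists (Rmin (/ (2 * (k + 1))) (eps / (8 * M * (k + 1) * (k + 1)))). split.
{ apply Rmin_glb_lt; [apply Rinv_0_lt_compat; lra|].
  apply Rdiv_lt_0_compat; [lra|]. repeat apply Rmult_lt_0_compat; lra. }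
intros w Hw.
assert (W1 : Cmod (w - z) < / (2 * (k + 1))) by (eapply Rlt_le_trans; [exact Hw|apply Rmin_l]).
assert (W2 : Cmod (w - z) < eps / (8 * M * (k + 1) * (k + 1))) by (eapply Rlt_le_trans; [exact Hw|apply Rmin_r]).
assert (W0 := Cmod_ge_0 (w - z)).
replace (w * c)%C with (z * c + (w - z) * c)%C by ring. rewrite Cexp_plus.
replace (Cexp (z * c) * Cexp ((w - z) * c) - Cexp (z * c) - (w - z) * (c * Cexp (z * c)))%C
  with (Cexp (z * c) * (Cexp ((w - z) * c) - 1 - (w - z) * c))%C by ring.
rewrite Cmod_mult, Cmod_Cexp. fold M.
assert (B : Cmod (Cexp ((w - z) * c) - 1 - (w - z) * c) <= 8 * (Cmod ((w - z) * c) * Cmod ((w - z) * c))).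
{ apply Cexp_minus_affine_le. rewrite Cmod_mult. fold k.
  apply Rle_trans with (/ (2 * (k + 1)) * (k + 1)); [apply Rmult_le_compat; lra|].
  apply Req_le; field; lra. }
rewrite Cmod_mult in B. fold k in B.
eapply Rle_trans; [apply Rmult_le_compat_l; [lra|exact B]|].
replace (M * (8 * (Cmod (w - z) * k * (Cmod (w - z) * k)))) with (8 * M * k * k * Cmod (w - z) * Cmod (w - z)) by ring.
apply Rmult_le_compat_r; [lra|].
apply (Rmult_lt_compat_l (8 * M * (k + 1) * (k + 1))) in W2; [|repeat apply Rmult_lt_0_compat; lra].
replace (8 * M * (k + 1) * (k + 1) * (eps / (8 * M * (k + 1) * (k + 1)))) with eps in W2 by (field; lra).
assert (8 * M * k * k * Cmod (w - z) <= 8 * M * (k + 1) * (k + 1) * Cmod (w - z)); [|lra].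
apply Rmult_le_compat_r; [lra|]. rewrite !Rmult_assoc. repeat apply Rmult_le_compat_l; try lra.
Qed.

Lemma is_Cderive_Rcpow x (z : C) : is_Cderive (Rcpow x) z (ln x * Rcpow x z)%C.
Proof. apply is_Cderive_Cexp_scal. Qed.

Lemma Cmod_Rcpow x (s : C) : Cmod (Rcpow x s) = Rpower x (Re s).
Proof.
unfold Rcpow, Rpower. rewrite Cmod_Cexp. f_equal.
destruct s; unfold Re, Cmult, RtoC; simpl. ring.
Qed.

Lemma Rcpow_plus x s t : Rcpow x (s + t) = (Rcpow x s * Rcpow x t)%C.
Proof. unfold Rcpow. rewrite <- Cexp_plus. f_equal. ring. Qed.

Lemma Rcpow_R x (a : R) : Rcpow x a = RtoC (Rpower x a).
Proof.
unfold Rcpow, Cexp, Rpower, Cmult, RtoC, Re, Im; simpl.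
replace (a * 0 + 0 * ln x) with 0 by ring. rewrite cos_0, sin_0.
f_equal; [rewrite Rmult_1_r; f_equal; ring|ring].
Qed.

Lemma Rcpow_0 x : Rcpow x 0 = 1%C.
Proof. rewrite Rcpow_R. unfold Rpower. rewrite Rmult_0_l, exp_0. reflexivity. Qed.

Lemma Rcpow_div x y s : 0 < x -> 0 < y -> Rcpow (x / y) s = (Rcpow x s * Rcpow y (- s))%C.
Proof.
intros Hx Hy. unfold Rcpow. rewrite <- Cexp_plus. f_equal.
rewrite ln_div by assumption. rewrite RtoC_minus. ring.
Qed.

(** * Neighbourhoods in the complex plane and removal of poles *)

(** [C] carries two uniform structures with the same neighbourhoods; discs in [Cmod] mediate between
    them. *)
Definition near (s : C) (P : C -> Prop) : Prop :=
  exists r, 0 < r /\ forall z, Cmod (z - s) < r -> P z.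

Lemma near_locally_AbsRing s P : near s P <-> locally (T := AbsRing_UniformSpace C_AbsRing) s P.
Proof.
split.
- intros [r [Hr H]]. exists (mkposreal r Hr). intros z Hz; apply H, Hz.
- intros [r H]. exists r; split; [apply cond_pos|]. intros z Hz; apply H, Hz.
Qed.

Lemma near_locally s P : near s P <-> locally (T := C_UniformSpace) s P.
Proof. rewrite near_locally_AbsRing. symmetry; apply locally_C. Qed.

Lemma near_and s P Q : near s P -> near s Q -> near s (fun z => P z /\ Q z).
Proof. rewrite !near_locally. apply filter_and. Qed.

Lemma near_imp s (P Q : C -> Prop) : (forall z, P z -> Q z) -> near s P -> near s Q.
Proof. intros H [r [Hr Hz]]; exists r; split; auto. Qed.

Lemma near_near s P : near s P -> near s (fun z => near z P).
Proof.
intros [r [Hr H]]. exists (r / 2); split; [lra|]. intros z Hz.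
exists (r / 2); split; [lra|]. intros w Hw. apply H.
replace (w - s)%C with (w - z + (z - s))%C by ring.
eapply Rle_lt_trans; [apply Cmod_triangle|]. lra.
Qed.

Lemma near_neq (s p : C) : s <> p -> near s (fun z => z <> p).
Proof.
intros H. exists (Cmod (s - p)). split.
- apply Cmod_gt_0. intros E; apply H. replace s with (s - p + p)%C by ring. rewrite E; ring.
- intros z Hz E. subst z. rewrite <- Cmod_opp in Hz.
  replace (- (p - s))%C with (s - p)%C in Hz by ring. lra.
Qed.

Lemma near_ex_Cderive_ext F G s : near s (fun z => F z = G z) -> ex_Cderive F s -> ex_Cderive G s.
Proof.
intros H [l Hl]. exists l. apply is_derive_ext_loc with F; [|exact Hl].
apply near_locally_AbsRing, H.
Qed.

Lemma analytic_at_near F s : analytic_at F s <-> near s (fun z => ex_Cderive F z).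
Proof. symmetry; apply near_locally. Qed.

Lemma analytic_at_derive F s : analytic_at F s -> ex_Cderive F s.
Proof.
rewrite analytic_at_near. intros [r [Hr H]]. apply H.
replace (s - s)%C with (RtoC 0) by ring. rewrite Cmod_0; exact Hr.
Qed.

Lemma analytic_at_ext F G s : near s (fun z => F z = G z) -> analytic_at F s -> analytic_at G s.
Proof.
rewrite !analytic_at_near. intros H1 H2.
generalize (near_and _ _ _ (near_near _ _ H1) H2). apply near_imp.
intros z [Hz1 Hz2]. apply near_ex_Cderive_ext with F; assumption.
Qed.

Lemma simple_pole_residue_near F p A : simple_pole_residue F p A <->
  exists g, analytic_at g p /\ near p (fun z => z <> p -> F z = (A / (z - p) + g z)%C).
Proof.
unfold simple_pole_residue, locally', within.
split; intros [g [H1 H2]]; exists g; (split; [exact H1|]); apply near_locally; exact H2.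
Qed.

(** Sums the first [n] terms, whereas [sum_n] includes the index [n]. *)
Fixpoint Csum (f : nat -> C) (n : nat) : C :=
  match n with O => 0%C | S n => (Csum f n + f n)%C end.

Lemma Cminus_neq_0 (z p : C) : z <> p -> (z - p <> 0)%C.
Proof. intros Hz E; apply Hz. replace z with (z - p + p)%C by ring. rewrite E; ring. Qed.

Lemma analytic_at_minus_pole F (A p s : C) : s <> p -> analytic_at F s ->
  analytic_at (fun z => F z - A / (z - p))%C s.
Proof.
intros Hs. rewrite !analytic_at_near. intros H.
generalize (near_and _ _ _ H (near_neq s p Hs)). apply near_imp. intros z [[l Hl] Hz].
eexists. apply is_Cderive_minus; [exact Hl|].
apply is_Cderive_mult; [apply is_Cderive_const|apply is_Cderive_inv, Cminus_neq_0, Hz].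
Qed.

(** [E] is [D] minus all principal parts, removed one pole at a time. [simple_pole_residue]
    describes [D] only off the pole, so the value of [E] at each pole is taken from the local
    analytic part. *)
Lemma subtract_poles D r rho (A : nat -> R) C0 : poles_condition D r rho A C0 ->
  exists E : C -> C, (forall s, half_plane C0 s -> analytic_at E s) /\
  forall s : C, (forall k, (k <= r)%nat -> s <> RtoC (rho k)) ->
    D s = (E s + Csum (fun k => A k / (s - rho k)) (S r))%C.
Proof.
intros HP.
assert (Inj : forall i j, (i <= r)%nat -> (j <= r)%nat -> i <> j -> RtoC (rho i) <> RtoC (rho j)).
{ intros i j Hi Hj Hij E. apply RtoC_inj in E.
  destruct (Nat.lt_gt_cases i j) as [HH _]. destruct (HH Hij) as [L|L].
  - generalize (rho_incr _ _ _ _ _ HP i j L Hj); lra.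
  - generalize (rho_incr _ _ _ _ _ HP j i L Hi); lra. }
assert (Step : forall j, (j <= S r)%nat -> exists E : C -> C,
  (forall s, half_plane C0 s -> (forall k, (j <= k <= r)%nat -> s <> RtoC (rho k)) -> analytic_at E s) /\
  (forall k, (j <= k <= r)%nat -> simple_pole_residue E (rho k) (A k)) /\
  (forall s, (forall k, (k < j)%nat -> s <> RtoC (rho k)) ->
     D s = (E s + Csum (fun k => A k / (s - rho k)) j)%C)).
{ induction j as [|j IH].
  - intros _. exists D. repeat split.
    + intros s Hs Hk. apply (D_analytic _ _ _ _ _ HP s Hs). intros k Hk'; apply Hk; lia.
    + intros k Hk; apply (D_poles _ _ _ _ _ HP); lia.
    + intros s _; simpl; ring.
  - intros Hj. destruct IH as (E & HE1 & HE2 & HE3); [lia|].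
    set (p := RtoC (rho j)).
    destruct (proj1 (simple_pole_residue_near _ _ _) (HE2 j ltac:(lia))) as [g [Hg1 Hg2]]. fold p in Hg1, Hg2.
    exists (fun s => if excluded_middle_informative (s = p) then g s else (E s - A j / (s - p))%C).
    repeat split.
    + intros s Hs Hk. destruct (classic (s = p)) as [Hsp|Hsp].
      * subst s. apply analytic_at_ext with g; [|exact Hg1].
        revert Hg2; apply near_imp. intros z Hz.
        destruct excluded_middle_informative as [Y|N]; [reflexivity|]. rewrite (Hz N). ring.
      * apply analytic_at_ext with (fun z => E z - A j / (z - p))%C.
        -- generalize (near_neq s p Hsp). apply near_imp. intros z Hz.
           destruct excluded_middle_informative; [contradiction|reflexivity].
        -- apply analytic_at_minus_pole; [exact Hsp|]. apply HE1; [exact Hs|].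
           intros k Hk'. destruct (Nat.eq_dec k j) as [->|]; [exact Hsp|]. apply Hk; lia.
    + intros k Hk. destruct (proj1 (simple_pole_residue_near _ _ _) (HE2 k ltac:(lia))) as [gk [Hk1 Hk2]].
      assert (Hkp : RtoC (rho k) <> p) by (apply Inj; lia).
      apply simple_pole_residue_near. exists (fun z => gk z - A j / (z - p))%C. split.
      * apply analytic_at_minus_pole; assumption.
      * generalize (near_and _ _ _ Hk2 (near_neq _ p Hkp)). apply near_imp. intros z [Hz1 Hz2] Hz3.
        destruct excluded_middle_informative; [contradiction|]. rewrite (Hz1 Hz3). ring.
    + intros s Hs. simpl. rewrite (HE3 s) by (intros; apply Hs; lia).
      destruct excluded_middle_informative as [Y|N]; [exfalso; apply (Hs j); [lia|exact Y]|].
      fold p. ring. }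
destruct (Step (S r) (le_n _)) as (E & HE1 & _ & HE3). exists E. split.
- intros s Hs. apply HE1; [exact Hs|]. intros k Hk; lia.
- intros s Hs. apply HE3. intros k Hk. apply Hs; lia.
Qed.

(** * Perron's formula for Riesz means *)

(* [Kone m s = m! / ((s+1)...(s+m))]; the Riesz kernel is [Kone m s / s]. *)
Fixpoint Kone (m : nat) (s : C) : C :=
  match m with
  | O => 1%C
  | S m => (Kone m s * (RtoC (INR (S m)) * / (s - RtoC (- INR (S m)))))%C
  end.

(** Written with [s - 0], so that the pole at 0 has the shape z - p of the derivative and Cauchy
    lemmas. *)
Definition Kker (m : nat) (s : C) : C := (Kone m s * / (s - 0))%C.

Definition off_poles (m : nat) (s : C) : Prop :=
  forall j, (j <= m)%nat -> (s - RtoC (- INR j) <> 0)%C.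

Lemma off_poles_S m s : off_poles (S m) s -> off_poles m s.
Proof. intros H j Hj; apply H; lia. Qed.

Lemma off_poles_0 m s : off_poles m s -> (s - 0 <> 0)%C.
Proof. intros H. generalize (H 0%nat (Nat.le_0_l m)). simpl INR. rewrite Ropp_0. tauto. Qed.

Lemma ex_Cderive_Kone m s : (forall j, (1 <= j <= m)%nat -> (s - RtoC (- INR j) <> 0)%C) ->
  ex_Cderive (Kone m) s.
Proof.
induction m as [|m IH]; intros H.
- exists (RtoC 0). apply is_Cderive_const.
- apply (ex_Cderive_mult (Kone m) (fun s => RtoC (INR (S m)) * / (s - RtoC (- INR (S m))))%C).
  + apply IH. intros j Hj; apply H; lia.
  + apply (ex_Cderive_mult (fun _ => RtoC (INR (S m))) (fun s => / (s - RtoC (- INR (S m))))%C).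
    * exists (RtoC 0). apply is_Cderive_const.
    * apply ex_Cderive_inv, H; lia.
Qed.

Lemma ex_Cderive_Kker m s : off_poles m s -> ex_Cderive (Kker m) s.
Proof.
intros H. apply (ex_Cderive_mult (Kone m) (fun s => / (s - 0))%C).
- apply ex_Cderive_Kone. intros j Hj; apply H; lia.
- apply ex_Cderive_inv, (off_poles_0 m), H.
Qed.

Lemma ex_Cderive_Rcpow x s : ex_Cderive (Rcpow x) s.
Proof. eexists; apply is_Cderive_Rcpow. Qed.

(** Both sides equal m!/((s+1)...(s+m+1)). *)
Lemma Kone_shift m s : off_poles (S m) s ->
  (Kone m (s + 1) * / (s + 1) = Kone m s * / (s + RtoC (INR (S m))))%C.
Proof.
induction m as [|m IH]; intros H.
- simpl. f_equal.
- change (Kone (S m) (s + 1)) with (Kone m (s + 1) * (RtoC (INR (S m)) * / (s + 1 - RtoC (- INR (S m)))))%C.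
  change (Kone (S m) s) with (Kone m s * (RtoC (INR (S m)) * / (s - RtoC (- INR (S m)))))%C.
  replace (Kone m (s + 1) * (RtoC (INR (S m)) * / (s + 1 - RtoC (- INR (S m)))) * / (s + 1))%C
    with (Kone m (s + 1) * / (s + 1) * (RtoC (INR (S m)) * / (s + 1 - RtoC (- INR (S m)))))%C by ring.
  rewrite IH by (apply off_poles_S, H).
  replace (s - RtoC (- INR (S m)))%C with (s + RtoC (INR (S m)))%C by (rewrite RtoC_opp; ring).
  replace (s + 1 - RtoC (- INR (S m)))%C with (s + RtoC (INR (S (S m))))%C
    by (rewrite (S_INR (S m)), RtoC_opp, RtoC_plus; ring).
  ring.
Qed.

(** Partial fractions. Shifting s by 1 costs y^s a factor 1/y, so this recurrence in [m] becomes
    multiplication by 1 - 1/y under the integral. *)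
Lemma Kker_S m s : off_poles (S m) s -> Kker (S m) s = (Kker m s - Kker m (s + 1))%C.
Proof.
intros H. unfold Kker.
replace (s + 1 - 0)%C with (s + 1)%C by ring. rewrite Kone_shift by exact H.
assert (H0 := off_poles_0 _ _ H). assert (H1 := H (S m) (le_n _)).
change (Kone (S m) s) with (Kone m s * (RtoC (INR (S m)) * / (s - RtoC (- INR (S m)))))%C.
replace (s + RtoC (INR (S m)))%C with (s - RtoC (- INR (S m)))%C by (rewrite RtoC_opp; ring).
replace (RtoC (INR (S m))) with (s - RtoC (- INR (S m)) - (s - 0))%C at 1 by (rewrite RtoC_opp; ring).
field. split; [exact H1|]. intros E; apply H0. rewrite E; ring.
Qed.

Lemma is_CInt_shift f v a b l : is_CInt f (a + v) (b + v) l -> is_CInt (fun t => f (t + v)) a b l.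
Proof.
intros H. apply is_CInt_ext with (fun t => scal 1 (f (1 * t + v))).
- intros t _. rewrite Rmult_1_l. apply (scal_one (V := C_R_NormedModule)).
- apply (is_RInt_comp_lin (V := C_R_NormedModule) f 1 v a b l). rewrite !Rmult_1_l. exact H.
Qed.

Lemma cont_edges_map F G x0 x1 y0 y1 : (forall z, Ccontinuous F z -> Ccontinuous G z) ->
  cont_edges F x0 x1 y0 y1 -> cont_edges G x0 x1 y0 y1.
Proof.
intros H [A B]. split; intros t Ht; [destruct (A t Ht)|destruct (B t Ht)]; split; apply H; assumption.
Qed.

Lemma rect_int_shift F x0 x1 y0 y1 : x0 <= x1 -> y0 <= y1 ->
  cont_edges F (x0 + 1) (x1 + 1) y0 y1 ->
  rect_int (fun s => F (s + 1)%C) x0 x1 y0 y1 = rect_int F (x0 + 1) (x1 + 1) y0 y1.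
Proof.
intros Hx Hy HF.
destruct (rect_int_elim F (x0 + 1) (x1 + 1) y0 y1) as (l1 & l2 & l3 & l4 & H1 & H2 & H3 & H4); try lra; [exact HF|].
rewrite (rect_int_intro F (x0 + 1) (x1 + 1) y0 y1 l1 l2 l3 l4) by assumption.
assert (P : forall a b : R, ((a, b) + 1)%C = (a + 1, b)) by (intros; unfold Cplus, RtoC; simpl; f_equal; ring).
apply rect_int_intro.
- apply is_CInt_ext with (fun u => F (u + 1, y0)); [intros; rewrite P; reflexivity|].
  apply (is_CInt_shift (fun u => F (u, y0))), H1.
- apply is_CInt_ext with (fun u => F (x1 + 1, u)); [intros; rewrite P; reflexivity|exact H2].
- apply is_CInt_ext with (fun u => F (u + 1, y1)); [intros; rewrite P; reflexivity|].
  apply (is_CInt_shift (fun u => F (u, y1))), H3.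
- apply is_CInt_ext with (fun u => F (x0 + 1, u)); [intros; rewrite P; reflexivity|exact H4].
Qed.

Lemma off_poles_intro m (s : C) : Re s < - INR m \/ 0 < Re s \/ Im s <> 0 -> off_poles m s.
Proof.
intros H j Hj E. assert (E1 : s = RtoC (- INR j)).
{ replace s with (s - RtoC (- INR j) + RtoC (- INR j))%C by ring. rewrite E; ring. }
apply le_INR in Hj. assert (0 <= INR j) by apply pos_INR.
subst s; simpl in H. lra.
Qed.

Lemma cont_edges_Rcpow_Kker y m x0 x1 y0 y1 : x0 < - INR m \/ 0 < x0 -> 0 < x1 -> y0 < 0 < y1 ->
  cont_edges (fun s => Rcpow y s * Kker m s)%C x0 x1 y0 y1.
Proof.
intros H0 H1 Hy.
assert (Q : forall s, off_poles m s -> Ccontinuous (fun s => Rcpow y s * Kker m s)%C s).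
{ intros s Hs. apply ex_Cderive_continuous, (ex_Cderive_mult (Rcpow y) (Kker m)).
  - apply ex_Cderive_Rcpow.
  - apply ex_Cderive_Kker, Hs. }
split; intros t Ht; split; apply Q, off_poles_intro; simpl; lra.
Qed.

(** Induction on [m] through [Kker_S] replaces the sum of m + 1 residues and the binomial theorem;
    the bound on [x0] keeps all poles inside both the rectangle and its shift. *)
Lemma rect_int_Kker y m x0 x1 y0 y1 : 0 < y -> x0 < - INR m -> 0 < x1 -> y0 < 0 < y1 ->
  rect_int (fun s => Rcpow y s * Kker m s)%C x0 x1 y0 y1 = (2 * PI * Ci * RtoC ((1 - / y) ^ m))%C.
Proof.
intros Hy. revert x0 x1. induction m as [|m IH]; intros x0 x1 H0 H1 Hy01.
- simpl in H0.
  rewrite (rect_int_ext _ (fun s => Rcpow y s * / (s - 0))%C); try lra.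
  + rewrite cauchy_formula; try (simpl; lra); [|intros; apply ex_Cderive_Rcpow].
    rewrite Rcpow_0. simpl. reflexivity.
  + apply cont_edges_Rcpow_Kker; simpl; lra.
  + intros z _ _. unfold Kker, Kone. ring.
- rewrite S_INR in H0. assert (Pm := pos_INR m).
  set (G := fun s => (Rcpow y s * Kker m s)%C).
  assert (CG : forall x0 x1, x0 < - INR m -> 0 < x1 -> cont_edges G x0 x1 y0 y1).
  { intros; apply cont_edges_Rcpow_Kker; lra. }
  assert (Ey : Rcpow y 1 = RtoC y).
  { rewrite Rcpow_R. rewrite Rpower_1 by exact Hy. reflexivity. }
  assert (Hyc : RtoC y <> 0%C) by (intros E; apply RtoC_inj in E; lra).
  assert (CG1 : cont_edges (fun s => G (s + 1)%C) x0 x1 y0 y1).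
  { assert (Q : forall s, off_poles m (s + 1)%C -> Ccontinuous (fun s => G (s + 1)%C) s).
    { intros s Hs. apply (continuous_comp (fun s => (s + 1)%C) G).
      - apply (continuous_plus (K := C_AbsRing) (V := C_NormedModule) (fun s => s) (fun _ => RtoC 1)).
        + apply continuous_id.
        + apply continuous_const.
      - apply ex_Cderive_continuous, (ex_Cderive_mult (Rcpow y) (Kker m)).
        + apply ex_Cderive_Rcpow.
        + apply ex_Cderive_Kker, Hs. }
    split; intros t Ht; split; apply Q, off_poles_intro; simpl; lra. }
  assert (CG2 : cont_edges (fun s => RtoC (/ y) * G (s + 1)%C)%C x0 x1 y0 y1).
  { assert (Q : forall s, Ccontinuous (fun s => G (s + 1)%C) s -> Ccontinuous (fun s => RtoC (/ y) * G (s + 1)%C)%C s).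
    { intros s Hs. apply (continuous_scal_r (K := C_AbsRing) (V := C_NormedModule) (RtoC (/ y)) (fun s => G (s + 1)%C)), Hs. }
    exact (cont_edges_map _ _ _ _ _ _ Q CG1). }
  rewrite (rect_int_ext _ (fun s => G s - RtoC (/ y) * G (s + 1)%C)%C); try lra.
  + rewrite rect_int_minus; try lra; [|apply CG; lra|exact CG2].
    rewrite rect_int_mult_l; try lra; [|exact CG1].
    rewrite rect_int_shift; try lra; [|apply CG; lra].
    unfold G. rewrite !IH by lra. simpl pow.
    rewrite (RtoC_mult (1 - / y)), RtoC_minus. ring.
  + apply cont_edges_Rcpow_Kker; try lra. rewrite S_INR; lra.
  + intros z [Z1 Z2] Hz.
    assert (Ho : off_poles (S m) z) by (apply off_poles_intro; rewrite S_INR; lra).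
    rewrite Kker_S by exact Ho. unfold G. rewrite Rcpow_plus, Ey, RtoC_inv by lra. field. exact Hyc.
Qed.

Lemma Cmod_Kker_le_pow m s T : 0 < T ->
  (forall j, (j <= m)%nat -> T <= Cmod (s - RtoC (- INR j))) ->
  Cmod (Kker m s) <= INR (fact m) / T ^ S m.
Proof.
intros HT H.
assert (B : forall n, (n <= m)%nat -> Cmod (Kone n s) <= INR (fact n) / T ^ n).
{ induction n as [|n IH]; intros Hn.
  - simpl. rewrite Cmod_1. lra.
  - change (Kone (S n) s) with (Kone n s * (RtoC (INR (S n)) * / (s - RtoC (- INR (S n)))))%C.
    assert (HS := H (S n) Hn).
    assert (N : (s - RtoC (- INR (S n)) <> 0)%C) by (intros E; rewrite E, Cmod_0 in HS; lra).
    rewrite !Cmod_mult, Cmod_inv, Cmod_R by exact N. rewrite Rabs_pos_eq by apply pos_INR.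
    assert (0 < T ^ n) by (apply pow_lt; lra).
    replace (INR (fact (S n)) / T ^ S n) with (INR (fact n) / T ^ n * (INR (S n) * / T)).
    2:{ change (fact (S n)) with (S n * fact n)%nat. rewrite mult_INR. simpl pow. field. lra. }
    assert (P := pos_INR (S n)).
    apply Rmult_le_compat.
    + apply Cmod_ge_0.
    + apply Rmult_le_pos; [exact P|]. apply Rlt_le, Rinv_0_lt_compat; lra.
    + apply IH; lia.
    + apply Rmult_le_compat_l; [exact P|]. apply Rinv_le_contravar; lra. }
unfold Kker. rewrite Cmod_mult.
assert (H0 := H 0%nat (Nat.le_0_l m)). simpl INR in H0. rewrite Ropp_0 in H0.
assert (N : (s - 0 <> 0)%C) by (intros E; rewrite E, Cmod_0 in H0; lra).
rewrite Cmod_inv by exact N.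
assert (0 < T ^ m) by (apply pow_lt; lra).
replace (INR (fact m) / T ^ S m) with (INR (fact m) / T ^ m * / T) by (simpl; field; lra).
apply Rmult_le_compat; [apply Cmod_ge_0|apply Rlt_le, Rinv_0_lt_compat; lra|apply B, le_n|apply Rinv_le_contravar; lra].
Qed.

Lemma Cmod_Kker_le m s T : 1 <= T -> (1 <= m)%nat ->
  (forall j, (j <= m)%nat -> T <= Cmod (s - RtoC (- INR j))) ->
  Cmod (Kker m s) <= INR (fact m) / (T * T).
Proof.
intros HT Hm H. eapply Rle_trans; [apply (Cmod_Kker_le_pow m s T); [lra|exact H]|].
apply Rmult_le_compat_l; [apply pos_INR|]. apply Rinv_le_contravar; [nra|].
destruct m as [|m]; [lia|]. simpl pow.
assert (1 <= T ^ m) by (apply pow_R1_Rle, HT). nra.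
Qed.

Lemma Rabs_Re_le_Cmod (z : C) : Rabs (Re z) <= Cmod z.
Proof. eapply Rle_trans; [apply Rmax_l|apply (Rmax_Cmod z)]. Qed.
Lemma Rabs_Im_le_Cmod (z : C) : Rabs (Im z) <= Cmod z.
Proof. eapply Rle_trans; [apply Rmax_r|apply (Rmax_Cmod z)]. Qed.

Lemma Rpower_le_base_le_1 y a b : 0 < y <= 1 -> a <= b -> Rpower y b <= Rpower y a.
Proof.
intros [Hy H1] Hab. unfold Rpower.
assert (ln y <= 0). { rewrite <- ln_1. apply ln_le; lra. }
destruct (Rle_lt_or_eq_dec (b * ln y) (a * ln y)) as [L|L]; [nra| |].
- apply Rlt_le, exp_increasing, L.
- rewrite L; lra.
Qed.

(** Truncated Perron formula. The segment is closed to the left, around all poles, if y >= 1 and to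
    the right if y < 1, so that |y^s| is at most y^sg on the added sides. Their length is O(T), and
    the kernel is O(1/T^2) there because m >= 1. *)
Theorem riesz_kernel_line (m : nat) (sg : R) : (1 <= m)%nat -> 0 < sg ->
  exists M, 0 <= M /\ forall y T, 0 < y -> 1 <= T ->
  exists J, is_CInt (fun t => Rcpow y (sg, t) * Kker m (sg, t))%C (- T) T J /\
    Cmod (J - RtoC (2 * PI * (Rmax 0 (1 - / y)) ^ m)) <= M * Rpower y sg / T.
Proof.
intros Hm Hs. assert (Pm := pos_INR m). assert (Pf : 0 < INR (fact m)) by (apply lt_0_INR, lt_O_fact).
exists (INR (fact m) * (2 * (sg + INR m + 1) + 2)). split; [nra|].
intros y T Hy HT.
assert (EK : forall s : C, T <= Rabs (Im s) \/ T <= Re s \/ Re s <= - T - INR m -> Cmod (Kker m s) <= INR (fact m) / (T * T)).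
{ intros s Hc. apply Cmod_Kker_le; try assumption. intros j Hj. apply le_INR in Hj. assert (Pj := pos_INR j).
  destruct Hc as [Hc|Hc].
  - eapply Rle_trans; [exact Hc|]. eapply Rle_trans; [|apply Rabs_Im_le_Cmod].
    apply Req_le. unfold Im, Cminus, Cplus, Copp, RtoC; simpl. f_equal; ring.
  - eapply Rle_trans; [|apply Rabs_Re_le_Cmod].
    replace (Re (s - RtoC (- INR j))) with (Re s + INR j) by (unfold Re, Cminus, Cplus, Copp, RtoC; simpl; ring).
    destruct Hc as [Hc|Hc]; [rewrite Rabs_pos_eq; lra|rewrite Rabs_left; lra]. }
set (Kb := INR (fact m) / (T * T)) in *.
assert (HKb : 0 <= Kb) by (unfold Kb; apply Rdiv_le_0_compat; nra).
set (G := fun s => (Rcpow y s * Kker m s)%C) in *.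
assert (Py : 0 < Rpower y sg) by apply exp_pos.
assert (EG : forall s : C, Rpower y (Re s) <= Rpower y sg ->
  T <= Rabs (Im s) \/ T <= Re s \/ Re s <= - T - INR m -> Cmod (G s) <= Rpower y sg * Kb).
{ intros s H1 H2. unfold G. rewrite Cmod_mult, Cmod_Rcpow.
  apply Rmult_le_compat; [apply Rlt_le, exp_pos|apply Cmod_ge_0|exact H1|apply EK, H2]. }
(* Two horizontal sides of length [L] and one vertical side of length 2 T; T >= 1 bounds sg + T + m
   by (sg + m + 1) T. *)
assert (Fin : forall L, L <= sg + T + INR m -> 0 <= L ->
  L * (Rpower y sg * Kb) + 2 * T * (Rpower y sg * Kb) + L * (Rpower y sg * Kb) <=
  INR (fact m) * (2 * (sg + INR m + 1) + 2) * Rpower y sg / T).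
{ intros L HL HL0.
  replace (INR (fact m) * (2 * (sg + INR m + 1) + 2) * Rpower y sg / T)
    with ((2 * ((sg + INR m + 1) * T) + 2 * T) * (Rpower y sg * Kb)) by (unfold Kb; field; lra).
  rewrite <- !Rmult_plus_distr_r. apply Rmult_le_compat_r; [nra|]. nra. }
destruct (Rle_dec 1 y) as [H1|H1].
- assert (Mon : forall a, a <= sg -> Rpower y a <= Rpower y sg) by (intros a Ha; apply Rle_Rpower; lra).
  assert (Ce : cont_edges G (- T - INR m - 1) sg (- T) T) by (apply cont_edges_Rcpow_Kker; lra).
  assert (Ce2 : cont_edges G (- T - INR m) sg (- T) T) by (apply cont_edges_Rcpow_Kker; lra).
  destruct (rect_int_elim G (- T - INR m) sg (- T) T ltac:(lra) ltac:(lra) Ce2) as (l1 & l2 & l3 & l4 & I1 & I2 & I3 & I4).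
  exists l2. split; [exact I2|].
  assert (R := rect_int_Kker y m (- T - INR m) sg (- T) T Hy ltac:(lra) Hs ltac:(lra)).
  fold G in R. rewrite (rect_int_intro G _ _ _ _ l1 l2 l3 l4) in R by assumption.
  assert (B1 : Cmod l1 <= (sg - (- T - INR m)) * (Rpower y sg * Kb)).
  { eapply is_CInt_norm_le_const with (3 := I1); [lra|]. intros t Ht.
    apply EG; simpl; [apply Mon; lra|left; rewrite Rabs_Ropp, Rabs_pos_eq; lra]. }
  assert (B3 : Cmod l3 <= (sg - (- T - INR m)) * (Rpower y sg * Kb)).
  { eapply is_CInt_norm_le_const with (3 := I3); [lra|]. intros t Ht.
    apply EG; simpl; [apply Mon; lra|left; rewrite Rabs_pos_eq; lra]. }
  assert (B4 : Cmod l4 <= (T - - T) * (Rpower y sg * Kb)).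
  { eapply is_CInt_norm_le_const with (3 := I4); [lra|]. intros t Ht.
    apply EG; simpl; [apply Mon; lra|right; right; lra]. }
  assert (Hiy : / y <= 1) by (rewrite <- Rinv_1; apply Rinv_le_contravar; lra).
  rewrite Rmax_right by lra.
  replace (l2 - RtoC (2 * PI * (1 - / y) ^ m))%C with (- Ci * (l3 - l1) + l4)%C.
  2:{ rewrite !RtoC_mult.
      replace l2 with (- Ci * (Ci * l2))%C by (replace (- Ci * (Ci * l2))%C with (- (Ci * Ci) * l2)%C by ring; rewrite Ci_sqr; ring).
      replace (Ci * l2)%C with (2 * PI * Ci * RtoC ((1 - / y) ^ m) - l1 + l3 + Ci * l4)%C by (rewrite <- R; ring).
      replace (- Ci * (2 * PI * Ci * RtoC ((1 - / y) ^ m) - l1 + l3 + Ci * l4))%C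
        with (- (Ci * Ci) * (2 * PI * RtoC ((1 - / y) ^ m)) + - Ci * (l3 - l1) + - (Ci * Ci) * l4)%C by ring.
      rewrite Ci_sqr. ring. }
  eapply Rle_trans; [|apply (Fin (sg - (- T - INR m))); lra].
  eapply Rle_trans; [apply Cmod_triangle|]. rewrite Cmod_mult, Cmod_opp, Cmod_Ci, Rmult_1_l.
  unfold Cminus. generalize (Cmod_triangle l3 (- l1)). rewrite Cmod_opp. lra.
- assert (Mon : forall a, sg <= a -> Rpower y a <= Rpower y sg) by (intros a Ha; apply Rpower_le_base_le_1; lra).
  assert (Ce : cont_edges G sg (sg + T) (- T) T) by (apply cont_edges_Rcpow_Kker; lra).
  destruct (rect_int_elim G sg (sg + T) (- T) T ltac:(lra) ltac:(lra) Ce) as (l1 & l2 & l3 & l4 & I1 & I2 & I3 & I4).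
  exists l4. split; [exact I4|].
  assert (R : rect_int G sg (sg + T) (- T) T = 0%C).
  { apply goursat; try lra. intros z [Z1 Z2]. apply (ex_Cderive_mult (Rcpow y) (Kker m)).
    - apply ex_Cderive_Rcpow.
    - apply ex_Cderive_Kker, off_poles_intro; lra. }
  rewrite (rect_int_intro G _ _ _ _ l1 l2 l3 l4) in R by assumption.
  assert (B1 : Cmod l1 <= (sg + T - sg) * (Rpower y sg * Kb)).
  { eapply is_CInt_norm_le_const with (3 := I1); [lra|]. intros t Ht.
    apply EG; simpl; [apply Mon; lra|left; rewrite Rabs_Ropp, Rabs_pos_eq; lra]. }
  assert (B3 : Cmod l3 <= (sg + T - sg) * (Rpower y sg * Kb)).
  { eapply is_CInt_norm_le_const with (3 := I3); [lra|]. intros t Ht.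
    apply EG; simpl; [apply Mon; lra|left; rewrite Rabs_pos_eq; lra]. }
  assert (B2 : Cmod l2 <= (T - - T) * (Rpower y sg * Kb)).
  { eapply is_CInt_norm_le_const with (3 := I2); [lra|]. intros t Ht.
    apply EG; simpl; [apply Mon; lra|right; left; lra]. }
  assert (Hiy : / 1 < / y) by (apply Rinv_lt_contravar; lra). rewrite Rinv_1 in Hiy.
  rewrite Rmax_left by lra.
  rewrite pow_i by lia. rewrite Rmult_0_r.
  replace (l4 - RtoC 0)%C with (- Ci * (l1 - l3) + l2)%C.
  2:{ replace (l4 - 0)%C with (- Ci * (Ci * l4))%C by (replace (- Ci * (Ci * l4))%C with (- (Ci * Ci) * l4)%C by ring; rewrite Ci_sqr; ring).
      replace (Ci * l4)%C with (l1 + Ci * l2 - l3 - (l1 + Ci * l2 - l3 - Ci * l4))%C by ring. rewrite R.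
      replace (- Ci * (l1 + Ci * l2 - l3 - 0))%C with (- Ci * (l1 - l3) + - (Ci * Ci) * l2)%C by ring.
      rewrite Ci_sqr. ring. }
  eapply Rle_trans; [|apply (Fin (sg + T - sg)); lra].
  eapply Rle_trans; [apply Cmod_triangle|]. rewrite Cmod_mult, Cmod_opp, Cmod_Ci, Rmult_1_l.
  unfold Cminus. generalize (Cmod_triangle l1 (- l3)). rewrite Cmod_opp. lra.
Qed.

(** * Residues of the Perron integrand *)

(** Minus the logarithmic derivative of [Kone m]; at 0 it is the harmonic number. *)
Fixpoint Klog (m : nat) (s : C) : C :=
  match m with O => 0%C | S m => (Klog m s + / (s - RtoC (- INR (S m))))%C end.

Fixpoint harmonic (m : nat) : R :=
  match m with O => 0 | S m => harmonic m + / INR (S m) end.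

Lemma is_Cderive_Kone m s : (forall j, (1 <= j <= m)%nat -> (s - RtoC (- INR j) <> 0)%C) ->
  is_Cderive (Kone m) s (- Kone m s * Klog m s)%C.
Proof.
induction m as [|m IH]; intros H.
- simpl. replace (- (1) * 0)%C with (RtoC 0) by ring. apply is_Cderive_const.
- set (p := RtoC (- INR (S m))). assert (Hp : (s - p <> 0)%C) by (apply H; lia).
  assert (D := is_Cderive_mult (Kone m) (fun s => RtoC (INR (S m)) * / (s - p))%C s _ _
    (IH ltac:(intros j Hj; apply H; lia))
    (is_Cderive_mult (fun _ => RtoC (INR (S m))) (fun s => / (s - p))%C s _ _
      (is_Cderive_const _ s) (is_Cderive_inv p s Hp))).
  replace (- Kone (S m) s * Klog (S m) s)%C with
    (- Kone m s * Klog m s * (INR (S m) * / (s - p)) +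
     Kone m s * (0 * / (s - p) + INR (S m) * - / ((s - p) * (s - p))))%C; [exact D|].
  change (Kone (S m) s) with (Kone m s * (RtoC (INR (S m)) * / (s - p)))%C.
  change (Klog (S m) s) with (Klog m s + / (s - p))%C. field. exact Hp.
Qed.

Lemma ex_Cderive_Klog m s : (forall j, (1 <= j <= m)%nat -> (s - RtoC (- INR j) <> 0)%C) ->
  ex_Cderive (Klog m) s.
Proof.
induction m as [|m IH]; intros H.
- exists (RtoC 0). apply is_Cderive_const.
- destruct IH as [l Hl]; [intros j Hj; apply H; lia|].
  eexists. apply (is_Cderive_plus (Klog m) (fun s => / (s - RtoC (- INR (S m))))%C); [exact Hl|].
  apply is_Cderive_inv, H; lia.
Qed.

Lemma Kone_0 m : Kone m 0 = 1%C.
Proof.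
induction m as [|m IH]; [reflexivity|].
change (Kone (S m) 0) with (Kone m 0 * (RtoC (INR (S m)) * / (0 - RtoC (- INR (S m)))))%C.
rewrite IH. replace (0 - RtoC (- INR (S m)))%C with (RtoC (INR (S m))) by (rewrite RtoC_opp; ring).
field. intros E; apply RtoC_inj in E. generalize (lt_0_INR (S m) (Nat.lt_0_succ m)); lra.
Qed.

Lemma Klog_0 m : Klog m 0 = RtoC (harmonic m).
Proof.
induction m as [|m IH]; [reflexivity|].
change (Klog (S m) 0) with (Klog m 0 + / (0 - RtoC (- INR (S m))))%C.
rewrite IH. replace (0 - RtoC (- INR (S m)))%C with (RtoC (INR (S m))) by (rewrite RtoC_opp; ring).
change (harmonic (S m)) with (harmonic m + / INR (S m)).
rewrite RtoC_plus, RtoC_inv; [reflexivity|].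
generalize (lt_0_INR (S m) (Nat.lt_0_succ m)); lra.
Qed.

(** [Kone] at nonnegative real arguments, that is m! Gamma(x+1)/Gamma(x+m+1). *)
Fixpoint Kone_R (m : nat) (x : R) : R :=
  match m with O => 1 | S m => Kone_R m x * (INR (S m) / (x + INR (S m))) end.

Lemma Kone_RtoC m x : 0 <= x -> Kone m (RtoC x) = RtoC (Kone_R m x).
Proof.
intros Hx. induction m as [|m IH]; [reflexivity|].
change (Kone (S m) (RtoC x)) with (Kone m (RtoC x) * (RtoC (INR (S m)) * / (RtoC x - RtoC (- INR (S m)))))%C.
change (Kone_R (S m) x) with (Kone_R m x * (INR (S m) / (x + INR (S m)))).
assert (P := lt_0_INR (S m) (Nat.lt_0_succ m)).
rewrite IH. replace (RtoC x - RtoC (- INR (S m)))%C with (RtoC (x + INR (S m))) by (rewrite RtoC_opp, RtoC_plus; ring).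
unfold Rdiv. rewrite !RtoC_mult, RtoC_inv; [reflexivity|lra].
Qed.

Section Residues.
Variables (x : R) (m : nat) (c sg T : R).
Hypotheses (Hc : 0 < c < 1) (Hsg : 0 < sg) (HT : 0 < T).

Let h (s : C) : C := (Rcpow x s * Kone m s)%C.

(** Since c < 1, the rectangle contains only the pole 0 of the kernel. *)
Lemma pole_free s : - c <= Re s -> forall j, (1 <= j <= m)%nat -> (s - RtoC (- INR j) <> 0)%C.
Proof.
intros Hs j Hj E. assert (E1 : s = RtoC (- INR j)).
{ replace s with (s - RtoC (- INR j) + RtoC (- INR j))%C by ring. rewrite E; ring. }
assert (1 <= INR j) by (apply (le_INR 1); lia). subst s; simpl in Hs. lra.
Qed.

Lemma ex_Cderive_h s : - c <= Re s -> ex_Cderive h s.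
Proof.
intros Hs. apply (ex_Cderive_mult (Rcpow x) (Kone m)); [apply ex_Cderive_Rcpow|].
apply ex_Cderive_Kone, pole_free, Hs.
Qed.

Definition on_border (z : C) : Prop :=
  in_rect (- c) sg (- T) T z /\ (Re z = - c \/ Re z = sg \/ Im z = - T \/ Im z = T).

Lemma cont_edges_border F : (forall z, on_border z -> Ccontinuous F z) -> cont_edges F (- c) sg (- T) T.
Proof.
intros H. split; intros t Ht; split; apply H; unfold on_border, in_rect; simpl; lra.
Qed.

Lemma border_neq z (p : R) : on_border z -> - c < p < sg -> (z - RtoC p <> 0)%C.
Proof.
intros [[Z1 Z2] Z3] Hp E. assert (E1 : z = RtoC p).
{ replace z with (z - RtoC p + RtoC p)%C by ring. rewrite E; ring. }
subst z; simpl in *. lra.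
Qed.

Lemma rect_int_pole (g : C -> C) (p : R) : - c < p < sg ->
  (forall z, in_rect (- c) sg (- T) T z -> ex_Cderive g z) ->
  cont_edges (fun s => g s * / (s - RtoC p))%C (- c) sg (- T) T /\
  rect_int (fun s => g s * / (s - RtoC p))%C (- c) sg (- T) T = (2 * PI * Ci * g (RtoC p))%C.
Proof.
intros Hp Hg. split.
- apply cont_edges_border. intros z Hz. apply ex_Cderive_continuous.
  apply (ex_Cderive_mult g (fun s => / (s - RtoC p))%C).
  + apply Hg, Hz.
  + apply ex_Cderive_inv, border_neq; assumption.
- apply cauchy_formula; simpl; try lra. exact Hg.
Qed.

(* [h/s^2] differs from [h'/s] by the derivative of [- h/s]. *)
Lemma rect_int_double_pole :
  cont_edges (fun s => h s * / (s - 0) * / (s - 0))%C (- c) sg (- T) T /\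
  rect_int (fun s => h s * / (s - 0) * / (s - 0))%C (- c) sg (- T) T
  = (2 * PI * Ci * RtoC (ln x - harmonic m))%C.
Proof.
set (h' := fun s => (h s * (ln x - Klog m s))%C).
assert (Dh : forall s, - c <= Re s -> is_Cderive h s (h' s)).
{ intros s Hs.
  assert (D := is_Cderive_mult (Rcpow x) (Kone m) s _ _ (is_Cderive_Rcpow x s) (is_Cderive_Kone m s (pole_free s Hs))).
  replace (h' s) with (ln x * Rcpow x s * Kone m s + Rcpow x s * (- Kone m s * Klog m s))%C by (unfold h', h; ring).
  exact D. }
assert (Dh' : forall s, - c <= Re s -> ex_Cderive h' s).
{ intros s Hs. apply (ex_Cderive_mult h (fun s => RtoC (ln x) - Klog m s)%C).
  - eexists; apply Dh, Hs.
  - destruct (ex_Cderive_Klog m s (pole_free s Hs)) as [l Hl].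
    eexists. apply (is_Cderive_minus (fun _ => RtoC (ln x)) (Klog m)); [apply is_Cderive_const|exact Hl]. }
destruct (rect_int_pole h' 0) as [P1 P2]; [lra|intros z [[Z _] _]; apply Dh', Z|].
assert (C2 : cont_edges (fun s => h s * / (s - 0) * / (s - 0))%C (- c) sg (- T) T).
{ apply cont_edges_border. intros z Hz. apply ex_Cderive_continuous.
  apply (ex_Cderive_mult (fun s => h s * / (s - 0))%C (fun s => / (s - 0))%C);
    [apply (ex_Cderive_mult h (fun s => / (s - 0))%C)|].
  - eexists; apply Dh, Hz.
  - apply ex_Cderive_inv, (border_neq z 0); [exact Hz|lra].
  - apply ex_Cderive_inv, (border_neq z 0); [exact Hz|lra]. }
split; [exact C2|].
assert (Z : rect_int (fun s => h' s * / (s - 0) - h s * / (s - 0) * / (s - 0))%C (- c) sg (- T) T = 0%C).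
{ assert (Pr : forall z, on_border z -> is_Cderive (fun s => h s * / (s - 0))%C z
     (h' z * / (z - 0) - h z * / (z - 0) * / (z - 0))%C).
  { intros z Hz. assert (N : (z - 0 <> 0)%C) by (apply (border_neq z 0); [exact Hz|lra]).
    assert (D := is_Cderive_mult h (fun s => / (s - 0))%C z _ _ (Dh z (proj1 (proj1 (proj1 Hz)))) (is_Cderive_inv 0 z N)).
    replace (h' z * / (z - 0) - h z * / (z - 0) * / (z - 0))%C
      with (h' z * / (z - 0) + h z * - / ((z - 0) * (z - 0)))%C; [exact D|].
    field. intros E; apply N; rewrite E; ring. }
  apply rect_int_primitive with (fun s => h s * / (s - 0))%C; try lra.
  - apply cont_edges_border. intros z Hz. 
    apply (continuous_minus (K := C_AbsRing) (V := C_NormedModule) (fun s => h' s * / (s - 0))%C (fun s => h s * / (s - 0) * / (s - 0))%C).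
    + apply ex_Cderive_continuous, (ex_Cderive_mult h' (fun s => / (s - 0))%C); [apply Dh', Hz|].
      apply ex_Cderive_inv, (border_neq z 0); [exact Hz|lra].
    + apply ex_Cderive_continuous.
      apply (ex_Cderive_mult (fun s => h s * / (s - 0))%C (fun s => / (s - 0))%C);
      [apply (ex_Cderive_mult h (fun s => / (s - 0))%C)|].
      * eexists; apply Dh, Hz.
      * apply ex_Cderive_inv, (border_neq z 0); [exact Hz|lra].
      * apply ex_Cderive_inv, (border_neq z 0); [exact Hz|lra].
  - intros u Hu; split; apply Pr; unfold on_border, in_rect; simpl; lra.
  - intros u Hu; split; apply Pr; unfold on_border, in_rect; simpl; lra. }
rewrite rect_int_minus in Z by (lra || assumption).
rewrite P2 in Z.
replace (rect_int (fun s => h s * / (s - 0) * / (s - 0)) (- c) sg (- T) T)%C with (2 * PI * Ci * h' 0)%C.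
- unfold h', h. rewrite Rcpow_0, Kone_0, Klog_0, RtoC_minus. ring.
- replace (2 * PI * Ci * h' 0)%C with (2 * PI * Ci * h' 0 - rect_int (fun s => h s * / (s - 0) * / (s - 0)) (- c) sg (- T) T
    + rect_int (fun s => h s * / (s - 0) * / (s - 0)) (- c) sg (- T) T)%C by ring.
  rewrite Z. ring.
Qed.

(** Partial fractions: 1/((s - p) s) is (1/(s - p) - 1/s)/p, so the pole [p] gives the power of [x]
    and the pole 0 the constant -a/p. *)
Lemma rect_int_simple_pole (a p : R) : 0 < p < sg ->
  let F := (fun s => RtoC a / (s - RtoC p) * (h s * / (s - 0)))%C in
  cont_edges F (- c) sg (- T) T /\
  rect_int F (- c) sg (- T) T = (2 * PI * Ci * RtoC (a / p * (Rpower x p * Kone_R m p - 1)))%C.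
Proof.
intros Hp F.
destruct (rect_int_pole h p) as [A1 A2]; [lra|intros z [[Z _] _]; apply ex_Cderive_h, Z|].
destruct (rect_int_pole h 0) as [B1 B2]; [lra|intros z [[Z _] _]; apply ex_Cderive_h, Z|].
assert (CF : cont_edges F (- c) sg (- T) T).
{ apply cont_edges_border. intros z Hz. apply ex_Cderive_continuous.
  apply (ex_Cderive_mult (fun s => RtoC a / (s - RtoC p))%C (fun s => h s * / (s - 0))%C).
  - apply (ex_Cderive_mult (fun _ => RtoC a) (fun s => / (s - RtoC p))%C).
    + exists (RtoC 0); apply is_Cderive_const.
    + apply ex_Cderive_inv, (border_neq z p); [exact Hz|lra].
  - apply (ex_Cderive_mult h (fun s => / (s - 0))%C).
    + apply ex_Cderive_h, Hz.
    + apply ex_Cderive_inv, (border_neq z 0); [exact Hz|lra]. }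
split; [exact CF|].
assert (Q : cont_edges (fun s => h s * / (s - RtoC p) - h s * / (s - 0))%C (- c) sg (- T) T).
{ apply cont_edges_border. intros z Hz.
  apply (continuous_minus (K := C_AbsRing) (V := C_NormedModule) (fun s => h s * / (s - RtoC p))%C (fun s => h s * / (s - 0))%C);
  apply ex_Cderive_continuous.
  - apply (ex_Cderive_mult h (fun s => / (s - RtoC p))%C).
    + apply ex_Cderive_h, Hz.
    + apply ex_Cderive_inv, (border_neq z p); [exact Hz|lra].
  - apply (ex_Cderive_mult h (fun s => / (s - 0))%C).
    + apply ex_Cderive_h, Hz.
    + apply ex_Cderive_inv, (border_neq z 0); [exact Hz|lra]. }
assert (Np : RtoC p <> 0%C) by (intros E; apply RtoC_inj in E; lra).
rewrite (rect_int_ext F (fun s => RtoC (a / p) * (h s * / (s - RtoC p) - h s * / (s - 0)))%C); try lra; try assumption.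
- rewrite rect_int_mult_l by (lra || exact Q).
  rewrite rect_int_minus by (lra || assumption). rewrite A2, B2.
  unfold h. rewrite Rcpow_0, Kone_0, Rcpow_R, Kone_RtoC by lra.
  rewrite (RtoC_mult (a / p)), RtoC_minus, (RtoC_mult (Rpower x p)). ring.
- intros z Hz Hb. assert (Hbd : on_border z) by (split; assumption).
  assert (N1 := border_neq z p Hbd ltac:(lra)). assert (N0 := border_neq z 0 Hbd ltac:(lra)).
  unfold F, Rdiv. rewrite RtoC_mult, RtoC_inv by lra. field. repeat split; try assumption.
  intros E; apply N0; rewrite E; ring.
Qed.

End Residues.

(** * Perron's formula for a Dirichlet series *)

Notation is_Cseries := (is_series (V := C_NormedModule)).

Lemma sum_n_Csum (a : nat -> C) N : sum_n (G := C_NormedModule) a N = Csum a (S N).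
Proof.
induction N as [|N IH].
- rewrite sum_O. simpl. ring.
- rewrite sum_Sn, IH. reflexivity.
Qed.

Lemma Re_Csum a n : Re (Csum a (S n)) = sum_n (fun k => Re (a k)) n.
Proof.
induction n as [|n IH].
- rewrite sum_O. unfold Re, Csum, Cplus; simpl. ring.
- rewrite sum_n_succ, <- IH. reflexivity.
Qed.

Lemma Im_Csum a n : Im (Csum a (S n)) = sum_n (fun k => Im (a k)) n.
Proof.
induction n as [|n IH].
- rewrite sum_O. unfold Im, Csum, Cplus; simpl. ring.
- rewrite sum_n_succ, <- IH. reflexivity.
Qed.

Lemma is_Cseries_Re a l : is_Cseries a l -> is_series (fun n => Re (a n)) (Re l).
Proof.
intros H. apply is_series_lim.
apply is_lim_seq_ext with (fun n => Re (sum_n (G := C_NormedModule) a n)).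
{ intros n. rewrite sum_n_Csum. apply Re_Csum. }
assert (Hf : filterlim (fun z : C => Re z) (locally (T := C_UniformSpace) l) (locally (Re l))).
{ intros P [e He]. exists e. intros z Hz. apply He. apply Hz. }
exact (filterlim_comp _ _ _ _ _ _ _ _ H Hf).
Qed.

Lemma is_Cseries_Im a l : is_Cseries a l -> is_series (fun n => Im (a n)) (Im l).
Proof.
intros H. apply is_series_lim.
apply is_lim_seq_ext with (fun n => Im (sum_n (G := C_NormedModule) a n)).
{ intros n. rewrite sum_n_Csum. apply Im_Csum. }
assert (Hf : filterlim (fun z : C => Im z) (locally (T := C_UniformSpace) l) (locally (Im l))).
{ intros P [e He]. exists e. intros z Hz. apply He. apply Hz. }
exact (filterlim_comp _ _ _ _ _ _ _ _ H Hf).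
Qed.

(** The factor 2 comes from estimating real and imaginary parts separately. *)
Lemma is_Cseries_tail a l (b : nat -> R) N : is_Cseries a l -> (forall n, Cmod (a n) <= b n) -> ex_series b ->
  Cmod (l - Csum a (S N)) <= 2 * (Series b - sum_n b N).
Proof.
intros H1 H2 Hb. eapply Rle_trans; [apply Cmod_le_Re_Im|].
assert (R1 := is_Cseries_Re _ _ H1). assert (R2 := is_Cseries_Im _ _ H1).
replace (Re (l - Csum a (S N))) with (Series (fun n => Re (a n)) - sum_n (fun n => Re (a n)) N)
  by (rewrite (is_series_unique _ _ R1), <- Re_Csum; reflexivity).
replace (Im (l - Csum a (S N))) with (Series (fun n => Im (a n)) - sum_n (fun n => Im (a n)) N)
  by (rewrite (is_series_unique _ _ R2), <- Im_Csum; reflexivity).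
assert (Rabs (Series (fun n => Re (a n)) - sum_n (fun n => Re (a n)) N) <= Series b - sum_n b N).
{ apply Series_tail_dom; [|exact Hb]. intros n. eapply Rle_trans; [apply Rabs_Re_le_Cmod|apply H2]. }
assert (Rabs (Series (fun n => Im (a n)) - sum_n (fun n => Im (a n)) N) <= Series b - sum_n b N).
{ apply Series_tail_dom; [|exact Hb]. intros n. eapply Rle_trans; [apply Rabs_Im_le_Cmod|apply H2]. }
lra.
Qed.

Lemma is_RInt_zero (a b : R) : is_RInt (fun _ => 0) a b 0.
Proof.
assert (E : scal (b - a) 0 = 0) by (unfold scal; simpl; unfold mult; simpl; ring).
exact (eq_ind _ (fun l => is_RInt (fun _ => 0) a b l) (is_RInt_const (V := R_NormedModule) a b 0) 0 E).
Qed.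

Lemma is_CInt_Csum (f : nat -> R -> C) (l : nat -> C) a b n :
  (forall k, (k < n)%nat -> is_CInt (f k) a b (l k)) ->
  is_CInt (fun t => Csum (fun k => f k t) n) a b (Csum l n).
Proof.
induction n as [|n IH]; intros H.
- simpl. apply is_CInt_pair; split; apply (is_RInt_zero a b).
- simpl. apply is_CInt_plus; [apply IH; intros; apply H; lia|apply H; lia].
Qed.

Lemma Csum_mult_l k a n : Csum (fun i => k * a i)%C n = (k * Csum a n)%C.
Proof. induction n as [|n IH]; simpl; [ring|rewrite IH; ring]. Qed.

Lemma Csum_ext a b n : (forall i, (i < n)%nat -> a i = b i) -> Csum a n = Csum b n.
Proof. induction n as [|n IH]; intros H; simpl; [reflexivity|rewrite IH, H by (auto || lia); reflexivity]. Qed.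

Lemma Cmod_Csum_minus_le a b (e : nat -> R) n : (forall i, Cmod (a i - b i) <= e i) ->
  Cmod (Csum a (S n) - Csum b (S n)) <= sum_n e n.
Proof.
intros H. induction n as [|n IH].
- rewrite sum_O. simpl. replace (0 + a 0%nat - (0 + b 0%nat))%C with (a 0%nat - b 0%nat)%C by ring. apply H.
- rewrite sum_n_succ. change (Csum a (S (S n))) with (Csum a (S n) + a (S n))%C.
  change (Csum b (S (S n))) with (Csum b (S n) + b (S n))%C.
  replace (Csum a (S n) + a (S n) - (Csum b (S n) + b (S n)))%C
    with (Csum a (S n) - Csum b (S n) + (a (S n) - b (S n)))%C by ring.
  eapply Rle_trans; [apply Cmod_triangle|]. specialize (H (S n)). lra.
Qed.

Lemma Csum_RtoC (a : nat -> R) n : Csum (fun k => RtoC (a k)) (S n) = RtoC (sum_n a n).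
Proof.
induction n as [|n IH].
- rewrite sum_O. simpl. ring.
- rewrite sum_n_succ, RtoC_plus, <- IH. reflexivity.
Qed.

(** The index [i] stands for k = i + 1. The cut-off by [Rmax] lets the sum up to any N >= x
    represent the Riesz mean. *)
Definition riesz_term (L : nat -> R) (m : nat) (x : R) (i : nat) : R :=
  L (S i) * (Rmax 0 (1 - INR (S i) / x)) ^ m.

Lemma sum_n_riesz_stable L m x N N' : (1 <= m)%nat -> 0 < x -> x <= INR N -> (N <= N')%nat ->
  sum_n (riesz_term L m x) N' = sum_n (riesz_term L m x) N.
Proof.
intros Hm Hx HN Hle. induction Hle as [|N' Hle IH]; [reflexivity|].
rewrite sum_n_succ, IH. unfold riesz_term.
rewrite Rmax_left.
- rewrite pow_i by lia. rewrite Rmult_0_r; apply Rplus_0_r.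
- apply le_INR in Hle. rewrite !S_INR. apply Rle_minus. apply Rle_div_r; lra.
Qed.

(** The kernel estimate is applied with y = x/k and summed over k. The Dirichlet series converges
    uniformly on the segment, since it converges absolutely at [sg]. *)
Theorem perron_line (L : nat -> R) (D : C -> C) (sg : R) (m : nat) : (1 <= m)%nat -> 0 < sg ->
  ex_series (fun i => Rabs (L (S i)) * Rpower (INR (S i)) (- sg)) ->
  (forall t, is_Cseries (fun i => Cmult (RtoC (L (S i))) (Rcpow (INR (S i)) (Copp (sg, t)))) (D (sg, t))) ->
  exists M, 0 <= M /\ forall x T N J, 0 < x -> 1 <= T -> x <= INR N ->
  is_CInt (fun t => Rcpow x (sg, t) * Kker m (sg, t) * D (sg, t))%C (- T) T J ->
  Cmod (J - RtoC (2 * PI * sum_n (riesz_term L m x) N)) <= M * Rpower x sg / T.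
Proof.
intros Hm Hs Hser HD.
destruct (riesz_kernel_line m sg Hm Hs) as [M [HM0 HM]].
set (b := fun i => Rabs (L (S i)) * Rpower (INR (S i)) (- sg)) in *.
assert (Hb0 : forall i, 0 <= b i).
{ intros i; unfold b. apply Rmult_le_pos; [apply Rabs_pos|apply Rlt_le, exp_pos]. }
exists (M * Series b). split; [apply Rmult_le_pos; [exact HM0|apply Series_nonneg; assumption]|].
intros x T N J Hx HT HN HJ.
set (Kb := INR (fact m) / sg ^ S m).
assert (HKb : forall t, Cmod (Kker m (sg, t)) <= Kb).
{ intros t. apply Cmod_Kker_le_pow; [exact Hs|]. intros j _. eapply Rle_trans; [|apply Rabs_Re_le_Cmod].
  assert (P := pos_INR j).
  replace (Re ((sg, t) - RtoC (- INR j))) with (sg + INR j) by (unfold Re, Cminus, Cplus, Copp, RtoC; simpl; ring).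
  rewrite Rabs_pos_eq; lra. }
assert (HKb0 : 0 <= Kb) by (eapply Rle_trans; [apply Cmod_ge_0|apply (HKb 0)]).
assert (Pk : forall i, 0 < INR (S i)) by (intros i; apply lt_0_INR; lia).
(* The truncation at [N'] is integrated termwise; its tail contributes the last summand, which is
   sent to 0 with [T] fixed. *)
assert (Key : forall N', (N <= N')%nat -> Cmod (J - RtoC (2 * PI * sum_n (riesz_term L m x) N))
   <= M * Series b * Rpower x sg / T + 4 * T * Rpower x sg * Kb * (Series b - sum_n b N')).
{ intros N' HN'.
  set (Jk := fun i => CInt (fun t => Rcpow (x / INR (S i)) (sg, t) * Kker m (sg, t))%C (- T) T).
  assert (HJk : forall i, is_CInt (fun t => Rcpow (x / INR (S i)) (sg, t) * Kker m (sg, t))%C (- T) T (Jk i) /\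
    Cmod (Jk i - RtoC (2 * PI * (Rmax 0 (1 - / (x / INR (S i)))) ^ m)) <= M * Rpower (x / INR (S i)) sg / T).
  { intros i. destruct (HM (x / INR (S i)) T) as [J' [J1 J2]]; [apply Rdiv_lt_0_compat; [exact Hx|apply Pk]|exact HT|].
    unfold Jk. rewrite (is_CInt_unique _ _ _ _ J1). split; assumption. }
  set (g := fun i t => (RtoC (L (S i)) * (Rcpow (x / INR (S i)) (sg, t) * Kker m (sg, t)))%C).
  assert (Ig : is_CInt (fun t => Csum (fun i => g i t) (S N')) (- T) T (Csum (fun i => RtoC (L (S i)) * Jk i)%C (S N'))).
  { apply (is_CInt_Csum g). intros i _. apply is_CInt_mult_l, HJk. }
  assert (A : Cmod (J - Csum (fun i => RtoC (L (S i)) * Jk i)%C (S N')) <= (T - - T) * (Rpower x sg * Kb * (2 * (Series b - sum_n b N')))).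
  { eapply is_CInt_norm_le_const with (3 := is_CInt_minus _ _ _ _ _ _ HJ Ig); [lra|].
    intros t _.
    replace (Rcpow x (sg, t) * Kker m (sg, t) * D (sg, t) - Csum (fun i => g i t) (S N'))%C with
      (Rcpow x (sg, t) * Kker m (sg, t) * (D (sg, t) - Csum (fun i => RtoC (L (S i)) * Rcpow (INR (S i)) (- (sg, t))) (S N')))%C.
    - rewrite !Cmod_mult, Cmod_Rcpow. simpl Re.
      apply Rmult_le_compat; [apply Rmult_le_pos; [apply Rlt_le, exp_pos|apply Cmod_ge_0]|apply Cmod_ge_0| |].
      + apply Rmult_le_compat_l; [apply Rlt_le, exp_pos|apply HKb].
      + apply is_Cseries_tail; [apply HD| |exact Hser].
        intros i. rewrite Cmod_mult, Cmod_R, Cmod_Rcpow. unfold b. simpl. lra.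
    - replace (Csum (fun i => g i t) (S N')) with (Rcpow x (sg, t) * Kker m (sg, t) *
        Csum (fun i => RtoC (L (S i)) * Rcpow (INR (S i)) (- (sg, t))) (S N'))%C; [ring|].
      rewrite <- Csum_mult_l. apply Csum_ext. intros i _.
      unfold g. rewrite Rcpow_div by (exact Hx || apply Pk). ring. }
  assert (B : Cmod (Csum (fun i => RtoC (L (S i)) * Jk i)%C (S N') - Csum (fun i => RtoC (2 * PI * riesz_term L m x i)) (S N'))
     <= sum_n (fun i => M * Rpower x sg / T * b i) N').
  { apply Cmod_Csum_minus_le. intros i. destruct (HJk i) as [_ Hi].
    replace (RtoC (L (S i)) * Jk i - RtoC (2 * PI * riesz_term L m x i))%C
      with (RtoC (L (S i)) * (Jk i - RtoC (2 * PI * (Rmax 0 (1 - / (x / INR (S i)))) ^ m)))%C.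
    - rewrite Cmod_mult, Cmod_R.
      replace (M * Rpower x sg / T * b i) with (Rabs (L (S i)) * (M * Rpower (x / INR (S i)) sg / T)).
      + apply Rmult_le_compat_l; [apply Rabs_pos|exact Hi].
      + unfold b. unfold Rpower. rewrite ln_div by (exact Hx || apply Pk).
        replace (sg * (ln x - ln (INR (S i)))) with (sg * ln x + - sg * ln (INR (S i))) by ring.
        rewrite exp_plus. field. lra.
    - unfold riesz_term. replace (/ (x / INR (S i))) with (INR (S i) / x) by (specialize (Pk i); field; lra).
      rewrite !RtoC_mult. ring. }
  rewrite sum_n_scal_l_R in B. rewrite Csum_RtoC, sum_n_scal_l_R, (sum_n_riesz_stable L m x N N') in B by assumption.
  assert (Sb : sum_n b N' <= Series b) by (apply sum_n_le_Series; assumption).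
  assert (P1 : M * Rpower x sg / T * sum_n b N' <= M * Rpower x sg / T * Series b).
  { apply Rmult_le_compat_l; [|exact Sb]. apply Rdiv_le_0_compat; [|lra]. apply Rmult_le_pos; [exact HM0|apply Rlt_le, exp_pos]. }
  replace (J - RtoC (2 * PI * sum_n (riesz_term L m x) N))%C with
    (J - Csum (fun i => RtoC (L (S i)) * Jk i) (S N') + (Csum (fun i => RtoC (L (S i)) * Jk i) (S N') - RtoC (2 * PI * sum_n (riesz_term L m x) N)))%C by ring.
  eapply Rle_trans; [apply Cmod_triangle|].
  replace (M * Series b * Rpower x sg / T) with (M * Rpower x sg / T * Series b) by (field; lra). lra. }
apply Rle_plus_epsilon. intros eps He.
set (Q := 4 * T * Rpower x sg * Kb).
assert (HQ : 0 <= Q). { unfold Q. apply Rmult_le_pos; [|exact HKb0]. apply Rmult_le_pos; [lra|apply Rlt_le, exp_pos]. }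
destruct (Series_tail_small b (eps / (Q + 1)) Hser) as [N1 HN1]; [apply Rdiv_lt_0_compat; lra|].
specialize (HN1 (Nat.max N N1) (Nat.le_max_r _ _)).
eapply Rle_trans; [apply (Key (Nat.max N N1)), Nat.le_max_l|].
apply Rplus_le_compat_l. fold Q.
apply Rle_trans with (Q * (eps / (Q + 1))); [apply Rmult_le_compat_l; lra|].
replace (Q * (eps / (Q + 1))) with (eps * (Q / (Q + 1))) by (field; lra).
assert (Q / (Q + 1) <= 1) by (apply Rle_div_l; lra). nra.
Qed.

Lemma Cminus_eq_0_inv (z p : C) : (z - p = 0)%C -> z = p.
Proof. intros H. replace z with (z - p + p)%C by ring. rewrite H. ring. Qed.

Lemma Csum_succ_l f n : Csum f (S n) = (f 0%nat + Csum (fun k => f (S k)) n)%C.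
Proof.
induction n as [|n IH]; [simpl; ring|].
change (Csum f (S (S n))) with (Csum f (S n) + f (S n))%C. rewrite IH. simpl. ring.
Qed.

Lemma rho_nonneg D r rho A C0 k : poles_condition D r rho A C0 -> (k <= r)%nat -> 0 <= rho k.
Proof.
intros H Hk. destruct k as [|k]; [rewrite (rho_zero _ _ _ _ _ H); lra|].
generalize (rho_incr _ _ _ _ _ H 0%nat (S k) ltac:(lia) Hk). rewrite (rho_zero _ _ _ _ _ H). lra.
Qed.

Lemma rho_pos D r rho A C0 k : poles_condition D r rho A C0 -> (1 <= k <= r)%nat -> 0 < rho k.
Proof.
intros H Hk. generalize (rho_incr _ _ _ _ _ H 0%nat k ltac:(lia) ltac:(lia)). rewrite (rho_zero _ _ _ _ _ H). lra.
Qed.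

Lemma rho_le_last D r rho A C0 k : poles_condition D r rho A C0 -> (k <= r)%nat -> rho k <= rho r.
Proof.
intros H Hk. destruct (Nat.eq_dec k r) as [->|N]; [lra|].
apply Rlt_le, (rho_incr _ _ _ _ _ H); lia.
Qed.

Lemma D_continuous D r rho A C0 s : poles_condition D r rho A C0 -> half_plane C0 s ->
  Re s < 0 \/ rho r < Re s \/ Im s <> 0 -> ex_Cderive D s.
Proof.
intros H Hs Hc. apply analytic_at_derive, (D_analytic _ _ _ _ _ H); [exact Hs|].
intros k Hk E. subst s. simpl in Hc.
generalize (rho_nonneg _ _ _ _ _ k H Hk), (rho_le_last _ _ _ _ _ k H Hk). lra.
Qed.

Section Contour.
Variables (D E : C -> C) (r : nat) (rho A : nat -> R) (C0 c sg : R) (m : nat).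
Hypotheses (HP : poles_condition D r rho A C0) (Hc : 0 < c < C0) (Hsg : rho r < sg)
  (HE : forall s, half_plane C0 s -> analytic_at E s)
  (HDE : forall s : C, (forall k, (k <= r)%nat -> s <> RtoC (rho k)) ->
    D s = (E s + Csum (fun k => A k / (s - rho k)) (S r))%C).

(** Principal parts are added one at a time. Each pole rho_k also contributes -A_k/rho_k through the
    pole of the kernel at 0; with [E 0] these constants make up Theta. *)
Lemma rect_int_perron x T : 0 < x -> 0 < T ->
  rect_int (fun s => Rcpow x s * Kker m s * D s)%C (- c) sg (- T) T =
  (2 * PI * Ci * (E 0 + RtoC (A 0%nat * (ln x - harmonic m))
   + Csum (fun k => RtoC (A (S k) / rho (S k) * (Rpower x (rho (S k)) * Kone_R m (rho (S k)) - 1))) r))%C.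
Proof.
intros Hx HT.
assert (C01 := C0_range _ _ _ _ _ HP). assert (Hc1 : 0 < c < 1) by lra.
assert (Hs0 : 0 < sg) by (generalize (rho_nonneg _ _ _ _ _ r HP (le_n r)); lra).
set (h := fun s => (Rcpow x s * Kone m s)%C).
set (G := fun j s => (E s * h s * / (s - 0) + A 0%nat * (h s * / (s - 0) * / (s - 0))
   + Csum (fun k => RtoC (A (S k)) / (s - RtoC (rho (S k))) * (h s * / (s - 0))) j)%C).
assert (HG : forall j, (j <= r)%nat -> cont_edges (G j) (- c) sg (- T) T /\
  rect_int (G j) (- c) sg (- T) T = (2 * PI * Ci * (E 0 + RtoC (A 0%nat * (ln x - harmonic m))
   + Csum (fun k => RtoC (A (S k) / rho (S k) * (Rpower x (rho (S k)) * Kone_R m (rho (S k)) - 1))) j))%C).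
{ induction j as [|j IH]; intros Hj.
  - destruct (rect_int_pole c sg T ltac:(lra) ltac:(lra) ltac:(lra) (fun s => E s * h s)%C 0) as [A1 A2]; [lra| |].
    { intros z [[Z _] _]. apply (ex_Cderive_mult E h).
      - apply analytic_at_derive, HE. unfold half_plane; lra.
      - apply (ex_Cderive_h x m c); lra. }
    destruct (rect_int_double_pole x m c sg T ltac:(lra) ltac:(lra) ltac:(lra)) as [B1 B2].
    assert (B3 : cont_edges (fun s => A 0%nat * (h s * / (s - 0) * / (s - 0)))%C (- c) sg (- T) T).
    { revert B1. apply cont_edges_map. intros z Hz.
      apply (continuous_scal_r (K := C_AbsRing) (V := C_NormedModule) (RtoC (A 0%nat)) (fun s => Rcpow x s * Kone m s * / (s - 0) * / (s - 0))%C), Hz. }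
    assert (B4 : cont_edges (G 0%nat) (- c) sg (- T) T).
    { split; intros t Ht; split.
      all: apply (continuous_ext (fun s => E s * h s * / (s - 0) + A 0%nat * (h s * / (s - 0) * / (s - 0)))%C);
        [intros z; unfold G; simpl; ring|].
      all: apply (continuous_plus (K := C_AbsRing) (V := C_NormedModule) (fun s => E s * h s * / (s - 0))%C (fun s => A 0%nat * (h s * / (s - 0) * / (s - 0)))%C).
      + exact (proj1 (proj1 A1 t Ht)). + exact (proj1 (proj1 B3 t Ht)).
      + exact (proj2 (proj1 A1 t Ht)). + exact (proj2 (proj1 B3 t Ht)).
      + exact (proj1 (proj2 A1 t Ht)). + exact (proj1 (proj2 B3 t Ht)).
      + exact (proj2 (proj2 A1 t Ht)). + exact (proj2 (proj2 B3 t Ht)). }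
    split; [exact B4|].
    rewrite (rect_int_ext (G 0%nat) (fun s => E s * h s * / (s - 0) + A 0%nat * (h s * / (s - 0) * / (s - 0)))%C); try lra; try assumption.
    + rewrite rect_int_plus by (lra || assumption). rewrite rect_int_mult_l by (lra || assumption).
      rewrite A2. unfold h at 2. rewrite B2. unfold h. rewrite Rcpow_0, Kone_0, (RtoC_mult (A 0%nat)). simpl. ring.
    + intros z _ _. unfold G. simpl. ring.
  - destruct IH as [A1 A2]; [lia|].
    assert (Hp : 0 < rho (S j) < sg).
    { split; [apply (rho_pos _ _ _ _ _ _ HP); lia|]. generalize (rho_le_last _ _ _ _ _ (S j) HP Hj); lra. }
    destruct (rect_int_simple_pole x m c sg T ltac:(lra) ltac:(lra) ltac:(lra) (A (S j)) (rho (S j)) Hp) as [B1 B2].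
    set (F := fun s => (RtoC (A (S j)) / (s - RtoC (rho (S j))) * (Rcpow x s * Kone m s * / (s - 0)))%C) in *.
    assert (B4 : cont_edges (G (S j)) (- c) sg (- T) T).
    { split; intros t Ht; split.
      all: apply (continuous_ext (fun s => G j s + F s)%C); [intros z; unfold G, F, h; simpl; ring|].
      all: apply (continuous_plus (K := C_AbsRing) (V := C_NormedModule) (G j) F).
      + exact (proj1 (proj1 A1 t Ht)). + exact (proj1 (proj1 B1 t Ht)).
      + exact (proj2 (proj1 A1 t Ht)). + exact (proj2 (proj1 B1 t Ht)).
      + exact (proj1 (proj2 A1 t Ht)). + exact (proj1 (proj2 B1 t Ht)).
      + exact (proj2 (proj2 A1 t Ht)). + exact (proj2 (proj2 B1 t Ht)). }
    split; [exact B4|].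
    rewrite (rect_int_ext (G (S j)) (fun s => G j s + F s)%C); try lra; try assumption.
    + rewrite rect_int_plus by (lra || assumption). rewrite A2, B2. simpl Csum. ring.
    + intros z _ _. unfold G, F, h. simpl. ring. }
destruct (HG r (le_n r)) as [H1 H2]. rewrite <- H2. symmetry.
apply rect_int_ext; try lra; [exact H1|].
intros z Hz Hb. assert (Hbd : on_border c sg T z) by (split; assumption).
assert (Np : forall k, (k <= r)%nat -> z <> RtoC (rho k)).
{ intros k Hk Ez. apply (border_neq c sg T HT z (rho k) Hbd).
  - generalize (rho_nonneg _ _ _ _ _ k HP Hk), (rho_le_last _ _ _ _ _ k HP Hk); lra.
  - rewrite Ez; ring. }
rewrite (HDE z Np), Csum_succ_l, (rho_zero _ _ _ _ _ HP).
unfold G, Kker. fold (h z).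
replace (Csum (fun k => RtoC (A (S k)) / (z - RtoC (rho (S k))) * (h z * / (z - 0))) r)%C
  with (h z * / (z - 0) * Csum (fun k => RtoC (A (S k)) / (z - RtoC (rho (S k)))) r)%C.
- unfold h, Cdiv. ring.
- rewrite <- Csum_mult_l. apply Csum_ext. intros; ring.
Qed.

(** The line Re s = -c meets no pole of [D] or of the kernel. For large |t| the kernel is
    O(|t|^(-m-1)) and [D] is O(|t|^(m-1)) because C1 <= m - 1; a compact segment remains. The
    majorant 1/(1 + t^2) has total integral PI. *)
Lemma left_edge_bound C1 M T0 :
  0 < C1 -> 0 < T0 -> C1 <= INR m - 1 ->
  (forall s, half_plane C0 s -> T0 <= Rabs (Im s) -> Cmod (D s) <= M * Rpower (Rabs (Im s)) C1) ->
  exists CL, 0 <= CL /\ forall t, Cmod (Kker m ((- c)%R, t) * D ((- c)%R, t)) <= CL / (1 + t * t).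
Proof.
intros HC1 HT0 Hm Hgr.
assert (C01 := C0_range _ _ _ _ _ HP).
set (T1 := Rmax T0 1). assert (HT1 : T0 <= T1) by apply Rmax_l. assert (HT11 : 1 <= T1) by apply Rmax_r.
assert (Hcont : forall t, continuous (U := C_UniformSpace) (fun t => Kker m ((- c)%R, t) * D ((- c)%R, t))%C t).
{ intros t. apply (Ccontinuous_vertical (fun s => Kker m s * D s)%C).
  apply ex_Cderive_continuous, (ex_Cderive_mult (Kker m) D).
  - apply ex_Cderive_Kker. intros j Hj Ez.
    assert (E1 : ((- c)%R, t) = RtoC (- INR j)).
    { apply (Cminus_eq_0_inv _ _ Ez). }
    injection E1; intros _ E2. destruct j as [|j]; [simpl in E2; lra|].
    assert (1 <= INR (S j)) by (apply (le_INR 1); lia). lra.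
  - apply (D_continuous _ _ _ _ _ _ HP); [unfold half_plane; simpl; lra|simpl; lra]. }
destruct (bounded_continuity (V := C_R_NormedModule) (fun t => Kker m ((- c)%R, t) * D ((- c)%R, t))%C (- T1) T1) as [B HB].
{ intros t _. apply Hcont. }
assert (HB0 : 0 <= B).
{ specialize (HB 0 ltac:(lra)). generalize (norm_ge_0 (V := C_R_NormedModule) (Kker m ((- c)%R, 0%R) * D ((- c)%R, 0%R))%C). lra. }
exists (2 * Rabs M * INR (fact m) + B * (1 + T1 * T1)).
assert (Pf := pos_INR (fact m)). assert (PM := Rabs_pos M).
assert (H1 : 0 <= 2 * Rabs M * INR (fact m)) by (apply Rmult_le_pos; [lra|exact Pf]).
assert (H2 : 0 <= B * (1 + T1 * T1)) by (apply Rmult_le_pos; nra).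
split; [lra|].
intros t. assert (Q : 0 < 1 + t * t) by nra.
apply Rle_div_r; [lra|].
destruct (Rle_dec T1 (Rabs t)) as [Ht|Ht].
- assert (Et : t * t = Rabs t * Rabs t) by (rewrite <- Rabs_mult, Rabs_pos_eq; nra).
  rewrite Et in *. set (y := Rabs t) in *.
  assert (K1 : Cmod (Kker m ((- c)%R, t)) <= INR (fact m) / y ^ S m).
  { apply Cmod_Kker_le_pow; [lra|]. intros j _. eapply Rle_trans; [|apply Rabs_Im_le_Cmod].
    apply Req_le. unfold y, Im, Cminus, Cplus, Copp, RtoC; simpl. f_equal; ring. }
  assert (K2 : Cmod (D ((- c)%R, t)) <= Rabs M * y ^ (m - 1)).
  { eapply Rle_trans; [apply Hgr; [unfold half_plane; simpl; lra|simpl; fold y; lra]|]. simpl Im. fold y.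
    apply Rle_trans with (Rabs M * Rpower y C1).
    - apply Rmult_le_compat_r; [apply Rlt_le, exp_pos|apply Rle_abs].
    - apply Rmult_le_compat_l; [exact PM|]. rewrite <- Rpower_pow by lra. apply Rle_Rpower; [lra|].
      destruct m as [|m']; [simpl in Hm; lra|]. rewrite S_INR in Hm. simpl. rewrite Nat.sub_0_r. lra. }
  rewrite Cmod_mult.
  assert (K3 : Cmod (Kker m ((- c)%R, t)) * Cmod (D ((- c)%R, t)) <= INR (fact m) / y ^ S m * (Rabs M * y ^ (m - 1))).
  { apply Rmult_le_compat; try apply Cmod_ge_0; assumption. }
  destruct m as [|m']; [simpl in Hm; lra|].
  simpl Nat.sub in K3. rewrite Nat.sub_0_r in K3.
  assert (Py : 0 < y ^ m') by (apply pow_lt; lra).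
  replace (INR (fact (S m')) / y ^ S (S m') * (Rabs M * y ^ m')) with (Rabs M * INR (fact (S m')) / (y * y)) in K3
    by (simpl pow; field; lra).
  apply Rle_trans with (Rabs M * INR (fact (S m')) / (y * y) * (1 + y * y)).
  + apply Rmult_le_compat_r; [nra|exact K3].
  + apply Rle_trans with (2 * Rabs M * INR (fact (S m'))); [|lra].
    replace (Rabs M * INR (fact (S m')) / (y * y) * (1 + y * y)) with (Rabs M * INR (fact (S m')) * ((1 + y * y) / (y * y))) by (field; lra).
    replace (2 * Rabs M * INR (fact (S m'))) with (Rabs M * INR (fact (S m')) * 2) by ring.
    apply Rmult_le_compat_l; [apply Rmult_le_pos; assumption|]. apply Rle_div_l; nra.
- assert (Ht2 : - T1 <= t <= T1) by (apply Rabs_le_between; lra).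
  specialize (HB t Ht2). rewrite Cmod_norm_R in HB.
  apply Rle_trans with (B * (1 + T1 * T1)); [|lra].
  apply Rmult_le_compat; [apply Cmod_ge_0|lra|lra|]. nra.
Qed.

End Contour.

Lemma is_RInt_inv_1_sqr T : 0 <= T -> is_RInt (fun t => / (1 + t * t)) (- T) T (2 * atan T).
Proof.
intros HT. replace (2 * atan T) with (minus (atan T) (atan (- T))).
2:{ rewrite atan_opp. unfold minus, plus, opp; simpl. ring. }
apply (is_RInt_derive atan).
- intros t _. auto_derive; [exact I|]. unfold Rsqr. field. assert (0 <= t * t) by apply Rle_0_sqr. lra.
- intros t _. apply continuity_pt_filterlim, derivable_continuous_pt, ex_derive_Reals_0. auto_derive.
  assert (0 <= t * t) by apply Rle_0_sqr. lra.
Qed.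

(** The terms of a convergent series are bounded, which gives a polynomial bound on the coefficients
    and hence absolute convergence further to the right. *)
Lemma dirichlet_coeff_bound L D : dirichlet_series L D ->
  exists s0 B q, 0 < B /\ 0 < q /\ (forall k, Rabs (L (S k)) <= B * Rpower (INR (S k)) q) /\
  (forall s, s0 < Re s -> is_Cseries (fun i => Cmult (RtoC (L (S i))) (Rcpow (INR (S i)) (Copp s))) (D s)).
Proof.
intros [s0 H]. exists s0.
set (q := Rabs s0 + 1). assert (Hq : s0 < q) by (unfold q; generalize (Rle_abs s0); lra).
assert (Hq0 : 0 < q) by (unfold q; generalize (Rabs_pos s0); lra).
assert (S1 := is_Cseries_Re _ _ (H (RtoC q) Hq)).
assert (E1 : ex_series (fun n => L (S n) * Rpower (INR (S n)) (- q))).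
{ exists (Re (D (RtoC q))). eapply is_series_ext; [|exact S1].
  intros n. cbv beta. rewrite <- RtoC_opp, Rcpow_R. unfold Re, Cmult, RtoC; simpl. ring. }
assert (L0 := ex_series_lim_0 _ E1).
destruct (filterlim_bounded (K := R_AbsRing) (V := R_NormedModule) (fun n => L (S n) * Rpower (INR (S n)) (- q))) as [B HB].
{ exists 0. exact L0. }
exists (Rabs B + 1), q. repeat split; [generalize (Rabs_pos B); lra|exact Hq0| |exact H].
intros k. specialize (HB k). change (norm (L (S k) * Rpower (INR (S k)) (- q))) with (Rabs (L (S k) * Rpower (INR (S k)) (- q))) in HB.
rewrite Rabs_mult, Rpower_Ropp in HB. rewrite (Rabs_pos_eq (/ _)) in HB by (apply Rlt_le, Rinv_0_lt_compat, exp_pos).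
assert (P : 0 < Rpower (INR (S k)) q) by apply exp_pos.
apply Rle_div_l in HB; [|lra].
eapply Rle_trans; [exact HB|]. apply Rmult_le_compat_r; [lra|]. generalize (Rle_abs B); lra.
Qed.

Lemma Rpower_neg_small c C e : 0 < c -> 0 <= C -> 0 < e -> exists x, 1 <= x /\ C * Rpower x (- c) < e.
Proof.
intros Hc HC He. set (v := ln (e / (C + 1))). set (y := Rabs v / c).
assert (Hy : 0 <= y) by (apply Rdiv_le_0_compat; [apply Rabs_pos|exact Hc]).
exists (exp y). split.
- rewrite <- exp_0. destruct Hy as [Hy|Hy]; [left; apply exp_increasing, Hy|rewrite Hy; lra].
- unfold Rpower. rewrite ln_exp. replace (- c * y) with (- Rabs v) by (unfold y; field; lra).
  assert (Q : exp (- Rabs v) <= e / (C + 1)).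
  { rewrite <- (exp_ln (e / (C + 1))) by (apply Rdiv_lt_0_compat; lra). fold v.
    assert (H : - Rabs v <= v) by (generalize (Rle_abs (- v)); rewrite Rabs_Ropp; lra).
    destruct H as [H|H]; [left; apply exp_increasing, H|rewrite H; lra]. }
  apply Rle_lt_trans with (C * (e / (C + 1))); [apply Rmult_le_compat_l; assumption|].
  apply Rmult_lt_reg_r with (C + 1); [lra|].
  replace (C * (e / (C + 1)) * (C + 1)) with (C * e) by (field; lra). nra.
Qed.

Lemma Csum_S f n : Csum f (S n) = (Csum f n + f n)%C.
Proof. reflexivity. Qed.

(** The part of the residues that depends on [x], together with the harmonic number; the constant
    Theta is kept apart. The poles 1, ..., r appear as [S k] with k <= pred r. *)
Definition riesz_main (r : nat) (rho A : nat -> R) (m : nat) (x : R) : R :=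
  A 0%nat * (ln x - harmonic m) +
  sum_n (fun k => A (S k) / rho (S k) * Kone_R m (rho (S k)) * Rpower x (rho (S k))) (pred r).

(** Near 0 but off it, D - A_0/s coincides with [E] plus the other principal parts, which is
    analytic there. *)
Lemma filterlim_locally'_Theta (D E : C -> C) r (rho A : nat -> R) C0 (Th : C) :
  poles_condition D r rho A C0 ->
  (forall s, half_plane C0 s -> analytic_at E s) ->
  (forall s : C, (forall k, (k <= r)%nat -> s <> RtoC (rho k)) ->
    D s = (E s + Csum (fun k => A k / (s - rho k)) (S r))%C) ->
  Th = (E 0 + Csum (fun k => RtoC (A (S k)) / (0 - RtoC (rho (S k)))) r)%C ->
  filterlim (fun s : C => Cminus (D s) (Cdiv (RtoC (A 0%nat)) s)) (locally' (RtoC 0)) (locally Th).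
Proof.
intros HP HE HDE HT.
set (W := fun s => (E s + Csum (fun k => RtoC (A (S k)) / (s - RtoC (rho (S k)))) r)%C).
assert (C01 := C0_range _ _ _ _ _ HP).
assert (Hsum : forall j, (j <= r)%nat -> ex_Cderive (fun s => Csum (fun k => RtoC (A (S k)) / (s - RtoC (rho (S k)))) j)%C (RtoC 0)).
{ induction j as [|j IH]; intros Hj.
  - exists (RtoC 0). exact (is_Cderive_const (RtoC 0) (RtoC 0)).
  - destruct IH as [l Hl]; [lia|].
    assert (Hp := rho_pos _ _ _ _ _ (S j) HP ltac:(lia)).
    assert (N : (RtoC 0 - RtoC (rho (S j)) <> 0)%C).
    { apply Cminus_neq_0. intros Ez; apply RtoC_inj in Ez; lra. }
    eexists. exact (is_Cderive_plus (fun s => Csum (fun k => RtoC (A (S k)) / (s - RtoC (rho (S k)))) j)%C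
      (fun s => RtoC (A (S j)) / (s - RtoC (rho (S j))))%C (RtoC 0) _ _ Hl
      (is_Cderive_mult (fun _ => RtoC (A (S j))) (fun s => / (s - RtoC (rho (S j))))%C (RtoC 0) _ _
        (is_Cderive_const (RtoC (A (S j))) (RtoC 0)) (is_Cderive_inv _ _ N))). }
assert (HW : Ccontinuous W (RtoC 0)).
{ apply ex_Cderive_continuous. destruct (Hsum r (le_n r)) as [l Hl].
  destruct (analytic_at_derive E (RtoC 0)) as [l' Hl'].
  { apply HE. unfold half_plane; simpl; lra. }
  eexists. apply (is_Cderive_plus E _ (RtoC 0) l' l Hl' Hl). }
assert (Hnear : near (RtoC 0) (fun s => forall k, (1 <= k <= r)%nat -> s <> RtoC (rho k))).
{ assert (Q : forall j, (j <= r)%nat -> near (RtoC 0) (fun s => forall k, (1 <= k <= j)%nat -> s <> RtoC (rho k))).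
  { induction j as [|j IH]; intros Hj.
    - exists 1; split; [lra|]. intros; lia.
    - assert (Hp := rho_pos _ _ _ _ _ (S j) HP ltac:(lia)).
      assert (Q2 : near (RtoC 0) (fun z => z <> RtoC (rho (S j)))).
      { apply near_neq. intros Ez; apply RtoC_inj in Ez; lra. }
      generalize (near_and _ _ _ (IH ltac:(lia)) Q2). apply near_imp. intros z [Z1 Z2] k Hk.
      destruct (Nat.eq_dec k (S j)) as [->|N]; [exact Z2|apply Z1; lia]. }
  apply Q, le_n. }
assert (EW : forall s : C, s <> RtoC 0 -> (forall k, (1 <= k <= r)%nat -> s <> RtoC (rho k)) -> W s = (D s - A 0%nat / s)%C).
{ intros s Hs S1. rewrite (HDE s).
  - rewrite Csum_succ_l, (rho_zero _ _ _ _ _ HP). unfold W.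
    replace (s - 0)%C with s by ring. ring.
  - intros k Hk. destruct k as [|k]; [rewrite (rho_zero _ _ _ _ _ HP); exact Hs|apply S1; lia]. }
intros P HPP. unfold filtermap, locally', within.
assert (HPW : locally (T := C_UniformSpace) (RtoC 0) (fun s => P (W s))).
{ apply HW. rewrite HT in HPP. exact HPP. }
apply near_locally in Hnear.
generalize (filter_and _ _ Hnear HPW). apply filter_imp.
intros s [S1 S2] Hs.
rewrite <- (EW s Hs S1). exact S2.
Qed.

(** The line Re s = sg is moved to Re s = -c. For fixed [x] the height [T] goes to infinity first,
    which removes the horizontal sides and the truncation error; only the integral on the left line
    remains, of size x^(-c). *)
Theorem riesz_asymptotics (L : nat -> R) D r rho A C0 :
  dirichlet_series L D -> poles_condition D r rho A C0 -> vertical_growth_condition D C0 ->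
  exists m c K Theta B q, (1 <= m)%nat /\ 0 < c /\ 0 <= K /\ 0 < B /\ 0 < q /\
  (forall k, Rabs (L (S k)) <= B * Rpower (INR (S k)) q) /\
  filterlim (fun s : C => Cminus (D s) (Cdiv (RtoC (A 0%nat)) s)) (locally' (RtoC 0)) (locally (RtoC Theta)) /\
  forall x N, 1 <= x -> x <= INR N ->
    Rabs (sum_n (riesz_term L m x) N - (Theta + riesz_main r rho A m x)) <= K * Rpower x (- c).
Proof.
intros HD HP (C1 & M & T0 & HC1 & HT0 & Hgr).
destruct (dirichlet_coeff_bound L D HD) as (s0 & B & q & HB & Hq & HLB & HDs).
destruct (subtract_poles D r rho A C0 HP) as (E & HE & HDE).
destruct (INR_unbounded C1) as [m' Hm'].
set (m := S m'). assert (Hm : C1 <= INR m - 1) by (unfold m; rewrite S_INR; lra).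
assert (C01 := C0_range _ _ _ _ _ HP).
set (c := C0 / 2). assert (Hc : 0 < c < C0) by (unfold c; lra).
assert (Hr0 := rho_nonneg _ _ _ _ _ r HP (le_n r)).
(* Right of all poles, inside the region where the Dirichlet series converges, and at least q + 2
   for absolute convergence by comparison with 1/k^2. *)
set (sg := Rmax (rho r) (Rmax s0 q) + 2).
assert (Hs1 : rho r + 2 <= sg) by (unfold sg; generalize (Rmax_l (rho r) (Rmax s0 q)); lra).
assert (Hs2 : s0 + 2 <= sg) by (unfold sg; generalize (Rmax_r (rho r) (Rmax s0 q)), (Rmax_l s0 q); lra).
assert (Hs3 : q + 2 <= sg) by (unfold sg; generalize (Rmax_r (rho r) (Rmax s0 q)), (Rmax_r s0 q); lra).
assert (Hser : ex_series (fun i => Rabs (L (S i)) * Rpower (INR (S i)) (- sg))).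
{ apply ex_series_dom with (fun i => B * / (INR (S i) * INR (S i))).
  - intros i. assert (Pi : 1 <= INR (S i)) by (apply (le_INR 1); lia).
    rewrite Rabs_pos_eq by (apply Rmult_le_pos; [apply Rabs_pos|apply Rlt_le, exp_pos]).
    apply Rle_trans with (B * Rpower (INR (S i)) q * Rpower (INR (S i)) (- sg)).
    + apply Rmult_le_compat_r; [apply Rlt_le, exp_pos|apply HLB].
    + rewrite Rmult_assoc, <- Rpower_plus. apply Rmult_le_compat_l; [lra|].
      apply Rle_trans with (Rpower (INR (S i)) (- (2))).
      * apply Rle_Rpower; lra.
      * rewrite Rpower_Ropp. replace 2 with (INR 2) by (simpl; ring). rewrite Rpower_pow by lra.
        apply Req_le. simpl. f_equal. ring.
  - apply (ex_series_scal_l (K := R_AbsRing) B (fun i => / (INR (S i) * INR (S i)))), ex_series_inv_sqr. }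
destruct (perron_line L D sg m) as (M1 & HM10 & HM1); [unfold m; lia|lra|exact Hser| |].
{ intros t. apply HDs. simpl; lra. }
destruct (left_edge_bound D r rho A C0 c m HP Hc C1 M T0 HC1 HT0 Hm Hgr) as (CL & HCL & Hleft).
set (ThC := (E 0 + Csum (fun k => RtoC (A (S k)) / (0 - RtoC (rho (S k)))) r)%C).
assert (Hr := r_pos _ _ _ _ _ HP).
assert (Main : forall x N, 1 <= x -> x <= INR N ->
   Cmod (RtoC (sum_n (riesz_term L m x) N) - (ThC + RtoC (riesz_main r rho A m x))) <= CL / 2 * Rpower x (- c)).
{ intros x N Hx HN.
  set (Res := (ThC + RtoC (riesz_main r rho A m x))%C).
  assert (Hrect := fun T HT => rect_int_perron D E r rho A C0 c sg m HP Hc ltac:(lra) HE HDE x T ltac:(lra) HT).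
  assert (ERes : forall T, 0 < T -> rect_int (fun s => Rcpow x s * Kker m s * D s)%C (- c) sg (- T) T = (2 * PI * Ci * Res)%C).
  { intros T HT. rewrite Hrect by exact HT. f_equal. unfold Res, ThC, riesz_main.
    destruct r as [|r']; [lia|]. simpl pred. rewrite RtoC_plus, <- Csum_RtoC.
    (* The constants -A_k/rho_k are the values at 0 of the principal parts A_k/(s - rho_k), so they
       are absorbed into [ThC]. *)
    assert (QQ : forall n, (n <= S r')%nat -> (Csum (fun k => RtoC (A (S k) / rho (S k) * (Rpower x (rho (S k)) * Kone_R m (rho (S k)) - 1))) n
      = Csum (fun k => RtoC (A (S k)) / (0 - RtoC (rho (S k)))) n +
        Csum (fun k => RtoC (A (S k) / rho (S k) * Kone_R m (rho (S k)) * Rpower x (rho (S k)))) n)%C).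
    { induction n as [|n IH]; intros Hn; [simpl; ring|]. rewrite !Csum_S, IH by lia.
      assert (Hp := rho_pos _ _ _ _ _ (S n) HP ltac:(lia)).
      assert (Np : RtoC (rho (S n)) <> 0%C) by (intros Ez; apply RtoC_inj in Ez; lra).
      replace (RtoC (A (S n)) / (0 - RtoC (rho (S n))))%C with (RtoC (- (A (S n) / rho (S n)))).
      - replace (A (S n) / rho (S n) * (Rpower x (rho (S n)) * Kone_R m (rho (S n)) - 1))
          with (- (A (S n) / rho (S n)) + A (S n) / rho (S n) * Kone_R m (rho (S n)) * Rpower x (rho (S n))) by ring.
        rewrite RtoC_plus. ring.
      - unfold Rdiv. rewrite RtoC_opp, RtoC_mult, RtoC_inv by lra. field. exact Np. }
    rewrite (QQ (S r') (le_n _)). ring. }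
  set (Pf := INR (fact m)). assert (HPf : 0 <= Pf) by apply pos_INR.
  set (Qx := M1 * Rpower x sg + 2 * (sg + c) * (Rpower x sg * (Pf * Rabs M))).
  assert (Px : 0 < Rpower x sg) by apply exp_pos. assert (PM := Rabs_pos M).
  assert (HQ : 0 <= Qx).
  { unfold Qx. assert (0 <= M1 * Rpower x sg) by (apply Rmult_le_pos; lra).
    assert (0 <= 2 * (sg + c) * (Rpower x sg * (Pf * Rabs M))); [|lra].
    apply Rmult_le_pos; [lra|]. apply Rmult_le_pos; [lra|]. apply Rmult_le_pos; assumption. }
  assert (PI0 := PI_RGT_0).
  assert (Key : forall T, 1 <= T -> T0 <= T ->
    2 * PI * Cmod (RtoC (sum_n (riesz_term L m x) N) - Res) <= PI * (CL * Rpower x (- c)) + Qx / T).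
  { intros T HT1 HT2.
    set (F := fun s => (Rcpow x s * Kker m s * D s)%C).
    assert (CF : cont_edges F (- c) sg (- T) T).
    { apply cont_edges_border; try lra. intros z [[Z1 Z2] Zb]. apply ex_Cderive_continuous.
      apply (ex_Cderive_mult (fun s => Rcpow x s * Kker m s)%C D); [apply (ex_Cderive_mult (Rcpow x) (Kker m))|].
      - apply ex_Cderive_Rcpow.
      - apply ex_Cderive_Kker. intros j Hj Ez. apply Cminus_eq_0_inv in Ez. subst z. simpl in Zb, Z1.
        destruct j as [|j]; [simpl in Zb; lra|]. assert (1 <= INR (S j)) by (apply (le_INR 1); lia). simpl in H, Z1. lra.
      - apply (D_continuous _ _ _ _ _ _ HP); [unfold half_plane; lra|lra]. }
    destruct (rect_int_elim F (- c) sg (- T) T ltac:(lra) ltac:(lra) CF) as (l1 & l2 & l3 & l4 & I1 & I2 & I3 & I4).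
    assert (R := ERes T ltac:(lra)). fold F in R. rewrite (rect_int_intro F _ _ _ _ l1 l2 l3 l4) in R by assumption.
    assert (H2 := HM1 x T N l2 ltac:(lra) HT1 HN I2).
    assert (Edge : forall s : C, - c <= Re s <= sg -> Rabs (Im s) = T -> Cmod (F s) <= Rpower x sg * (Pf * Rabs M) / (T * T)).
    { intros s Hs1' Hs2'. unfold F. rewrite !Cmod_mult, Cmod_Rcpow.
      assert (K1 : Cmod (Kker m s) <= Pf / T ^ S m).
      { apply Cmod_Kker_le_pow; [lra|]. intros j _. eapply Rle_trans; [|apply Rabs_Im_le_Cmod].
        rewrite <- Hs2'. apply Req_le. unfold Im, Cminus, Cplus, Copp, RtoC; simpl. f_equal; ring. }
      assert (K2 : Cmod (D s) <= Rabs M * T ^ m').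
      { eapply Rle_trans; [apply Hgr; [unfold half_plane; lra|lra]|]. rewrite Hs2'.
        apply Rle_trans with (Rabs M * Rpower T C1).
        - apply Rmult_le_compat_r; [apply Rlt_le, exp_pos|apply Rle_abs].
        - apply Rmult_le_compat_l; [exact PM|]. rewrite <- Rpower_pow by lra. apply Rle_Rpower; lra. }
      assert (K3 : Rpower x (Re s) <= Rpower x sg) by (apply Rle_Rpower; lra).
      assert (PT : 0 < T ^ m') by (apply pow_lt; lra).
      replace (Rpower x sg * (Pf * Rabs M) / (T * T)) with (Rpower x sg * (Pf / T ^ S m) * (Rabs M * T ^ m'))
        by (unfold m; simpl pow; field; lra).
      apply Rmult_le_compat; [apply Rmult_le_pos; [apply Rlt_le, exp_pos|apply Cmod_ge_0]|apply Cmod_ge_0| |exact K2].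
      apply Rmult_le_compat; [apply Rlt_le, exp_pos|apply Cmod_ge_0|exact K3|exact K1]. }
    assert (B1 : Cmod l1 <= (sg - - c) * (Rpower x sg * (Pf * Rabs M) / (T * T))).
    { eapply is_CInt_norm_le_const with (3 := I1); [lra|]. intros t Ht. apply Edge; simpl; [lra|].
      rewrite Rabs_Ropp, Rabs_pos_eq; lra. }
    assert (B3 : Cmod l3 <= (sg - - c) * (Rpower x sg * (Pf * Rabs M) / (T * T))).
    { eapply is_CInt_norm_le_const with (3 := I3); [lra|]. intros t Ht. apply Edge; simpl; [lra|].
      rewrite Rabs_pos_eq; lra. }
    assert (B4 : Cmod l4 <= PI * (CL * Rpower x (- c))).
    { apply Rle_trans with (Rpower x (- c) * CL * (2 * atan T)).
      - apply (is_CInt_norm_le (fun v => F ((- c)%R, v)) (fun t => Rpower x (- c) * CL * / (1 + t * t)) (- T) T); [lra| |exact I4|].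
        + intros t _. unfold F. rewrite <- Cmult_assoc, Cmod_mult, Cmod_Rcpow. simpl Re. rewrite Rmult_assoc.
          apply Rmult_le_compat_l; [apply Rlt_le, exp_pos|apply Hleft].
        + apply (is_RInt_scal (V := R_NormedModule) (fun t => / (1 + t * t))). apply is_RInt_inv_1_sqr; lra.
      - assert (0 <= Rpower x (- c) * CL) by (apply Rmult_le_pos; [apply Rlt_le, exp_pos|exact HCL]).
        generalize (atan_bound T); intros. nra. }
    (* The contour identity is solved for the right side; multiplication by -i removes the factor i
       of dz. *)
    assert (E2 : (l2 - RtoC (2 * PI) * Res)%C = (Ci * (l1 - l3) + l4)%C).
    { replace l2 with (- Ci * (Ci * l2))%C by (replace (- Ci * (Ci * l2))%C with (- (Ci * Ci) * l2)%C by ring; rewrite Ci_sqr; ring).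
      replace (Ci * l2)%C with (2 * PI * Ci * Res - l1 + l3 + Ci * l4)%C by (rewrite <- R; ring).
      replace (- Ci * (2 * PI * Ci * Res - l1 + l3 + Ci * l4))%C
        with (- (Ci * Ci) * (2 * PI * Res) + Ci * (l1 - l3) + - (Ci * Ci) * l4)%C by ring.
      rewrite Ci_sqr, RtoC_mult. ring. }
    assert (B5 : Cmod (l2 - RtoC (2 * PI) * Res) <= 2 * ((sg + c) * (Rpower x sg * (Pf * Rabs M) / (T * T))) + PI * (CL * Rpower x (- c))).
    { rewrite E2. eapply Rle_trans; [apply Cmod_triangle|]. rewrite Cmod_mult, Cmod_Ci, Rmult_1_l.
      unfold Cminus. generalize (Cmod_triangle l1 (- l3)). rewrite Cmod_opp.
      replace (sg - - c) with (sg + c) in B1, B3 by ring. lra. }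
    replace (2 * PI * Cmod (RtoC (sum_n (riesz_term L m x) N) - Res))
      with (Cmod ((l2 - RtoC (2 * PI) * Res) - (l2 - RtoC (2 * PI * sum_n (riesz_term L m x) N)))).
    2:{ replace (l2 - RtoC (2 * PI) * Res - (l2 - RtoC (2 * PI * sum_n (riesz_term L m x) N)))%C
          with (RtoC (2 * PI) * (RtoC (sum_n (riesz_term L m x) N) - Res))%C by (rewrite (RtoC_mult (2 * PI)); ring).
        rewrite Cmod_mult, Cmod_R, Rabs_pos_eq; [reflexivity|lra]. }
    unfold Cminus at 1. eapply Rle_trans; [apply Cmod_triangle|]. rewrite Cmod_opp.
    assert (B6 : 2 * ((sg + c) * (Rpower x sg * (Pf * Rabs M) / (T * T))) <= 2 * (sg + c) * (Rpower x sg * (Pf * Rabs M)) / T).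
    { replace (2 * (sg + c) * (Rpower x sg * (Pf * Rabs M)) / T) with (2 * ((sg + c) * (Rpower x sg * (Pf * Rabs M) * / T))) by (field; lra).
      apply Rmult_le_compat_l; [lra|]. apply Rmult_le_compat_l; [lra|].
      apply Rmult_le_compat_l; [|apply Rinv_le_contravar; nra].
      apply Rmult_le_pos; [lra|]. apply Rmult_le_pos; assumption. }
    replace (Qx / T) with (M1 * Rpower x sg / T + 2 * (sg + c) * (Rpower x sg * (Pf * Rabs M)) / T) by (unfold Qx; field; lra).
    lra. }
  apply (Rmult_le_reg_l (2 * PI)); [lra|].
  replace (2 * PI * (CL / 2 * Rpower x (- c))) with (PI * (CL * Rpower x (- c))) by field.
  apply Rle_plus_epsilon. intros eps He.
  set (T := Rmax (Rmax 1 T0) (Qx / eps)).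
  assert (HT1 : 1 <= T) by (eapply Rle_trans; [apply (Rmax_l 1 T0)|apply Rmax_l]).
  assert (HT2 : T0 <= T) by (eapply Rle_trans; [apply (Rmax_r 1 T0)|apply Rmax_l]).
  assert (HT3 : Qx / eps <= T) by apply Rmax_r.
  eapply Rle_trans; [apply (Key T HT1 HT2)|]. apply Rplus_le_compat_l.
  apply Rle_div_l; [lra|]. apply Rle_div_l in HT3; lra. }
(* Everything else in [Main] is real and the error tends to 0 as [x] grows, so the constant is
   real. *)
assert (HIm : Im ThC = 0).
{ destruct (Req_dec (Im ThC) 0) as [Z|Z]; [exact Z|exfalso].
  assert (P : 0 < Rabs (Im ThC)) by (apply Rabs_pos_lt, Z).
  destruct (Rpower_neg_small c (CL / 2) _ (proj1 Hc) ltac:(lra) P) as [x [Hx1 Hx2]].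
  destruct (INR_unbounded x) as [N HN].
  assert (Q := Main x N Hx1 ltac:(lra)).
  assert (Q2 := Rabs_Im_le_Cmod (RtoC (sum_n (riesz_term L m x) N) - (ThC + RtoC (riesz_main r rho A m x)))).
  replace (Im (RtoC (sum_n (riesz_term L m x) N) - (ThC + RtoC (riesz_main r rho A m x)))) with (- Im ThC) in Q2.
  - rewrite Rabs_Ropp in Q2. lra.
  - unfold Im, Cminus, Cplus, Copp, RtoC; simpl. ring. }
assert (ETh : ThC = RtoC (Re ThC)).
{ destruct ThC as [u v]. simpl in HIm. rewrite HIm. reflexivity. }
exists m, c, (CL / 2), (Re ThC), B, q.
split; [unfold m; lia|]. split; [lra|]. split; [lra|]. split; [lra|]. split; [lra|]. split; [exact HLB|]. split.
- rewrite <- ETh. apply (filterlim_locally'_Theta D E r rho A C0 ThC HP HE HDE). reflexivity.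
- intros x N Hx HN. specialize (Main x N Hx HN). rewrite ETh in Main.
  rewrite <- RtoC_plus, <- RtoC_minus, Cmod_R in Main. exact Main.
Qed.

(** * From Riesz means to the Laplace transform *)

Lemma ln_1p_bounds u : 0 <= u -> u / (1 + u) <= ln (1 + u) <= u.
Proof.
intros Hu. split.
- assert (H := exp_ineq1_le (- ln (1 + u))). rewrite exp_Ropp, exp_ln in H by lra.
  replace (u / (1 + u)) with (1 - / (1 + u)) by (field; lra). lra.
- rewrite <- (ln_exp u) at 2. apply ln_le; [lra|]. generalize (exp_ineq1_le u); lra.
Qed.

(** [euler_gamma] is defined through the total function [Lim_seq], so existence of the limit has to
    be proved: the sequence decreases and is bounded below. *)
Lemma euler_gamma_lim :
  is_lim_seq (fun n => sum_n_m (fun k => / INR k) 1 n - ln (INR n)) euler_gamma.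
Proof.
set (a := fun n => sum_n_m (fun k => / INR k) 1 n - ln (INR n)).
assert (Hs : forall n, a (S (S n)) - a (S n) = / INR (S (S n)) - ln (1 + / INR (S n))).
{ intros n. unfold a. rewrite (sum_n_Sm _ 1 (S n)) by lia.
  assert (P := lt_0_INR (S n) (Nat.lt_0_succ n)).
  assert (Q : ln (INR (S (S n))) = ln (INR (S n)) + ln (1 + / INR (S n))).
  { rewrite <- ln_mult; [|exact P|]. f_equal. rewrite (S_INR (S n)). field; lra.
    assert (0 < / INR (S n)) by (apply Rinv_0_lt_compat, P). lra. }
  rewrite Q. unfold plus; simpl plus. simpl. ring. }
assert (Hdec : forall n, a (S (S n)) <= a (S n)).
{ intros n. assert (P := lt_0_INR (S n) (Nat.lt_0_succ n)).
  destruct (ln_1p_bounds (/ INR (S n))) as [B _]; [apply Rlt_le, Rinv_0_lt_compat, P|].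
  replace (/ INR (S n) / (1 + / INR (S n))) with (/ INR (S (S n))) in B; [generalize (Hs n); lra|].
  rewrite (S_INR (S n)). field. lra. }
(* Subtracting 1/n makes the bound inductive: with the sum stopped at n - 1 the sequence
   increases. *)
assert (Hpos : forall n, - 1 <= a (S n) - / INR (S n)).
{ induction n as [|n IH].
  - unfold a. rewrite sum_n_n. simpl. rewrite ln_1. lra.
  - assert (P := lt_0_INR (S n) (Nat.lt_0_succ n)).
    destruct (ln_1p_bounds (/ INR (S n))) as [_ B]; [apply Rlt_le, Rinv_0_lt_compat, P|].
    generalize (Hs n). lra. }
assert (E : ex_finite_lim_seq (fun n => a (S n))).
{ apply ex_finite_lim_seq_decr with (-1); [exact Hdec|].
  intros n. assert (P := lt_0_INR (S n) (Nat.lt_0_succ n)).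
  assert (0 < / INR (S n)) by (apply Rinv_0_lt_compat, P). generalize (Hpos n); lra. }
destruct E as [l Hl]. apply is_lim_seq_incr_1 in Hl.
unfold euler_gamma. fold a. rewrite (is_lim_seq_unique _ _ Hl). exact Hl.
Qed.

Lemma pow_diff_le (a b : R) m : 0 <= b <= a ->
  INR (S m) * (a - b) * b ^ m <= a ^ S m - b ^ S m <= INR (S m) * (a - b) * a ^ m.
Proof.
intros H. induction m as [|m IH]; [simpl; lra|].
assert (Pb : 0 <= b ^ S m) by (apply pow_le; lra).
assert (Pa : b ^ S m <= a ^ S m) by (apply pow_incr; lra).
replace (a ^ S (S m) - b ^ S (S m)) with (a * (a ^ S m - b ^ S m) + (a - b) * b ^ S m) by (simpl; ring).
rewrite (S_INR (S m)).
replace ((INR (S m) + 1) * (a - b) * b ^ S m) with (b * (INR (S m) * (a - b) * b ^ m) + (a - b) * b ^ S m) by (simpl; ring).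
replace ((INR (S m) + 1) * (a - b) * a ^ S m) with (a * (INR (S m) * (a - b) * a ^ m) + (a - b) * a ^ S m) by (simpl; ring).
assert (Q : 0 <= a ^ S m - b ^ S m) by lra.
split.
- apply Rplus_le_compat_r. apply Rle_trans with (b * (a ^ S m - b ^ S m)); [apply Rmult_le_compat_l; lra|]. nra.
- apply Rplus_le_compat; [apply Rmult_le_compat_l; lra|]. apply Rmult_le_compat_l; lra.
Qed.

(* [inv_riesz m x n] is [sum_(1 <= k <= n+1) (1 - k/x)^m / k]. *)
Definition inv_riesz (m : nat) (x : R) (n : nat) : R :=
  sum_n (fun i => / INR (S i) * (1 - INR (S i) / x) ^ m) n.

(** A Riemann sum of mesh 1/x for the integral of (1 - u)^m over [0, 1], with an incomplete last
    cell. *)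
Lemma riemann_sum_pow m x n : INR (S n) <= x < INR (S (S n)) ->
  Rabs (sum_n (fun i => / x * (1 - INR (S i) / x) ^ m) n - / INR (S m)) <= 2 / x.
Proof.
intros Hx. assert (P := lt_0_INR (S n) (Nat.lt_0_succ n)). assert (Hx0 : 0 < x) by lra.
assert (Pm := lt_0_INR (S m) (Nat.lt_0_succ m)).
set (u := fun k => 1 - INR k / x).
assert (Hu : forall k, (k <= S n)%nat -> 0 <= u (S k - 1)%nat /\ 0 <= u k <= 1).
{ intros k Hk. unfold u. apply le_INR in Hk as Hk'. assert (Pk := pos_INR k).
  assert (INR k / x <= 1) by (apply Rle_div_l; lra).
  assert (0 <= INR k / x) by (apply Rdiv_le_0_compat; lra).
  simpl. rewrite Nat.sub_0_r. lra. }
assert (Hd : forall k, u k - u (S k) = / x) by (intros k; unfold u; rewrite S_INR; field; lra).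
assert (B : forall j, (j <= n)%nat ->
  INR (S m) * sum_n (fun i => / x * u (S i) ^ m) j <= 1 - u (S j) ^ S m <= INR (S m) * (sum_n (fun i => / x * u (S i) ^ m) j + / x * (1 - u (S j) ^ m))).
{ assert (U0 : u 0%nat = 1) by (unfold u; simpl; field; lra).
  induction j as [|j IH]; intros Hj.
  - rewrite sum_O. destruct (Hu 1%nat ltac:(lia)) as [_ U1].
    destruct (pow_diff_le (u 0%nat) (u 1%nat) m) as [D1 D2]; [rewrite U0; lra|].
    rewrite Hd, U0, !pow1 in *. lra.
  - rewrite sum_n_succ. destruct (IH ltac:(lia)) as [I1 I2].
    destruct (Hu (S j) ltac:(lia)) as [_ U1]. destruct (Hu (S (S j)) ltac:(lia)) as [_ U2].
    destruct (pow_diff_le (u (S j)) (u (S (S j))) m) as [D1 D2].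
    { generalize (Hd (S j)). assert (0 < / x) by (apply Rinv_0_lt_compat, Hx0). lra. }
    rewrite Hd in *. lra. }
destruct (B n (le_n n)) as [B1 B2].
destruct (Hu (S n) ltac:(lia)) as [_ U1].
assert (Ux : u (S n) <= / x).
{ unfold u. apply (Rmult_le_reg_r x); [exact Hx0|]. rewrite Rinv_l by lra.
  replace ((1 - INR (S n) / x) * x) with (x - INR (S n)) by (field; lra). rewrite (S_INR (S n)) in Hx. lra. }
assert (U2 : 0 <= u (S n) ^ m <= 1).
{ split; [apply pow_le; lra|]. rewrite <- (pow1 m). apply pow_incr; lra. }
assert (U3 : 0 <= u (S n) ^ S m <= / x) by (simpl; nra).
assert (Pi : 0 < / x) by (apply Rinv_0_lt_compat, Hx0).
change (fun i => / x * (1 - INR (S i) / x) ^ m) with (fun i => / x * u (S i) ^ m).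
set (Sg := sum_n (fun i => / x * u (S i) ^ m) n) in *.
assert (M1 : 1 <= INR (S m)) by (apply (le_INR 1); lia).
apply Rabs_le. split.
- apply (Rmult_le_reg_l (INR (S m))); [lra|].
  replace (INR (S m) * (Sg - / INR (S m))) with (INR (S m) * Sg - 1) by (field; lra).
  replace (INR (S m) * - (2 / x)) with (- INR (S m) * / x - INR (S m) * / x) by (field; lra).
  assert (/ x <= INR (S m) * / x) by nra.
  assert (INR (S m) * (/ x * (1 - u (S n) ^ m)) <= INR (S m) * / x).
  { apply Rmult_le_compat_l; [lra|]. nra. }
  lra.
- apply (Rmult_le_reg_l (INR (S m))); [lra|].
  replace (INR (S m) * (Sg - / INR (S m))) with (INR (S m) * Sg - 1) by (field; lra).
  assert (0 <= INR (S m) * (2 / x)) by (apply Rmult_le_pos; [lra|]; unfold Rdiv; lra). lra.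
Qed.

(** One more factor 1 - k/x changes the k-th term by 1/x in place of 1/k, so raising the order by
    one lowers the limit by 1/(m+1). The harmonic numbers that arise in this way match those of the
    double-pole residue. *)
Lemma inv_riesz_step m x n : 0 < x ->
  inv_riesz m x n - inv_riesz (S m) x n = sum_n (fun i => / x * (1 - INR (S i) / x) ^ m) n.
Proof.
intros Hx. unfold inv_riesz. rewrite <- sum_n_minus. apply sum_n_ext. intros i.
assert (P := lt_0_INR (S i) (Nat.lt_0_succ i)). set (y := INR (S i)) in *. change ((1 - y / x) ^ S m) with ((1 - y / x) * (1 - y / x) ^ m). as_R_eq. set (v := (1 - y / x) ^ m). field. lra.
Qed.

Lemma inv_riesz_0_lim eta : 0 < eta -> exists X, 1 <= X /\ forall x n, X <= x -> INR (S n) <= x < INR (S (S n)) ->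
  Rabs (inv_riesz 0 x n - (ln x + euler_gamma)) <= eta.
Proof.
intros He.
destruct (proj1 (is_lim_seq_eps _ _) euler_gamma_lim (eta / 2) ltac:(lra)) as [N0 HN].
exists (Rmax (INR N0 + 1) (2 / eta + 2)).
assert (M1 := Rmax_l (INR N0 + 1) (2 / eta + 2)). assert (M2 := Rmax_r (INR N0 + 1) (2 / eta + 2)).
split. { assert (0 <= 2 / eta) by (apply Rdiv_le_0_compat; lra). lra. }
intros x n HX Hx.
assert (P := lt_0_INR (S n) (Nat.lt_0_succ n)).
rewrite (S_INR (S n)) in Hx.
assert (HN0 : (N0 <= S n)%nat) by (apply INR_le; lra).
specialize (HN (S n) HN0).
assert (E1 : sum_n_m (fun k => / INR k) 1 (S n) = inv_riesz 0 x n).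
{ unfold inv_riesz, sum_n. rewrite <- sum_n_m_S. apply sum_n_m_ext. intros k. simpl pow. as_R_eq. ring. }
rewrite E1 in HN.
assert (E2 : ln x = ln (INR (S n)) + ln (1 + (x - INR (S n)) / INR (S n))).
{ rewrite <- ln_mult; [f_equal; field; lra|exact P|].
  assert (0 <= (x - INR (S n)) / INR (S n)) by (apply Rdiv_le_0_compat; lra). lra. }
assert (E3 : 0 <= (x - INR (S n)) / INR (S n) <= eta / 2).
{ split; [apply Rdiv_le_0_compat; lra|]. apply Rle_div_l; [lra|].
  assert (2 / eta <= INR (S n)) by lra. apply Rle_div_l in H; [|lra]. lra. }
destruct (ln_1p_bounds _ (proj1 E3)) as [L1 L2].
assert (L3 : 0 <= ln (1 + (x - INR (S n)) / INR (S n))).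
{ eapply Rle_trans; [|exact L1]. apply Rdiv_le_0_compat; lra. }
apply Rabs_def2 in HN. apply Rabs_le. lra.
Qed.

Lemma inv_riesz_lim m eta : 0 < eta -> exists X, 1 <= X /\ forall x n, X <= x -> INR (S n) <= x < INR (S (S n)) ->
  Rabs (inv_riesz m x n - (ln x - harmonic m + euler_gamma)) <= eta.
Proof.
revert eta. induction m as [|m IH]; intros eta He.
- destruct (inv_riesz_0_lim eta He) as [X [H1 H2]]. exists X. split; [exact H1|].
  intros x n Hx Hn. simpl. replace (ln x - 0 + euler_gamma) with (ln x + euler_gamma) by ring. apply H2; assumption.
- destruct (IH (eta / 2) ltac:(lra)) as [X [H1 H2]].
  exists (Rmax X (4 / eta)). split; [eapply Rle_trans; [exact H1|apply Rmax_l]|].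
  intros x n Hx Hn.
  assert (HX : X <= x) by (eapply Rle_trans; [apply Rmax_l|exact Hx]).
  assert (H4 : 4 / eta <= x) by (eapply Rle_trans; [apply Rmax_r|exact Hx]).
  specialize (H2 x n HX Hn). assert (R := riemann_sum_pow m x n Hn).
  rewrite <- inv_riesz_step in R by lra.
  assert (2 / x <= eta / 2).
  { apply Rle_div_l; [lra|]. apply Rle_div_l in H4; lra. }
  change (harmonic (S m)) with (harmonic m + / INR (S m)).
  apply Rabs_le_between in R. apply Rabs_le_between in H2. apply Rabs_le. lra.
Qed.

(** * The Gamma function at real arguments *)

(** The exponent is shifted: this kernel integrates to Gamma(p + 1). *)
Definition gamma_kernel (p t : R) : R := Rpower t p * exp (- t).
Definition ibox (p a b : R) : R := RInt (gamma_kernel p) a b.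

Lemma gamma_kernel_pos p t : 0 < gamma_kernel p t.
Proof. apply Rmult_lt_0_compat; apply exp_pos. Qed.

Lemma ex_RInt_cont (f : R -> R) a b : a <= b -> (forall t, a <= t <= b -> ex_derive f t) -> ex_RInt f a b.
Proof.
intros Hab H. apply (ex_RInt_continuous (V := R_CompleteNormedModule)). rewrite Rmin_left, Rmax_right by exact Hab.
intros t Ht. apply (ex_derive_continuous (K := R_AbsRing) (V := R_NormedModule)), H, Ht.
Qed.

Lemma ex_derive_gamma_kernel p t : 0 < t -> ex_derive (gamma_kernel p) t.
Proof. intros Ht. unfold gamma_kernel, Rpower. auto_derive. exact Ht. Qed.

Lemma ex_RInt_gamma_kernel p a b : 0 < a <= b -> ex_RInt (gamma_kernel p) a b.
Proof. intros H. apply ex_RInt_cont; [lra|]. intros t Ht. apply ex_derive_gamma_kernel; lra. Qed.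

Lemma ibox_ge_0 p a b : 0 < a <= b -> 0 <= ibox p a b.
Proof.
intros H. apply RInt_ge_0; [lra|apply ex_RInt_gamma_kernel, H|]. intros; apply Rlt_le, gamma_kernel_pos.
Qed.

Lemma ibox_Chasles p a b c : 0 < a <= b -> b <= c -> ibox p a c = ibox p a b + ibox p b c.
Proof.
intros H1 H2. unfold ibox. symmetry.
apply (RInt_Chasles (V := R_CompleteNormedModule)); apply ex_RInt_gamma_kernel; lra.
Qed.

Lemma ibox_mono p a b a' b' : 0 < a <= a' -> a' <= b' -> b' <= b -> ibox p a' b' <= ibox p a b.
Proof.
intros H1 H2 H3. rewrite (ibox_Chasles p a a' b), (ibox_Chasles p a' b' b) by lra.
assert (A1 := ibox_ge_0 p a a' ltac:(lra)). assert (A2 := ibox_ge_0 p b' b ltac:(lra)). lra.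
Qed.

Lemma pow_le_exp n t : (1 <= n)%nat -> 0 <= t -> (t / INR n) ^ n <= exp t.
Proof.
intros Hn Ht. assert (P : 0 < INR n) by (apply lt_0_INR; lia).
replace (exp t) with (exp (t / INR n) ^ n).
- apply pow_incr. split; [apply Rdiv_le_0_compat; lra|]. generalize (exp_ineq1_le (t / INR n)); lra.
- rewrite <- Rpower_pow by apply exp_pos. unfold Rpower. rewrite ln_exp. f_equal. field. lra.
Qed.

(** Half of the exponential absorbs the power. Passing to the base 1 + t >= 1 allows the exponent
    [p] to be raised to an integer. *)
Lemma gamma_kernel_le_exp p : 0 <= p -> exists K, 0 < K /\ forall t, 0 < t -> gamma_kernel p t <= K * exp (- (t / 2)).
Proof.
intros Hp. destruct (INR_unbounded (p + 1)) as [n Hn].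
assert (Hn1 : (1 <= n)%nat) by (apply INR_le; simpl; lra).
assert (P : 0 < INR n) by lra.
exists ((2 * INR n) ^ n * exp (1 / 2)). split.
{ apply Rmult_lt_0_compat; [apply pow_lt; lra|apply exp_pos]. }
intros t Ht. unfold gamma_kernel.
assert (E : Rpower t p <= (2 * INR n) ^ n * exp ((1 + t) / 2)).
{ apply Rle_trans with ((1 + t) ^ n).
  - rewrite <- Rpower_pow by lra. apply Rle_trans with (Rpower (1 + t) p).
    + unfold Rpower. assert (Hl : ln t <= ln (1 + t)) by (apply ln_le; lra).
      assert (Hl2 : p * ln t <= p * ln (1 + t)) by (apply Rmult_le_compat_l; lra).
      destruct Hl2 as [L|L]; [left; apply exp_increasing, L|rewrite L; lra].
    + apply Rle_Rpower; lra.
  - assert (Q := pow_le_exp n ((1 + t) / 2) Hn1 ltac:(lra)).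
    apply (Rmult_le_compat_l ((2 * INR n) ^ n)) in Q; [|apply pow_le; lra].
    rewrite <- Rpow_mult_distr in Q. replace (2 * INR n * ((1 + t) / 2 / INR n)) with (1 + t) in Q by (field; lra). exact Q. }
apply Rle_trans with ((2 * INR n) ^ n * exp ((1 + t) / 2) * exp (- t)).
- apply Rmult_le_compat_r; [apply Rlt_le, exp_pos|exact E].
- rewrite !Rmult_assoc, <- !exp_plus. apply Req_le. f_equal. f_equal. field.
Qed.

Lemma ibox_bounded p : 0 <= p -> exists B, forall a b, 0 < a <= b -> ibox p a b <= B.
Proof.
intros Hp. destruct (gamma_kernel_le_exp p Hp) as [K [HK HB]].
exists (2 * K). intros a b Hab.
assert (I : is_RInt (fun t => K * exp (- (t / 2))) a b (minus (- (2 * K) * exp (- (b / 2))) (- (2 * K) * exp (- (a / 2))))).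
{ apply (is_RInt_derive (fun t => - (2 * K) * exp (- (t / 2)))).
  - intros t _. auto_derive; [exact I|]. unfold Rdiv. field.
  - intros t _. apply (ex_derive_continuous (K := R_AbsRing) (V := R_NormedModule)). auto_derive. exact I. }
apply Rle_trans with (RInt (fun t => K * exp (- (t / 2))) a b).
- apply RInt_le; [lra|apply ex_RInt_gamma_kernel, Hab|eexists; exact I|]. intros t Ht. apply HB; lra.
- rewrite (is_RInt_unique _ _ _ _ I). unfold minus, plus, opp; simpl.
  assert (0 < exp (- (b / 2))) by apply exp_pos.
  assert (exp (- (a / 2)) <= 1). { rewrite <- exp_0. left. apply exp_increasing. lra. } nra.
Qed.

(** The number Gamma(p + 1). The integrand is positive, so integrals over boxes increase and one
    sequence of boxes determines the improper integral. *)
Definition gam (p : R) : R := real (Lim_seq (fun N => ibox p (/ INR (S N)) (INR (S N)))).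

Lemma inv_INR_S N : 0 < / INR (S N) <= 1 /\ 1 <= INR (S N).
Proof.
assert (P : 1 <= INR (S N)) by (apply (le_INR 1); lia).
split; [split; [apply Rinv_0_lt_compat; lra|rewrite <- Rinv_1; apply Rinv_le_contravar; lra]|exact P].
Qed.

Lemma gam_lim p : 0 <= p -> is_lim_seq (fun N => ibox p (/ INR (S N)) (INR (S N))) (gam p) /\
  forall a b, 0 < a <= b -> ibox p a b <= gam p.
Proof.
intros Hp. destruct (ibox_bounded p Hp) as [B HB].
assert (Hinc : forall N, ibox p (/ INR (S N)) (INR (S N)) <= ibox p (/ INR (S (S N))) (INR (S (S N)))).
{ intros N. destruct (inv_INR_S N) as [A1 A2]. destruct (inv_INR_S (S N)) as [A3 A4].
  assert (INR (S N) <= INR (S (S N))) by (apply le_INR; lia).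
  assert (/ INR (S (S N)) <= / INR (S N)) by (apply Rinv_le_contravar; lra).
  apply ibox_mono; lra. }
destruct (ex_finite_lim_seq_incr (fun N => ibox p (/ INR (S N)) (INR (S N))) B Hinc) as [l Hl].
{ intros N. destruct (inv_INR_S N) as [A1 A2]. apply HB. lra. }
assert (E : gam p = l) by (unfold gam; rewrite (is_lim_seq_unique _ _ Hl); reflexivity).
rewrite E. split; [exact Hl|]. intros a b Hab.
destruct (INR_unbounded (Rmax b (/ a))) as [N HN].
assert (M1 := Rmax_l b (/ a)). assert (M2 := Rmax_r b (/ a)).
eapply Rle_trans; [|apply (is_lim_seq_incr_compare _ _ Hl Hinc N)].
rewrite S_INR. assert (0 < / a) by (apply Rinv_0_lt_compat; lra).
assert (/ (INR N + 1) <= a).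
{ rewrite <- (Rinv_inv a). apply Rinv_le_contravar; lra. }
apply ibox_mono; try lra. split; [apply Rinv_0_lt_compat|]; lra.
Qed.

Lemma gam_approx p eps : 0 <= p -> 0 < eps -> exists a0 b0, 0 < a0 <= 1 /\ 1 <= b0 /\
  forall a b, 0 < a <= a0 -> b0 <= b -> gam p - eps < ibox p a b <= gam p.
Proof.
intros Hp He. destruct (gam_lim p Hp) as [H1 H2].
destruct (proj1 (is_lim_seq_eps _ _) H1 eps He) as [N HN]. specialize (HN N (le_n N)).
destruct (inv_INR_S N) as [A1 A2].
exists (/ INR (S N)), (INR (S N)). repeat split; try lra; [|apply H2; lra].
apply Rabs_def2 in HN.
assert (ibox p (/ INR (S N)) (INR (S N)) <= ibox p a b) by (apply ibox_mono; lra). lra.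
Qed.

(** In [RInt_gen] the two endpoints vary independently, which is what the two thresholds of
    [gam_approx] provide. *)
Lemma Gamma_gam p : 0 <= p -> Gamma (p + 1) = gam p.
Proof.
intros Hp. unfold Gamma. apply is_RInt_gen_unique.
replace (p + 1 - 1) with p by ring. fold (gamma_kernel p).
intros P [eps HP].
destruct (gam_approx p eps Hp (cond_pos eps)) as (a0 & b0 & Ha & Hb & Hab).
exists (fun a => 0 < a <= a0) (fun b => b0 < b).
- exists (mkposreal a0 (proj1 Ha)). intros y Hy Hy0. split; [exact Hy0|].
  assert (Rabs (y - 0) < a0) by exact Hy. rewrite Rminus_0_r in H. apply Rabs_def2 in H. lra.
- exists b0. intros y Hy; exact Hy.
- intros a b H1 H2. exists (ibox p a b). split.
  + apply (RInt_correct (V := R_CompleteNormedModule)), ex_RInt_gamma_kernel. simpl; lra.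
  + apply HP. destruct (Hab a b H1 ltac:(lra)) as [Q1 Q2].
    apply Rabs_def1; unfold minus, plus, opp; simpl; lra.
Qed.

(** Controls the piece near 0 that is lost because the Laplace integrals of the Riesz means start at
    x = 1. *)
Lemma ibox_small p a b : 0 <= p -> 0 < a <= b -> ibox p a b <= Rpower b (p + 1).
Proof.
intros Hp Hab. unfold ibox.
apply Rle_trans with (RInt (fun _ => Rpower b p) a b).
- apply RInt_le; [lra|apply ex_RInt_gamma_kernel, Hab|apply ex_RInt_const|].
  intros t Ht. unfold gamma_kernel. rewrite <- (Rmult_1_r (Rpower b p)).
  apply Rmult_le_compat; [apply Rlt_le, exp_pos|apply Rlt_le, exp_pos| |].
  + unfold Rpower. assert (p * ln t <= p * ln b) by (apply Rmult_le_compat_l; [exact Hp|apply ln_le; lra]).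
    destruct H as [L|L]; [left; apply exp_increasing, L|rewrite L; lra].
  + rewrite <- exp_0. left; apply exp_increasing; lra.
- rewrite RInt_const. unfold scal; simpl; unfold mult; simpl.
  rewrite Rpower_plus, Rpower_1 by lra. rewrite Rmult_comm. apply Rmult_le_compat_l; [apply Rlt_le, exp_pos|lra].
Qed.

Lemma ibox_by_parts p a b : 0 < a <= b ->
  ibox (p + 1) a b = (p + 1) * ibox p a b + (gamma_kernel (p + 1) a - gamma_kernel (p + 1) b).
Proof.
intros H.
assert (D : forall t, 0 < t -> is_derive (fun t => - gamma_kernel (p + 1) t) t (gamma_kernel (p + 1) t - (p + 1) * gamma_kernel p t)).
{ intros t Ht. unfold gamma_kernel, Rpower. auto_derive; [exact Ht|].
  replace ((p + 1) * ln t) with (p * ln t + ln t) by ring. rewrite exp_plus, exp_ln by exact Ht. field. lra. }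
assert (I1 : is_RInt (fun t => gamma_kernel (p + 1) t - (p + 1) * gamma_kernel p t) a b
   (minus (- gamma_kernel (p + 1) b) (- gamma_kernel (p + 1) a))).
{ apply (is_RInt_derive (fun t => - gamma_kernel (p + 1) t)); rewrite Rmin_left, Rmax_right by lra; intros t Ht.
  - apply D; lra.
  - apply (ex_derive_continuous (K := R_AbsRing) (V := R_NormedModule)).
    unfold gamma_kernel, Rpower. auto_derive. repeat split; lra. }
assert (I2 : is_RInt (fun t => gamma_kernel (p + 1) t - (p + 1) * gamma_kernel p t) a b
   (minus (ibox (p + 1) a b) (scal (p + 1) (ibox p a b)))).
{ apply (is_RInt_minus (V := R_NormedModule) (gamma_kernel (p + 1)) (fun t => (p + 1) * gamma_kernel p t)).
  - apply (RInt_correct (V := R_CompleteNormedModule)), ex_RInt_gamma_kernel, H.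
  - apply (is_RInt_scal (V := R_NormedModule)), (RInt_correct (V := R_CompleteNormedModule)), ex_RInt_gamma_kernel, H. }
assert (E := is_RInt_unique _ _ _ _ I1). rewrite (is_RInt_unique _ _ _ _ I2) in E.
unfold minus, plus, opp, scal in E; simpl in E. unfold mult in E; simpl in E. lra.
Qed.

Lemma is_lim_seq_inv_INR : is_lim_seq (fun N => / INR (S N)) 0.
Proof.
apply (is_lim_seq_incr_1 (fun N => / INR N)). replace (Finite 0) with (Rbar_inv p_infty) by reflexivity.
apply is_lim_seq_inv; [apply is_lim_seq_INR|discriminate].
Qed.

Lemma is_lim_seq_exp_neg c : 0 < c -> is_lim_seq (fun N => exp (- (c * INR N))) 0.
Proof.
intros Hc. apply is_lim_seq_eps. intros eps He.
destruct (INR_unbounded (/ (c * eps))) as [N0 HN0].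
exists N0. intros n Hn. apply le_INR in Hn.
assert (Q : 0 < / (c * eps)) by (apply Rinv_0_lt_compat; nra).
rewrite Rminus_0_r, Rabs_pos_eq by apply Rlt_le, exp_pos.
rewrite exp_Ropp. rewrite <- (Rinv_inv eps). apply Rinv_lt_contravar.
- apply Rmult_lt_0_compat; [apply Rinv_0_lt_compat, He|apply exp_pos].
- assert (E := exp_ineq1_le (c * INR n)). assert (/ eps = c * / (c * eps)) by (field; lra).
  assert (c * / (c * eps) <= c * INR n) by (apply Rmult_le_compat_l; lra). lra.
Qed.

(** The boundary terms of the integration by parts vanish at both ends of the growing boxes. *)
Lemma gam_succ p : 0 <= p -> gam (p + 1) = (p + 1) * gam p.
Proof.
intros Hp. destruct (gam_lim p Hp) as [H1 _]. destruct (gam_lim (p + 1) ltac:(lra)) as [H2 _].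
destruct (gamma_kernel_le_exp (p + 1) ltac:(lra)) as [K [HK HB]].
assert (Z1 : is_lim_seq (fun N => gamma_kernel (p + 1) (/ INR (S N))) 0).
{ apply (is_lim_seq_le_le (fun _ => 0) _ (fun N => / INR (S N))); [|apply is_lim_seq_const|apply is_lim_seq_inv_INR].
  intros N. split; [apply Rlt_le, gamma_kernel_pos|]. destruct (inv_INR_S N) as [A1 A2].
  unfold gamma_kernel. rewrite <- (Rmult_1_r (/ INR (S N))) at 3.
  apply Rmult_le_compat; [apply Rlt_le, exp_pos|apply Rlt_le, exp_pos| |].
  - rewrite <- (Rpower_1 (/ INR (S N))) at 2 by lra. apply Rpower_le_base_le_1; lra.
  - rewrite <- exp_0. left; apply exp_increasing; lra. }
assert (Z2 : is_lim_seq (fun N => gamma_kernel (p + 1) (INR (S N))) 0).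
{ apply (is_lim_seq_le_le (fun _ => 0) _ (fun N => K * exp (- (/ 2 * INR (S N))))); [|apply is_lim_seq_const|].
  - intros N. split; [apply Rlt_le, gamma_kernel_pos|]. destruct (inv_INR_S N) as [A1 A2].
    replace (/ 2 * INR (S N)) with (INR (S N) / 2) by field. apply HB; lra.
  - replace (Finite 0) with (Rbar_mult K 0) by (simpl; f_equal; ring).
    apply is_lim_seq_scal_l. apply (is_lim_seq_incr_1 (fun N => exp (- (/ 2 * INR N)))), is_lim_seq_exp_neg. lra. }
assert (H3 : is_lim_seq (fun N => ibox (p + 1) (/ INR (S N)) (INR (S N))) ((p + 1) * gam p + (0 - 0))).
{ apply is_lim_seq_ext with (fun N => (p + 1) * ibox p (/ INR (S N)) (INR (S N)) +
    (gamma_kernel (p + 1) (/ INR (S N)) - gamma_kernel (p + 1) (INR (S N)))).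
  - intros N. destruct (inv_INR_S N) as [A1 A2]. symmetry; apply ibox_by_parts. lra.
  - apply is_lim_seq_plus'; [|apply is_lim_seq_minus'; assumption].
    apply (is_lim_seq_scal_l (fun N => ibox p (/ INR (S N)) (INR (S N))) (p + 1) (gam p)), H1. }
assert (E := is_lim_seq_unique _ _ H3). rewrite (is_lim_seq_unique _ _ H2) in E.
injection E; lra.
Qed.

Lemma gam_pos p : 0 <= p -> 0 < gam p.
Proof.
intros Hp. destruct (gam_lim p Hp) as [_ H]. eapply Rlt_le_trans; [|apply (H 1 2); lra].
apply RInt_gt_0; [lra|intros; apply gamma_kernel_pos|].
intros x Hx. apply continuity_pt_filterlim. apply derivable_continuous_pt, ex_derive_Reals_0, ex_derive_gamma_kernel. lra.
Qed.

Lemma gam_0 : gam 0 = 1.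
Proof.
destruct (gam_lim 0 (Rle_refl 0)) as [H _].
assert (E : forall a b, 0 < a <= b -> ibox 0 a b = exp (- a) - exp (- b)).
{ intros a b Hab. unfold ibox. apply is_RInt_unique.
  apply is_RInt_ext with (fun t => exp (- t)).
  - rewrite Rmin_left, Rmax_right by lra. intros t Ht. unfold gamma_kernel. rewrite Rpower_O by lra. as_R_eq. ring.
  - replace (exp (- a) - exp (- b)) with (minus (- exp (- b)) (- exp (- a))) by (unfold minus, plus, opp; simpl; ring).
    apply (is_RInt_derive (fun t => - exp (- t))).
    + intros t _. auto_derive; [exact I|]. ring.
    + intros t _. apply (ex_derive_continuous (K := R_AbsRing) (V := R_NormedModule)). auto_derive. exact I. }
assert (H3 : is_lim_seq (fun N => ibox 0 (/ INR (S N)) (INR (S N))) (exp (- 0) - 0)).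
{ apply is_lim_seq_ext with (fun N => exp (- / INR (S N)) - exp (- (1 * INR (S N)))).
  - intros N. destruct (inv_INR_S N) as [A1 A2]. rewrite E by lra. rewrite Rmult_1_l. reflexivity.
  - apply is_lim_seq_minus'.
    + apply (is_lim_seq_continuous (fun x => exp (- x)) (fun N => / INR (S N)) 0).
      * apply derivable_continuous_pt, ex_derive_Reals_0. auto_derive. exact I.
      * apply is_lim_seq_inv_INR.
    + apply (is_lim_seq_incr_1 (fun N => exp (- (1 * INR N)))), is_lim_seq_exp_neg. lra. }
assert (E2 := is_lim_seq_unique _ _ H3). rewrite (is_lim_seq_unique _ _ H) in E2.
injection E2. rewrite Ropp_0, exp_0. lra.
Qed.

Lemma gam_INR m : gam (INR m) = INR (fact m).
Proof.
induction m as [|m IH]; [simpl; apply gam_0|].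
rewrite S_INR, gam_succ, IH by apply pos_INR.
change (fact (S m)) with (S m * fact m)%nat. rewrite mult_INR, S_INR. ring.
Qed.

(** The functional equation used m times. It combines the Perron residue at rho_k with the Laplace
    transform of x^(rho_k + m) to Gamma(rho_k + 1), whatever the order [m]. *)
Lemma Kone_R_gam m p : 0 <= p -> Kone_R m p * gam (p + INR m) = INR (fact m) * gam p.
Proof.
intros Hp. induction m as [|m IH]; [simpl; rewrite Rplus_0_r; ring|].
assert (P := pos_INR m).
change (Kone_R (S m) p) with (Kone_R m p * (INR (S m) / (p + INR (S m)))).
change (fact (S m)) with (S m * fact m)%nat. rewrite mult_INR.
rewrite S_INR. replace (p + (INR m + 1)) with (p + INR m + 1) by ring. rewrite gam_succ by lra.
replace (Kone_R m p * ((INR m + 1) / (p + INR m + 1)) * ((p + INR m + 1) * gam (p + INR m)))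
  with ((INR m + 1) * (Kone_R m p * gam (p + INR m))) by (field; lra).
rewrite IH. ring.
Qed.

(** * Laplace integrals of Riesz kernels *)

(** The primitive of z^m exp(-dl z) that vanishes at infinity, by repeated integration by parts. *)
Fixpoint Aint (m : nat) (dl z : R) : R :=
  match m with
  | O => - exp (- (dl * z)) / dl
  | S m => - z ^ S m * exp (- (dl * z)) / dl + INR (S m) / dl * Aint m dl z
  end.

Lemma is_derive_Aint m dl z : 0 < dl -> is_derive (Aint m dl) z (z ^ m * exp (- (dl * z))).
Proof.
intros Hd. induction m as [|m IH].
- unfold Aint. auto_derive; [exact I|]. simpl. field. lra.
- assert (D : is_derive (fun z => - z ^ S m * exp (- (dl * z)) / dl) z
    (- (INR (S m) * z ^ m) * exp (- (dl * z)) / dl + z ^ S m * exp (- (dl * z)))).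
  { auto_derive; [exact I|]. change (Init.Nat.pred (S m)) with m. change (match m with O => 1 | S _ => INR m + 1 end) with (INR (S m)). rewrite <- tech_pow_Rmult. field. lra. }
  assert (D2 : is_derive (fun z => INR (S m) / dl * Aint m dl z) z (INR (S m) / dl * (z ^ m * exp (- (dl * z))))).
  { apply (is_derive_scal (Aint m dl) z (INR (S m) / dl)), IH. }
  replace (z ^ S m * exp (- (dl * z))) with (plus (- (INR (S m) * z ^ m) * exp (- (dl * z)) / dl + z ^ S m * exp (- (dl * z)))
    (INR (S m) / dl * (z ^ m * exp (- (dl * z))))) by (unfold plus; cbv [AbelianMonoid.plus]; as_R_eq; change (@eq R (- (INR (S m) * z ^ m) * exp (- (dl * z)) / dl + z ^ S m * exp (- (dl * z)) + INR (S m) / dl * (z ^ m * exp (- (dl * z)))) (z ^ S m * exp (- (dl * z)))); field; lra).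
  exact (is_derive_plus _ _ z _ _ D D2).
Qed.

Lemma Aint_0 m dl : 0 < dl -> Aint m dl 0 = - (INR (fact m) / dl ^ S m).
Proof.
intros Hd. induction m as [|m IH].
- simpl. rewrite Rmult_0_r, Ropp_0, exp_0. field. lra.
- change (Aint (S m) dl 0) with (- 0 ^ S m * exp (- (dl * 0)) / dl + INR (S m) / dl * Aint m dl 0).
  rewrite IH, pow_i by lia. change (fact (S m)) with (S m * fact m)%nat. rewrite mult_INR.
  assert (0 < dl ^ m) by (apply pow_lt, Hd). simpl pow. field. lra.
Qed.

Lemma Aint_nonpos m dl z : 0 < dl -> 0 <= z -> Aint m dl z <= 0.
Proof.
intros Hd Hz. induction m as [|m IH].
- simpl. assert (P := exp_pos (- (dl * z))).
  assert (0 < exp (- (dl * z)) / dl) by (apply Rdiv_lt_0_compat; lra). unfold Rdiv in *. lra.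
- change (Aint (S m) dl z) with (- z ^ S m * exp (- (dl * z)) / dl + INR (S m) / dl * Aint m dl z).
  assert (0 <= z ^ S m * exp (- (dl * z)) / dl).
  { apply Rdiv_le_0_compat; [|exact Hd]. apply Rmult_le_pos; [apply pow_le, Hz|apply Rlt_le, exp_pos]. }
  assert (0 <= INR (S m) / dl) by (apply Rdiv_le_0_compat; [apply pos_INR|exact Hd]).
  assert (INR (S m) / dl * Aint m dl z <= 0) by nra. unfold Rdiv in *. lra.
Qed.

Lemma is_RInt_Aint m dl k a b : 0 < dl ->
  is_RInt (fun x => (x - k) ^ m * exp (- (dl * x))) a b (exp (- (dl * k)) * (Aint m dl (b - k) - Aint m dl (a - k))).
Proof.
intros Hd.
replace (exp (- (dl * k)) * (Aint m dl (b - k) - Aint m dl (a - k)))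
  with (minus (exp (- (dl * k)) * Aint m dl (b - k)) (exp (- (dl * k)) * Aint m dl (a - k)))
  by (unfold minus, plus, opp; simpl; ring).
apply (is_RInt_derive (fun x => exp (- (dl * k)) * Aint m dl (x - k))).
- intros x _.
  replace ((x - k) ^ m * exp (- (dl * x))) with (exp (- (dl * k)) * ((x - k) ^ m * exp (- (dl * (x - k))))).
  + apply (is_derive_scal (fun x => Aint m dl (x - k)) x).
    assert (D := is_derive_comp (Aint m dl) (fun x => x - k) x _ 1 (is_derive_Aint m dl (x - k) Hd)).
    replace ((x - k) ^ m * exp (- (dl * (x - k)))) with (scal 1 ((x - k) ^ m * exp (- (dl * (x - k)))))
      by (unfold scal; simpl; unfold mult; simpl; ring).
    apply D. auto_derive; [exact I|ring].
  + replace (- (dl * x)) with (- (dl * k) + - (dl * (x - k))) by ring. rewrite exp_plus. ring.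
- intros x _. apply (ex_derive_continuous (K := R_AbsRing) (V := R_NormedModule)). auto_derive. exact I.
Qed.

Lemma Aint_mono m dl z : 0 < dl -> 0 <= z -> Aint m dl 0 <= Aint m dl z.
Proof.
intros Hd Hz. assert (I := is_RInt_Aint m dl 0 0 z Hd).
assert (P : 0 <= RInt (fun x => (x - 0) ^ m * exp (- (dl * x))) 0 z).
{ apply RInt_ge_0; [exact Hz|eexists; exact I|]. intros x Hx. apply Rmult_le_pos; [apply pow_le; lra|apply Rlt_le, exp_pos]. }
rewrite (is_RInt_unique _ _ _ _ I), Rmult_0_r, Ropp_0, exp_0, !Rminus_0_r in P. lra.
Qed.

Lemma is_lim_seq_pow_exp j dl : 0 < dl -> is_lim_seq (fun n => INR n ^ j * exp (- (dl * INR n))) 0.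
Proof.
intros Hd. destruct j as [|j].
- apply is_lim_seq_ext with (fun n => exp (- (dl * INR n))); [intros; simpl; ring|]. apply is_lim_seq_exp_neg, Hd.
- set (K := (2 * INR (S j) / dl) ^ S j).
  assert (Pj := lt_0_INR (S j) (Nat.lt_0_succ j)).
  apply (is_lim_seq_le_le (fun _ => 0) _ (fun n => K * exp (- (dl / 2 * INR n)))); [|apply is_lim_seq_const|].
  + intros n. assert (Pn := pos_INR n). split; [apply Rmult_le_pos; [apply pow_le, Pn|apply Rlt_le, exp_pos]|].
    assert (Q := pow_le_exp (S j) (dl / 2 * INR n) ltac:(lia) ltac:(nra)).
    apply (Rmult_le_compat_l K) in Q; [|apply pow_le, Rdiv_le_0_compat; lra].
    unfold K in Q. rewrite <- Rpow_mult_distr in Q.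
    replace (2 * INR (S j) / dl * (dl / 2 * INR n / INR (S j))) with (INR n) in Q by (field; lra).
    fold K in Q.
    apply Rle_trans with (K * exp (dl / 2 * INR n) * exp (- (dl * INR n))).
    * apply Rmult_le_compat_r; [apply Rlt_le, exp_pos|exact Q].
    * rewrite Rmult_assoc, <- exp_plus. apply Req_le. f_equal. f_equal. field.
  + replace (Finite 0) with (Rbar_mult K 0) by (simpl; f_equal; ring).
    apply is_lim_seq_scal_l, is_lim_seq_exp_neg. lra.
Qed.

Lemma Aint_lim m dl : 0 < dl -> is_lim_seq (fun n => Aint m dl (INR n)) 0.
Proof.
intros Hd. induction m as [|m IH].
- apply is_lim_seq_ext with (fun n => - / dl * (INR n ^ 0 * exp (- (dl * INR n)))); [intros; simpl; field; lra|].
  replace (Finite 0) with (Rbar_mult (- / dl) 0) by (simpl; f_equal; ring).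
  apply is_lim_seq_scal_l, is_lim_seq_pow_exp, Hd.
- apply is_lim_seq_ext with (fun n => - / dl * (INR n ^ S m * exp (- (dl * INR n))) + INR (S m) / dl * Aint m dl (INR n)).
  { intros n. change (Aint (S m) dl (INR n)) with (- INR n ^ S m * exp (- (dl * INR n)) / dl + INR (S m) / dl * Aint m dl (INR n)).
    field. lra. }
  replace (Finite 0) with (Finite (- / dl * 0 + INR (S m) / dl * 0)) by (f_equal; ring).
  apply is_lim_seq_plus'.
  + apply (is_lim_seq_scal_l (fun n => INR n ^ S m * exp (- (dl * INR n))) (- / dl) 0), is_lim_seq_pow_exp, Hd.
  + apply (is_lim_seq_scal_l (fun n => Aint m dl (INR n)) (INR (S m) / dl) 0), IH.
Qed.

(** The integral of (x - k)_+^m exp(-dl x) over [1, N] in closed form; starting at 1 loses nothing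
    since k >= 1. *)
Definition vint (m : nat) (dl : R) (k N : nat) : R :=
  exp (- (dl * INR k)) * (Aint m dl (Rmax 0 (INR N - INR k)) - Aint m dl 0).

Lemma is_RInt_vint m dl k N : (1 <= m)%nat -> 0 < dl -> (1 <= k)%nat -> (1 <= N)%nat ->
  is_RInt (fun x => (Rmax 0 (x - INR k)) ^ m * exp (- (dl * x))) 1 (INR N) (vint m dl k N).
Proof.
intros Hm Hd Hk HN. apply (le_INR 1) in Hk as Hk'. apply (le_INR 1) in HN as HN'. simpl in Hk', HN'.
assert (Z : forall a b, a <= b -> b <= INR k -> is_RInt (fun x => (Rmax 0 (x - INR k)) ^ m * exp (- (dl * x))) a b 0).
{ intros a b Hab Hb. apply is_RInt_ext with (fun _ => 0); [|apply is_RInt_zero].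
  rewrite Rmin_left, Rmax_right by lra. intros x Hx. rewrite Rmax_left by lra. rewrite pow_i by lia. as_R_eq. ring. }
unfold vint. destruct (Rle_dec (INR k) (INR N)) as [L|L].
- rewrite Rmax_right by lra.
  replace (exp (- (dl * INR k)) * (Aint m dl (INR N - INR k) - Aint m dl 0))
    with (plus 0 (exp (- (dl * INR k)) * (Aint m dl (INR N - INR k) - Aint m dl (INR k - INR k))))
    by (unfold plus; simpl; rewrite Rminus_diag; ring).
  apply (is_RInt_Chasles (V := R_NormedModule)) with (INR k); [apply Z; lra|].
  eapply is_RInt_ext; [|apply is_RInt_Aint, Hd].
  rewrite Rmin_left, Rmax_right by lra. intros x Hx. rewrite Rmax_right by lra. reflexivity.
- rewrite Rmax_left by lra. rewrite Rminus_diag, Rmult_0_r. apply Z; lra.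
Qed.

Lemma vint_bound m dl k N : 0 < dl -> 0 <= vint m dl k N <= exp (- (dl * INR k)) * (INR (fact m) / dl ^ S m).
Proof.
intros Hd. unfold vint. assert (P := exp_pos (- (dl * INR k))).
assert (Q := Aint_mono m dl (Rmax 0 (INR N - INR k)) Hd (Rmax_l _ _)).
assert (Q2 := Aint_nonpos m dl (Rmax 0 (INR N - INR k)) Hd (Rmax_l _ _)).
assert (Q3 := Aint_0 m dl Hd). split; [apply Rmult_le_pos; lra|]. apply Rmult_le_compat_l; lra.
Qed.

Lemma vint_lim m dl k : 0 < dl -> is_lim_seq (fun N => vint m dl k N) (exp (- (dl * INR k)) * (INR (fact m) / dl ^ S m)).
Proof.
intros Hd. apply (is_lim_seq_incr_n _ k).
apply is_lim_seq_ext with (fun N => exp (- (dl * INR k)) * (Aint m dl (INR N) - Aint m dl 0)).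
- intros N. unfold vint. rewrite plus_INR. replace (INR N + INR k - INR k) with (INR N) by ring.
  rewrite Rmax_right by apply pos_INR. reflexivity.
- rewrite (Aint_0 m dl Hd).
  set (F := INR (fact m) / dl ^ S m).
  replace (Finite (exp (- (dl * INR k)) * F)) with (Finite (exp (- (dl * INR k)) * (0 - - F))) by (f_equal; ring).
  apply (is_lim_seq_scal_l (fun N => Aint m dl (INR N) - - F) (exp (- (dl * INR k))) (0 - - F)).
  apply is_lim_seq_minus'; [apply Aint_lim, Hd|apply is_lim_seq_const].
Qed.

(** (dl k)^(q+2) exp(-dl k) is bounded, which leaves a multiple of 1/k^2. *)
Lemma ex_series_poly_exp q dl : 0 < dl -> 0 <= q ->
  ex_series (fun i => Rpower (INR (S i)) q * exp (- (dl * INR (S i)))).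
Proof.
intros Hd Hq. destruct (gamma_kernel_le_exp (q + 2) ltac:(lra)) as [K [HK HB]].
apply ex_series_dom with (fun i => K / Rpower dl (q + 2) * / (INR (S i) * INR (S i))).
- intros i. assert (Pi : 1 <= INR (S i)) by (apply (le_INR 1); lia).
  rewrite Rabs_pos_eq by (apply Rmult_le_pos; apply Rlt_le, exp_pos).
  assert (Q := HB (dl * INR (S i)) ltac:(nra)). unfold gamma_kernel in Q.
  rewrite <- Rpower_mult_distr in Q by lra.
  assert (P1 : 0 < Rpower dl (q + 2)) by apply exp_pos.
  assert (P2 : Rpower (INR (S i)) (q + 2) = Rpower (INR (S i)) q * (INR (S i) * INR (S i))).
  { rewrite Rpower_plus. f_equal. replace 2 with (INR 2) by (simpl; ring). rewrite Rpower_pow by lra. simpl. ring. }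
  rewrite P2 in Q.
  assert (Q2 : exp (- (dl * INR (S i) / 2)) <= 1).
  { rewrite <- exp_0. left. apply exp_increasing. nra. }
  apply (Rmult_le_reg_r (Rpower dl (q + 2) * (INR (S i) * INR (S i)))); [apply Rmult_lt_0_compat; [lra|nra]|].
  replace (K / Rpower dl (q + 2) * / (INR (S i) * INR (S i)) * (Rpower dl (q + 2) * (INR (S i) * INR (S i)))) with K by (field; lra).
  apply Rle_trans with (K * exp (- (dl * INR (S i) / 2))); [|nra].
  eapply Rle_trans; [|exact Q]. apply Req_le. ring.
- apply (ex_series_scal_l (K := R_AbsRing) (K / Rpower dl (q + 2)) (fun i => / (INR (S i) * INR (S i)))), ex_series_inv_sqr.
Qed.

Lemma is_RInt_sum_n (f : nat -> R -> R) (l : nat -> R) a b n :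
  (forall k, (k <= n)%nat -> is_RInt (f k) a b (l k)) ->
  is_RInt (fun t => sum_n (fun k => f k t) n) a b (sum_n l n).
Proof.
induction n as [|n IH]; intros H.
- rewrite sum_O. apply is_RInt_ext_all with (f 0%nat); [intros; rewrite sum_O; reflexivity|apply H; lia].
- rewrite sum_n_succ. apply is_RInt_ext_all with (fun t => sum_n (fun k => f k t) n + f (S n) t).
  + intros; rewrite sum_n_succ; reflexivity.
  + apply (is_RInt_plus (V := R_NormedModule)); [apply IH; intros; apply H; lia|apply H; lia].
Qed.

Lemma eventually_forall_le (P : nat -> nat -> Prop) J :
  (forall j, (j <= J)%nat -> exists N0, forall n, (N0 <= n)%nat -> P j n) ->
  exists N0, forall n, (N0 <= n)%nat -> forall j, (j <= J)%nat -> P j n.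
Proof.
induction J as [|J IH]; intros H.
- destruct (H 0%nat (le_n _)) as [N HN]. exists N. intros n Hn j Hj. replace j with 0%nat by lia. apply HN, Hn.
- destruct IH as [N1 H1]; [intros; apply H; lia|]. destruct (H (S J) (le_n _)) as [N2 H2].
  exists (Nat.max N1 N2). intros n Hn j Hj. destruct (Nat.eq_dec j (S J)) as [->|N].
  + apply H2; lia.
  + apply H1; lia.
Qed.

(** Multiplied by x^m, the Riesz mean is the sum of L_k (x - k)_+^m, whose Laplace transform is F
    g(dl) with F = m!/dl^(m+1). A main term x^(rh + m) transforms to Gamma(rh + m + 1)/dl^(rh + m +
    1), and an error K + eta x^m to at most K/dl + eta F, where K/dl is negligible against F. The
    constant [K] frees the hypothesis from small [x]. *)
Theorem riesz_to_abel (L : nat -> R) (B q : R) (m J : nat) (kap rh : nat -> R) :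
  (1 <= m)%nat -> 0 <= q -> (forall k, Rabs (L (S k)) <= B * Rpower (INR (S k)) q) ->
  (forall j, (j <= J)%nat -> 0 <= rh j) ->
  (forall eta, 0 < eta -> exists K, forall x N, 1 <= x -> x <= INR N ->
     Rabs (sum_n (riesz_term L m x) N - sum_n (fun j => kap j * Rpower x (rh j)) J) * x ^ m <= K + eta * x ^ m) ->
  forall eta, 0 < eta -> exists d0, 0 < d0 /\ forall dl, 0 < dl < d0 ->
    Rabs (Series (fun i => L (S i) * exp (- (dl * INR (S i))))
      - sum_n (fun j => kap j * (Rpower dl (- rh j) * (gam (rh j + INR m) / INR (fact m)))) J) <= eta.
Proof.
intros Hm Hq HB Hrh HR eta He.
destruct (HR (eta / 2) ltac:(lra)) as [K' HK'].
set (K := Rmax 0 K'). assert (HK0 : 0 <= K) by apply Rmax_l. assert (HKK : K' <= K) by apply Rmax_r.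
set (S1 := sum_n (fun j => Rabs (kap j)) J).
assert (HS1 : 0 <= S1) by (apply sum_n_nonneg; intros; apply Rabs_pos).
(* Collects the errors that become O(dl) after division by [F]. *)
set (Z := K + 2 * S1).
exists (Rmin 1 (eta / 2 / (Z + 1))). split.
{ apply Rmin_glb_lt; [lra|]. apply Rdiv_lt_0_compat; unfold Z; lra. }
intros dl [Hd0 Hd].
assert (Hd1 : dl < 1) by (eapply Rlt_le_trans; [exact Hd|apply Rmin_l]).
assert (Hd2 : dl < eta / 2 / (Z + 1)) by (eapply Rlt_le_trans; [exact Hd|apply Rmin_r]).
assert (Pm : 0 < dl ^ m) by (apply pow_lt, Hd0).
assert (Pf : 1 <= INR (fact m)) by (apply (le_INR 1); apply lt_O_fact).
set (F := INR (fact m) / dl ^ S m). assert (HF : 0 < F) by (apply Rdiv_lt_0_compat; [lra|apply pow_lt, Hd0]).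
set (g := Series (fun i => L (S i) * exp (- (dl * INR (S i))))).
(* [X N] and [Y N] are the Laplace integrals over [1, N] of the Riesz sums and of the main terms;
   [Yi] is the full integral of the main terms from 0 to infinity. *)
set (X := fun N => sum_n (fun i => L (S i) * vint m dl (S i) N) N).
set (Y := fun N => sum_n (fun j => kap j * (Rpower dl (- (rh j + INR m + 1)) * ibox (rh j + INR m) dl (dl * INR N))) J).
set (Yi := sum_n (fun j => kap j * (Rpower dl (- (rh j + INR m + 1)) * gam (rh j + INR m))) J).
assert (HX : is_lim_seq X (g * F)).
{ apply is_lim_seq_ext with (fun N => Series (fun i => L (S i) * vint m dl (S i) N)).
  - intros N. rewrite (Series_incr_n _ (S N)).
    + simpl pred. rewrite <- sum_n_Reals. unfold X.
      replace (Series (fun k => L (S (S N + k)) * vint m dl (S (S N + k)) N)) with 0; [ring|].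
      symmetry. apply Series_zero. intros k.
      unfold vint. rewrite Rmax_left; [ring|]. apply Rle_minus, le_INR. lia.
    + lia.
    + apply ex_series_dom with (fun i => F * B * (Rpower (INR (S i)) q * exp (- (dl * INR (S i))))).
      * intros i. destruct (vint_bound m dl (S i) N Hd0) as [V1 V2]. fold F in V2.
        rewrite Rabs_mult, (Rabs_pos_eq (vint _ _ _ _)) by exact V1.
        replace (F * B * (Rpower (INR (S i)) q * exp (- (dl * INR (S i)))))
          with (B * Rpower (INR (S i)) q * (exp (- (dl * INR (S i))) * F)) by ring.
        apply Rmult_le_compat; [apply Rabs_pos|exact V1|apply HB|exact V2].
      * apply (ex_series_scal_l (K := R_AbsRing) (F * B) (fun i => Rpower (INR (S i)) q * exp (- (dl * INR (S i))))), ex_series_poly_exp; assumption.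
  - unfold g. rewrite <- Series_scal_r.
    apply (tannery (fun N i => L (S i) * vint m dl (S i) N) (fun i => L (S i) * exp (- (dl * INR (S i))) * F)
      (fun i => F * B * (Rpower (INR (S i)) q * exp (- (dl * INR (S i)))))).
    + intros N i. destruct (vint_bound m dl (S i) N Hd0) as [V1 V2]. fold F in V2.
      rewrite Rabs_mult, (Rabs_pos_eq (vint _ _ _ _)) by exact V1.
      replace (F * B * (Rpower (INR (S i)) q * exp (- (dl * INR (S i)))))
        with (B * Rpower (INR (S i)) q * (exp (- (dl * INR (S i))) * F)) by ring.
      apply Rmult_le_compat; [apply Rabs_pos|exact V1|apply HB|exact V2].
    + apply (ex_series_scal_l (K := R_AbsRing) (F * B) (fun i => Rpower (INR (S i)) q * exp (- (dl * INR (S i))))), ex_series_poly_exp; assumption.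
    + intros i. rewrite Rmult_assoc.
      apply (is_lim_seq_scal_l (fun N => vint m dl (S i) N) (L (S i)) (exp (- (dl * INR (S i))) * F)).
      apply vint_lim, Hd0. }
assert (IX : forall N, (1 <= N)%nat -> is_RInt (fun x => sum_n (fun i => L (S i) * ((Rmax 0 (x - INR (S i))) ^ m * exp (- (dl * x)))) N) 1 (INR N) (X N)).
{ intros N HN. apply (is_RInt_sum_n (fun i x => L (S i) * ((Rmax 0 (x - INR (S i))) ^ m * exp (- (dl * x))))).
  intros i _. apply (is_RInt_scal (V := R_NormedModule) (fun x => (Rmax 0 (x - INR (S i))) ^ m * exp (- (dl * x)))).
  apply is_RInt_vint; try assumption. lia. }
assert (IY : forall N, (1 <= N)%nat -> is_RInt (fun x => sum_n (fun j => kap j * (Rpower x (rh j + INR m) * exp (- (dl * x)))) J) 1 (INR N) (Y N)).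
{ intros N HN. apply (le_INR 1) in HN as HN'. simpl in HN'.
  apply (is_RInt_sum_n (fun j x => kap j * (Rpower x (rh j + INR m) * exp (- (dl * x))))).
  intros j _. apply (is_RInt_scal (V := R_NormedModule) (fun x => Rpower x (rh j + INR m) * exp (- (dl * x)))).
  set (p := rh j + INR m).
  apply is_RInt_ext with (fun x => scal (Rpower dl (- (p + 1))) (scal dl (gamma_kernel p (dl * x + 0)))).
  - rewrite Rmin_left, Rmax_right by lra. intros x Hx. unfold scal; simpl; unfold mult; simpl. as_R_eq.
    unfold gamma_kernel. rewrite Rplus_0_r, <- Rpower_mult_distr by lra.
    rewrite Rpower_Ropp, Rpower_plus, Rpower_1 by lra. assert (0 < Rpower dl p) by apply exp_pos. field. lra.
  - apply (is_RInt_scal (V := R_NormedModule)).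
    apply (is_RInt_comp_lin (V := R_NormedModule) (gamma_kernel p) dl 0 1 (INR N)).
    rewrite !Rplus_0_r, Rmult_1_r. apply (RInt_correct (V := R_CompleteNormedModule)), ex_RInt_gamma_kernel. nra. }
assert (HXY : forall N, (1 <= N)%nat -> Rabs (X N - Y N) <= K / dl + eta / 2 * F).
{ intros N HN. apply (le_INR 1) in HN as HN'. simpl in HN'.
  assert (ID := is_RInt_minus (V := R_NormedModule) _ _ _ _ _ _ (IX N HN) (IY N HN)).
  assert (IG : is_RInt (fun x => K * ((x - 0) ^ 0 * exp (- (dl * x))) + eta / 2 * ((x - 0) ^ m * exp (- (dl * x)))) 1 (INR N)
    (K * (exp (- (dl * 0)) * (Aint 0 dl (INR N - 0) - Aint 0 dl (1 - 0))) + eta / 2 * (exp (- (dl * 0)) * (Aint m dl (INR N - 0) - Aint m dl (1 - 0))))).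
  { apply (is_RInt_plus (V := R_NormedModule) (fun x => K * ((x - 0) ^ 0 * exp (- (dl * x)))) (fun x => eta / 2 * ((x - 0) ^ m * exp (- (dl * x))))).
    - apply (is_RInt_scal (V := R_NormedModule) (fun x => (x - 0) ^ 0 * exp (- (dl * x)))), is_RInt_Aint, Hd0.
    - apply (is_RInt_scal (V := R_NormedModule) (fun x => (x - 0) ^ m * exp (- (dl * x)))), is_RInt_Aint, Hd0. }
  eapply Rle_trans; [refine (norm_RInt_le (V := R_NormedModule) _ _ 1 (INR N) _ _ HN' _ ID IG)|].
  - intros x Hx.
    change (Rabs (sum_n (fun i => L (S i) * ((Rmax 0 (x - INR (S i))) ^ m * exp (- (dl * x)))) N
      - sum_n (fun j => kap j * (Rpower x (rh j + INR m) * exp (- (dl * x)))) J)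
      <= K * ((x - 0) ^ 0 * exp (- (dl * x))) + eta / 2 * ((x - 0) ^ m * exp (- (dl * x)))).
    assert (Hx0 : 0 < x) by lra. assert (Pe := exp_pos (- (dl * x))).
    specialize (HK' x N ltac:(lra) ltac:(lra)).
    replace (sum_n (fun i => L (S i) * ((Rmax 0 (x - INR (S i))) ^ m * exp (- (dl * x)))) N)
      with (x ^ m * exp (- (dl * x)) * sum_n (riesz_term L m x) N).
    2:{ rewrite <- sum_n_scal_l_R. apply sum_n_ext. intros i. as_R_eq. unfold riesz_term.
        replace (Rmax 0 (x - INR (S i))) with (x * Rmax 0 (1 - INR (S i) / x)).
        - rewrite Rpow_mult_distr. ring.
        - rewrite <- RmaxRmult by lra. f_equal; [ring|field; lra]. }
    replace (sum_n (fun j => kap j * (Rpower x (rh j + INR m) * exp (- (dl * x)))) J)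
      with (x ^ m * exp (- (dl * x)) * sum_n (fun j => kap j * Rpower x (rh j)) J).
    2:{ rewrite <- sum_n_scal_l_R. apply sum_n_ext. intros j. as_R_eq. rewrite Rpower_plus, Rpower_pow by lra. ring. }
    rewrite <- Rmult_minus_distr_l, Rabs_mult, Rabs_pos_eq by (apply Rmult_le_pos; [apply pow_le; lra|lra]).
    rewrite Rminus_0_r.
    replace (K * (x ^ 0 * exp (- (dl * x))) + eta / 2 * (x ^ m * exp (- (dl * x)))) with ((K + eta / 2 * x ^ m) * exp (- (dl * x))) by (simpl; ring).
    apply Rle_trans with ((K' + eta / 2 * x ^ m) * exp (- (dl * x))).
    + apply (Rmult_le_compat_r (exp (- (dl * x)))) in HK'; [|lra]. eapply Rle_trans; [|exact HK']. apply Req_le. ring.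
    + apply Rmult_le_compat_r; lra.
  - rewrite Rmult_0_r, Ropp_0, exp_0, !Rminus_0_r, !Rmult_1_l.
    assert (A1 := Aint_nonpos 0 dl (INR N) Hd0 ltac:(lra)). assert (A2 := Aint_mono 0 dl 1 Hd0 ltac:(lra)).
    assert (A3 := Aint_nonpos m dl (INR N) Hd0 ltac:(lra)). assert (A4 := Aint_mono m dl 1 Hd0 ltac:(lra)).
    rewrite Aint_0 in A2, A4 by exact Hd0. fold F in A4.
    replace (INR (fact 0) / dl ^ 1) with (/ dl) in A2 by (simpl; field; lra).
    apply Rplus_le_compat; [unfold Rdiv|]; apply Rmult_le_compat_l; lra. }
(* The integral starts at x = 1, so its scaled lower end is [dl] instead of 0. The missing piece is
   at most dl^(p+1), which the prefactor dl^(-(p+1)) turns into O(1). *)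
assert (HY : exists N0, forall N, (N0 <= N)%nat -> forall j, (j <= J)%nat ->
   Rabs (ibox (rh j + INR m) dl (dl * INR N) - gam (rh j + INR m)) <= 2 * Rpower dl (rh j + INR m + 1)).
{ apply (eventually_forall_le (fun j N => Rabs (ibox (rh j + INR m) dl (dl * INR N) - gam (rh j + INR m)) <= 2 * Rpower dl (rh j + INR m + 1))).
  intros j Hj. set (p := rh j + INR m). assert (Hp : 0 <= p) by (unfold p; generalize (pos_INR m), (Hrh j Hj); lra).
  destruct (gam_approx p (Rpower dl (p + 1)) Hp (exp_pos _)) as (a0 & b0 & Ha & Hb & Hab).
  destruct (INR_unbounded (b0 / dl)) as [N0 HN0]. exists N0. intros N HN. apply le_INR in HN.
  assert (Hbn : b0 <= dl * INR N) by (assert (Q : b0 / dl <= INR N) by lra; apply Rle_div_l in Q; lra).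
  set (a := Rmin a0 dl). assert (Ha1 : a <= a0) by apply Rmin_l. assert (Ha2 : a <= dl) by apply Rmin_r.
  assert (Ha3 : 0 < a) by (apply Rmin_glb_lt; lra).
  destruct (Hab a (dl * INR N) ltac:(lra) Hbn) as [Q1 Q2].
  rewrite (ibox_Chasles p a dl (dl * INR N)) in Q1, Q2 by lra.
  assert (Q3 := ibox_small p a dl Hp ltac:(lra)). assert (Q4 := ibox_ge_0 p a dl ltac:(lra)).
  apply Rabs_le. lra. }
destruct HY as [N0 HN0].
assert (HYY : forall N, (N0 <= N)%nat -> Rabs (Y N - Yi) <= 2 * S1).
{ intros N HN. unfold Y, Yi. rewrite <- sum_n_minus. eapply Rle_trans; [apply sum_n_Rabs|].
  unfold S1. rewrite <- sum_n_scal_l_R. apply sum_n_le_compat. intros j Hj.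
  rewrite <- Rmult_minus_distr_l, <- Rmult_minus_distr_l, !Rabs_mult.
  rewrite (Rabs_pos_eq (Rpower _ _)) by apply Rlt_le, exp_pos.
  rewrite Rpower_Ropp. assert (P : 0 < Rpower dl (rh j + INR m + 1)) by apply exp_pos.
  specialize (HN0 N HN j Hj).
  apply Rle_trans with (Rabs (kap j) * (/ Rpower dl (rh j + INR m + 1) * (2 * Rpower dl (rh j + INR m + 1)))).
  - apply Rmult_le_compat_l; [apply Rabs_pos|]. apply Rmult_le_compat_l; [apply Rlt_le, Rinv_0_lt_compat, P|exact HN0].
  - apply Req_le. field. lra. }
assert (Fin : Rabs (g * F - Yi) <= K / dl + eta / 2 * F + 2 * S1).
{ apply (is_lim_seq_le (fun N => Rabs (X (N + S N0)%nat - Yi)) (fun _ => K / dl + eta / 2 * F + 2 * S1)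
    (Rabs (g * F - Yi)) (K / dl + eta / 2 * F + 2 * S1)).
  - intros N. specialize (HXY (N + S N0)%nat ltac:(lia)). specialize (HYY (N + S N0)%nat ltac:(lia)).
    replace (X (N + S N0)%nat - Yi) with (X (N + S N0)%nat - Y (N + S N0)%nat + (Y (N + S N0)%nat - Yi)) by ring.
    eapply Rle_trans; [apply Rabs_triang|]. lra.
  - apply (is_lim_seq_abs (fun N => X (N + S N0)%nat - Yi) (g * F - Yi)).
    apply is_lim_seq_minus'; [apply is_lim_seq_incr_n, HX|apply is_lim_seq_const].
  - apply is_lim_seq_const. }
assert (EY : Yi = F * sum_n (fun j => kap j * (Rpower dl (- rh j) * (gam (rh j + INR m) / INR (fact m)))) J).
{ unfold Yi. rewrite <- sum_n_scal_l_R. apply sum_n_ext. intros j. as_R_eq.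
  replace (- (rh j + INR m + 1)) with (- rh j + - INR (S m)) by (rewrite S_INR; ring).
  rewrite Rpower_plus, (Rpower_Ropp dl (INR (S m))), Rpower_pow by exact Hd0. unfold F.
  assert (0 < dl ^ S m) by (apply pow_lt, Hd0). field. lra. }
rewrite EY in Fin. rewrite (Rmult_comm g F), <- Rmult_minus_distr_l, Rabs_mult, (Rabs_pos_eq F) in Fin by lra.
apply (Rmult_le_reg_l F); [exact HF|]. eapply Rle_trans; [exact Fin|].
(* After division by [F] the errors K/dl and 2 S1 become O(dl), since m >= 1 and dl < 1. *)
assert (E1 : K / dl <= F * (K * dl)).
{ unfold F. replace (INR (fact m) / dl ^ S m * (K * dl)) with (K * (INR (fact m) / dl ^ m)) by (simpl; field; lra).
  unfold Rdiv at 1. apply Rmult_le_compat_l; [exact HK0|].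
  apply Rle_div_r; [exact Pm|]. destruct m as [|m']; [lia|].
  replace (/ dl * dl ^ S m') with (dl ^ m') by (simpl; field; lra).
  apply Rle_trans with 1; [|exact Pf]. rewrite <- (pow1 m'). apply pow_incr. lra. }
assert (E2 : 1 <= F * dl).
{ unfold F. replace (INR (fact m) / dl ^ S m * dl) with (INR (fact m) / dl ^ m) by (simpl; field; lra).
  apply Rle_div_r; [exact Pm|]. rewrite Rmult_1_l. apply Rle_trans with 1; [|exact Pf].
  rewrite <- (pow1 m). apply pow_incr. lra. }
assert (E3 : dl * (Z + 1) <= eta / 2).
{ apply Rlt_le in Hd2. apply Rle_div_r in Hd2; [exact Hd2|unfold Z; lra]. }
apply Rle_trans with (F * (K * dl) + eta / 2 * F + 2 * S1 * (F * dl)); [nra|].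
replace (F * (K * dl) + eta / 2 * F + 2 * S1 * (F * dl)) with (F * (eta / 2 + dl * Z)) by (unfold Z; ring).
apply Rmult_le_compat_l; lra.
Qed.

Lemma CV_radius_ge_1 (a : nat -> R) : (forall n, Rabs (a n) <= 1) -> Rbar_le 1 (CV_radius a).
Proof.
intros H. apply CV_radius_ge_1_of_disk. intros x Hx.
apply ex_series_dom with (fun n => x ^ n).
- intros n. rewrite Rabs_Rabsolu, Rabs_mult. rewrite (Rabs_pos_eq (x ^ n)) by (apply pow_le; lra).
  rewrite <- (Rmult_1_l (x ^ n)) at 2. apply Rmult_le_compat_r; [apply pow_le; lra|apply H].
- apply ex_series_geom. rewrite Rabs_pos_eq; lra.
Qed.

(** The derivative of the series is geometric and cancels that of ln(1 - x). *)
Lemma log_series x : 0 <= x < 1 -> Series (fun i => / INR (S i) * x ^ S i) = - ln (1 - x).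
Proof.
intros Hx.
set (a := fun n => match n with O => 0 | S n => / INR (S n) end).
assert (Ra : Rbar_le 1 (CV_radius a)).
{ apply CV_radius_ge_1. intros [|n]; [change (a 0%nat) with 0; rewrite Rabs_R0; lra|]. change (a (S n)) with (/ INR (S n)).
  destruct (inv_INR_S n) as [A _]. rewrite Rabs_pos_eq; lra. }
assert (Cv : forall y, 0 <= y < 1 -> Rbar_lt (Rabs y) (CV_radius a)).
{ intros y Hy. eapply Rbar_lt_le_trans; [|exact Ra]. simpl. rewrite Rabs_pos_eq; lra. }
assert (E : PSeries a x + ln (1 - x) = PSeries a 0 + ln (1 - 0)).
{ destruct (MVT_gen (fun y => PSeries a y + ln (1 - y)) 0 x (fun _ => 0)) as [c [_ Hc]].
  - rewrite Rmin_left, Rmax_right by lra. intros y Hy.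
    assert (D := is_derive_PSeries a y (Cv y ltac:(lra))).
    assert (ED : PSeries (PS_derive a) y = / (1 - y)).
    { rewrite <- Series_geom by (rewrite Rabs_pos_eq; lra). apply Series_ext. intros n.
      unfold PS_derive, a. assert (P := lt_0_INR (S n) (Nat.lt_0_succ n)). field. lra. }
    rewrite ED in D.
    replace 0 with (/ (1 - y) + (- (1) * / (1 - y))) by (field; lra).
    apply (is_derive_plus (V := R_NormedModule) (PSeries a) (fun y => ln (1 - y))); [exact D|].
    auto_derive; [lra|]. field; lra.
  - rewrite Rmin_left, Rmax_right by lra. intros y Hy.
    apply continuity_pt_plus.
    + apply derivable_continuous_pt, ex_derive_Reals_0. eexists. apply is_derive_PSeries, Cv. lra.
    + apply derivable_continuous_pt, ex_derive_Reals_0. auto_derive. lra.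
  - lra. }
rewrite PSeries_0, Rminus_0_r, ln_1 in E. change (a 0%nat) with 0 in E.
assert (E2 : PSeries a x = Series (fun i => / INR (S i) * x ^ S i)).
{ unfold PSeries. rewrite Series_incr_1.
  - change (a 0%nat) with 0. rewrite Rmult_0_l, Rplus_0_l. reflexivity.
  - apply ex_series_Rabs, CV_disk_inside, Cv, Hx. }
lra.
Qed.

Lemma ln_one_minus_exp dl : 0 < dl <= 1 / 4 -> Rabs (ln (1 - exp (- dl)) - ln dl) <= 4 * dl.
Proof.
intros Hd. assert (H := exp_minus_affine_le (- dl)). rewrite Rabs_Ropp, Rabs_pos_eq in H by lra.
specialize (H ltac:(lra)).
assert (Q1 : 1 - exp (- dl) <= dl) by lra.
assert (Q2 : dl * (1 - 2 * dl) <= 1 - exp (- dl)) by nra.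
assert (L1 : ln (1 - exp (- dl)) <= ln dl) by (apply ln_le; nra).
assert (L2 : ln dl + ln (1 - 2 * dl) <= ln (1 - exp (- dl))).
{ rewrite <- ln_mult by lra. apply ln_le; nra. }
assert (L3 : - (4 * dl) <= ln (1 - 2 * dl)).
{ assert (E := exp_ineq1_le (- ln (1 - 2 * dl))). rewrite exp_Ropp, exp_ln in E by lra.
  assert (/ (1 - 2 * dl) <= 1 + 4 * dl); [|lra].
  apply (Rmult_le_reg_l (1 - 2 * dl)); [lra|]. rewrite Rinv_r by lra. nra. }
apply Rabs_le. lra.
Qed.

Lemma floor_S x : 1 <= x -> exists n, INR (S n) <= x < INR (S (S n)).
Proof.
intros Hx. destruct (nfloor_ex x) as [k Hk]; [lra|].
destruct k as [|k]; [simpl in Hk; lra|]. exists k. rewrite (S_INR (S k)). exact Hk.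
Qed.

(** With n + 1 the integer part of [x], the cut-off becomes a sharp upper limit of summation. *)
Lemma sum_n_riesz_floor L m x n N : (1 <= m)%nat -> 0 < x -> INR (S n) <= x < INR (S (S n)) -> x <= INR N ->
  sum_n (riesz_term L m x) N = sum_n (fun i => L (S i) * (1 - INR (S i) / x) ^ m) n.
Proof.
intros Hm Hx Hn HN.
assert (HNn : (n <= N)%nat). { assert (Q : INR (S n) <= INR N) by lra. apply INR_le in Q. lia. }
induction HNn as [|N' HN' IH] in HN |- *.
- apply sum_n_ext_loc. intros i Hi. unfold riesz_term. rewrite Rmax_right; [reflexivity|].
  apply le_n_S, le_INR in Hi. assert (INR (S i) / x <= 1) by (apply Rle_div_l; lra). lra.
- assert (G : forall M, (n <= M)%nat -> sum_n (riesz_term L m x) M = sum_n (fun i => L (S i) * (1 - INR (S i) / x) ^ m) n).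
  { intros M HM. induction HM as [|M HM IHM].
    - apply sum_n_ext_loc. intros i Hi. unfold riesz_term. rewrite Rmax_right; [reflexivity|].
      apply le_n_S, le_INR in Hi. assert (INR (S i) / x <= 1) by (apply Rle_div_l; lra). lra.
    - rewrite sum_n_succ, IHM. unfold riesz_term. rewrite Rmax_left, pow_i by
        (lia || (assert (Q : INR (S (S n)) <= INR (S (S M))) by (apply le_INR; lia);
        assert (1 <= INR (S (S M)) / x) by (apply Rle_div_r; lra); lra)).
      rewrite Rmult_0_r. apply Rplus_0_r. }
  apply G. lia.
Qed.

Lemma inv_riesz_bound m x n : INR (S n) <= x -> 0 <= inv_riesz m x n <= x.
Proof.
intros Hn. assert (P := lt_0_INR (S n) (Nat.lt_0_succ n)).
assert (T : forall i, (i <= n)%nat -> 0 <= / INR (S i) * (1 - INR (S i) / x) ^ m <= 1).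
{ intros i Hi. apply le_n_S, le_INR in Hi. destruct (inv_INR_S i) as [A1 A2].
  assert (U : 0 <= (1 - INR (S i) / x) ^ m <= 1).
  { assert (INR (S i) / x <= 1) by (apply Rle_div_l; lra). assert (0 <= INR (S i) / x) by (apply Rdiv_le_0_compat; lra).
    split; [apply pow_le; lra|]. assert (Q := pow_incr (1 - INR (S i) / x) 1 m ltac:(lra)). rewrite pow1 in Q. exact Q. }
  nra. }
unfold inv_riesz. split.
- apply sum_n_nonneg. intros i Hi; apply T, Hi.
- apply Rle_trans with (INR (S n)); [|exact Hn].
  eapply Rle_trans; [apply (sum_n_le_compat _ (fun _ => 1)); intros; apply T; assumption|].
  rewrite sum_n_const. lra.
Qed.

Lemma sum_n_shift (f : nat -> R) n : sum_n f (S n) = f 0%nat + sum_n (fun k => f (S k)) n.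
Proof.
induction n as [|n IH].
- rewrite sum_n_succ, !sum_O. reflexivity.
- rewrite sum_n_succ, IH, sum_n_succ. as_R_eq; ring.
Qed.

Theorem log_gf_expansion (L : nat -> R) D r rho A C0 :
  dirichlet_series L D -> poles_condition D r rho A C0 -> vertical_growth_condition D C0 ->
  exists Theta,
  filterlim (fun s : C => Cminus (D s) (Cdiv (RtoC (A 0%nat)) s)) (locally' (RtoC 0)) (locally (RtoC Theta)) /\
  forall eta, 0 < eta -> exists d0, 0 < d0 /\ forall dl, 0 < dl < d0 ->
    Rabs (Series (fun i => L (S i) * exp (- (dl * INR (S i))))
      - (sum_n (fun k => A (S k) * Gamma (rho (S k) + 1) / rho (S k) * Rpower dl (- rho (S k))) (pred r)
         - A 0%nat * ln dl + Theta - euler_gamma * A 0%nat)) <= eta.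
Proof.
intros HD HP HG.
destruct (riesz_asymptotics L D r rho A C0 HD HP HG) as (m & c & K & Th & B & q & Hm & Hc & HK & HB & Hq & HL & HTh & HR).
exists Th. split; [exact HTh|].
(* Subtracting A_0/k cancels the logarithm in the Riesz means and leaves - gamma A_0; what remains
   is a combination of powers, as [riesz_to_abel] requires. *)
set (L' := fun k => L k - A 0%nat * / INR k).
(* Index 0 carries the constant, with exponent rho 0 = 0. *)
set (kap := fun j => match j with O => Th - euler_gamma * A 0%nat | S k => A (S k) / rho (S k) * Kone_R m (rho (S k)) end).
assert (Hr := r_pos _ _ _ _ _ HP). assert (rho0 := rho_zero _ _ _ _ _ HP).
assert (PA := Rabs_pos (A 0%nat)).
assert (ESum : forall f : nat -> R, sum_n f r = f 0%nat + sum_n (fun k => f (S k)) (pred r)).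
{ intros f. destruct r as [|r']; [lia|]. apply sum_n_shift. }
assert (HL' : forall k, Rabs (L' (S k)) <= (B + Rabs (A 0%nat)) * Rpower (INR (S k)) q).
{ intros k. unfold L'. destruct (inv_INR_S k) as [A1 A2].
  unfold Rminus. eapply Rle_trans; [apply Rabs_triang|]. rewrite Rabs_Ropp, Rabs_mult, (Rabs_pos_eq (/ _)) by lra.
  rewrite Rmult_plus_distr_r. apply Rplus_le_compat; [apply HL|]. apply Rmult_le_compat_l; [exact PA|].
  apply Rle_trans with 1; [lra|]. rewrite <- (Rpower_O (INR (S k))) by lra. apply Rle_Rpower; lra. }
assert (HR' : forall eta, 0 < eta -> exists K0, forall x N, 1 <= x -> x <= INR N ->
     Rabs (sum_n (riesz_term L' m x) N - sum_n (fun j => kap j * Rpower x (rho j)) r) * x ^ m <= K0 + eta * x ^ m).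
{ intros eta He.
  assert (Split : forall x N n, 1 <= x -> x <= INR N -> INR (S n) <= x < INR (S (S n)) ->
    Rabs (sum_n (riesz_term L' m x) N - sum_n (fun j => kap j * Rpower x (rho j)) r) <=
    K * Rpower x (- c) + Rabs (A 0%nat) * Rabs (inv_riesz m x n - (ln x - harmonic m + euler_gamma))).
  { intros x N n Hx HN Hn.
    assert (E1 : sum_n (riesz_term L' m x) N = sum_n (riesz_term L m x) N - A 0%nat * inv_riesz m x n).
    { rewrite !(sum_n_riesz_floor _ m x n N) by (assumption || lra).
      unfold inv_riesz. rewrite <- sum_n_scal_l_R, <- sum_n_minus. apply sum_n_ext. intros i. as_R_eq. unfold L'. ring. }
    rewrite E1, ESum. unfold kap at 1. rewrite rho0, Rpower_O by lra. rewrite Rmult_1_r.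
    specialize (HR x N Hx HN). unfold riesz_main in HR.
    replace (sum_n (riesz_term L m x) N - A 0%nat * inv_riesz m x n -
      (Th - euler_gamma * A 0%nat + sum_n (fun k => kap (S k) * Rpower x (rho (S k))) (pred r)))
     with (sum_n (riesz_term L m x) N - (Th + (A 0%nat * (ln x - harmonic m) +
        sum_n (fun k => A (S k) / rho (S k) * Kone_R m (rho (S k)) * Rpower x (rho (S k))) (pred r)))
        + - (A 0%nat * (inv_riesz m x n - (ln x - harmonic m + euler_gamma)))) by (unfold kap; ring).
    eapply Rle_trans; [apply Rabs_triang|]. rewrite Rabs_Ropp, Rabs_mult. lra. }
  destruct (inv_riesz_lim m (eta / 2 / (Rabs (A 0%nat) + 1))) as [X1 [HX1 HX1b]]; [apply Rdiv_lt_0_compat; lra|].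
  destruct (Rpower_neg_small c K (eta / 2) Hc HK ltac:(lra)) as [X2 [HX2 HX2b]].
  set (X := Rmax X1 X2). assert (M1 : X1 <= X) by apply Rmax_l. assert (M2 : X2 <= X) by apply Rmax_r.
  set (hm := Rabs (harmonic m) + Rabs euler_gamma).
  assert (Hhm : 0 <= hm) by (unfold hm; generalize (Rabs_pos (harmonic m)), (Rabs_pos euler_gamma); lra).
  (* For x below [X] crude bounds suffice, and x^m <= X^m makes them a constant. *)
  exists ((K + Rabs (A 0%nat) * (2 * X + hm)) * X ^ m). intros x N Hx HN.
  destruct (floor_S x Hx) as [n Hn].
  assert (Pm : 0 < x ^ m) by (apply pow_lt; lra). assert (PXm : 0 < X ^ m) by (apply pow_lt; lra).
  assert (Q0 : 0 <= Rabs (A 0%nat) * (2 * X + hm)) by (apply Rmult_le_pos; lra).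
  specialize (Split x N n Hx HN Hn).
  destruct (Rle_dec X x) as [LX|LX].
  - assert (S1 : K * Rpower x (- c) <= eta / 2).
    { apply Rle_trans with (K * Rpower X2 (- c)); [|lra]. apply Rmult_le_compat_l; [exact HK|].
      rewrite !Rpower_Ropp. apply Rinv_le_contravar; [apply exp_pos|]. apply Rle_Rpower_l; lra. }
    assert (S2 : Rabs (A 0%nat) * Rabs (inv_riesz m x n - (ln x - harmonic m + euler_gamma)) <= eta / 2).
    { specialize (HX1b x n ltac:(lra) Hn).
      apply Rle_trans with (Rabs (A 0%nat) * (eta / 2 / (Rabs (A 0%nat) + 1))); [apply Rmult_le_compat_l; assumption|].
      replace (Rabs (A 0%nat) * (eta / 2 / (Rabs (A 0%nat) + 1))) with (eta / 2 * (Rabs (A 0%nat) / (Rabs (A 0%nat) + 1))) by (field; lra).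
      assert (Rabs (A 0%nat) / (Rabs (A 0%nat) + 1) <= 1) by (apply Rle_div_l; lra). nra. }
    apply Rle_trans with (eta * x ^ m); [apply Rmult_le_compat_r; lra|].
    assert (0 <= (K + Rabs (A 0%nat) * (2 * X + hm)) * X ^ m) by (apply Rmult_le_pos; lra). lra.
  - assert (S1 : K * Rpower x (- c) <= K * 1).
    { apply Rmult_le_compat_l; [exact HK|]. rewrite <- (Rpower_O x) by lra. apply Rle_Rpower; lra. }
    assert (S2 : Rabs (inv_riesz m x n - (ln x - harmonic m + euler_gamma)) <= 2 * X + hm).
    { destruct (inv_riesz_bound m x n (proj1 Hn)) as [I1 I2].
      assert (L1 : 0 <= ln x) by (rewrite <- ln_1; apply ln_le; lra).
      assert (L2 : ln x <= x). { generalize (ln_1p_bounds (x - 1) ltac:(lra)). replace (1 + (x - 1)) with x by ring. lra. }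
      unfold hm. assert (H1 := Rle_abs (harmonic m)). assert (H2 := Rle_abs euler_gamma).
      assert (H3 := Rle_abs (- harmonic m)). assert (H4 := Rle_abs (- euler_gamma)). rewrite Rabs_Ropp in H3, H4.
      apply Rabs_le. lra. }
    assert (S3 : Rabs (A 0%nat) * Rabs (inv_riesz m x n - (ln x - harmonic m + euler_gamma)) <= Rabs (A 0%nat) * (2 * X + hm)).
    { apply Rmult_le_compat_l; assumption. }
    apply Rle_trans with ((K + Rabs (A 0%nat) * (2 * X + hm)) * x ^ m); [apply Rmult_le_compat_r; lra|].
    apply Rle_trans with ((K + Rabs (A 0%nat) * (2 * X + hm)) * X ^ m).
    + apply Rmult_le_compat_l; [lra|]. apply pow_incr. lra.
    + assert (0 <= eta * x ^ m) by (apply Rmult_le_pos; lra). lra. }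
assert (Hrho : forall j, (j <= r)%nat -> 0 <= rho j) by (intros j Hj; apply (rho_nonneg _ _ _ _ _ _ HP Hj)).
intros eta He.
destruct (riesz_to_abel L' _ q m r kap rho Hm ltac:(lra) HL' Hrho HR' (eta / 2) ltac:(lra)) as [d0 [Hd0 Hd]].
exists (Rmin (Rmin d0 (1 / 4)) (eta / 2 / (4 * (Rabs (A 0%nat) + 1)))). split.
{ repeat apply Rmin_glb_lt; try lra. apply Rdiv_lt_0_compat; lra. }
intros dl [D0 D1].
assert (D2 : dl < d0) by (eapply Rlt_le_trans; [exact D1|]; eapply Rle_trans; [apply Rmin_l|apply Rmin_l]).
assert (D3 : dl < 1 / 4) by (eapply Rlt_le_trans; [exact D1|]; eapply Rle_trans; [apply Rmin_l|apply Rmin_r]).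
assert (D4 : dl < eta / 2 / (4 * (Rabs (A 0%nat) + 1))) by (eapply Rlt_le_trans; [exact D1|]; apply Rmin_r).
specialize (Hd dl ltac:(lra)).
assert (EX : ex_series (fun i => L (S i) * exp (- (dl * INR (S i))))).
{ apply ex_series_dom with (fun i => B * (Rpower (INR (S i)) q * exp (- (dl * INR (S i))))).
  - intros i. rewrite Rabs_mult, (Rabs_pos_eq (exp _)) by apply Rlt_le, exp_pos. rewrite <- Rmult_assoc.
    apply Rmult_le_compat_r; [apply Rlt_le, exp_pos|apply HL].
  - apply (ex_series_scal_l (K := R_AbsRing) B (fun i => Rpower (INR (S i)) q * exp (- (dl * INR (S i))))), ex_series_poly_exp; lra. }
assert (EX2 : ex_series (fun i => / INR (S i) * exp (- (dl * INR (S i))))).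
{ apply ex_series_dom with (fun i => Rpower (INR (S i)) 0 * exp (- (dl * INR (S i)))); [|apply ex_series_poly_exp; lra].
  intros i. destruct (inv_INR_S i) as [A1 A2].
  rewrite Rabs_mult, (Rabs_pos_eq (exp _)), (Rabs_pos_eq (/ _)) by (lra || apply Rlt_le, exp_pos).
  apply Rmult_le_compat_r; [apply Rlt_le, exp_pos|]. rewrite Rpower_O by lra. lra. }
(* The subtracted part is restored: the Abel sum of 1/k is -ln(1 - exp(-dl)), within O(dl) of -ln
   dl. *)
assert (E1 : Series (fun i => L' (S i) * exp (- (dl * INR (S i)))) =
  Series (fun i => L (S i) * exp (- (dl * INR (S i)))) + A 0%nat * ln (1 - exp (- dl))).
{ replace (ln (1 - exp (- dl))) with (- Series (fun i => / INR (S i) * exp (- (dl * INR (S i))))).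
  - rewrite <- Ropp_mult_distr_r, <- Series_scal_l. rewrite <- Series_opp, <- Series_plus.
    + apply Series_ext. intros i. unfold L'. ring.
    + exact EX.
    + apply (ex_series_opp (V := R_NormedModule) (fun i => A 0%nat * (/ INR (S i) * exp (- (dl * INR (S i)))))).
      apply (ex_series_scal_l (K := R_AbsRing) (A 0%nat) (fun i => / INR (S i) * exp (- (dl * INR (S i))))), EX2.
  - rewrite <- (Ropp_involutive (ln _)), <- log_series.
    + f_equal. apply Series_ext. intros i. f_equal. rewrite <- Rpower_pow by apply exp_pos. unfold Rpower. rewrite ln_exp. f_equal. ring.
    + split; [apply Rlt_le, exp_pos|]. rewrite <- exp_0. apply exp_increasing. lra. }
assert (E2 : sum_n (fun j => kap j * (Rpower dl (- rho j) * (gam (rho j + INR m) / INR (fact m)))) r =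
  Th - euler_gamma * A 0%nat + sum_n (fun k => A (S k) * Gamma (rho (S k) + 1) / rho (S k) * Rpower dl (- rho (S k))) (pred r)).
{ assert (Pf : 0 < INR (fact m)) by (apply lt_0_INR, lt_O_fact).
  rewrite ESum. f_equal.
  - unfold kap. rewrite rho0, Rplus_0_l, gam_INR, Ropp_0, Rpower_O by lra. field. lra.
  - apply sum_n_ext_loc. intros k Hk. as_R_eq.
    assert (Hp := rho_pos _ _ _ _ _ (S k) HP ltac:(lia)).
    rewrite Gamma_gam by lra. unfold kap.
    replace (A (S k) / rho (S k) * Kone_R m (rho (S k)) * (Rpower dl (- rho (S k)) * (gam (rho (S k) + INR m) / INR (fact m))))
      with (A (S k) / rho (S k) * Rpower dl (- rho (S k)) * (Kone_R m (rho (S k)) * gam (rho (S k) + INR m)) / INR (fact m)) by (field; lra).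
    rewrite Kone_R_gam by lra. field. lra. }
rewrite E1, E2 in Hd.
assert (LB := ln_one_minus_exp dl ltac:(lra)).
assert (D5 : Rabs (A 0%nat) * (4 * dl) <= eta / 2).
{ apply Rlt_le in D4. apply Rle_div_r in D4; [|lra]. nra. }
match goal with |- Rabs ?z <= _ => match type of Hd with Rabs ?w <= _ =>
  replace z with (w + - (A 0%nat * (ln (1 - exp (- dl)) - ln dl))) by ring end end.
eapply Rle_trans; [apply Rabs_triang|]. rewrite Rabs_Ropp, Rabs_mult.
assert (Rabs (A 0%nat) * Rabs (ln (1 - exp (- dl)) - ln dl) <= Rabs (A 0%nat) * (4 * dl)) by (apply Rmult_le_compat_l; assumption).
lra.
Qed.

(** * The generating function on circles *)

Lemma Rabs_mult_le_1 u v : Rabs v <= 1 -> Rabs (u * v) <= Rabs u.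
Proof. intros H. rewrite Rabs_mult. generalize (Rabs_pos u); nra. Qed.

Lemma CV_radius_gt_abs (a : nat -> R) x : Rbar_le 1 (CV_radius a) -> Rabs x < 1 -> Rbar_lt (Rabs x) (CV_radius a).
Proof. intros H Hx. eapply Rbar_lt_le_trans; [|exact H]. exact Hx. Qed.

Lemma is_derive_PSeries_ge_1 (a : nat -> R) x : Rbar_le 1 (CV_radius a) -> Rabs x < 1 ->
  is_derive (PSeries a) x (PSeries (PS_derive a) x).
Proof. intros H Hx. apply is_derive_PSeries, CV_radius_gt_abs; assumption. Qed.

(** The coefficient form of f' = (log f)' f. It carries an identity known on a real interval over to
    complex arguments, because the series with factors cos(n th) and sin(n th) involve the
    coefficients only. *)
Lemma exp_log_recursion (a l : nat -> R) :
  Rbar_le 1 (CV_radius a) -> Rbar_le 1 (CV_radius l) ->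
  (forall x, Rabs x < 1 -> PSeries a x = exp (PSeries l x)) ->
  forall n, PS_derive a n = PS_mult (PS_derive l) a n.
Proof.
intros Ha Hl H n.
assert (Hdl : Rbar_le 1 (CV_radius (PS_derive l))) by (rewrite CV_radius_derive; exact Hl).
assert (Hda : Rbar_le 1 (CV_radius (PS_derive a))) by (rewrite CV_radius_derive; exact Ha).
apply PSeries_ext_recip.
- eapply Rbar_lt_le_trans; [|exact Hda]. simpl; lra.
- destruct (Rbar_lt_le_dec 0 (CV_radius (PS_mult (PS_derive l) a))) as [L|L]; [exact L|exfalso].
  assert (E : ex_pseries (PS_mult (PS_derive l) a) (1 / 2)).
  { apply ex_pseries_mult; apply CV_radius_gt_abs; try assumption; rewrite Rabs_pos_eq; lra. }
  assert (Q : Rbar_lt (CV_radius (PS_mult (PS_derive l) a)) (Rabs (1 / 2))).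
  { eapply Rbar_le_lt_trans; [exact L|]. simpl. rewrite Rabs_pos_eq; lra. }
  apply CV_disk_outside in Q. apply Q. apply ex_series_lim_0. apply ex_pseries_R, E.
- exists (mkposreal 1 Rlt_0_1). intros y Hy.
  assert (Hy1 : Rabs y < 1).
  { assert (Q : Rabs (y - 0) < 1) by exact Hy. rewrite Rminus_0_r in Q. exact Q. }
  rewrite PSeries_mult by (apply CV_radius_gt_abs; assumption).
  assert (D1 := is_derive_PSeries_ge_1 a y Ha Hy1).
  assert (D2 : is_derive (PSeries a) y (PSeries (PS_derive l) y * PSeries a y)).
  { rewrite (H y Hy1).
    apply is_derive_ext_loc with (fun x => exp (PSeries l x)).
    - assert (Pd : 0 < 1 - Rabs y) by lra. exists (mkposreal _ Pd). intros z Hz. symmetry. apply H.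
      assert (Q : Rabs (z - y) < 1 - Rabs y) by exact Hz.
      replace z with (z - y + y) by ring. eapply Rle_lt_trans; [apply Rabs_triang|]. lra.
    - apply (is_derive_comp exp (PSeries l) y (exp (PSeries l y)) (PSeries (PS_derive l) y)).
      + apply is_derive_exp.
      + apply is_derive_PSeries_ge_1; assumption. }
  rewrite <- (is_derive_unique _ _ _ D1). apply is_derive_unique, D2.
Qed.

(* [(p, q)] are the real and imaginary parts of [a] at [x exp (i th)]; along the ray, the squared
   modulus satisfies the same first-order equation as [exp (2 Re (l (x exp (i th))))]. *)
Lemma circle_modulus (a l : nat -> R) (th x : R) :
  Rbar_le 1 (CV_radius a) -> Rbar_le 1 (CV_radius l) -> a 0%nat = 1 -> l 0%nat = 0 ->
  (forall x, Rabs x < 1 -> PSeries a x = exp (PSeries l x)) -> 0 <= x < 1 ->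
  PSeries (fun n => a n * cos (INR n * th)) x * PSeries (fun n => a n * cos (INR n * th)) x +
  PSeries (fun n => a n * sin (INR n * th)) x * PSeries (fun n => a n * sin (INR n * th)) x =
  exp (2 * PSeries (fun n => l n * cos (INR n * th)) x).
Proof.
intros Ha Hl Ha0 Hl0 H Hx. assert (Rec := exp_log_recursion a l Ha Hl H).
set (pc := fun n => a n * cos (INR n * th)). set (qc := fun n => a n * sin (INR n * th)).
set (uc := fun n => l n * cos (INR n * th)). set (vc := fun n => l n * sin (INR n * th)).
assert (Bc : forall (f : nat -> R) n, Rabs (f n * cos (INR n * th)) <= Rabs (f n)).
{ intros f n. apply Rabs_mult_le_1, Rabs_le, COS_bound. }
assert (Bs : forall (f : nat -> R) n, Rabs (f n * sin (INR n * th)) <= Rabs (f n)).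
{ intros f n. apply Rabs_mult_le_1, Rabs_le, SIN_bound. }
assert (Rp : Rbar_le 1 (CV_radius pc)) by (apply CV_radius_ge_1_dom with a; [apply Bc|exact Ha]).
assert (Rq : Rbar_le 1 (CV_radius qc)) by (apply CV_radius_ge_1_dom with a; [apply Bs|exact Ha]).
assert (Ru : Rbar_le 1 (CV_radius uc)) by (apply CV_radius_ge_1_dom with l; [apply Bc|exact Hl]).
assert (Rv : Rbar_le 1 (CV_radius vc)) by (apply CV_radius_ge_1_dom with l; [apply Bs|exact Hl]).
assert (Rdu : Rbar_le 1 (CV_radius (PS_derive uc))) by (rewrite CV_radius_derive; exact Ru).
assert (Rdv : Rbar_le 1 (CV_radius (PS_derive vc))) by (rewrite CV_radius_derive; exact Rv).
(* The addition theorems split the angle (n+1) th along the Cauchy product. *)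
assert (Ang : forall k n, (k <= n)%nat -> INR (S n) * th = INR (S k) * th + INR (n - k) * th).
{ intros k n Hk. rewrite <- Rmult_plus_distr_r, <- plus_INR. f_equal. f_equal. lia. }
assert (Ec : forall n, PS_derive pc n = PS_mult (PS_derive uc) pc n - PS_mult (PS_derive vc) qc n).
{ intros n. unfold PS_derive at 1, pc at 1.
  replace (INR (S n) * (a (S n) * cos (INR (S n) * th))) with (PS_derive a n * cos (INR (S n) * th)) by (unfold PS_derive; ring).
  rewrite Rec. unfold PS_mult. rewrite (Rmult_comm _ (cos _)), scal_sum, <- minus_sum. apply sum_eq. intros k Hk.
  rewrite (Ang k n Hk), cos_plus. unfold PS_derive, pc, qc, uc, vc. ring. }
assert (Es : forall n, PS_derive qc n = PS_mult (PS_derive vc) pc n + PS_mult (PS_derive uc) qc n).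
{ intros n. unfold PS_derive at 1, qc at 1.
  replace (INR (S n) * (a (S n) * sin (INR (S n) * th))) with (PS_derive a n * sin (INR (S n) * th)) by (unfold PS_derive; ring).
  rewrite Rec. unfold PS_mult. rewrite (Rmult_comm _ (sin _)), scal_sum, <- sum_plus. apply sum_eq. intros k Hk.
  rewrite (Ang k n Hk), sin_plus. unfold PS_derive, pc, qc, uc, vc. ring. }
set (U := PSeries (PS_derive uc)). set (V := PSeries (PS_derive vc)).
assert (Dp : forall t, Rabs t < 1 -> is_derive (PSeries pc) t (U t * PSeries pc t - V t * PSeries qc t)).
{ intros t Ht. replace (U t * PSeries pc t - V t * PSeries qc t) with (PSeries (PS_derive pc) t).
  - apply is_derive_PSeries_ge_1; assumption.
  - unfold U, V. rewrite <- !PSeries_mult by (apply CV_radius_gt_abs; assumption).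
    rewrite <- PSeries_minus by (apply ex_pseries_mult; apply CV_radius_gt_abs; assumption).
    apply PSeries_ext. intros n. rewrite Ec. reflexivity. }
assert (Dq : forall t, Rabs t < 1 -> is_derive (PSeries qc) t (V t * PSeries pc t + U t * PSeries qc t)).
{ intros t Ht. replace (V t * PSeries pc t + U t * PSeries qc t) with (PSeries (PS_derive qc) t).
  - apply is_derive_PSeries_ge_1; assumption.
  - unfold U, V. rewrite <- !PSeries_mult by (apply CV_radius_gt_abs; assumption).
    rewrite <- PSeries_plus by (apply ex_pseries_mult; apply CV_radius_gt_abs; assumption).
    apply PSeries_ext. intros n. rewrite Es. reflexivity. }
set (h := fun t => (PSeries pc t * PSeries pc t + PSeries qc t * PSeries qc t) * exp (- 2 * PSeries uc t)).
assert (Dh : forall t, Rabs t < 1 -> is_derive h t 0).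
{ intros t Ht. assert (D1 := Dp t Ht). assert (D2 := Dq t Ht). assert (D3 := is_derive_PSeries_ge_1 uc t Ru Ht). fold U in D3.
  unfold h. auto_derive.
  - repeat split; eexists; eassumption.
  - change (fun x0 => PSeries pc x0) with (PSeries pc). change (fun x0 => PSeries qc x0) with (PSeries qc).
    change (fun x0 => PSeries uc x0) with (PSeries uc).
    rewrite (is_derive_unique _ _ _ D1), (is_derive_unique _ _ _ D2), (is_derive_unique _ _ _ D3). unfold U. ring. }
assert (Eh : h x = h 0).
{ destruct (MVT_gen h 0 x (fun _ => 0)) as [c [_ Hc]].
  - rewrite Rmin_left, Rmax_right by lra. intros y Hy. apply Dh. rewrite Rabs_pos_eq; lra.
  - rewrite Rmin_left, Rmax_right by lra. intros y Hy.
    apply derivable_continuous_pt, ex_derive_Reals_0. eexists. apply Dh. rewrite Rabs_pos_eq; lra.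
  - lra. }
assert (E0 : h 0 = 1).
{ unfold h. rewrite !PSeries_0. unfold pc, qc, uc. simpl. rewrite Rmult_0_l, cos_0, sin_0, Ha0, Hl0.
  replace (- 2 * (0 * 1)) with 0 by ring. rewrite exp_0. ring. }
rewrite E0 in Eh. unfold h in Eh.
replace (- 2 * PSeries uc x) with (- (2 * PSeries uc x)) in Eh by ring. rewrite exp_Ropp in Eh.
assert (P := exp_pos (2 * PSeries uc x)).
apply (Rmult_eq_reg_r (/ exp (2 * PSeries uc x))); [|apply Rinv_neq_0_compat; lra].
rewrite Eh. field. lra.
Qed.

Lemma div_mod_succ m K : (1 <= K)%nat ->
  ((S m) mod K = 0 /\ (S m) / K = S (m / K))%nat \/ ((S m) mod K <> 0 /\ (S m) / K = m / K)%nat.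
Proof.
intros HK. assert (E := Nat.div_mod_eq m K). assert (B := Nat.mod_upper_bound m K ltac:(lia)).
set (q := (m / K)%nat) in *. set (r := (m mod K)%nat) in *.
destruct (Nat.eq_dec (S r) K) as [H|H].
- left. split.
  + symmetry. apply Nat.mod_unique with (S q); lia.
  + symmetry. apply Nat.div_unique with 0%nat; lia.
- right. split.
  + rewrite <- (Nat.mod_unique (S m) K q (S r)); lia.
  + symmetry. apply Nat.div_unique with (S r); lia.
Qed.

(** One row of the double sum over products j k: the terms sit at the multiples of [K], and the
    index [i] stands for the integer i + 1. *)
Lemma sparse_series (u : nat -> R) (K : nat) (l : R) : (1 <= K)%nat -> u 0%nat = 0 -> is_series u l ->
  is_series (fun i => if Nat.eqb (S i mod K) 0 then u (S i / K)%nat else 0) l.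
Proof.
intros HK Hu H.
assert (E : forall n, sum_n (fun i => if Nat.eqb (S i mod K) 0 then u (S i / K)%nat else 0) n = sum_n u (S n / K)).
{ induction n as [|n IH].
  - rewrite sum_O. assert (Z : (0 / K = 0)%nat) by (apply Nat.Div0.div_0_l).
    destruct (div_mod_succ 0 K HK) as [[A1 A2]|[A1 A2]]; rewrite A2, Z.
    + rewrite A1. simpl Nat.eqb. cbv iota. rewrite sum_n_succ, sum_O, Hu. as_R_eq; ring.
    + apply Nat.eqb_neq in A1. rewrite A1, sum_O, Hu. reflexivity.
  - rewrite sum_n_succ, IH. destruct (div_mod_succ (S n) K HK) as [[A1 A2]|[A1 A2]]; rewrite A2.
    + rewrite A1. simpl Nat.eqb. cbv iota. rewrite sum_n_succ. reflexivity.
    + apply Nat.eqb_neq in A1. rewrite A1. as_R_eq; ring. }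
apply is_series_lim. eapply is_lim_seq_ext; [intros n; symmetry; apply E|].
apply (is_lim_seq_subseq (sum_n u) l (fun n => (S n / K)%nat)); [|exact H].
intros P [N HN]. exists (K * N)%nat. intros n Hn. apply HN. apply Nat.div_le_lower_bound; lia.
Qed.

Lemma term_le_sum_n (a : nat -> R) i n : (forall k, 0 <= a k) -> (i <= n)%nat -> a i <= sum_n a n.
Proof.
intros H Hi. induction Hi as [|n Hi IH].
- destruct i as [|i]; [rewrite sum_O; lra|]. rewrite sum_n_succ.
  assert (0 <= sum_n a i) by (apply sum_n_nonneg; intros; apply H). lra.
- rewrite sum_n_succ. generalize (H (S n)). lra.
Qed.

Lemma two_terms_le_Series (a : nat -> R) i : (forall k, 0 <= a k) -> ex_series a -> (0 < i)%nat ->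
  a 0%nat + a i <= Series a.
Proof.
intros H He Hi. eapply Rle_trans; [|apply (sum_n_le_Series a i H He)].
destruct i as [|i]; [lia|]. rewrite sum_n_succ. apply Rplus_le_compat_r. apply term_le_sum_n; [exact H|lia].
Qed.

Lemma Series_finite (t : nat -> R) N : (forall k, (N < k)%nat -> t k = 0) -> ex_series t -> Series t = sum_n t N.
Proof.
intros H He. rewrite (Series_incr_n t (S N)) by (lia || exact He). simpl pred. rewrite <- sum_n_Reals.
rewrite Series_zero; [ring|]. intros k. apply H. lia.
Qed.

(** * The logarithm of the product *)

Section Setting.
Variables (a b c d xi : nat -> R) (l0 : nat).
Hypotheses (Hset : product_setting a b c d xi) (Hl0 : least_positive_index d l0).

Lemma xi_radius_ge_1 : Rbar_le 1 (CV_radius xi).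
Proof. rewrite (xi_radius _ _ _ _ _ Hset). apply Rbar_le_refl. Qed.

Lemma S_exp_log x : Rabs x < 1 -> PSeries d x = exp (PSeries xi x).
Proof. intros Hx. destruct (log_S _ _ _ _ _ Hset x Hx) as [P E]. rewrite <- E, exp_ln; [reflexivity|exact P]. Qed.

Lemma ex_series_d y : 0 <= y < 1 -> ex_series (fun n => d n * y ^ n).
Proof.
intros Hy. apply ex_series_Rabs. apply CV_disk_of_radius_ge_1; [apply (d_radius _ _ _ _ _ Hset)|]. rewrite Rabs_pos_eq; lra.
Qed.

Lemma ex_series_xi y : 0 <= y < 1 -> ex_series (fun n => Rabs (xi n) * y ^ n).
Proof.
intros Hy. apply ex_series_ext with (fun n => Rabs (xi n * y ^ n)).
- intros n. rewrite Rabs_mult, (Rabs_pos_eq (y ^ n)) by (apply pow_le; lra). reflexivity.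
- apply CV_disk_of_radius_ge_1; [apply xi_radius_ge_1|]. rewrite Rabs_pos_eq; lra.
Qed.

Lemma S_lower y : 0 <= y < 1 -> 1 + d l0 * y ^ l0 <= PSeries d y.
Proof.
intros Hy. destruct Hl0 as (L1 & L2 & _).
assert (T := two_terms_le_Series (fun n => d n * y ^ n) l0
  (fun n => Rmult_le_pos _ _ (d_nonneg _ _ _ _ _ Hset n) (pow_le y n (proj1 Hy))) (ex_series_d y Hy) L1).
cbv beta in T. rewrite (d_zero _ _ _ _ _ Hset), pow_O, Rmult_1_r in T. exact T.
Qed.

(** From ln(1 + u) >= u/(1 + u), with the denominator bounded by 1 + d_l0 because y < 1. *)
Lemma log_S_lower y : 0 <= y < 1 -> d l0 / (1 + d l0) * y ^ l0 <= ln (PSeries d y).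
Proof.
intros Hy. destruct Hl0 as (L1 & L2 & _). assert (P : 0 <= y ^ l0) by (apply pow_le; lra).
assert (P1 : y ^ l0 <= 1). { rewrite <- (pow1 l0). apply pow_incr; lra. }
assert (Q := S_lower y Hy). assert (Q0 : 0 <= d l0 * y ^ l0) by nra.
apply Rle_trans with (ln (1 + d l0 * y ^ l0)); [|apply ln_le; lra].
destruct (ln_1p_bounds (d l0 * y ^ l0) Q0) as [B _]. eapply Rle_trans; [|exact B].
replace (d l0 / (1 + d l0) * y ^ l0) with (d l0 * y ^ l0 * / (1 + d l0)) by (field; lra).
unfold Rdiv. apply Rmult_le_compat_l; [exact Q0|]. apply Rinv_le_contravar; nra.
Qed.

Lemma d_below j : (0 < j < l0)%nat -> d j = 0.
Proof.
intros Hj. destruct Hl0 as (_ & _ & L3). destruct (d_nonneg _ _ _ _ _ Hset j) as [P|P]; [|auto].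
specialize (L3 j ltac:(lia) P). lia.
Qed.

(** S is 1 + O(z^l0), so log S is O(z^l0); the coefficient recursion gives n xi_n = 0 for n below
    [l0]. *)
Lemma xi_below j : (j < l0)%nat -> xi j = 0.
Proof.
assert (Rec := exp_log_recursion d xi (d_radius _ _ _ _ _ Hset) xi_radius_ge_1 S_exp_log).
induction j as [j IH] using lt_wf_ind. intros Hj.
destruct j as [|n]; [apply (xi_zero _ _ _ _ _ Hset)|].
specialize (Rec n). unfold PS_derive at 1 in Rec. rewrite (d_below (S n)), Rmult_0_r in Rec by lia.
unfold PS_mult in Rec.
assert (E : sum_f_R0 (fun k => PS_derive xi k * d (n - k)%nat) n = INR (S n) * xi (S n)).
{ destruct n as [|n].
  - simpl sum_f_R0. unfold PS_derive. rewrite (d_zero _ _ _ _ _ Hset). ring.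
  - rewrite tech5. rewrite Nat.sub_diag, (d_zero _ _ _ _ _ Hset).
    rewrite (sum_eq _ (fun _ => 0)).
    + rewrite sum_cte. unfold PS_derive. ring.
    + intros i Hi. unfold PS_derive. rewrite IH by lia. ring. }
rewrite E in Rec. assert (P := lt_0_INR (S n) (Nat.lt_0_succ n)).
symmetry in Rec. apply Rmult_integral in Rec. destruct Rec; [lra|assumption].
Qed.

(** Since xi vanishes below [l0], a factor y^l0 can be taken out; this links the logarithm to the
    weights b_k a_k^l0 of condition (III). *)
Lemma xi_series_bound X : 0 < X < 1 -> exists K, 0 <= K /\ forall y, 0 <= y <= X ->
  Series (fun j => Rabs (xi j) * y ^ j) <= K * y ^ l0.
Proof.
intros HX. exists (Series (fun j => Rabs (xi j) * X ^ j) / X ^ l0).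
assert (PX : 0 < X ^ l0) by (apply pow_lt; lra).
assert (EX := ex_series_xi X ltac:(lra)).
assert (P0 : forall j, 0 <= Rabs (xi j) * X ^ j) by (intros; apply Rmult_le_pos; [apply Rabs_pos|apply pow_le; lra]).
split; [apply Rdiv_le_0_compat; [apply Series_nonneg; assumption|exact PX]|].
intros y Hy. unfold Rdiv. rewrite Rmult_assoc, <- Series_scal_r.
apply Series_le.
- intros j. split; [apply Rmult_le_pos; [apply Rabs_pos|apply pow_le; lra]|].
  destruct (le_lt_dec l0 j) as [L|L].
  + rewrite Rmult_assoc. apply Rmult_le_compat_l; [apply Rabs_pos|].
    replace j with (l0 + (j - l0))%nat by lia. rewrite !pow_add.
    replace (X ^ l0 * X ^ (j - l0) * (/ X ^ l0 * y ^ l0)) with (y ^ l0 * X ^ (j - l0)) by (field; lra).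
    apply Rmult_le_compat_l; [apply pow_le; lra|]. apply pow_incr; lra.
  + rewrite (xi_below j L), Rabs_R0. lra.
- apply (ex_series_scal_r (/ X ^ l0 * y ^ l0) (fun j => Rabs (xi j) * X ^ j)), EX.
Qed.

Lemma arg_range k x : 0 <= x < 1 -> 0 <= a (S k) * x ^ S k <= x.
Proof.
intros Hx. destruct (a_range _ _ _ _ _ Hset (S k) ltac:(lia)) as [A1 A2].
assert (P : 0 <= x ^ k) by (apply pow_le; lra).
assert (P1 : x ^ k <= 1). { rewrite <- (pow1 k). apply pow_incr; lra. }
simpl pow. assert (0 <= x * x ^ k <= x) by nra. nra.
Qed.

Lemma b_S_nonneg k : 0 <= b (S k).
Proof. apply (b_nonneg _ _ _ _ _ Hset); lia. Qed.

Lemma prod_exp_sum x N : (forall i, 0 < PSeries d (a (S i) * x ^ S i)) ->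
  prod_f_R0 (fun i => Rpower (PSeries d (a (S i) * x ^ S i)) (b (S i))) N =
  exp (sum_n (fun i => b (S i) * ln (PSeries d (a (S i) * x ^ S i))) N).
Proof.
intros H. induction N as [|N IH].
- rewrite sum_O. reflexivity.
- rewrite sum_n_succ, exp_plus. match goal with |- prod_f_R0 ?f (S ?n) = _ => change (prod_f_R0 f (S n)) with (prod_f_R0 f n * f (S n)) end.
  rewrite IH. reflexivity.
Qed.

Lemma S_pos x k : Rabs x < 1 -> 0 < PSeries d (a (S k) * x ^ S k).
Proof.
intros Hx. apply (log_S _ _ _ _ _ Hset). rewrite Rabs_mult, <- RPow_abs.
assert (Q := arg_range k (Rabs x) ltac:(split; [apply Rabs_pos|exact Hx])).
rewrite (Rabs_pos_eq (a (S k))) by (generalize (a_range _ _ _ _ _ Hset (S k) ltac:(lia)); lra). lra.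
Qed.

(** For positive [x] the partial products increase to f(x), and each log S(a_k x^k) is at least a
    fixed multiple of (a_k x^k)^l0. This is the source of absolute convergence of the double
    series. *)
Lemma weights_summable x : 0 < x < 1 -> ex_series (fun k => b (S k) * (a (S k) * x ^ S k) ^ l0).
Proof.
intros Hx. destruct Hl0 as (L1 & L2 & _).
assert (Hx1 : Rabs x < 1) by (rewrite Rabs_pos_eq; lra).
set (t := fun i => b (S i) * ln (PSeries d (a (S i) * x ^ S i))).
assert (Low : forall i, d l0 / (1 + d l0) * (b (S i) * (a (S i) * x ^ S i) ^ l0) <= t i).
{ intros i. unfold t. assert (Q := arg_range i x ltac:(lra)).
  assert (Q2 := log_S_lower (a (S i) * x ^ S i) ltac:(lra)).
  replace (d l0 / (1 + d l0) * (b (S i) * (a (S i) * x ^ S i) ^ l0)) with (b (S i) * (d l0 / (1 + d l0) * (a (S i) * x ^ S i) ^ l0)) by ring.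
  apply Rmult_le_compat_l; [apply b_S_nonneg|exact Q2]. }
assert (Kp : 0 < d l0 / (1 + d l0)) by (apply Rdiv_lt_0_compat; lra).
assert (W0 : forall i, 0 <= b (S i) * (a (S i) * x ^ S i) ^ l0).
{ intros i. apply Rmult_le_pos; [apply b_S_nonneg|apply pow_le]. apply (arg_range i x); lra. }
assert (Lim := f_product _ _ _ _ _ Hset x Hx1).
apply is_lim_seq_ext with (v := fun N => exp (sum_n t N)) in Lim; [|intros N; apply prod_exp_sum; intros i; apply S_pos, Hx1].
assert (Inc : forall N, exp (sum_n t N) <= exp (sum_n t (S N))).
{ intros N. rewrite sum_n_succ. assert (0 <= t (S N)) by (generalize (Low (S N)), (W0 (S N)); nra).
  apply exp_le_compat. lra. }
assert (Up := is_lim_seq_incr_compare _ _ Lim Inc).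
apply ex_series_bounded with ((1 + d l0) / d l0 * ln (PSeries c x)); [exact W0|].
intros n. assert (U := Up n).
assert (U2 : sum_n t n <= ln (PSeries c x)).
{ rewrite <- (ln_exp (sum_n t n)). apply ln_le; [apply exp_pos|exact U]. }
assert (U3 : d l0 / (1 + d l0) * sum_n (fun i => b (S i) * (a (S i) * x ^ S i) ^ l0) n <= sum_n t n).
{ rewrite <- sum_n_scal_l_R. apply sum_n_le_compat. intros; apply Low. }
apply (Rmult_le_reg_l (d l0 / (1 + d l0))); [exact Kp|].
replace (d l0 / (1 + d l0) * ((1 + d l0) / d l0 * ln (PSeries c x))) with (ln (PSeries c x)) by (field; lra). lra.
Qed.

(** Fubini on the pairs (k, j), then grouping by the product j k. The factor [phi] is 1 for log f
    itself and 1 - cos(m th) for its real part on circles; the bound 2 covers both. *)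
Theorem lambda_rearrangement x (phi : nat -> R) : Rabs x < 1 -> (forall m, Rabs (phi m) <= 2) ->
  let inner := fun k => Series (fun j => xi j * (a (S k) * x ^ S k) ^ j * phi (j * S k)%nat) in
  is_series (fun i => Lambda a b xi (S i) * (x ^ S i * phi (S i))) (Series (fun k => b (S k) * inner k)) /\
  ex_series (fun i => Rabs (Lambda a b xi (S i) * (x ^ S i * phi (S i)))) /\
  (forall k, ex_series (fun j => Rabs (xi j * (a (S k) * x ^ S k) ^ j * phi (j * S k)%nat))) /\
  ex_series (fun k => Rabs (b (S k) * inner k)).
Proof.
intros Hx Hphi inner.
(* Positive even for x = 0, as the summable weights are available only strictly between 0 and 1. *)
set (X := (Rabs x + 1) / 2). assert (Px := Rabs_pos x). assert (HX : 0 < X < 1) by (unfold X; lra).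
assert (HxX : Rabs x <= X) by (unfold X; lra).
destruct (xi_series_bound X HX) as [K [HK HKy]].
set (y := fun k => a (S k) * Rabs x ^ S k).
assert (Hy : forall k, 0 <= y k <= Rabs x) by (intros k; apply arg_range; lra).
set (u := fun k j => b (S k) * (xi j * (a (S k) * x ^ S k) ^ j * phi (j * S k)%nat)).
assert (Iabs : forall k j, Rabs (xi j * (a (S k) * x ^ S k) ^ j * phi (j * S k)%nat) <= 2 * (Rabs (xi j) * y k ^ j)).
{ intros k j. rewrite !Rabs_mult, <- RPow_abs, Rabs_mult, <- RPow_abs.
  rewrite (Rabs_pos_eq (a (S k))) by (generalize (a_range _ _ _ _ _ Hset (S k) ltac:(lia)); lra). fold (y k).
  rewrite (Rmult_comm 2). apply Rmult_le_compat; [|apply Rabs_pos|lra|apply Hphi].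
  apply Rmult_le_pos; [apply Rabs_pos|apply pow_le, Hy]. }
assert (Exi : forall k, ex_series (fun j => Rabs (xi j) * y k ^ j)).
{ intros k. apply ex_series_xi. generalize (Hy k). lra. }
assert (Ein : forall k, ex_series (fun j => Rabs (xi j * (a (S k) * x ^ S k) ^ j * phi (j * S k)%nat))).
{ intros k. apply ex_series_dom with (fun j => 2 * (Rabs (xi j) * y k ^ j)).
  - intros j. rewrite Rabs_Rabsolu. apply Iabs.
  - apply (ex_series_scal_l (K := R_AbsRing) 2 (fun j => Rabs (xi j) * y k ^ j)), Exi. }
assert (Eu : forall k, ex_series (fun j => Rabs (u k j))).
{ intros k. apply ex_series_ext with (fun j => b (S k) * Rabs (xi j * (a (S k) * x ^ S k) ^ j * phi (j * S k)%nat)).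
  - intros j. unfold u. rewrite (Rabs_mult (b (S k))), (Rabs_pos_eq (b (S k))) by apply b_S_nonneg. reflexivity.
  - apply (ex_series_scal_l (K := R_AbsRing) (b (S k)) (fun j => Rabs (xi j * (a (S k) * x ^ S k) ^ j * phi (j * S k)%nat))), Ein. }
assert (Su : forall k, Series (fun j => Rabs (u k j)) <= 2 * K * (b (S k) * (a (S k) * X ^ S k) ^ l0)).
{ intros k. assert (B := b_S_nonneg k).
  apply Rle_trans with (Series (fun j => b (S k) * (2 * (Rabs (xi j) * y k ^ j)))).
  - apply Series_le.
    + intros j. split; [apply Rabs_pos|]. unfold u. rewrite (Rabs_mult (b (S k))), (Rabs_pos_eq (b (S k))) by exact B.
      apply Rmult_le_compat_l; [exact B|apply Iabs].
    + apply (ex_series_scal_l (K := R_AbsRing) (b (S k)) (fun j => 2 * (Rabs (xi j) * y k ^ j))).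
      apply (ex_series_scal_l (K := R_AbsRing) 2 (fun j => Rabs (xi j) * y k ^ j)), Exi.
  - rewrite !Series_scal_l. 
    assert (Q := HKy (y k) ltac:(generalize (Hy k); lra)).
    assert (Q2 : y k ^ l0 <= (a (S k) * X ^ S k) ^ l0).
    { apply pow_incr. split; [apply Hy|]. unfold y. apply Rmult_le_compat_l.
      - generalize (a_range _ _ _ _ _ Hset (S k) ltac:(lia)); lra.
      - apply pow_incr; lra. }
    apply Rle_trans with (b (S k) * (2 * (K * y k ^ l0))).
    + apply Rmult_le_compat_l; [exact B|]. lra.
    + replace (2 * K * (b (S k) * (a (S k) * X ^ S k) ^ l0)) with (b (S k) * (2 * (K * (a (S k) * X ^ S k) ^ l0))) by ring.
      apply Rmult_le_compat_l; [exact B|]. apply Rmult_le_compat_l; [lra|]. apply Rmult_le_compat_l; assumption. }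
(* Row [k] spreads its terms over the multiples of k + 1, so that column [i] collects the divisors
   of i + 1. *)
set (t := fun k i => if Nat.eqb (S i mod S k) 0 then u k (S i / S k)%nat else 0).
assert (U0 : forall k, u k 0%nat = 0) by (intros k; unfold u; rewrite (xi_zero _ _ _ _ _ Hset); ring).
assert (Ta : forall k, is_series (fun i => Rabs (t k i)) (Series (fun j => Rabs (u k j)))).
{ intros k. apply is_series_ext with (fun i => if Nat.eqb (S i mod S k) 0 then Rabs (u k (S i / S k)%nat) else 0).
  - intros i. unfold t. destruct Nat.eqb; [reflexivity|rewrite Rabs_R0; reflexivity].
  - apply (sparse_series (fun j => Rabs (u k j)) (S k)); [lia|rewrite U0; apply Rabs_R0|apply Series_correct, Eu]. }
assert (Tb : forall k, Series (t k) = b (S k) * inner k).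
{ intros k. unfold inner. rewrite <- Series_scal_l. fold (u k). apply is_series_unique.
  apply (sparse_series (u k) (S k)); [lia|apply U0|]. apply Series_correct, ex_series_Rabs, Eu. }
assert (EW : ex_series (fun k => 2 * K * (b (S k) * (a (S k) * X ^ S k) ^ l0))).
{ apply (ex_series_scal_l (K := R_AbsRing) (2 * K) (fun k => b (S k) * (a (S k) * X ^ S k) ^ l0)), weights_summable, HX. }
destruct (series_fubini t (fun k => 2 * K * (b (S k) * (a (S k) * X ^ S k) ^ l0))) as (F1 & F2 & F3).
{ intros k. eexists; apply Ta. }
{ intros k. rewrite (is_series_unique _ _ (Ta k)). apply Su. }
{ exact EW. }
assert (TL : forall i, Series (fun k => t k i) = Lambda a b xi (S i) * (x ^ S i * phi (S i))).
{ intros i. rewrite (Series_finite _ i).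
  - unfold Lambda. rewrite <- sum_n_m_S. rewrite Rmult_comm.
    match goal with |- _ = _ * sum_n_m ?f 0 ?n => change (sum_n_m f 0 n) with (sum_n f n) end.
    rewrite <- sum_n_scal_l_R. apply sum_n_ext. intros k. as_R_eq.
    unfold t. destruct (Nat.eqb (S i mod S k) 0) eqn:E; [|ring]. apply Nat.eqb_eq in E.
    assert (Ei : (S i = (S i / S k) * S k)%nat) by (rewrite Nat.mul_comm; apply Nat.Div0.div_exact; exact E).
    unfold u. rewrite <- Ei. rewrite Rpow_mult_distr, <- pow_mult, (Nat.mul_comm (S k)), <- Ei. ring.
  - intros k Hk. unfold t. rewrite Nat.mod_small by lia. reflexivity.
  - apply ex_series_Rabs, F1. }
split; [|split; [|split]].
- apply is_series_ext with (fun m => Series (fun k => t k m)); [intros i; apply TL|].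
  rewrite (Series_ext _ (fun k => Series (t k))) by (intros k; symmetry; apply Tb). exact F2.
- apply ex_series_dom with (fun m => Series (fun k => Rabs (t k m))); [|exact F3].
  intros i. rewrite Rabs_Rabsolu, <- TL. apply Series_Rabs. apply F1.
- exact Ein.
- apply ex_series_dom with (fun k => 2 * K * (b (S k) * (a (S k) * X ^ S k) ^ l0)); [|exact EW].
  intros k. rewrite Rabs_Rabsolu, <- Tb. eapply Rle_trans; [apply Series_Rabs; eexists; apply Ta|].
  rewrite (is_series_unique _ _ (Ta k)). apply Su.
Qed.

Lemma Lambda_0 : Lambda a b xi 0 = 0.
Proof. exact (sum_n_m_zero (G := R_AbelianMonoid) _ 1 0 Nat.lt_0_1). Qed.

Lemma Lambda_abs_summable x : Rabs x < 1 -> ex_series (fun i => Rabs (Lambda a b xi (S i) * x ^ S i)).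
Proof.
intros Hx. destruct (lambda_rearrangement x (fun _ => 1) Hx) as (_ & H & _).
- intros _. rewrite Rabs_R1. lra.
- eapply ex_series_ext; [|exact H]. intros i. simpl. rewrite Rmult_1_r. reflexivity.
Qed.

Lemma Lambda_radius : Rbar_le 1 (CV_radius (Lambda a b xi)).
Proof.
apply CV_radius_ge_1_of_disk. intros x Hx. unfold CV_disk. apply ex_series_incr_1.
apply Lambda_abs_summable. rewrite Rabs_pos_eq; lra.
Qed.

Lemma PSeries_Lambda x : Rabs x < 1 ->
  PSeries (Lambda a b xi) x = Series (fun i => Lambda a b xi (S i) * x ^ S i).
Proof.
intros Hx. unfold PSeries. rewrite Series_incr_1.
- rewrite Lambda_0. ring.
- apply ex_series_Rabs, CV_disk_of_radius_ge_1; [apply Lambda_radius|exact Hx].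
Qed.

(** Real [x] suffice here; complex arguments are reached through [circle_modulus]. *)
Theorem f_exp_log x : Rabs x < 1 -> PSeries c x = exp (PSeries (Lambda a b xi) x).
Proof.
intros Hx. destruct (lambda_rearrangement x (fun _ => 1) Hx) as (H1 & _ & H3 & H4).
{ intros _. rewrite Rabs_R1. lra. }
assert (Ein : forall k, Series (fun j => xi j * (a (S k) * x ^ S k) ^ j * 1) = ln (PSeries d (a (S k) * x ^ S k))).
{ intros k. rewrite (S_exp_log (a (S k) * x ^ S k)).
  - rewrite ln_exp. apply Series_ext. intros; ring.
  - rewrite Rabs_mult, <- RPow_abs.
    assert (Q := arg_range k (Rabs x) ltac:(split; [apply Rabs_pos|exact Hx])).
    rewrite (Rabs_pos_eq (a (S k))) by (generalize (a_range _ _ _ _ _ Hset (S k) ltac:(lia)); lra). lra. }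
assert (Lim := f_product _ _ _ _ _ Hset x Hx).
apply is_lim_seq_ext with (v := fun N => exp (sum_n (fun i => b (S i) * ln (PSeries d (a (S i) * x ^ S i))) N)) in Lim;
  [|intros N; apply prod_exp_sum; intros i; apply S_pos, Hx].
assert (ES : ex_series (fun i => b (S i) * ln (PSeries d (a (S i) * x ^ S i)))).
{ apply ex_series_Rabs. eapply ex_series_ext; [|exact H4]. intros k. cbv beta. rewrite Ein. reflexivity. }
assert (Lim2 : is_lim_seq (fun N => exp (sum_n (fun i => b (S i) * ln (PSeries d (a (S i) * x ^ S i))) N))
   (exp (Series (fun i => b (S i) * ln (PSeries d (a (S i) * x ^ S i)))))).
{ apply (is_lim_seq_continuous exp). apply derivable_continuous_pt, derivable_pt_exp. apply Series_lim, ES. }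
apply is_lim_seq_unique in Lim. rewrite (is_lim_seq_unique _ _ Lim2) in Lim. injection Lim as Lim. rewrite <- Lim.
f_equal. symmetry. rewrite PSeries_Lambda by exact Hx.
rewrite (Series_ext _ (fun i => Lambda a b xi (S i) * (x ^ S i * 1))) by (intros; ring).
rewrite (is_series_unique _ _ H1). apply Series_ext. intros k. rewrite Ein. reflexivity.
Qed.

End Setting.

(** * Decay of the modulus off the real axis *)

Lemma one_minus_cos_ge t : 0 <= t <= 1 -> t * t / 4 <= 1 - cos t.
Proof.
intros Ht.
assert (E : 1 - cos t = 2 * (sin (t / 2) * sin (t / 2))).
{ replace t with (2 * (t / 2)) at 1 by field. rewrite cos_2a_sin. ring. }
assert (H := sin_minus_id_le (t / 2)). rewrite (Rabs_pos_eq (t / 2)) in H by lra.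
apply Rabs_le_between in H.
assert (Q : t / 2 * (t / 2 * (t / 2) / 2) <= t / 2 * (1 / 8)) by (apply Rmult_le_compat_l; nra).
assert (S1 : 7 / 8 * (t / 2) <= sin (t / 2)) by lra.
rewrite E. assert (7 / 8 * (t / 2) * (7 / 8 * (t / 2)) <= sin (t / 2) * sin (t / 2)) by (apply Rmult_le_compat; lra). nra.
Qed.

Lemma sum_n_window (t : nat -> R) h M : (forall k, 0 <= t k) ->
  sum_n (fun i => t (h + i)%nat) M <= sum_n t (h + M).
Proof.
intros H. induction M as [|M IH].
- rewrite sum_O, Nat.add_0_r. apply term_le_sum_n; [exact H|lia].
- rewrite sum_n_succ, Nat.add_succ_r, sum_n_succ. lra.
Qed.

Lemma sum_n_mono (t : nat -> R) n m : (forall k, 0 <= t k) -> (n <= m)%nat -> sum_n t n <= sum_n t m.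
Proof.
intros H Hn. induction Hn as [|m Hn IH]; [lra|]. rewrite sum_n_succ. generalize (H (S m)). lra.
Qed.

Lemma least_multiple psi c : 0 < psi -> 0 < c -> exists h, c <= INR h * psi <= c + psi.
Proof.
intros Hp Hc. destruct (nfloor_ex (c / psi)) as [n [N1 N2]]; [apply Rdiv_le_0_compat; lra|].
exists (S n). rewrite S_INR. split.
- assert (Q : c / psi <= INR n + 1) by lra. apply Rle_div_l in Q; lra.
- apply Rle_div_r in N1; lra.
Qed.

(* Far from multiples of [2 pi], the terms [k] and [k + h] with [h * psi] bounded away from
   [2 pi Z] cannot both be small. *)
Lemma cosine_sum_lower : exists c, 0 < c /\ forall N psi, (1 <= N)%nat -> Rabs psi <= PI ->
  c * INR N * Rmin 1 (INR N * psi * (INR N * psi)) <= sum_n (fun i => 1 - cos (INR (N + i) * psi)) (3 * N).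
Proof.
assert (C18 := one_minus_cos_ge (1 / 8) ltac:(lra)).
set (c := 1 - cos (1 / 8)) in *. assert (Hc : 0 < c) by lra.
exists (Rmin c (1 / 4)). split; [apply Rmin_glb_lt; lra|].
assert (M1 := Rmin_l c (1 / 4)). assert (M2 := Rmin_r c (1 / 4)).
set (c1 := Rmin c (1 / 4)) in *. assert (Hc1 : 0 < c1) by (unfold c1; apply Rmin_glb_lt; lra).
assert (Main : forall N psi, (1 <= N)%nat -> 0 <= psi <= PI ->
  c1 * INR N * Rmin 1 (INR N * psi * (INR N * psi)) <= sum_n (fun i => 1 - cos (INR (N + i) * psi)) (3 * N)).
{ intros N psi HN Hpsi. assert (HN1 : 1 <= INR N) by (apply (le_INR 1); exact HN).
  assert (T0 : forall i, 0 <= 1 - cos (INR (N + i) * psi)) by (intros i; generalize (COS_bound (INR (N + i) * psi)); lra).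
  set (s := INR N * psi) in *. assert (Hs : 0 <= s) by (unfold s; nra).
  destruct (Rle_dec s (1 / 4)) as [L|L].
  (* Here all angles lie in [s, 1], where 1 - cos t >= t^2/4. *)
  - apply Rle_trans with (1 / 4 * INR N * (s * s)).
    + assert (Rmin 1 (s * s) <= s * s) by apply Rmin_r.
      assert (0 <= Rmin 1 (s * s)) by (apply Rmin_glb; nra).
      apply Rmult_le_compat; try nra.
    + apply Rle_trans with (sum_n (fun _ => s * s / 4) (3 * N)).
      * rewrite sum_n_const. assert (INR N <= INR (S (3 * N))) by (apply le_INR; lia). nra.
      * apply sum_n_le_compat. intros i Hi.
        assert (Bi : INR N <= INR (N + i) <= 4 * INR N).
        { split; [apply le_INR; lia|]. replace 4 with (INR 4) by (simpl; ring). rewrite <- mult_INR. apply le_INR. lia. }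
        assert (Q : s <= INR (N + i) * psi <= 1) by (unfold s in *; nra).
        eapply Rle_trans; [|apply one_minus_cos_ge; lra]. nra.
  - assert (Hp : 0 < psi) by (unfold s in *; nra).
    (* The shift [h] brings h psi into [1/4, 1/4 + PI], so h psi/2 stays at least 1/8 away from
       multiples of PI; s > 1/4 makes h <= N. *)
    destruct (least_multiple psi (1 / 4) Hp ltac:(lra)) as [h [Hh1 Hh2]].
    assert (HhN : (h <= N)%nat).
    { assert (Q : (INR h - 1) * psi < INR N * psi) by (unfold s in *; lra).
      apply Rmult_lt_reg_r in Q; [|exact Hp].
      assert (Q2 : INR h < INR (S N)) by (rewrite S_INR; lra). apply INR_lt in Q2. lia. }
    assert (Hcos : Rabs (cos (INR h * psi / 2)) <= 1 - c).
    { assert (P := PI2_3_2). unfold c. replace (1 - (1 - cos (1 / 8))) with (cos (1 / 8)) by ring.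
      apply Rabs_le. split.
      - apply Rle_trans with (cos (PI - 1 / 8)); [rewrite Rtrigo_facts.cos_pi_minus; lra|apply cos_decr_1; lra].
      - apply cos_decr_1; lra. }
    (* 1 - cos(t - u) + 1 - cos(t + u) = 2 - 2 cos t cos u, with u = h psi/2. *)
    assert (Pair : forall i, 2 * c <= (1 - cos (INR (N + i) * psi)) + (1 - cos (INR (N + (h + i)) * psi))).
    { intros i. set (t := INR (N + i) * psi + INR h * psi / 2).
      replace (INR (N + i) * psi) with (t - INR h * psi / 2) by (unfold t; ring).
      replace (INR (N + (h + i)) * psi) with (t + INR h * psi / 2) by (unfold t; rewrite !plus_INR; field).
      rewrite cos_plus, cos_minus.
      assert (Q : cos t * cos (INR h * psi / 2) <= 1 - c).
      { eapply Rle_trans; [apply Rle_abs|]. rewrite Rabs_mult.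
        assert (Rabs (cos t) <= 1) by (apply Rabs_le, COS_bound). generalize (Rabs_pos (cos t)), (Rabs_pos (cos (INR h * psi / 2))). nra. }
      lra. }
    assert (A1 : sum_n (fun i => 1 - cos (INR (N + i) * psi)) (2 * N) <= sum_n (fun i => 1 - cos (INR (N + i) * psi)) (3 * N))
      by (apply sum_n_mono; [exact T0|lia]).
    assert (A2 : sum_n (fun i => 1 - cos (INR (N + (h + i)) * psi)) (2 * N) <= sum_n (fun i => 1 - cos (INR (N + i) * psi)) (3 * N)).
    { eapply Rle_trans; [apply (sum_n_window (fun i => 1 - cos (INR (N + i) * psi)) h (2 * N) T0)|].
      apply sum_n_mono; [exact T0|lia]. }
    assert (A3 : sum_n (fun _ => 2 * c) (2 * N) <= sum_n (fun i => 1 - cos (INR (N + i) * psi)) (2 * N) + sum_n (fun i => 1 - cos (INR (N + (h + i)) * psi)) (2 * N)).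
    { replace (sum_n (fun i => 1 - cos (INR (N + i) * psi)) (2 * N) + sum_n (fun i => 1 - cos (INR (N + (h + i)) * psi)) (2 * N))
        with (sum_n (fun i => (1 - cos (INR (N + i) * psi)) - - (1 - cos (INR (N + (h + i)) * psi))) (2 * N)).
      - apply sum_n_le_compat. intros i _. generalize (Pair i). lra.
      - rewrite sum_n_minus. rewrite (sum_n_ext (fun k => - (1 - cos (INR (N + (h + k)) * psi))) (fun k => -1 * (1 - cos (INR (N + (h + k)) * psi)))).
        + rewrite sum_n_scal_l_R. as_R_eq; ring.
        + intros k. as_R_eq. ring. }
    rewrite sum_n_const in A3.
    assert (INR N <= INR (S (2 * N))) by (apply le_INR; lia).
    assert (Rmin 1 (s * s) <= 1) by apply Rmin_l.
    assert (0 <= Rmin 1 (s * s)) by (apply Rmin_glb; nra).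
    assert (c1 * INR N * Rmin 1 (s * s) <= c * INR N * 1) by (apply Rmult_le_compat; nra). nra. }
intros N psi HN Hpsi. assert (Q := Main N (Rabs psi) HN ltac:(split; [apply Rabs_pos|exact Hpsi])).
replace (INR N * psi * (INR N * psi)) with (INR N * Rabs psi * (INR N * Rabs psi)).
2:{ unfold Rabs. destruct Rcase_abs; ring. }
eapply Rle_trans; [exact Q|]. apply Req_le, sum_n_ext. intros i. f_equal.
unfold Rabs. destruct Rcase_abs; [|reflexivity].
rewrite <- cos_neg. f_equal. ring.
Qed.

Lemma exp_neg_pow dl n : exp (- dl) ^ n = exp (- (dl * INR n)).
Proof. rewrite <- Rpower_pow by apply exp_pos. unfold Rpower. rewrite ln_exp. f_equal. ring. Qed.

Section Setting.
Variables (a b c d xi : nat -> R) (l0 : nat).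
Hypotheses (Hset : product_setting a b c d xi) (Hl0 : least_positive_index d l0).

(** With (al, be) the direction of S(y e^(i phi)), the difference S(y) - |S(y e^(i phi))| is a sum
    of terms d_n y^n (1 - cos of an angle) >= 0. Only n = 0 and n = l0 are kept: the vectors 1 and Y
    e^(i psi) cannot both point in the direction (al, be) unless Y = 0 or cos psi = 1. *)
Lemma log_modulus_gap y phi : 0 <= y < 1 ->
  d l0 * y ^ l0 * (1 - cos (INR l0 * phi)) / ((1 + d l0 * y ^ l0) * PSeries d y)
  <= ln (PSeries d y) - PSeries (fun n => xi n * cos (INR n * phi)) y.
Proof.
intros Hy. destruct Hl0 as (L1 & L2 & _).
assert (Hy1 : Rabs y < 1) by (rewrite Rabs_pos_eq; lra).
set (u := PSeries (fun n => xi n * cos (INR n * phi)) y).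
set (p := PSeries (fun n => d n * cos (INR n * phi)) y).
set (q := PSeries (fun n => d n * sin (INR n * phi)) y).
set (Sy := PSeries d y). set (psi := INR l0 * phi).
assert (E := circle_modulus d xi phi y (d_radius _ _ _ _ _ Hset) (xi_radius_ge_1 _ _ _ _ _ Hset)
  (d_zero _ _ _ _ _ Hset) (xi_zero _ _ _ _ _ Hset) (S_exp_log _ _ _ _ _ Hset) Hy). fold p q u in E.
replace (2 * u) with (u + u) in E by ring. rewrite exp_plus in E.
set (R := exp u) in *. assert (PR : 0 < R) by apply exp_pos.
set (al := p / R). set (be := q / R).
assert (Eab : al * al + be * be = 1) by (unfold al, be; replace (p / R * (p / R) + q / R * (q / R)) with ((p * p + q * q) / (R * R)) by (field; lra); rewrite E; field; lra).
assert (ER : al * p + be * q = R) by (unfold al, be; replace (p / R * p + q / R * q) with ((p * p + q * q) / R) by (field; lra); rewrite E; field; lra).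
assert (CS : forall w, al * cos w + be * sin w <= 1).
{ intros w. assert (T := sin2_cos2 w). unfold Rsqr in T. assert (Q1 := Rle_0_sqr (al - cos w)). assert (Q2 := Rle_0_sqr (be - sin w)). unfold Rsqr in Q1, Q2. lra. }
assert (Ed := ex_series_d _ _ _ _ _ Hset y Hy).
assert (Pd : forall n, 0 <= d n * y ^ n) by (intros n; apply Rmult_le_pos; [apply (d_nonneg _ _ _ _ _ Hset)|apply pow_le; lra]).
assert (Ep : ex_series (fun n => d n * cos (INR n * phi) * y ^ n)).
{ apply ex_series_dom with (fun n => d n * y ^ n); [|exact Ed]. intros n.
  replace (d n * cos (INR n * phi) * y ^ n) with (d n * y ^ n * cos (INR n * phi)) by ring.
  eapply Rle_trans; [apply Rabs_mult_le_1, Rabs_le, COS_bound|]. rewrite Rabs_pos_eq; [lra|apply Pd]. }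
assert (Eq : ex_series (fun n => d n * sin (INR n * phi) * y ^ n)).
{ apply ex_series_dom with (fun n => d n * y ^ n); [|exact Ed]. intros n.
  replace (d n * sin (INR n * phi) * y ^ n) with (d n * y ^ n * sin (INR n * phi)) by ring.
  eapply Rle_trans; [apply Rabs_mult_le_1, Rabs_le, SIN_bound|]. rewrite Rabs_pos_eq; [lra|apply Pd]. }
set (t := fun n => d n * y ^ n * (1 - (al * cos (INR n * phi) + be * sin (INR n * phi)))).
assert (Et : is_series t (Sy - R)).
{ rewrite <- ER. unfold Sy, p, q, PSeries.
  replace (Series (fun k => d k * y ^ k) - (al * Series (fun k => d k * cos (INR k * phi) * y ^ k) + be * Series (fun k => d k * sin (INR k * phi) * y ^ k)))
    with (minus (Series (fun k => d k * y ^ k)) (plus (scal al (Series (fun k => d k * cos (INR k * phi) * y ^ k))) (scal be (Series (fun k => d k * sin (INR k * phi) * y ^ k))))) by reflexivity.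
  eapply is_series_ext; [|apply (is_series_minus (V := R_NormedModule) _ _ _ _ (Series_correct _ Ed)
    (is_series_plus (V := R_NormedModule) _ _ _ _ (is_series_scal (V := R_NormedModule) al _ _ (Series_correct _ Ep)) (is_series_scal (V := R_NormedModule) be _ _ (Series_correct _ Eq))))].
  intros n. unfold t, minus, plus, opp, scal; simpl. unfold mult; simpl. as_R_eq. ring. }
assert (Pt : forall n, 0 <= t n) by (intros n; unfold t; apply Rmult_le_pos; [apply Pd|generalize (CS (INR n * phi)); lra]).
assert (T2 := two_terms_le_Series t l0 Pt ltac:(eexists; exact Et) L1). rewrite (is_series_unique _ _ Et) in T2.
unfold t in T2. rewrite (d_zero _ _ _ _ _ Hset), pow_O in T2. simpl INR at 1 2 in T2. rewrite Rmult_0_l, cos_0, sin_0 in T2.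
fold psi in T2. set (Y := d l0 * y ^ l0) in *.
assert (PY : 0 <= Y) by (unfold Y; apply Pd).
(* [V] is at most |1 + Y e^(i psi)|, and [W] bounds this modulus: its square exceeds (1 + Y)^2 - 2 Y
   (1 - cos psi) by a square. *)
set (V := al * (1 + Y * cos psi) + be * (Y * sin psi)).
set (W := (1 + Y) - Y * (1 - cos psi) / (1 + Y)).
assert (Cb := COS_bound psi).
assert (HW0 : 0 <= W).
{ unfold W. assert (Y * (1 - cos psi) / (1 + Y) <= 1 + Y); [|lra]. apply Rle_div_l; nra. }
assert (HV : V * V <= W * W).
{ assert (V * V <= (1 + Y * cos psi) * (1 + Y * cos psi) + Y * sin psi * (Y * sin psi)).
  { unfold V. set (g := 1 + Y * cos psi). set (g' := Y * sin psi).
    assert (0 <= (al * g' - be * g) * (al * g' - be * g)) by apply Rle_0_sqr.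
    replace (g * g + g' * g') with ((al * al + be * be) * (g * g + g' * g')) by (rewrite Eab; ring). nra. }
  assert (T := sin2_cos2 psi). unfold Rsqr in T.
  assert ((1 + Y * cos psi) * (1 + Y * cos psi) + Y * sin psi * (Y * sin psi) = (1 + Y) * (1 + Y) - 2 * Y * (1 - cos psi)).
  { replace ((1 + Y * cos psi) * (1 + Y * cos psi) + Y * sin psi * (Y * sin psi))
      with (1 + 2 * Y * cos psi + Y * Y * (sin psi * sin psi + cos psi * cos psi)) by ring. rewrite T. ring. }
  assert (W * W = (1 + Y) * (1 + Y) - 2 * Y * (1 - cos psi) + (Y * (1 - cos psi) / (1 + Y)) * (Y * (1 - cos psi) / (1 + Y))).
  { unfold W. field. lra. }
  assert (0 <= (Y * (1 - cos psi) / (1 + Y)) * (Y * (1 - cos psi) / (1 + Y))) by apply Rle_0_sqr. lra. }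
assert (HVW : V <= W) by nra.
assert (G : Y * (1 - cos psi) / (1 + Y) <= Sy - R).
{ unfold V, W in HVW. lra. }
assert (PS : 0 < Sy) by (apply (log_S _ _ _ _ _ Hset y Hy1)).
(* ln(R/S) <= R/S - 1 turns the gap between the moduli into a gap between the logarithms. *)
assert (Ln : u - ln Sy <= R / Sy - 1).
{ assert (Q := exp_ineq1_le (u - ln Sy)). unfold Rminus in Q at 2. rewrite exp_plus, exp_Ropp, exp_ln in Q by exact PS. fold R in Q. unfold Rdiv. lra. }
apply Rle_trans with ((Sy - R) / Sy).
- replace (Y * (1 - cos psi) / ((1 + Y) * Sy)) with (Y * (1 - cos psi) / (1 + Y) / Sy) by (field; lra).
  apply Rmult_le_compat_r; [apply Rlt_le, Rinv_0_lt_compat, PS|exact G].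
- replace ((Sy - R) / Sy) with (1 - R / Sy) by (field; lra). lra.
Qed.

(** Only a window of k between 1/dl and 8/dl is kept: there exp(-k dl) is bounded below, and
    condition (III) makes each weight at least a multiple of dl^(1-rr). Since the gaps depend on
    cos(l0 k th), [cosine_sum_lower] is applied to psi = l0 th, whence the restriction on [th]. *)
Theorem central_lower_bound (rr C2 : R) : 0 < C2 ->
  (forall k, (1 <= k)%nat -> C2 * Rpower (INR k) (rr - 1) <= b k * a k ^ l0) ->
  exists c0, 0 < c0 /\ forall dl th, 0 < dl < 1 -> INR l0 * Rabs th <= PI ->
  c0 * Rpower dl (- rr) * Rmin 1 (th / dl * (th / dl)) <=
  Series (fun i => Lambda a b xi (S i) * (exp (- (dl * INR (S i))) * (1 - cos (INR (S i) * th)))).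
Proof.
intros HC2 Hb. destruct Hl0 as (L1 & L2 & L3).
destruct cosine_sum_lower as [cs [Hcs Hcos]].
set (S1 := PSeries d (exp (- (1)))). 
assert (He1 := exp_neg_range 1 Rlt_0_1).
assert (PS1 : 0 < S1) by (apply (log_S _ _ _ _ _ Hset); rewrite Rabs_pos_eq; lra).
set (kap := d l0 / ((1 + d l0) * S1)). assert (Pk : 0 < kap) by (apply Rdiv_lt_0_compat; [exact L2|apply Rmult_lt_0_compat; lra]).
(* The worst case of (k dl)^(rr-1) for k dl in [1, 8], whatever the sign of rr - 1. *)
set (cr := Rpower 8 (- Rabs (rr - 1))). assert (Pcr : 0 < cr) by apply exp_pos.
(* Lower bound for exp(-l0 k dl) on the window. *)
set (ce := exp (- (8 * INR l0))). assert (Pce : 0 < ce) by apply exp_pos.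
exists (kap * ce * C2 * cr * cs). split; [repeat first [assumption | apply Rmult_lt_0_compat]|].
intros dl th Hd Hth.
set (x := exp (- dl)). assert (Hx : 0 < x < 1) by (apply exp_neg_range; lra).
assert (Hx1 : Rabs x < 1) by (rewrite Rabs_pos_eq; lra).
assert (Hphi : forall m, Rabs (1 - cos (INR m * th)) <= 2) by (intros m; apply Rabs_le; generalize (COS_bound (INR m * th)); lra).
destruct (lambda_rearrangement a b c d xi l0 Hset Hl0 x (fun m => 1 - cos (INR m * th)) Hx1 Hphi) as (R1 & _ & R3 & R4).
set (inner := fun k => Series (fun j => xi j * (a (S k) * x ^ S k) ^ j * (1 - cos (INR (j * S k) * th)))) in *.
assert (Hy : forall k, 0 <= a (S k) * x ^ S k <= x) by (intros k; apply (arg_range a b c d xi Hset); lra).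
assert (Ein : forall k, inner k = ln (PSeries d (a (S k) * x ^ S k)) - PSeries (fun n => xi n * cos (INR n * (INR (S k) * th))) (a (S k) * x ^ S k)).
{ intros k. set (y := a (S k) * x ^ S k). assert (Hyk : 0 <= y < 1) by (generalize (Hy k); fold y; lra).
  rewrite (S_exp_log _ _ _ _ _ Hset y), ln_exp by (rewrite Rabs_pos_eq; lra).
  assert (E1 := ex_series_xi _ _ _ _ _ Hset y Hyk).
  assert (X1 : ex_series (fun n => xi n * y ^ n)).
  { apply ex_series_dom with (fun n => Rabs (xi n) * y ^ n); [|exact E1]. intros n. rewrite Rabs_mult, (Rabs_pos_eq (y ^ n)) by (apply pow_le; lra). lra. }
  assert (X2 : ex_series (fun n => xi n * cos (INR n * (INR (S k) * th)) * y ^ n)).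
  { apply ex_series_dom with (fun n => Rabs (xi n) * y ^ n); [|exact E1]. intros n.
    rewrite Rabs_mult, (Rabs_pos_eq (y ^ n)) by (apply pow_le; lra). apply Rmult_le_compat_r; [apply pow_le; lra|].
    apply Rabs_mult_le_1, Rabs_le, COS_bound. }
  unfold PSeries. rewrite <- Series_minus by assumption. unfold inner. fold y. apply Series_ext. intros n.
  rewrite mult_INR. replace (INR n * INR (S k) * th) with (INR n * (INR (S k) * th)) by ring. ring. }
assert (Gap : forall k, d l0 * (a (S k) * x ^ S k) ^ l0 * (1 - cos (INR l0 * (INR (S k) * th))) / ((1 + d l0 * (a (S k) * x ^ S k) ^ l0) * PSeries d (a (S k) * x ^ S k)) <= inner k).
{ intros k. rewrite Ein. apply log_modulus_gap. generalize (Hy k); lra. }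
assert (In0 : forall k, 0 <= inner k).
{ intros k. eapply Rle_trans; [|apply Gap].
  assert (P0 : 0 <= d l0 * (a (S k) * x ^ S k) ^ l0) by (apply Rmult_le_pos; [lra|apply pow_le, Hy]).
  apply Rdiv_le_0_compat.
  - apply Rmult_le_pos; [exact P0|]. generalize (COS_bound (INR l0 * (INR (S k) * th))); lra.
  - apply Rmult_lt_0_compat; [lra|]. apply (log_S _ _ _ _ _ Hset). generalize (Hy k); intros; rewrite Rabs_pos_eq; lra. }
assert (Tn : forall k, 0 <= b (S k) * inner k) by (intros k; apply Rmult_le_pos; [apply (b_nonneg _ _ _ _ _ Hset); lia|apply In0]).
assert (ES : ex_series (fun k => b (S k) * inner k)) by (apply ex_series_Rabs, R4).
rewrite (Series_ext _ (fun i => Lambda a b xi (S i) * (x ^ S i * (1 - cos (INR (S i) * th))))).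
2:{ intros i. unfold x. rewrite exp_neg_pow. reflexivity. }
rewrite (is_series_unique _ _ R1).
destruct (floor_S (/ dl)) as [n0 [Hn1 Hn2]].
{ rewrite <- Rinv_1. apply Rinv_le_contravar; lra. }
(* The integer with 1/dl < N <= 2/dl; the window is N, ..., 4 N. *)
set (N := S (S n0)).
assert (Hid : 1 < / dl) by (rewrite <- Rinv_1; apply Rinv_lt_contravar; lra).
assert (HN2 : INR N <= 2 / dl) by (unfold N; rewrite S_INR; unfold Rdiv; lra).
assert (HN1 : / dl < INR N) by exact Hn2.
set (psi := INR l0 * th).
assert (Win : forall i, (i <= 3 * N)%nat ->
   kap * ce * C2 * (cr * Rpower dl (1 - rr)) * (1 - cos (INR (N + i) * psi)) <= b (S (S n0 + i)) * inner (S n0 + i)%nat).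
{ intros i Hi. set (k := (S n0 + i)%nat).
  assert (Ek : S k = (N + i)%nat) by (unfold k, N; lia).
  assert (Bk : / dl <= INR (S k) <= 8 / dl).
  { rewrite Ek. split.
    - apply Rle_trans with (INR N); [lra|]. apply le_INR; lia.
    - apply Rle_trans with (INR (4 * N)); [apply le_INR; lia|]. rewrite mult_INR. simpl (INR 4).
      unfold Rdiv in *. lra. }
  assert (Bkd : 1 <= INR (S k) * dl <= 8).
  { destruct Bk as [B1 B2]. split.
    - apply (Rmult_le_compat_r dl) in B1; [|lra]. rewrite Rinv_l in B1; lra.
    - apply Rle_div_r in B2; [exact B2|lra]. }
  set (y := a (S k) * x ^ S k). assert (Hyk := Hy k). fold y in Hyk.
  destruct (a_range _ _ _ _ _ Hset (S k) ltac:(lia)) as [A1 A2].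
  assert (Ex : x ^ S k = exp (- (dl * INR (S k)))) by apply exp_neg_pow.
  assert (Hy1 : y <= exp (- (1))).
  { unfold y. rewrite Ex. apply Rle_trans with (1 * exp (- (dl * INR (S k)))); [apply Rmult_le_compat_r; [apply Rlt_le, exp_pos|exact A2]|].
    rewrite Rmult_1_l. apply exp_le_compat. lra. }
  assert (Hyl : ce * a (S k) ^ l0 <= y ^ l0).
  { unfold y. rewrite Rpow_mult_distr, (Rmult_comm (_ ^ l0)). apply Rmult_le_compat_r; [apply pow_le; lra|].
    rewrite Ex, exp_neg_pow.
    unfold ce. apply exp_le_compat. assert (0 <= INR l0) by apply pos_INR. nra. }
  assert (Py : 0 <= y ^ l0) by (apply pow_le; lra).
  assert (Py1 : y ^ l0 <= 1). { rewrite <- (pow1 l0). apply pow_incr; lra. }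
  assert (HS : 0 < PSeries d y <= S1).
  { split; [apply (log_S _ _ _ _ _ Hset); rewrite Rabs_pos_eq; lra|].
    unfold S1, PSeries. apply Series_le.
    - intros m. assert (Pdm := d_nonneg _ _ _ _ _ Hset m). split; [apply Rmult_le_pos; [exact Pdm|apply pow_le; lra]|].
      apply Rmult_le_compat_l; [exact Pdm|]. apply pow_incr; lra.
    - apply (ex_series_d _ _ _ _ _ Hset). lra. }
  set (v := 1 - cos (INR (N + i) * psi)). assert (Pv : 0 <= v) by (unfold v; generalize (COS_bound (INR (N + i) * psi)); lra).
  assert (G := Gap k). fold y in G.
  replace (INR l0 * (INR (S k) * th)) with (INR (N + i) * psi) in G by (rewrite Ek; unfold psi; ring). fold v in G.
  assert (G2 : kap * y ^ l0 * v <= inner k).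
  { eapply Rle_trans; [|exact G].
    replace (kap * y ^ l0 * v) with (d l0 * y ^ l0 * v * / ((1 + d l0) * S1)) by (unfold kap; field; lra).
    unfold Rdiv. apply Rmult_le_compat_l; [apply Rmult_le_pos; [apply Rmult_le_pos; lra|exact Pv]|].
    apply Rinv_le_contravar; [apply Rmult_lt_0_compat; nra|]. apply Rmult_le_compat; nra. }
  assert (Bb : 0 <= b (S k)) by (apply (b_nonneg _ _ _ _ _ Hset); lia).
  apply Rle_trans with (b (S k) * (kap * y ^ l0 * v)); [|apply Rmult_le_compat_l; assumption].
  assert (Hpw : cr * Rpower dl (1 - rr) <= Rpower (INR (S k)) (rr - 1)).
  { replace (Rpower (INR (S k)) (rr - 1)) with (Rpower (INR (S k) * dl) (rr - 1) * Rpower dl (1 - rr)).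
    - apply Rmult_le_compat_r; [apply Rlt_le, exp_pos|]. unfold cr, Rpower. apply exp_le_compat.
      assert (Lk : 0 <= ln (INR (S k) * dl)) by (rewrite <- ln_1; apply ln_le; lra).
      assert (Lk8 : ln (INR (S k) * dl) <= ln 8) by (apply ln_le; lra).
      assert (P1 := Rle_abs (- (rr - 1))). rewrite Rabs_Ropp in P1. assert (P2 := Rabs_pos (rr - 1)). nra.
    - assert (PSk : 0 < INR (S k)) by (apply lt_0_INR; lia).
      rewrite <- Rpower_mult_distr by lra. rewrite Rmult_assoc, <- Rpower_plus.
      replace (rr - 1 + (1 - rr)) with 0 by ring. rewrite Rpower_O by lra. ring. }
  assert (Hbk := Hb (S k) ltac:(lia)).
  assert (F1 : C2 * (cr * Rpower dl (1 - rr)) <= b (S k) * a (S k) ^ l0).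
  { eapply Rle_trans; [|exact Hbk]. apply Rmult_le_compat_l; [lra|exact Hpw]. }
  assert (F2 : ce * (C2 * (cr * Rpower dl (1 - rr))) <= b (S k) * y ^ l0).
  { apply Rle_trans with (ce * (b (S k) * a (S k) ^ l0)); [apply Rmult_le_compat_l; lra|].
    replace (ce * (b (S k) * a (S k) ^ l0)) with (b (S k) * (ce * a (S k) ^ l0)) by ring. apply Rmult_le_compat_l; assumption. }
  replace (b (S k) * (kap * y ^ l0 * v)) with (kap * v * (b (S k) * y ^ l0)) by ring.
  replace (kap * ce * C2 * (cr * Rpower dl (1 - rr)) * v) with (kap * v * (ce * (C2 * (cr * Rpower dl (1 - rr))))) by ring.
  apply Rmult_le_compat_l; [apply Rmult_le_pos; lra|exact F2]. }
assert (Hpsi : Rabs psi <= PI).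
{ unfold psi. rewrite Rabs_mult, (Rabs_pos_eq (INR l0)) by apply pos_INR. exact Hth. }
assert (HC := Hcos N psi ltac:(unfold N; lia) Hpsi).
apply Rle_trans with (sum_n (fun k => b (S k) * inner k) (S n0 + 3 * N)).
2:{ apply sum_n_le_Series; assumption. }
eapply Rle_trans; [|apply (sum_n_window (fun k => b (S k) * inner k) (S n0) (3 * N) Tn)].
apply Rle_trans with (sum_n (fun i => kap * ce * C2 * (cr * Rpower dl (1 - rr)) * (1 - cos (INR (N + i) * psi))) (3 * N)).
2:{ apply sum_n_le_compat. exact Win. }
rewrite sum_n_scal_l_R.
assert (Pdr : 0 < Rpower dl (1 - rr)) by apply exp_pos.
assert (Kp : 0 <= kap * ce * C2 * (cr * Rpower dl (1 - rr))).
{ apply Rlt_le. repeat first [assumption | apply Rmult_lt_0_compat]. }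
eapply Rle_trans; [|apply Rmult_le_compat_l; [exact Kp|exact HC]].
(* l0 >= 1 and N dl > 1 give N |psi| >= |th|/dl. *)
assert (Em : Rmin 1 (th / dl * (th / dl)) <= Rmin 1 (INR N * psi * (INR N * psi))).
{ apply Rle_min_compat_l. 
  assert (Hl1 : 1 <= INR l0) by (apply (le_INR 1); lia).
  replace (th / dl * (th / dl)) with (/ dl * / dl * (th * th)) by (field; lra).
  replace (INR N * psi * (INR N * psi)) with (INR N * INR N * (INR l0 * INR l0) * (th * th)) by (unfold psi; ring).
  apply Rmult_le_compat_r; [apply Rle_0_sqr|].
  assert (/ dl * / dl <= INR N * INR N) by (apply Rmult_le_compat; lra). apply Rle_trans with (INR N * INR N * 1); [lra|]. apply Rmult_le_compat_l; [apply Rle_0_sqr|nra]. }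
assert (Pm : 0 <= Rmin 1 (th / dl * (th / dl))) by (apply Rmin_glb; [lra|apply Rle_0_sqr]).
assert (Er : Rpower dl (- rr) = Rpower dl (1 - rr) * / dl).
{ replace (- rr) with ((1 - rr) + - (1)) by ring. rewrite Rpower_plus, Rpower_Ropp, Rpower_1 by lra. reflexivity. }
rewrite Er.
replace (kap * ce * C2 * cr * cs * (Rpower dl (1 - rr) * / dl) * Rmin 1 (th / dl * (th / dl)))
  with (kap * ce * C2 * (cr * Rpower dl (1 - rr)) * (cs * (/ dl) * Rmin 1 (th / dl * (th / dl)))) by ring.
apply Rmult_le_compat_l; [exact Kp|].
apply Rmult_le_compat; [apply Rmult_le_pos; lra|exact Pm|apply Rmult_le_compat_l; lra|exact Em].
Qed.

End Setting.

(** * The local limit theorem *)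

(** With [gauss_B], the classical pair for the Gaussian integral: A^2 + B is constant, equals PI/4
    at 0, and B tends to 0 at infinity. *)
Definition gauss_A (t : R) : R := RInt (fun x => exp (- (x * x))) 0 t.
Definition gauss_B (t : R) : R := RInt (fun x => exp (- (t * t * (1 + x * x))) / (1 + x * x)) 0 1.

Lemma one_add_sq_pos x : 0 < 1 + x * x.
Proof. nra. Qed.

Lemma continuous_of_ex_derive (f : R -> R) x : ex_derive f x -> continuous f x.
Proof. apply (ex_derive_continuous (K := R_AbsRing) (V := R_NormedModule)). Qed.

Lemma ex_RInt_gauss a b : ex_RInt (fun x => exp (- (x * x))) a b.
Proof.
apply (ex_RInt_continuous (V := R_CompleteNormedModule)). intros x _.
apply continuous_of_ex_derive. auto_derive. exact I.
Qed.

Lemma is_derive_gauss_A t : is_derive gauss_A t (exp (- (t * t))).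
Proof.
apply (is_derive_RInt (fun x => exp (- (x * x))) gauss_A 0 t).
- exists (mkposreal 1 Rlt_0_1). intros y _. apply (RInt_correct (V := R_CompleteNormedModule)), ex_RInt_gauss.
- apply continuous_of_ex_derive. auto_derive. exact I.
Qed.

Lemma gauss_B_integrand_derive x v :
  is_derive (fun z => exp (- (z * z * (1 + v * v))) / (1 + v * v)) x (- (2 * x) * exp (- (x * x * (1 + v * v)))).
Proof.
assert (P := one_add_sq_pos v). auto_derive; [lra|]. field. lra.
Qed.

Lemma is_derive_gauss_B t : is_derive gauss_B t (- (2 * gauss_A t * exp (- (t * t)))).
Proof.
assert (E : RInt (fun v => Derive (fun z => exp (- (z * z * (1 + v * v))) / (1 + v * v)) t) 0 1
   = - (2 * gauss_A t * exp (- (t * t)))).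
{ apply is_RInt_unique.
  apply is_RInt_ext with (fun v => scal (- (2 * exp (- (t * t)))) (scal t (exp (- ((t * v + 0) * (t * v + 0)))))).
  - intros v _. symmetry. eapply eq_trans; [exact (is_derive_unique _ _ _ (gauss_B_integrand_derive t v))|].
    unfold scal; simpl; unfold mult; simpl. as_R_eq.
    replace (- (t * t * (1 + v * v))) with (- (t * t) + - ((t * v + 0) * (t * v + 0))) by ring. rewrite exp_plus. ring.
  - replace (- (2 * gauss_A t * exp (- (t * t)))) with (scal (- (2 * exp (- (t * t)))) (gauss_A t))
      by (unfold scal; simpl; unfold mult; simpl; ring).
    apply (is_RInt_scal (V := R_NormedModule)).
    apply (is_RInt_comp_lin (V := R_NormedModule) (fun x => exp (- (x * x))) t 0 0 1).
    rewrite Rmult_0_r, Rmult_1_r, !Rplus_0_r.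
    apply (RInt_correct (V := R_CompleteNormedModule)), ex_RInt_gauss. }
rewrite <- E. unfold gauss_B.
apply (is_derive_RInt_param (fun z v => exp (- (z * z * (1 + v * v))) / (1 + v * v)) 0 1 t).
- exists (mkposreal 1 Rlt_0_1). intros y _ v _. eexists. apply gauss_B_integrand_derive.
- intros v _.
  apply (continuity_2d_pt_ext (fun x w => - (2 * x) * exp (- (x * x * (1 + w * w))))).
  { intros x w. symmetry. apply is_derive_unique, gauss_B_integrand_derive. }
  apply continuity_2d_pt_mult.
  + apply continuity_2d_pt_opp, continuity_2d_pt_mult; [apply continuity_2d_pt_const|apply continuity_2d_pt_id1].
  + apply (continuity_1d_2d_pt_comp exp (fun x w => - (x * x * (1 + w * w)))).
    * apply derivable_continuous_pt, derivable_pt_exp.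
    * apply continuity_2d_pt_opp, continuity_2d_pt_mult.
      -- apply continuity_2d_pt_mult; apply continuity_2d_pt_id1.
      -- apply continuity_2d_pt_plus; [apply continuity_2d_pt_const|].
         apply continuity_2d_pt_mult; apply continuity_2d_pt_id2.
- exists (mkposreal 1 Rlt_0_1). intros y _. apply (ex_RInt_continuous (V := R_CompleteNormedModule)). intros v _.
  assert (P := one_add_sq_pos v). apply continuous_of_ex_derive. auto_derive. lra.
Qed.

Lemma gauss_sum_const t : 0 <= t -> gauss_A t * gauss_A t + gauss_B t = PI / 4.
Proof.
intros Ht.
assert (D : forall y, is_derive (fun t => gauss_A t * gauss_A t + gauss_B t) y 0).
{ intros y. assert (D1 := is_derive_gauss_A y). assert (D2 := is_derive_gauss_B y).
  auto_derive; [repeat split; eexists; eassumption|].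
  change (fun x => gauss_A x) with gauss_A. change (fun x => gauss_B x) with gauss_B.
  rewrite (is_derive_unique _ _ _ D1), (is_derive_unique _ _ _ D2). ring. }
assert (E : gauss_A t * gauss_A t + gauss_B t = gauss_A 0 * gauss_A 0 + gauss_B 0).
{ destruct (MVT_gen (fun t => gauss_A t * gauss_A t + gauss_B t) 0 t (fun _ => 0)) as [c [_ Hc]].
  - intros; apply D.
  - intros. apply derivable_continuous_pt, ex_derive_Reals_0. eexists. apply D.
  - lra. }
rewrite E. unfold gauss_A. rewrite RInt_point. unfold gauss_B.
rewrite (RInt_ext _ (fun x => / (1 + x * x))).
- assert (I : is_RInt (fun x => / (1 + x * x)) 0 1 (minus (atan 1) (atan 0))).
  { apply (is_RInt_derive atan).
    - intros x _. assert (P := one_add_sq_pos x). auto_derive; [exact I|]. unfold Rsqr. field. lra.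
    - intros x _. assert (P := one_add_sq_pos x). apply continuous_of_ex_derive. auto_derive. lra. }
  rewrite (is_RInt_unique _ _ _ _ I). rewrite atan_1, atan_0. unfold minus, plus, opp, zero; simpl. lra.
- intros x _. assert (P := one_add_sq_pos x). replace (- (0 * 0 * (1 + x * x))) with 0 by ring. rewrite exp_0. as_R_eq. field. lra.
Qed.

Lemma gauss_B_bounds t : 0 <= gauss_B t <= exp (- (t * t)).
Proof.
assert (EB : ex_RInt (fun x => exp (- (t * t * (1 + x * x))) / (1 + x * x)) 0 1).
{ apply (ex_RInt_continuous (V := R_CompleteNormedModule)). intros v _.
  assert (P := one_add_sq_pos v). apply continuous_of_ex_derive. auto_derive. lra. }
split.
- apply RInt_ge_0; [lra|exact EB|]. intros x _. apply Rlt_le, Rdiv_lt_0_compat; [apply exp_pos|apply one_add_sq_pos].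
- apply Rle_trans with (RInt (fun _ => exp (- (t * t))) 0 1).
  + apply RInt_le; [lra|exact EB|apply ex_RInt_const|]. intros x _. assert (P := one_add_sq_pos x).
    apply Rle_div_l; [exact P|]. apply Rle_trans with (exp (- (t * t)) * 1).
    * rewrite Rmult_1_r. apply exp_le_compat. assert (0 <= t * t) by apply Rle_0_sqr. assert (0 <= x * x) by apply Rle_0_sqr. nra.
    * apply Rmult_le_compat_l; [apply Rlt_le, exp_pos|]. assert (0 <= x * x) by apply Rle_0_sqr. lra.
  + rewrite RInt_const. unfold scal; simpl; unfold mult; simpl. lra.
Qed.

Lemma gauss_A_bounds t : 0 <= t -> sqrt PI / 2 - 2 * exp (- (t * t)) <= gauss_A t <= sqrt PI / 2.
Proof.
intros Ht. assert (E := gauss_sum_const t Ht). assert (B := gauss_B_bounds t).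
assert (PA : 0 <= gauss_A t).
{ apply RInt_ge_0; [exact Ht|apply ex_RInt_gauss|intros; apply Rlt_le, exp_pos]. }
assert (P := PI2_3_2). assert (Es : sqrt PI * sqrt PI = PI) by (apply sqrt_sqrt; lra).
assert (P1 : 1 <= sqrt PI) by (rewrite <- sqrt_1; apply sqrt_le_1; lra).
assert (P2 := exp_pos (- (t * t))).
split.
- destruct (Rle_dec (sqrt PI / 2) (2 * exp (- (t * t)))) as [L|L]; [lra|].
  apply Rnot_lt_le. intros K.
  assert (gauss_A t * gauss_A t < (sqrt PI / 2 - 2 * exp (- (t * t))) * (sqrt PI / 2 - 2 * exp (- (t * t))))
    by (apply Rmult_le_0_lt_compat; lra).
  nra.
- nra.
Qed.

Theorem gaussian_integral (kap U : R) : 0 < kap -> 0 <= U ->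
  exists G, is_RInt (fun u => exp (- (kap * (u * u) / 2))) 0 U G /\
  Rabs (G - sqrt (2 * PI / kap) / 2) <= 2 * sqrt (2 / kap) * exp (- (kap * (U * U) / 2)).
Proof.
intros Hk HU. set (w := sqrt (kap / 2)).
assert (Hw : 0 < w) by (apply sqrt_lt_R0; lra).
assert (Ew : w * w = kap / 2) by (apply sqrt_sqrt; lra).
assert (Ewi : sqrt (2 / kap) = / w).
{ unfold w. rewrite <- sqrt_inv. f_equal. field. lra. }
exists (/ w * gauss_A (w * U)). split.
{ apply is_RInt_ext with (fun u => scal (/ w) (scal w (exp (- ((w * u + 0) * (w * u + 0)))))).
  - intros u _. unfold scal; simpl; unfold mult; simpl. as_R_eq.
    replace ((w * u + 0) * (w * u + 0)) with (w * w * (u * u)) by ring. rewrite Ew.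
    replace (kap * (u * u) / 2) with (kap / 2 * (u * u)) by field. field. lra.
  - apply (is_RInt_scal (V := R_NormedModule)).
    apply (is_RInt_comp_lin (V := R_NormedModule) (fun x => exp (- (x * x))) w 0 0 U).
    rewrite Rmult_0_r, !Rplus_0_r. apply (RInt_correct (V := R_CompleteNormedModule)), ex_RInt_gauss. }
assert (B := gauss_A_bounds (w * U) ltac:(nra)).
replace (w * U * (w * U)) with (kap * (U * U) / 2) in B by (replace (w * U * (w * U)) with (w * w * (U * U)) by ring; rewrite Ew; field).
assert (Es : sqrt (2 * PI / kap) = / w * sqrt PI).
{ rewrite <- Ewi, <- sqrt_mult by (try apply Rdiv_le_0_compat; try lra; apply Rlt_le, PI_RGT_0). f_equal. field. lra. }
rewrite Es, Ewi.
replace (/ w * gauss_A (w * U) - / w * sqrt PI / 2) with (/ w * (gauss_A (w * U) - sqrt PI / 2)) by (field; lra).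
assert (Pw : 0 < / w) by (apply Rinv_0_lt_compat, Hw).
rewrite Rabs_mult, (Rabs_pos_eq (/ w)) by lra.
replace (2 * / w * exp (- (kap * (U * U) / 2))) with (/ w * (2 * exp (- (kap * (U * U) / 2)))) by ring.
apply Rmult_le_compat_l; [lra|].
assert (Pe := exp_pos (- (kap * (U * U) / 2))).
apply Rabs_le. lra.
Qed.

(** * Even moments and characteristic functions *)

Lemma is_series_exp x : is_series (fun n => x ^ n / INR (fact n)) (exp x).
Proof.
apply (is_series_ext (fun n => scal (pow_n x n) (/ INR (fact n)))); [|exact (is_exp_Reals x)].
intros n. rewrite pow_n_pow. unfold scal; simpl; unfold mult; simpl. reflexivity.
Qed.

Lemma is_series_even_part (e v : nat -> R) (l : R) : is_series e l ->
  (forall j, e (2 * j)%nat = v j) -> (forall j, e (S (2 * j)) = 0) -> is_series v l.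
Proof.
intros H H0 H1. apply is_series_lim.
apply is_lim_seq_ext with (fun N => sum_n e (2 * N)).
- induction n as [|n IH].
  + change (2 * 0)%nat with 0%nat. rewrite !sum_O. apply (H0 0%nat).
  + replace (2 * S n)%nat with (S (S (2 * n))) by lia. rewrite !sum_n_succ, IH, H1.
    replace (S (S (2 * n))) with (2 * S n)%nat by lia. rewrite H0. ring.
- apply (is_lim_seq_subseq (sum_n e) l (fun N => (2 * N)%nat)); [|apply is_series_lim, H].
  apply eventually_subseq. intros n. lia.
Qed.

Lemma is_series_cosh x : is_series (fun j => (x * x) ^ j / INR (fact (2 * j))) ((exp x + exp (- x)) / 2).
Proof.
assert (H : is_series (fun n => / 2 * (x ^ n / INR (fact n) + (- x) ^ n / INR (fact n))) (/ 2 * (exp x + exp (- x)))).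
{ apply (is_series_scal (K := R_AbsRing) (V := R_NormedModule)).
  apply (is_series_plus (V := R_NormedModule)); apply is_series_exp. }
replace ((exp x + exp (- x)) / 2) with (/ 2 * (exp x + exp (- x))) by field.
apply (is_series_even_part _ _ _ H).
- intros j. cbv beta. rewrite !pow_mult. replace ((- x) ^ 2) with (x * x) by ring. replace (x ^ 2) with (x * x) by ring.
  field. apply INR_fact_neq_0.
- intros j. cbv beta. change ((- x) ^ S (2 * j)) with (- x * (- x) ^ (2 * j)). change (x ^ S (2 * j)) with (x * x ^ (2 * j)).
  rewrite !pow_mult. replace ((- x) ^ 2) with (x ^ 2) by ring. field. apply INR_fact_neq_0.
Qed.

Lemma is_series_cos x : is_series (fun j => (- (x * x)) ^ j / INR (fact (2 * j))) (cos x).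
Proof.
unfold cos. destruct (exist_cos (Rsqr x)) as [l Hl].
apply (is_series_ext (fun i => cos_n i * Rsqr x ^ i)).
- intros j. unfold cos_n, Rsqr. replace (- (x * x)) with (-1 * (x * x)) by ring. rewrite (Rpow_mult_distr (-1)).
  as_R_eq. field. apply INR_fact_neq_0.
- apply is_series_Reals. exact Hl.
Qed.

Lemma Rabs_cos_le_cosh_term y j : Rabs ((- (y * y)) ^ j / INR (fact (2 * j))) = (y * y) ^ j / INR (fact (2 * j)).
Proof.
assert (P := INR_fact_lt_0 (2 * j)).
unfold Rdiv. rewrite Rabs_mult, <- RPow_abs, Rabs_Ropp, (Rabs_pos_eq (y * y)) by apply Rle_0_sqr.
rewrite (Rabs_pos_eq (/ _)); [reflexivity|]. apply Rlt_le, Rinv_0_lt_compat, P.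
Qed.

(** The 2j-th moment over (2j)!: the coefficient of z^j in a series that gives the even part of the
    moment generating function at z = u^2 and the cosine transform at z = -u^2. *)
Definition even_moment (p x : nat -> R) (j : nat) : R :=
  Series (fun m => p m * ((x m * x m) ^ j / INR (fact (2 * j)))).

(** The cosine terms have the hyperbolic cosine terms as absolute values, so summability of the
    latter justifies both interchanges. *)
Lemma even_moment_series (p x : nat -> R) (u : R) :
  (forall m, 0 <= p m) -> ex_series (fun m => p m * ((exp (u * x m) + exp (- (u * x m))) / 2)) ->
  is_series (fun j => even_moment p x j * (u * u) ^ j) (Series (fun m => p m * ((exp (u * x m) + exp (- (u * x m))) / 2))) /\
  is_series (fun j => even_moment p x j * (- (u * u)) ^ j) (Series (fun m => p m * cos (u * x m))).
Proof.
intros Hp Hex.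
assert (T0 : forall k j, 0 <= p k * ((u * x k * (u * x k)) ^ j / INR (fact (2 * j)))).
{ intros k j. apply Rmult_le_pos; [apply Hp|]. apply Rdiv_le_0_compat; [apply pow_le, Rle_0_sqr|apply INR_fact_lt_0]. }
assert (S1 : forall k, is_series (fun j => p k * ((u * x k * (u * x k)) ^ j / INR (fact (2 * j))))
   (p k * ((exp (u * x k) + exp (- (u * x k))) / 2))).
{ intros k. apply (is_series_scal (K := R_AbsRing) (V := R_NormedModule)), is_series_cosh. }
assert (S2 : forall k, is_series (fun j => p k * ((- (u * x k * (u * x k))) ^ j / INR (fact (2 * j))))
   (p k * cos (u * x k))).
{ intros k. apply (is_series_scal (K := R_AbsRing) (V := R_NormedModule)), is_series_cos. }
split.
- destruct (series_fubini (fun k j => p k * ((u * x k * (u * x k)) ^ j / INR (fact (2 * j))))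
     (fun m => p m * ((exp (u * x m) + exp (- (u * x m))) / 2))) as [_ [F _]].
  + intros k. eexists. apply (is_series_ext (fun j => p k * ((u * x k * (u * x k)) ^ j / INR (fact (2 * j))))); [|apply S1].
    intros j. symmetry. apply Rabs_pos_eq, T0.
  + intros k. right. apply is_series_unique.
    apply (is_series_ext (fun j => p k * ((u * x k * (u * x k)) ^ j / INR (fact (2 * j))))); [|apply S1].
    intros j. symmetry. apply Rabs_pos_eq, T0.
  + exact Hex.
  + rewrite (Series_ext _ _ (fun k => is_series_unique _ _ (S1 k))) in F.
    refine (is_series_ext _ _ _ _ F). intros j. unfold even_moment. rewrite <- Series_scal_r. apply Series_ext.
    intros m. replace (u * x m * (u * x m)) with (x m * x m * (u * u)) by ring. rewrite Rpow_mult_distr. as_R_eq. field. apply INR_fact_neq_0.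
- assert (TA : forall k j, Rabs (p k * ((- (u * x k * (u * x k))) ^ j / INR (fact (2 * j))))
     = p k * ((u * x k * (u * x k)) ^ j / INR (fact (2 * j)))).
  { intros k j. rewrite Rabs_mult, Rabs_cos_le_cosh_term, (Rabs_pos_eq (p k)) by apply Hp. reflexivity. }
  destruct (series_fubini (fun k j => p k * ((- (u * x k * (u * x k))) ^ j / INR (fact (2 * j))))
     (fun m => p m * ((exp (u * x m) + exp (- (u * x m))) / 2))) as [_ [F _]].
  + intros k. eexists. apply (is_series_ext (fun j => p k * ((u * x k * (u * x k)) ^ j / INR (fact (2 * j))))); [|apply S1].
    intros j. symmetry. apply TA.
  + intros k. right. apply is_series_unique.
    apply (is_series_ext (fun j => p k * ((u * x k * (u * x k)) ^ j / INR (fact (2 * j))))); [|apply S1].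
    intros j. symmetry. apply TA.
  + exact Hex.
  + rewrite (Series_ext _ _ (fun k => is_series_unique _ _ (S2 k))) in F.
    refine (is_series_ext _ _ _ _ F). intros j. unfold even_moment. rewrite <- Series_scal_r. apply Series_ext.
    intros m. replace (- (u * x m * (u * x m))) with (x m * x m * (- (u * u))) by ring. rewrite Rpow_mult_distr. as_R_eq. field. apply INR_fact_neq_0.
Qed.

Lemma even_moment_nonneg (p x : nat -> R) j : (forall m, 0 <= p m) ->
  ex_series (fun m => p m * ((exp (1 * x m) + exp (- (1 * x m))) / 2)) -> 0 <= even_moment p x j.
Proof.
intros Hp Hex.
assert (T : forall m j, 0 <= (x m * x m) ^ j / INR (fact (2 * j))).
{ intros m i. apply Rdiv_le_0_compat; [apply pow_le, Rle_0_sqr|apply INR_fact_lt_0]. }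
apply Series_nonneg.
- intros m. apply Rmult_le_pos; [apply Hp|apply T].
- apply ex_series_dom with (2 := Hex). intros m. rewrite Rabs_pos_eq by (apply Rmult_le_pos; [apply Hp|apply T]).
  apply Rmult_le_compat_l; [apply Hp|]. rewrite Rmult_1_l.
  assert (S := is_series_cosh (x m)). rewrite <- (is_series_unique _ _ S).
  eapply Rle_trans; [|apply (sum_n_le_Series _ j); [apply T|eexists; exact S]].
  apply (term_le_sum_n (fun j => (x m * x m) ^ j / INR (fact (2 * j)))); [apply T|lia].
Qed.

(** For z <= 1 each term beyond [j] carries a factor z^(j+1), and the value at 1 measures the
    rest. *)
Lemma pow_series_tail (a : nat -> R) (z S S1 : R) j : (forall i, 0 <= a i) -> 0 < z <= 1 ->
  is_series (fun i => a i * z ^ i) S -> is_series (fun i => a i * 1 ^ i) S1 ->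
  0 <= S - sum_n (fun i => a i * z ^ i) j <= z ^ (Datatypes.S j) * S1.
Proof.
intros Ha Hz HS HS1.
assert (Pz : forall i, 0 <= a i * z ^ i) by (intros; apply Rmult_le_pos; [apply Ha|apply pow_le; lra]).
assert (P1 : forall i, 0 <= a i * 1 ^ i) by (intros; rewrite pow1, Rmult_1_r; apply Ha).
rewrite <- (is_series_unique _ _ HS), <- (is_series_unique _ _ HS1). split.
- generalize (sum_n_le_Series _ j Pz (ex_intro _ _ HS)); lra.
- assert (B : forall n, sum_n (fun i => a i * z ^ i) n <= sum_n (fun i => a i * z ^ i) j + z ^ (Datatypes.S j) * sum_n (fun i => a i * 1 ^ i) n).
  { assert (Pj : 0 <= z ^ Datatypes.S j) by (apply pow_le; lra).
    induction n as [|n IH].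
    - assert (Q := term_le_sum_n (fun i => a i * z ^ i) 0 j Pz (Nat.le_0_l j)). rewrite !sum_O. specialize (P1 0%nat). nra.
    - destruct (le_lt_dec (Datatypes.S n) j) as [L|L].
      + assert (Q := sum_n_mono (fun i => a i * z ^ i) (Datatypes.S n) j Pz L).
        assert (Q1 := sum_n_nonneg (fun i => a i * 1 ^ i) (Datatypes.S n) (fun i _ => P1 i)). nra.
      + rewrite !sum_n_succ. assert (a (Datatypes.S n) * z ^ Datatypes.S n <= z ^ Datatypes.S j * (a (Datatypes.S n) * 1 ^ Datatypes.S n)); [|nra].
        rewrite pow1, Rmult_1_r, Rmult_comm. apply Rmult_le_compat_r; [apply Ha|].
        replace (Datatypes.S n) with (Datatypes.S j + (n - j))%nat by lia. rewrite pow_add.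
        rewrite <- (Rmult_1_r (z ^ Datatypes.S j)) at 2. apply Rmult_le_compat_l; [exact Pj|].
        rewrite <- (pow1 (n - j)). apply pow_incr. lra. }
  apply Rle_minus_l. apply Series_le_bound; [eexists; exact HS|]. intros n. eapply Rle_trans; [apply B|].
  rewrite Rplus_comm. apply Rplus_le_compat_r. apply Rmult_le_compat_l; [apply pow_le; lra|].
  apply sum_n_le_Series; [exact P1|eexists; exact HS1].
Qed.

(** Induction on [j]: once the lower coefficients converge, the difference at a small [z] isolates
    the j-th one, up to a tail O(z^(j+1)) that nonnegativity controls uniformly in [n]. *)
Lemma coefficients_converge (mu : nat -> nat -> R) (gam : nat -> R) (M : nat -> R -> R) (G : R -> R) :
  (forall j, 0 <= gam j) -> (forall z, 0 <= z -> is_series (fun j => gam j * z ^ j) (G z)) ->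
  (exists N, forall n, (N <= n)%nat -> forall j, 0 <= mu n j) ->
  (forall z, 0 <= z -> exists N, forall n, (N <= n)%nat -> is_series (fun j => mu n j * z ^ j) (M n z)) ->
  (forall z, 0 <= z -> is_lim_seq (fun n => M n z) (G z)) ->
  forall j, is_lim_seq (fun n => mu n j) (gam j).
Proof.
intros Hg HG [N0 Hmu] HM HL.
(* Convergence of the full series at z <= 1 passes to the partial sums, up to tails measured at the
   point 1. *)
assert (Pfx : forall z j eps, 0 < z <= 1 -> 0 < eps -> exists N, forall n, (N <= n)%nat ->
   Rabs (sum_n (fun i => (mu n i - gam i) * z ^ i) j) <= eps + z ^ S j * (2 * G 1 + 1)).
{ intros z j eps Hz He.
  destruct (HM z ltac:(lra)) as [N1 H1]. destruct (HM 1 ltac:(lra)) as [N2 H2].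
  destruct (proj1 (is_lim_seq_eps _ _) (HL z ltac:(lra)) eps He) as [N3 H3].
  destruct (proj1 (is_lim_seq_eps _ _) (HL 1 ltac:(lra)) 1 Rlt_0_1) as [N4 H4].
  exists (N0 + N1 + N2 + N3 + N4)%nat. intros n Hn.
  assert (Q := pow_series_tail (mu n) z _ _ j (Hmu n ltac:(lia)) Hz (H1 n ltac:(lia)) (H2 n ltac:(lia))).
  assert (Q' := pow_series_tail gam z _ _ j Hg Hz (HG z ltac:(lra)) (HG 1 ltac:(lra))).
  specialize (H3 n ltac:(lia)). specialize (H4 n ltac:(lia)). apply Rabs_def2 in H3. apply Rabs_def2 in H4.
  rewrite (sum_n_ext _ (fun i => mu n i * z ^ i - gam i * z ^ i)) by (intros; as_R_eq; ring). rewrite sum_n_minus.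
  assert (Pz : 0 <= z ^ S j) by (apply pow_le; lra).
  assert (z ^ S j * M n 1 <= z ^ S j * (G 1 + 1)) by (apply Rmult_le_compat_l; lra).
  assert (0 <= z ^ S j * G 1) by lra.
  apply Rabs_le. lra. }
assert (Key : forall j, (forall prev, is_lim_seq (fun n => sum_n (fun i => (mu n i - gam i) * prev ^ i) j - (mu n j - gam j) * prev ^ j) 0) ->
   is_lim_seq (fun n => mu n j) (gam j)).
{ intros j Hprev. apply is_lim_seq_eps. intros eps He.
  assert (PG : 0 <= G 1).
  { rewrite <- (is_series_unique _ _ (HG 1 ltac:(lra))). apply Series_nonneg; [|eexists; apply HG; lra].
    intros i. rewrite pow1, Rmult_1_r. apply Hg. }
  set (B := 2 * G 1 + 1) in *. assert (PB : 0 < B) by (unfold B; lra).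
  (* Chosen so that the tail bound z^(j+1) B is at most a quarter of eps z^j. *)
  set (z := Rmin 1 (eps / (4 * B))).
  assert (Hz : 0 < z <= 1).
  { unfold z. split; [apply Rmin_pos; [lra|apply Rdiv_lt_0_compat; lra]|apply Rmin_l]. }
  assert (Hz2 : z * B <= eps / 4).
  { apply Rle_trans with (eps / (4 * B) * B); [apply Rmult_le_compat_r; [lra|apply Rmin_r]|]. right. field. lra. }
  assert (Pj : 0 < z ^ j) by (apply pow_lt; lra).
  destruct (Pfx z j (z ^ j * (eps / 4)) Hz ltac:(nra)) as [N1 H1].
  destruct (proj1 (is_lim_seq_eps _ _) (Hprev z) (z ^ j * (eps / 4)) ltac:(nra)) as [N2 H2].
  exists (N1 + N2)%nat. intros n Hn. specialize (H1 n ltac:(lia)). specialize (H2 n ltac:(lia)).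
  change (z ^ S j) with (z * z ^ j) in H1. rewrite Rminus_0_r in H2.
  assert (E : z ^ j * Rabs (mu n j - gam j) < z ^ j * eps).
  { rewrite <- (Rabs_pos_eq (z ^ j)) at 1 by lra. rewrite <- Rabs_mult.
    replace (z ^ j * (mu n j - gam j)) with (sum_n (fun i => (mu n i - gam i) * z ^ i) j
      - (sum_n (fun i => (mu n i - gam i) * z ^ i) j - (mu n j - gam j) * z ^ j)) by ring.
    eapply Rle_lt_trans; [apply Rabs_triang|]. rewrite Rabs_Ropp.
    assert (z ^ j * (z * B) <= z ^ j * (eps / 4)) by (apply Rmult_le_compat_l; lra). fold B in H1. nra. }
  apply Rmult_lt_reg_l in E; [exact E|exact Pj]. }
assert (Ind : forall j i, (i <= j)%nat -> is_lim_seq (fun n => mu n i) (gam i)).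
{ induction j as [|j IH].
  - intros i Hi. replace i with 0%nat by lia. apply Key. intros z.
    apply is_lim_seq_ext with (fun _ => 0); [|apply is_lim_seq_const]. intros n. rewrite sum_O. ring.
  - intros i Hi. destruct (le_lt_dec i j) as [L|L]; [apply IH, L|]. replace i with (S j) by lia. apply Key. intros z.
    apply is_lim_seq_ext with (fun n => sum_n (fun i => (mu n i - gam i) * z ^ i) j).
    { intros n. rewrite sum_n_succ. symmetry. as_R_eq. ring. }
    replace (Finite 0) with (Finite (sum_n (fun i => (gam i - gam i) * z ^ i) j)).
    { apply (is_lim_seq_sum_n (fun n i => (mu n i - gam i) * z ^ i)). intros k Hk.
      apply is_lim_seq_mult'; [|apply is_lim_seq_const].
      apply is_lim_seq_minus'; [apply IH, Hk|apply is_lim_seq_const]. }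
    f_equal. rewrite (sum_n_ext _ (fun i => 0 * 0)) by (intros; as_R_eq; ring). rewrite sum_n_scal_l_R. apply Rmult_0_l. }
intros j. apply (Ind j j). lia.
Qed.

(* Dominated by a geometric series through convergence at the single point [2 (Y + 1)]. *)
Lemma alternating_uniform (mu : nat -> nat -> R) (gam : nat -> R) (M : nat -> R -> R) (G : R -> R) (Y : R) :
  0 <= Y ->
  (forall j, 0 <= gam j) -> (forall z, 0 <= z -> is_series (fun j => gam j * z ^ j) (G z)) ->
  (exists N, forall n, (N <= n)%nat -> forall j, 0 <= mu n j) ->
  (forall z, 0 <= z -> exists N, forall n, (N <= n)%nat -> is_series (fun j => mu n j * z ^ j) (M n z)) ->
  (forall z, 0 <= z -> is_lim_seq (fun n => M n z) (G z)) ->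
  forall eps, 0 < eps -> exists N, forall n, (N <= n)%nat -> forall y S S', 0 <= y <= Y ->
    is_series (fun j => mu n j * (- y) ^ j) S -> is_series (fun j => gam j * (- y) ^ j) S' -> Rabs (S - S') <= eps.
Proof.
intros HY Hg HG Hmu' HM HL eps He.
assert (CC := coefficients_converge mu gam M G Hg HG Hmu' HM HL).
destruct Hmu' as [N0 Hmu].
set (W := 2 * (Y + 1)). assert (HW : 0 <= W) by (unfold W; lra).
destruct (HM W HW) as [N1 H1]. destruct (proj1 (is_lim_seq_eps _ _) (HL W HW) 1 Rlt_0_1) as [N2 H2].
set (N := (N0 + N1 + N2)%nat). set (B := 2 * G W + 1).
assert (Pw : forall j, 0 <= W ^ j) by (intros; apply pow_le, HW).
assert (Dom : forall n k, Rabs (Rabs (mu (n + N)%nat k - gam k) * Y ^ k) <= B * (/ 2) ^ k).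
{ intros n k. rewrite Rabs_mult, Rabs_Rabsolu, (Rabs_pos_eq (Y ^ k)) by (apply pow_le, HY).
  assert (Hn : forall k, 0 <= mu (n + N)%nat k) by (apply Hmu; unfold N; lia).
  assert (E1 := H1 (n + N)%nat ltac:(unfold N; lia)). assert (E2 := H2 (n + N)%nat ltac:(unfold N; lia)). apply Rabs_def2 in E2.
  assert (T1 : mu (n + N)%nat k * W ^ k <= M (n + N)%nat W).
  { rewrite <- (is_series_unique _ _ E1). eapply Rle_trans; [|apply (sum_n_le_Series _ k)].
    - apply (term_le_sum_n (fun j => mu (n + N)%nat j * W ^ j)); [|lia]. intros; apply Rmult_le_pos; [apply Hn|apply Pw].
    - intros; apply Rmult_le_pos; [apply Hn|apply Pw].
    - eexists; exact E1. }
  assert (T2 : gam k * W ^ k <= G W).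
  { rewrite <- (is_series_unique _ _ (HG W HW)). eapply Rle_trans; [|apply (sum_n_le_Series _ k)].
    - apply (term_le_sum_n (fun j => gam j * W ^ j)); [|lia]. intros; apply Rmult_le_pos; [apply Hg|apply Pw].
    - intros; apply Rmult_le_pos; [apply Hg|apply Pw].
    - eexists; apply (HG W HW). }
  assert (T3 : Rabs (mu (n + N)%nat k - gam k) <= mu (n + N)%nat k + gam k).
  { specialize (Hn k). specialize (Hg k). apply Rabs_le. lra. }
  assert (T4 : Y ^ k <= W ^ k * (/ 2) ^ k).
  { rewrite <- Rpow_mult_distr. apply pow_incr. unfold W. lra. }
  assert (P2 : 0 <= (/ 2) ^ k) by (apply pow_le; lra).
  apply Rle_trans with ((mu (n + N)%nat k + gam k) * (W ^ k * (/ 2) ^ k)).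
  - apply Rmult_le_compat; [apply Rabs_pos|apply pow_le, HY|exact T3|exact T4].
  - rewrite <- Rmult_assoc. apply Rmult_le_compat_r; [exact P2|]. unfold B. lra. }
assert (T : is_lim_seq (fun n => Series (fun k => Rabs (mu (n + N)%nat k - gam k) * Y ^ k)) (Series (fun _ => 0))).
{ apply (tannery (fun n k => Rabs (mu (n + N)%nat k - gam k) * Y ^ k) (fun _ => 0) (fun k => B * (/ 2) ^ k)).
  - exact Dom.
  - apply (ex_series_scal_l (K := R_AbsRing) B (fun k => (/ 2) ^ k)). eexists. apply is_series_geom. rewrite Rabs_pos_eq; lra.
  - intros k. replace 0 with (Rabs (gam k - gam k) * Y ^ k) by (rewrite Rminus_diag, Rabs_R0; ring).
    apply is_lim_seq_mult'; [|apply is_lim_seq_const].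
    apply (is_lim_seq_abs (fun n => mu (n + N)%nat k - gam k) (Finite (gam k - gam k))).
    apply is_lim_seq_minus'; [|apply is_lim_seq_const]. apply (is_lim_seq_incr_n (fun n => mu n k) N), CC. }
rewrite Series_zero in T by reflexivity.
destruct (proj1 (is_lim_seq_eps _ _) T eps He) as [N3 H3].
exists (N + N3)%nat. intros n Hn y S S' Hy HS HS'.
specialize (H3 (n - N)%nat ltac:(lia)). rewrite Rminus_0_r in H3. apply Rabs_def2 in H3.
assert (Hdiff : is_series (fun j => mu n j * (- y) ^ j - gam j * (- y) ^ j) (S - S')).
{ apply (is_series_minus (V := R_NormedModule)); assumption. }
rewrite <- (is_series_unique _ _ Hdiff).
eapply Rle_trans; [apply (Series_Rabs_dom _ (fun k => Rabs (mu (n - N + N)%nat k - gam k) * Y ^ k))|lra].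
- intros k. replace (n - N + N)%nat with n by lia.
  replace (mu n k * (- y) ^ k - gam k * (- y) ^ k) with ((mu n k - gam k) * (- y) ^ k) by ring.
  rewrite Rabs_mult. apply Rmult_le_compat_l; [apply Rabs_pos|]. rewrite <- RPow_abs, Rabs_Ropp, Rabs_pos_eq by lra.
  apply pow_incr. lra.
- apply ex_series_dom with (fun k => B * (/ 2) ^ k); [apply Dom|].
  apply (ex_series_scal_l (K := R_AbsRing) B (fun k => (/ 2) ^ k)). eexists. apply is_series_geom. rewrite Rabs_pos_eq; lra.
Qed.

(** * Fourier inversion *)

Lemma sin_nat_PI n : sin (INR n * PI) = 0.
Proof.
induction n as [|n IH].
- simpl. rewrite Rmult_0_l. apply sin_0.
- rewrite S_INR, Rmult_plus_distr_r, Rmult_1_l, neg_sin, IH. lra.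
Qed.

Lemma sin_nat_diff_PI m n : sin ((INR m - INR n) * PI) = 0.
Proof.
destruct (le_lt_dec n m) as [L|L].
- rewrite <- minus_INR by exact L. apply sin_nat_PI.
- replace ((INR m - INR n) * PI) with (- (INR (n - m) * PI)) by (rewrite minus_INR by lia; ring).
  rewrite sin_neg, sin_nat_PI. ring.
Qed.

Lemma is_RInt_cos_diff m n : is_RInt (fun th => cos (th * (INR m - INR n))) 0 PI (if Nat.eq_dec m n then PI else 0).
Proof.
destruct (Nat.eq_dec m n) as [E|E].
- subst. apply is_RInt_ext with (fun _ => 1).
  + intros x _. rewrite Rminus_diag, Rmult_0_r, cos_0. reflexivity.
  + replace PI with (scal (PI - 0) 1) at 2 by (unfold scal; simpl; unfold mult; simpl; ring).
    apply (is_RInt_const (V := R_NormedModule)).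
- assert (H : INR m - INR n <> 0) by (intros K; apply E, INR_eq; lra).
  replace 0 with (minus (sin (PI * (INR m - INR n)) / (INR m - INR n)) (sin (0 * (INR m - INR n)) / (INR m - INR n))) at 2.
  + apply (is_RInt_derive (fun th => sin (th * (INR m - INR n)) / (INR m - INR n))).
    * intros x _. auto_derive; [exact I|]. field. exact H.
    * intros x _. apply continuous_of_ex_derive. auto_derive. exact I.
  + rewrite (Rmult_comm PI), sin_nat_diff_PI, Rmult_0_l, sin_0. unfold minus, plus, opp; simpl. unfold Rdiv. rewrite Rmult_0_l. apply Rplus_opp_r.
Qed.

(** Recentred at [n], the sine part of the transform is odd, so the cosine series over half a period
    suffices. Summability of [p] makes the partial sums converge uniformly. *)
Lemma fourier_coefficient (p : nat -> R) n : (forall m, 0 <= p m) -> ex_series p ->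
  is_RInt (fun th => Series (fun m => p m * cos (th * (INR m - INR n)))) 0 PI (PI * p n).
Proof.
intros Hp Hex.
set (f := fun N th => sum_n (fun m => p m * cos (th * (INR m - INR n))) N).
set (h := fun N => sum_n (fun m => p m * (if Nat.eq_dec m n then PI else 0)) N).
assert (HN : forall N, is_RInt (f N) 0 PI (h N)).
{ intros N. apply (is_RInt_sum_n (fun m th => p m * cos (th * (INR m - INR n)))).
  intros k _. apply (is_RInt_scal (V := R_NormedModule)), is_RInt_cos_diff. }
destruct (filterlim_RInt (V := R_CompleteNormedModule) f 0 PI eventually _
  (fun th => Series (fun m => p m * cos (th * (INR m - INR n)))) h HN) as [If [H1 H2]].
- apply filterlim_locally. intros eps.
  destruct (Series_tail_small p eps Hex (cond_pos eps)) as [N HNN]. exists N. intros k Hk th.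
  specialize (HNN k Hk). unfold f.
  change (Rabs (sum_n (fun m => p m * cos (th * (INR m - INR n))) k - Series (fun m => p m * cos (th * (INR m - INR n)))) < eps).
  rewrite Rabs_minus_sym. eapply Rle_lt_trans; [apply (Series_tail_dom _ p)|exact HNN].
  + intros m. rewrite Rabs_mult, (Rabs_pos_eq (p m)) by apply Hp. rewrite <- (Rmult_1_r (p m)) at 2.
    apply Rmult_le_compat_l; [apply Hp|]. apply Rabs_le, COS_bound.
  + exact Hex.
- assert (E : forall N, h N = if le_lt_dec n N then PI * p n else 0).
  { unfold h. induction N as [|N IH].
    - rewrite sum_O. as_R_eq. destruct (Nat.eq_dec 0 n) as [E|E]; destruct (le_lt_dec n 0); try lia; [subst; ring|ring].
    - rewrite sum_n_succ, IH. as_R_eq. destruct (Nat.eq_dec (S N) n) as [E|E]; destruct (le_lt_dec n N); destruct (le_lt_dec n (S N)); try lia;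
        [subst; ring|ring|ring]. }
  assert (L : is_lim_seq h (PI * p n)).
  { apply is_lim_seq_eps. intros eps He. exists n. intros k Hk. rewrite E. destruct (le_lt_dec n k); [|lia].
    rewrite Rminus_diag, Rabs_R0. exact He. }
  replace (PI * p n) with If; [exact H2|].
  apply is_lim_seq_unique in L. assert (L2 : is_lim_seq h If) by exact H1. apply is_lim_seq_unique in L2.
  rewrite L in L2. injection L2. auto.
Qed.

Lemma fourier_coefficient_scaled (p : nat -> R) n s : 0 < s -> (forall m, 0 <= p m) -> ex_series p ->
  is_RInt (fun u => Series (fun m => p m * cos (u * ((INR m - INR n) * s)))) 0 (PI / s) (PI * (p n / s)).
Proof.
intros Hs Hp Hex.
apply is_RInt_ext with (fun u => scal (/ s) (scal s (Series (fun m => p m * cos ((s * u + 0) * (INR m - INR n)))))).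
- intros u _. unfold scal; simpl; unfold mult; simpl. as_R_eq. rewrite <- Rmult_assoc, Rinv_l, Rmult_1_l by lra.
  apply Series_ext. intros m. f_equal. f_equal. ring.
- replace (PI * (p n / s)) with (scal (/ s) (PI * p n)) by (unfold scal; simpl; unfold mult; simpl; field; lra).
  apply (is_RInt_scal (V := R_NormedModule)).
  apply (is_RInt_comp_lin (V := R_NormedModule) (fun th => Series (fun m => p m * cos (th * (INR m - INR n)))) s 0 0 (PI / s)).
  replace (s * 0 + 0) with 0 by ring. replace (s * (PI / s) + 0) with PI by (field; lra).
  apply fourier_coefficient; assumption.
Qed.

(* Beyond [u = 1] the Gaussian is dominated by the exponential. *)
Lemma tail_integral_bound (phi : R -> R) c1 E U V I0 : 0 < c1 -> 0 <= E -> 1 <= U <= V ->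
  (forall u, U <= u <= V -> Rabs (phi u) <= exp (- (c1 * (u * u))) + E) ->
  is_RInt phi U V I0 -> Rabs I0 <= exp (- (c1 * U)) / c1 + E * V.
Proof.
intros Hc HE HU Hphi HI.
assert (J : is_RInt (fun u => exp (- (c1 * u)) + E) U V
   (minus (- exp (- (c1 * V)) / c1 + E * V) (- exp (- (c1 * U)) / c1 + E * U))).
{ apply (is_RInt_derive (fun u => - exp (- (c1 * u)) / c1 + E * u)).
  - intros x _. auto_derive; [exact I|]. field. lra.
  - intros x _. apply continuous_of_ex_derive. auto_derive. exact I. }
assert (HB : forall x, U <= x <= V -> norm (phi x) <= exp (- (c1 * x)) + E).
{ intros x Hx. eapply Rle_trans; [apply Hphi, Hx|]. apply Rplus_le_compat_r, exp_le_compat.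
  replace (c1 * (x * x)) with (c1 * x + c1 * (x * (x - 1))) by ring.
  assert (0 <= c1 * (x * (x - 1))) by (apply Rmult_le_pos; nra). lra. }
assert (B := norm_RInt_le (V := R_NormedModule) phi (fun u => exp (- (c1 * u)) + E) U V I0 _ (proj2 HU) HB HI J).
change (norm I0) with (Rabs I0) in B.
eapply Rle_trans; [exact B|]. unfold minus, plus, opp; simpl.
assert (P1 := exp_pos (- (c1 * V))). assert (P2 : 0 < exp (- (c1 * V)) / c1) by (apply Rdiv_lt_0_compat; assumption).
unfold Rdiv in *. nra.
Qed.

(** * Local limit theorem for the tilted weights *)

Section LocalLimit.
Variables (c : nat -> R) (g : R -> R) (del s E : nat -> R) (kap c1 : R).
Hypothesis c_nn : forall n, 0 <= c n.
Hypothesis Hf : forall x, 0 < x -> is_series (fun m => c m * exp (- (x * INR m))) (exp (g x)).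
Hypothesis del_pos : forall n, 0 < del n.
Hypothesis s_pos : forall n, 0 < s n.
Hypothesis Hkap : 0 < kap.
Hypothesis Hc1 : 0 < c1.
Hypothesis s_small : is_lim_seq (fun n => s n) 0.
Hypothesis s_del : is_lim_seq (fun n => s n / del n) 0.
Hypothesis Hmgf : forall t, is_lim_seq (fun n => g (del n - t * s n) - g (del n) - t * s n * INR n) (kap * (t * t) / 2).
Hypothesis E_nn : forall n, 0 <= E n.
Hypothesis HE : is_lim_seq (fun n => E n / s n) 0.

(** The law of the index under the tilt [del n]; [x n m] is its deviation from [n] in the scale
    [s n]. *)
Let p n m := c m * exp (- (del n * INR m)) / exp (g (del n)).
Let x n m := (INR m - INR n) * s n.

Hypothesis Hmod : exists N, forall n, (N <= n)%nat -> forall u, 0 <= u <= PI / s n ->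
  Rabs (Series (fun m => p n m * cos (u * x n m))) <= exp (- (c1 * (u * u))) + E n.

Lemma weight_nonneg n m : 0 <= p n m.
Proof.
apply Rdiv_le_0_compat; [apply Rmult_le_pos; [apply c_nn|apply Rlt_le, exp_pos]|apply exp_pos].
Qed.

Lemma weight_summable n : ex_series (p n).
Proof.
apply (ex_series_ext (fun m => scal (/ exp (g (del n))) (c m * exp (- (del n * INR m))))).
- intros m. unfold scal; simpl; unfold mult; simpl. unfold p, Rdiv. as_R_eq. ring.
- apply (ex_series_scal (K := R_AbsRing) (V := R_NormedModule)). eexists. apply Hf, del_pos.
Qed.

(** The moment generating function of the deviation: a factor exp(t x) shifts the tilt from [del n]
    to del n - t s n. *)
Let Mexp n t := exp (g (del n - t * s n) - g (del n) - t * s n * INR n).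

Lemma mgf_series n t : 0 < del n - t * s n -> is_series (fun m => p n m * exp (t * x n m)) (Mexp n t).
Proof.
intros Ht.
replace (Mexp n t) with (scal (exp (- g (del n) - t * s n * INR n)) (exp (g (del n - t * s n)))).
- apply (is_series_ext (fun m => scal (exp (- g (del n) - t * s n * INR n)) (c m * exp (- ((del n - t * s n) * INR m))))).
  + intros m. unfold scal; simpl; unfold mult; simpl. unfold p, x. as_R_eq.
    unfold Rdiv. rewrite <- exp_Ropp.
    replace (exp (- g (del n) - t * s n * INR n) * (c m * exp (- ((del n - t * s n) * INR m))))
      with (c m * (exp (- g (del n) - t * s n * INR n) * exp (- ((del n - t * s n) * INR m)))) by ring.
    replace (c m * exp (- (del n * INR m)) * exp (- g (del n)) * exp (t * ((INR m - INR n) * s n)))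
      with (c m * (exp (- (del n * INR m)) * exp (- g (del n)) * exp (t * ((INR m - INR n) * s n)))) by ring.
    rewrite <- !exp_plus. f_equal. f_equal. ring.
  + apply (is_series_scal (K := R_AbsRing) (V := R_NormedModule)), Hf, Ht.
- unfold scal; simpl; unfold mult; simpl. unfold Mexp. rewrite <- exp_plus. f_equal. ring.
Qed.

(** An even function of t, written in the variable z = t^2 on z >= 0. *)
Let Mcosh n z := (Mexp n (sqrt z) + Mexp n (- sqrt z)) / 2.

(** The scale is small against the tilt, so every fixed [t] eventually lies in the domain of
    convergence. *)
Lemma eventually_small t : exists N, forall n, (N <= n)%nat -> 0 < del n - t * s n.
Proof.
destruct (proj1 (is_lim_seq_eps _ _) s_del (/ (1 + Rabs t))) as [N HN].
- apply Rinv_0_lt_compat. generalize (Rabs_pos t); lra.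
- exists N. intros n Hn. specialize (HN n Hn). rewrite Rminus_0_r in HN.
  assert (P1 := del_pos n). assert (P2 := s_pos n). assert (P3 := Rabs_pos t). assert (P4 := Rle_abs t).
  rewrite Rabs_pos_eq in HN by (apply Rlt_le, Rdiv_lt_0_compat; assumption).
  assert (HH : s n * (1 + Rabs t) < del n).
  { apply Rmult_lt_reg_r with (/ del n * / (1 + Rabs t)).
    - apply Rmult_lt_0_compat; apply Rinv_0_lt_compat; lra.
    - replace (s n * (1 + Rabs t) * (/ del n * / (1 + Rabs t))) with (s n / del n) by (field; lra).
      replace (del n * (/ del n * / (1 + Rabs t))) with (/ (1 + Rabs t)) by (field; lra). exact HN. }
  nra.
Qed.

Lemma cosh_mgf_series t : exists N, forall n, (N <= n)%nat ->
  is_series (fun m => p n m * ((exp (t * x n m) + exp (- (t * x n m))) / 2)) ((Mexp n t + Mexp n (- t)) / 2).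
Proof.
destruct (eventually_small t) as [N1 H1]. destruct (eventually_small (- t)) as [N2 H2].
exists (N1 + N2)%nat. intros n Hn.
replace ((Mexp n t + Mexp n (- t)) / 2) with (scal (/ 2) (plus (Mexp n t) (Mexp n (- t))))
  by (unfold scal; simpl; unfold mult, plus; simpl; field).
apply (is_series_ext (fun m => scal (/ 2) (plus (p n m * exp (t * x n m)) (p n m * exp (- t * x n m))))).
- intros m. unfold scal; simpl; unfold mult, plus; simpl. as_R_eq.
  replace (- (t * x n m)) with (- t * x n m) by ring. field.
- apply (is_series_scal (K := R_AbsRing) (V := R_NormedModule)), (is_series_plus (V := R_NormedModule)).
  + apply mgf_series, H1. lia.
  + apply mgf_series, H2. lia.
Qed.

(** The Gaussian generating function has the coefficients (kap/2)^j/j! in z = t^2, and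
    [alternating_uniform] passes from z = t^2 to z = -u^2. *)
Lemma char_fun_uniform U eps : 0 <= U -> 0 < eps -> exists N, forall n, (N <= n)%nat -> forall u, 0 <= u <= U ->
  Rabs (Series (fun m => p n m * cos (u * x n m)) - exp (- (kap * (u * u) / 2))) <= eps.
Proof.
intros HU He.
assert (Hgam : forall j : nat, 0 <= (kap / 2) ^ j / INR (fact j)).
{ intros j. apply Rdiv_le_0_compat; [apply pow_le; lra|apply INR_fact_lt_0]. }
assert (HG : forall z, is_series (fun j => (kap / 2) ^ j / INR (fact j) * z ^ j) (exp (kap / 2 * z))).
{ intros z. apply (is_series_ext (fun j => (kap / 2 * z) ^ j / INR (fact j))); [|apply is_series_exp].
  intros j. rewrite Rpow_mult_distr. as_R_eq. field. apply INR_fact_neq_0. }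
destruct (alternating_uniform (fun n => even_moment (p n) (x n)) (fun j => (kap / 2) ^ j / INR (fact j)) Mcosh
   (fun z => exp (kap / 2 * z)) (U * U)) with (eps := eps) as [N HN].
- nra.
- exact Hgam.
- intros z _. apply HG.
(* Convergence at t = 1 makes all even moments convergent sums of nonnegative terms. *)
- destruct (cosh_mgf_series 1) as [N HN]. exists N. intros n Hn j. apply even_moment_nonneg; [apply weight_nonneg|].
  eexists. apply HN, Hn.
- intros z Hz. destruct (cosh_mgf_series (sqrt z)) as [N HN]. exists N. intros n Hn.
  destruct (even_moment_series (p n) (x n) (sqrt z)) as [S _]; [apply weight_nonneg|eexists; apply HN, Hn|].
  rewrite sqrt_sqrt in S by exact Hz. rewrite (is_series_unique _ _ (HN n Hn)) in S. exact S.
- intros z Hz. unfold Mcosh. replace (exp (kap / 2 * z)) with ((exp (kap * (sqrt z * sqrt z) / 2) + exp (kap * (- sqrt z * - sqrt z) / 2)) * / 2).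
  + unfold Rdiv at 1. apply is_lim_seq_mult'; [|apply is_lim_seq_const]. apply is_lim_seq_plus'.
    * apply (is_lim_seq_continuous exp); [apply derivable_continuous_pt, derivable_pt_exp|apply Hmgf].
    * apply (is_lim_seq_continuous exp); [apply derivable_continuous_pt, derivable_pt_exp|apply Hmgf].
  + replace (- sqrt z * - sqrt z) with (sqrt z * sqrt z) by ring. rewrite sqrt_sqrt by exact Hz.
    replace (kap * z / 2) with (kap / 2 * z) by field. field.
- exact He.
- destruct (eventually_small U) as [N1 H1]. destruct (eventually_small 0) as [N2 H2].
  exists (N + N1)%nat. intros n Hn u Hu. apply (HN n ltac:(lia) (u * u)).
  + nra.
  + specialize (H1 n ltac:(lia)). assert (P1 := s_pos n). assert (P2 := del_pos n).
    destruct (even_moment_series (p n) (x n) u) as [_ S]; [apply weight_nonneg| |exact S].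
    apply (ex_series_ext (fun m => scal (/ 2) (plus (p n m * exp (u * x n m)) (p n m * exp (- u * x n m))))).
    * intros m. unfold scal; simpl; unfold mult, plus; simpl. as_R_eq.
      replace (- (u * x n m)) with (- u * x n m) by ring. field.
    * apply (ex_series_scal (K := R_AbsRing) (V := R_NormedModule)), (ex_series_plus (V := R_NormedModule));
        eexists; apply mgf_series; nra.
  + replace (exp (- (kap * (u * u) / 2))) with (exp (kap / 2 * (- (u * u)))) by (f_equal; field). apply HG.
Qed.

(** The Fourier integral over [0, PI/s] is cut at [U]: uniform Gaussian limit on [0, U], decay bound
    beyond. The error [E n] is integrated over a length of at most PI/s, whence the hypothesis E n =
    o(s n). *)
Theorem local_limit : is_lim_seq (fun n => c n * exp (- (del n * INR n)) / exp (g (del n)) / s n) (/ sqrt (2 * PI * kap)).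
Proof.
assert (PP := PI_RGT_0). assert (P3 := PI2_3_2).
assert (Lim1 : is_lim_seq (fun n => PI * (p n n / s n)) (sqrt (2 * PI / kap) / 2)).
{ apply is_lim_seq_eps. intros eps He.
  (* A cut beyond which both the majorant and the Gaussian have small integrals; exp(-y) < 1/y is
     enough to find it. *)
  assert (LU : exists U, 1 <= U /\ exp (- (c1 * U)) / c1 < eps / 8 /\ 2 * sqrt (2 / kap) * exp (- (kap * (U * U) / 2)) < eps / 8).
  { assert (Q : 0 < sqrt (2 / kap)) by (apply sqrt_lt_R0, Rdiv_lt_0_compat; lra).
    set (X1 := 8 / (eps * c1)). set (X2 := 16 * sqrt (2 / kap) / eps).
    assert (0 < X1) by (apply Rdiv_lt_0_compat; nra). assert (0 < X2) by (apply Rdiv_lt_0_compat; nra).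
    exists (1 + X1 / c1 + X2 * 2 / kap).
    assert (A1 : 0 < X1 / c1) by (apply Rdiv_lt_0_compat; lra). assert (A2 : 0 < X2 * 2 / kap) by (apply Rdiv_lt_0_compat; lra).
    set (U := 1 + X1 / c1 + X2 * 2 / kap).
    assert (EX : forall y, 0 < y -> exp (- y) < / y).
    { intros y Hy. rewrite exp_Ropp. apply Rinv_lt_contravar; [apply Rmult_lt_0_compat; [exact Hy|apply exp_pos]|].
      generalize (exp_ineq1 y); lra. }
    assert (B1 : X1 <= c1 * U).
    { unfold U. replace (c1 * (1 + X1 / c1 + X2 * 2 / kap)) with (c1 + X1 + c1 * (X2 * 2 / kap)) by (field; lra). nra. }
    assert (B2 : X2 <= kap * (U * U) / 2).
    { apply Rle_trans with (kap * U / 2).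
      - unfold U. replace (kap * (1 + X1 / c1 + X2 * 2 / kap) / 2) with (kap / 2 + X2 + kap * (X1 / c1) / 2) by (field; lra). nra.
      - assert (1 <= U) by (unfold U; lra). unfold Rdiv. apply Rmult_le_compat_r; [lra|]. apply Rmult_le_compat_l; [lra|].
        rewrite <- (Rmult_1_r U) at 1. apply Rmult_le_compat_l; lra. }
    repeat split.
    - unfold U; lra.
    - apply Rlt_div_l; [lra|]. apply Rle_lt_trans with (exp (- X1)); [apply exp_le_compat; lra|].
      eapply Rlt_le_trans; [apply EX; assumption|]. right. unfold X1. field. lra.
    - apply Rle_lt_trans with (2 * sqrt (2 / kap) * exp (- X2)).
      + apply Rmult_le_compat_l; [lra|]. apply exp_le_compat. lra.
      + apply Rlt_le_trans with (2 * sqrt (2 / kap) * / X2).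
        * apply Rmult_lt_compat_l; [lra|apply EX; assumption].
        * right. unfold X2. field. lra. }
  destruct LU as [U [HU1 [HU2 HU3]]].
  destruct (char_fun_uniform U (eps / (8 * U))) as [N1 H1]; [lra|apply Rdiv_lt_0_compat; lra|].
  destruct Hmod as [N2 H2].
  destruct (proj1 (is_lim_seq_eps _ _) HE (eps / (8 * PI))) as [N3 H3]; [apply Rdiv_lt_0_compat; lra|].
  destruct (proj1 (is_lim_seq_eps _ _) s_small (PI / U)) as [N4 H4]; [apply Rdiv_lt_0_compat; lra|].
  exists (N1 + N2 + N3 + N4)%nat. intros n Hn.
  specialize (H1 n ltac:(lia)). specialize (H2 n ltac:(lia)). specialize (H3 n ltac:(lia)). specialize (H4 n ltac:(lia)).
  rewrite Rminus_0_r in H3, H4. assert (Ps := s_pos n). rewrite (Rabs_pos_eq (s n)) in H4 by lra.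
  assert (HUV : U <= PI / s n).
  { apply Rle_div_r; [lra|]. apply Rlt_le. rewrite Rmult_comm. apply Rlt_div_r in H4; [exact H4|lra]. }
  assert (F := fourier_coefficient_scaled (p n) n (s n) Ps (weight_nonneg n) (weight_summable n)).
  set (phi := fun u => Series (fun m => p n m * cos (u * ((INR m - INR n) * s n)))) in *.
  assert (X1 : ex_RInt phi 0 U) by (apply (ex_RInt_Chasles_1 (V := R_CompleteNormedModule)) with (PI / s n); [lra|eexists; exact F]).
  assert (X2 : ex_RInt phi U (PI / s n)) by (apply (ex_RInt_Chasles_2 (V := R_CompleteNormedModule)) with 0; [lra|eexists; exact F]).
  destruct X1 as [I1 HI1]. destruct X2 as [I2 HI2].
  assert (ES : PI * (p n n / s n) = I1 + I2).
  { rewrite <- (is_RInt_unique (V := R_CompleteNormedModule) _ _ _ _ F).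
    apply (is_RInt_unique (V := R_CompleteNormedModule)). apply (is_RInt_Chasles (V := R_NormedModule) phi 0 U (PI / s n)); assumption. }
  destruct (gaussian_integral kap U Hkap ltac:(lra)) as [G [HG1 HG2]].
  assert (D1 : Rabs (I1 - G) <= eps / 8).
  { assert (Hd : is_RInt (fun u => minus (phi u) (exp (- (kap * (u * u) / 2)))) 0 U (minus I1 G)).
    { apply (is_RInt_minus (V := R_NormedModule)); assumption. }
    change (Rabs (I1 - G)) with (norm (minus I1 G)).
    eapply Rle_trans; [refine (norm_RInt_le_const (V := R_NormedModule) _ 0 U _ (eps / (8 * U)) _ _ Hd)|].
    - lra.
    - intros u Hu. exact (H1 u Hu).
    - right. field. lra. }
  assert (D2 : Rabs I2 <= exp (- (c1 * U)) / c1 + E n * (PI / s n)).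
  { refine (tail_integral_bound phi c1 (E n) U (PI / s n) I2 _ _ _ _ _); [exact Hc1|apply E_nn|lra| |exact HI2].
    intros u Hu. apply H2. lra. }
  assert (D3 : E n * (PI / s n) < eps / 8).
  { rewrite Rabs_pos_eq in H3 by (apply Rdiv_le_0_compat; [apply E_nn|exact Ps]).
    replace (E n * (PI / s n)) with (E n / s n * PI) by (field; lra).
    apply Rlt_le_trans with (eps / (8 * PI) * PI); [apply Rmult_lt_compat_r; lra|]. right. field. lra. }
  rewrite ES. apply Rabs_le_between in D1. apply Rabs_le_between in D2. apply Rabs_le_between in HG2.
  apply Rabs_def1; lra. }
apply is_lim_seq_ext with (fun n => PI * (p n n / s n) * / PI).
- intros n. unfold p. assert (Ps := s_pos n). assert (Pe := exp_pos (g (del n))). field. lra.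
(* Half of sqrt(2 PI/kap), divided by PI, is 1/sqrt(2 PI kap). *)
- replace (/ sqrt (2 * PI * kap)) with (sqrt (2 * PI / kap) / 2 * / PI).
  + apply is_lim_seq_mult'; [exact Lim1|apply is_lim_seq_const].
  + assert (Q : 0 < sqrt (2 * PI * kap)) by (apply sqrt_lt_R0; nra).
    apply Rmult_eq_reg_r with (sqrt (2 * PI * kap)); [|lra]. rewrite Rinv_l by lra.
    replace (sqrt (2 * PI / kap) / 2 * / PI * sqrt (2 * PI * kap)) with (sqrt (2 * PI / kap) * sqrt (2 * PI * kap) / (2 * PI)) by (field; lra).
    rewrite <- sqrt_mult by (try (apply Rdiv_le_0_compat); nra).
    replace (2 * PI / kap * (2 * PI * kap)) with (Rsqr (2 * PI)) by (unfold Rsqr; field; lra).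
    rewrite sqrt_Rsqr by lra. field. lra.
Qed.
End LocalLimit.

(** * Binomial expansion and powers of null sequences *)

Fixpoint gbinom (p : R) (k : nat) : R :=
  match k with O => 1 | S k => gbinom p k * (p - INR k) / INR (S k) end.

Lemma gbinom_shift p k : INR (S k) * gbinom p (S k) = p * gbinom (p - 1) k.
Proof.
assert (N := lt_0_INR (S k) (Nat.lt_0_succ k)).
revert p N. induction k as [|k IH]; intros p N.
- simpl. field.
- assert (Nk := lt_0_INR (S k) (Nat.lt_0_succ k)). specialize (IH p Nk).
  change (gbinom p (S (S k))) with (gbinom p (S k) * (p - INR (S k)) / INR (S (S k))).
  change (gbinom (p - 1) (S k)) with (gbinom (p - 1) k * (p - 1 - INR k) / INR (S k)).
  replace (p * (gbinom (p - 1) k * (p - 1 - INR k) / INR (S k))) with (p * gbinom (p - 1) k * (p - 1 - INR k) / INR (S k)) by (field; lra).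
  rewrite <- IH. assert (Ek := S_INR k). replace (INR k) with (INR (S k) - 1) by lra. field. lra.
Qed.

(** The binomial series cut to [n] terms, so that the remainder is of order y^n. *)
Fixpoint binom_sum (p : R) (n : nat) (y : R) : R :=
  match n with O => 0 | S n => binom_sum p n y + gbinom p n * y ^ n end.

Lemma binom_sum_derive p n y : is_derive (binom_sum p (S n)) y (p * binom_sum (p - 1) n y).
Proof.
induction n as [|n IH].
- apply (is_derive_ext (fun _ => 1)); [intros t; simpl; ring|].
  replace (p * binom_sum (p - 1) 0 y) with (@zero R_NormedModule) by (simpl; rewrite Rmult_0_r; reflexivity).
  apply (is_derive_const (V := R_NormedModule) 1 y).
- change (binom_sum p (S (S n))) with (fun y => binom_sum p (S n) y + gbinom p (S n) * y ^ S n).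
  change (binom_sum (p - 1) (S n) y) with (binom_sum (p - 1) n y + gbinom (p - 1) n * y ^ n).
  replace (p * (binom_sum (p - 1) n y + gbinom (p - 1) n * y ^ n))
    with (plus (p * binom_sum (p - 1) n y) (gbinom p (S n) * (INR (S n) * y ^ n))).
  + apply (is_derive_plus (K := R_AbsRing) (V := R_NormedModule)); [exact IH|].
    apply (is_derive_scal (fun y => y ^ S n)).
    replace (INR (S n) * y ^ n) with (INR (S n) * 1 * y ^ pred (S n)) by (simpl pred; ring).
    apply (is_derive_pow (fun y => y)). apply (is_derive_id (K := R_AbsRing)).
  + match goal with |- plus ?a ?b = _ => change (a + b = p * (binom_sum (p - 1) n y + gbinom (p - 1) n * y ^ n)) end.
    replace (gbinom p (S n) * (INR (S n) * y ^ n)) with (INR (S n) * gbinom p (S n) * y ^ n) by ring.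
    rewrite gbinom_shift. ring.
Qed.

Lemma binom_sum_at_0 p n : binom_sum p (S n) 0 = 1.
Proof.
induction n as [|n IH]; [simpl; ring|].
change (binom_sum p (S (S n)) 0) with (binom_sum p (S n) 0 + gbinom p (S n) * 0 ^ S n).
rewrite IH, pow_i by lia. ring.
Qed.

Lemma is_derive_Rpower_1p p y : -1 < y -> is_derive (fun y => Rpower (1 + y) p) y (p * Rpower (1 + y) (p - 1)).
Proof.
intros Hy. replace (p * Rpower (1 + y) (p - 1)) with (scal 1 (p * Rpower (1 + y) (p - 1)))
  by (unfold scal; simpl; unfold mult; simpl; ring).
apply (is_derive_comp (fun z => Rpower z p) (fun y => 1 + y)).
- apply is_derive_Reals, derivable_pt_lim_power. lra.
- auto_derive; [exact I|ring].
Qed.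

(** The remainder for [p] has as derivative p times the remainder for p - 1 with one term less, so
    the mean value theorem gains one power. Hence the induction runs over all [p] at once. *)
Theorem binom_taylor n : forall p, exists K, 0 <= K /\ forall y, Rabs y <= 1 / 2 ->
  Rabs (Rpower (1 + y) p - binom_sum p n y) <= K * Rabs y ^ n.
Proof.
induction n as [|n IH]; intros p.
- exists (exp (Rabs p * ln 2)). split; [apply Rlt_le, exp_pos|]. intros y Hy. apply Rabs_le_between in Hy.
  simpl. rewrite Rminus_0_r, Rmult_1_r. rewrite Rabs_pos_eq by (apply Rlt_le, exp_pos).
  unfold Rpower. apply exp_le_compat. eapply Rle_trans; [apply Rle_abs|]. rewrite Rabs_mult.
  apply Rmult_le_compat_l; [apply Rabs_pos|].
  assert (L2 : 0 < ln 2) by (rewrite <- ln_1; apply ln_increasing; lra).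
  apply Rabs_le. split.
  + rewrite <- ln_Rinv by lra. apply ln_le; lra.
  + apply ln_le; lra.
- destruct (IH (p - 1)) as [K [HK HB]]. exists (Rabs p * K). split; [apply Rmult_le_pos; [apply Rabs_pos|exact HK]|].
  intros y Hy. set (F := fun y => Rpower (1 + y) p - binom_sum p (S n) y).
  assert (Hd : forall z, Rabs z <= 1 / 2 -> is_derive F z (p * (Rpower (1 + z) (p - 1) - binom_sum (p - 1) n z))).
  { intros z Hz. apply Rabs_le_between in Hz. rewrite Rmult_minus_distr_l.
    apply (is_derive_minus (K := R_AbsRing) (V := R_NormedModule) (fun y => Rpower (1 + y) p) (binom_sum p (S n))).
    - apply is_derive_Rpower_1p. lra.
    - apply binom_sum_derive. }
  assert (Rng : forall z, Rmin 0 y <= z <= Rmax 0 y -> Rabs z <= Rabs y).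
  { intros z. unfold Rmin, Rmax. destruct (Rle_dec 0 y).
    - intros. rewrite !Rabs_pos_eq; lra.
    - intros. rewrite !Rabs_left1; lra. }
  destruct (MVT_gen F 0 y (fun z => p * (Rpower (1 + z) (p - 1) - binom_sum (p - 1) n z))) as [xi [Hxi E]].
  + intros x Hx. apply Hd. eapply Rle_trans; [apply Rng; lra|exact Hy].
  + intros x Hx. apply derivable_continuous_pt, ex_derive_Reals_0. eexists. apply Hd.
    eapply Rle_trans; [apply Rng; lra|exact Hy].
  + assert (F0 : F 0 = 0).
    { unfold F. rewrite binom_sum_at_0, Rplus_0_r. unfold Rpower. rewrite ln_1, Rmult_0_r, exp_0. ring. }
    rewrite F0, !Rminus_0_r in E. fold (F y). rewrite E. rewrite !Rabs_mult. change (Rabs y ^ S n) with (Rabs y * Rabs y ^ n).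
    specialize (Rng xi Hxi). specialize (HB xi ltac:(lra)).
    assert (P : Rabs xi ^ n <= Rabs y ^ n) by (apply pow_incr; split; [apply Rabs_pos|exact Rng]).
    assert (K * Rabs xi ^ n <= K * Rabs y ^ n) by (apply Rmult_le_compat_l; assumption).
    replace (Rabs p * K * (Rabs y * Rabs y ^ n)) with (Rabs p * (K * Rabs y ^ n) * Rabs y) by ring.
    apply Rmult_le_compat_r; [apply Rabs_pos|]. apply Rmult_le_compat_l; [apply Rabs_pos|]. lra.
Qed.

Lemma pow_le_fact_exp k y : 0 <= y -> y ^ k <= INR (fact k) * exp y.
Proof.
intros Hy. assert (P := INR_fact_lt_0 k). rewrite Rmult_comm. apply Rle_div_l; [exact P|].
assert (T : forall n, 0 <= y ^ n / INR (fact n)).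
{ intros n. apply Rdiv_le_0_compat; [apply pow_le, Hy|apply INR_fact_lt_0]. }
rewrite <- (is_series_unique _ _ (is_series_exp y)).
eapply Rle_trans; [|apply (sum_n_le_Series _ k T); eexists; apply is_series_exp].
apply (term_le_sum_n (fun n => y ^ n / INR (fact n))); [exact T|lia].
Qed.

Lemma is_lim_seq_dom_0 (u v : nat -> R) : (exists N, forall n, (N <= n)%nat -> Rabs (u n) <= v n) ->
  is_lim_seq v 0 -> is_lim_seq u 0.
Proof.
intros [N HN] Hv. apply is_lim_seq_eps. intros eps He.
destruct (proj1 (is_lim_seq_eps _ _) Hv eps He) as [N2 H2]. exists (N + N2)%nat. intros n Hn.
specialize (HN n ltac:(lia)). specialize (H2 n ltac:(lia)). rewrite Rminus_0_r in *.
generalize (Rle_abs (v n)); lra.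
Qed.

Lemma is_lim_seq_scal_0 (u : nat -> R) K : is_lim_seq u 0 -> is_lim_seq (fun n => K * u n) 0.
Proof. intros H. replace 0 with (K * 0) by ring. apply is_lim_seq_mult'; [apply is_lim_seq_const|exact H]. Qed.

Lemma is_lim_seq_Rpower_0 (d : nat -> R) e : 0 < e -> (forall n, 0 < d n) -> is_lim_seq d 0 ->
  is_lim_seq (fun n => Rpower (d n) e) 0.
Proof.
intros He Hd Hl. apply is_lim_seq_eps. intros eps Heps.
destruct (proj1 (is_lim_seq_eps _ _) Hl (Rpower eps (/ e))) as [N HN]; [apply exp_pos|].
exists N. intros n Hn. specialize (HN n Hn). rewrite Rminus_0_r in *. specialize (Hd n).
rewrite Rabs_pos_eq in HN by lra. rewrite Rabs_pos_eq by (apply Rlt_le, exp_pos).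
replace eps with (Rpower (Rpower eps (/ e)) e).
- apply Rlt_Rpower_l; [exact He|lra].
- rewrite Rpower_mult, Rinv_l by lra. apply Rpower_1, Heps.
Qed.

Lemma Rpower_inv_base x e : 0 < x -> Rpower (/ x) e = Rpower x (- e).
Proof. intros Hx. unfold Rpower. rewrite ln_Rinv by exact Hx. f_equal. ring. Qed.

(** exp(-y) is at most k!/y^k for every k; taking k above q/e beats the power in the denominator. *)
Lemma is_lim_seq_exp_Rpower (d : nat -> R) c e q : 0 < c -> 0 < e -> 0 <= q -> (forall n, 0 < d n) -> is_lim_seq d 0 ->
  is_lim_seq (fun n => exp (- (c * Rpower (d n) (- e))) / Rpower (d n) q) 0.
Proof.
intros Hc He Hq Hd Hl. destruct (INR_unbounded (q / e)) as [k Hk].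
assert (Hk2 : 0 < e * INR k - q) by (apply Rlt_div_l in Hk; lra).
apply is_lim_seq_dom_0 with (fun n => (INR (fact k) * / c ^ k) * Rpower (d n) (e * INR k - q)).
- exists 0%nat. intros n _. specialize (Hd n).
  rewrite Rabs_pos_eq by (apply Rlt_le, Rdiv_lt_0_compat; apply exp_pos).
  set (y := c * Rpower (d n) (- e)). assert (Hy : 0 < y) by (apply Rmult_lt_0_compat; [exact Hc|apply exp_pos]).
  assert (Py : y ^ k <= INR (fact k) * exp y) by (apply pow_le_fact_exp; lra).
  assert (Pk : 0 < y ^ k) by (apply pow_lt, Hy).
  assert (B : exp (- y) <= INR (fact k) / y ^ k).
  { rewrite exp_Ropp. apply Rle_div_r; [exact Pk|]. rewrite Rmult_comm. apply Rle_div_l; [apply exp_pos|exact Py]. }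
  assert (Eyk : y ^ k = c ^ k * Rpower (d n) (- (e * INR k))).
  { unfold y. rewrite Rpow_mult_distr. f_equal. rewrite <- Rpower_pow by apply exp_pos. rewrite Rpower_mult. f_equal. ring. }
  apply Rle_trans with (INR (fact k) / y ^ k / Rpower (d n) q).
  + apply Rmult_le_compat_r; [apply Rlt_le, Rinv_0_lt_compat, exp_pos|exact B].
  + right. rewrite Eyk. unfold Rminus. rewrite Rpower_plus, (Rpower_Ropp (d n) q), (Rpower_Ropp (d n) (e * INR k)).
    assert (P1 := pow_lt c k Hc). assert (P2 : 0 < Rpower (d n) q) by apply exp_pos.
    assert (P3 : 0 < Rpower (d n) (e * INR k)) by apply exp_pos. field. lra.
- apply is_lim_seq_scal_0, is_lim_seq_Rpower_0; assumption.
Qed.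

Lemma sum_n_plus_R (a b : nat -> R) n : sum_n (fun k => a k + b k) n = sum_n a n + sum_n b n.
Proof.
induction n as [|n IH]; [rewrite !sum_O; reflexivity|]. rewrite !sum_n_succ, IH. symmetry. as_R_eq. ring.
Qed.

Lemma sum_n_last_only (f : nat -> R) v J : (forall k, (k < J)%nat -> f k = 0) -> f J = v -> sum_n f J = v.
Proof.
intros H0 HJ. destruct J as [|J]; [rewrite sum_O; exact HJ|]. rewrite sum_n_succ, HJ.
assert (E : forall m, (m <= J)%nat -> sum_n f m = 0).
{ induction m as [|m IH]; intros Hm; [rewrite sum_O; apply H0; lia|]. rewrite sum_n_succ, IH, H0 by lia. apply Rplus_0_l. }
rewrite E by lia. apply Rplus_0_l.
Qed.

(** * Gaussian limit of the moment generating function *)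

Section MgfLimit.
Variables (g : R -> R) (J : nat) (h rh : nat -> R) (rr A0 Th : R) (del : nat -> R).
Let G x := sum_n (fun k => h k * Rpower x (- rh k)) J - A0 * ln x + Th.
Hypothesis HgG : forall eta, 0 < eta -> exists d0, 0 < d0 /\ forall x, 0 < x < d0 -> Rabs (g x - G x) <= eta.
Hypothesis rr_pos : 0 < rr.
Hypothesis rh_last : rh J = rr.
Hypothesis rh_lt : forall k, (k < J)%nat -> rh k < rr.
Hypothesis del_pos : forall n, 0 < del n.
Hypothesis del_lim : is_lim_seq del 0.
Let s n := Rpower (del n) (1 + rr / 2).
Hypothesis saddle : is_lim_seq (fun n => s n * (INR n - sum_n (fun k => h k * rh k * Rpower (del n) (- rh k - 1)) J)) 0.

Lemma expansion_gap (u : nat -> R) : (exists N, forall n, (N <= n)%nat -> 0 < u n) -> is_lim_seq u 0 ->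
  is_lim_seq (fun n => g (u n) - G (u n)) 0.
Proof.
intros [N HN] Hu. apply is_lim_seq_eps. intros eps He.
destruct (HgG (eps / 2)) as [d0 [Hd0 HG]]; [lra|].
destruct (proj1 (is_lim_seq_eps _ _) Hu d0 Hd0) as [N2 H2]. exists (N + N2)%nat. intros n Hn.
specialize (HN n ltac:(lia)). specialize (H2 n ltac:(lia)). rewrite Rminus_0_r in *. rewrite Rabs_pos_eq in H2 by lra.
specialize (HG (u n) ltac:(lra)). lra.
Qed.

Lemma rh_le k : (k <= J)%nat -> rh k <= rr.
Proof.
intros Hk. destruct (le_lt_eq_dec k J Hk) as [L|E]; [apply Rlt_le, rh_lt, L|subst; lra].
Qed.

(** The relative shift t s(n)/del(n), that is, del - t s = del (1 - z). *)
Let z t n := t * Rpower (del n) (rr / 2).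

Lemma z_lim t : is_lim_seq (z t) 0.
Proof. apply is_lim_seq_scal_0, is_lim_seq_Rpower_0; [lra|exact del_pos|exact del_lim]. Qed.

Lemma z_small t : exists N, forall n, (N <= n)%nat -> Rabs (z t n) <= 1 / 2.
Proof.
destruct (proj1 (is_lim_seq_eps _ _) (z_lim t) (1 / 2)) as [N HN]; [lra|]. exists N. intros n Hn.
specialize (HN n Hn). rewrite Rminus_0_r in HN. lra.
Qed.

(** z^2 has size del^rr, so the second-order term survives for the leading exponent only; the cubic
    remainder is O(del^(3 rr/2 - rh k)). *)
Lemma second_order_term t k : (k <= J)%nat ->
  is_lim_seq (fun n => Rpower (del n) (- rh k) * (Rpower (1 + - z t n) (- rh k) - 1 - rh k * z t n))
    (Finite (if Nat.eqb k J then rr * (rr + 1) / 2 * (t * t) else 0)).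
Proof.
intros Hk. destruct (binom_taylor 3 (- rh k)) as [K [HK HB]].
apply is_lim_seq_ext with (fun n => Rpower (del n) (- rh k) * (Rpower (1 + - z t n) (- rh k) - binom_sum (- rh k) 3 (- z t n))
   + rh k * (rh k + 1) / 2 * (t * t) * Rpower (del n) (rr - rh k)).
- intros n. assert (E : Rpower (del n) (rr - rh k) * (t * t) = Rpower (del n) (- rh k) * (z t n * z t n)).
  { unfold z. replace (rr - rh k) with (- rh k + (rr / 2 + rr / 2)) by field. rewrite !Rpower_plus. ring. }
  replace (rh k * (rh k + 1) / 2 * (t * t) * Rpower (del n) (rr - rh k))
    with (rh k * (rh k + 1) / 2 * (Rpower (del n) (rr - rh k) * (t * t))) by ring.
  rewrite E. simpl. field.
- replace (Finite (if Nat.eqb k J then rr * (rr + 1) / 2 * (t * t) else 0))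
    with (Finite (0 + rh k * (rh k + 1) / 2 * (t * t) * (if Nat.eqb k J then 1 else 0))).
  2:{ f_equal. destruct (Nat.eqb_spec k J) as [E|E]; [subst k; rewrite rh_last; ring|ring]. }
  apply is_lim_seq_plus'.
  + apply is_lim_seq_dom_0 with (fun n => K * Rabs t ^ 3 * Rpower (del n) (3 * rr / 2 - rh k)).
    * destruct (z_small t) as [N HN]. exists N. intros n Hn. specialize (HN n Hn).
      rewrite Rabs_mult, Rabs_pos_eq by (apply Rlt_le, exp_pos).
      specialize (HB (- z t n)). rewrite Rabs_Ropp in HB. specialize (HB HN).
      apply Rle_trans with (Rpower (del n) (- rh k) * (K * Rabs (z t n) ^ 3)).
      -- apply Rmult_le_compat_l; [apply Rlt_le, exp_pos|exact HB].
      -- right. unfold z. rewrite Rabs_mult, (Rabs_pos_eq (Rpower (del n) (rr / 2))) by (apply Rlt_le, exp_pos).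
         replace (3 * rr / 2 - rh k) with (- rh k + (rr / 2 + (rr / 2 + rr / 2))) by field. rewrite !Rpower_plus. ring.
    * apply is_lim_seq_scal_0, is_lim_seq_Rpower_0; [|exact del_pos|exact del_lim]. assert (Q := rh_le k Hk). lra.
  + apply is_lim_seq_mult'; [apply is_lim_seq_const|]. destruct (Nat.eqb_spec k J) as [E|E].
    * apply is_lim_seq_ext with (fun _ => 1); [|apply is_lim_seq_const]. intros n. subst k. rewrite rh_last, Rminus_diag.
      symmetry. apply Rpower_O, del_pos.
    * apply is_lim_seq_Rpower_0; [|exact del_pos|exact del_lim]. generalize (rh_lt k ltac:(lia)). lra.
Qed.

(** The linear terms of the expansion combine with -t s n into the saddle-point defect, the
    logarithm contributes a multiple of ln(1 - z), and g - G vanishes in the limit at both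
    arguments. The leading second-order term remains. *)
Theorem mgf_limit t : is_lim_seq (fun n => g (del n - t * s n) - g (del n) - t * s n * INR n)
  (h J * rr * (rr + 1) * (t * t) / 2).
Proof.
assert (Es : forall n, t * s n = del n * z t n).
{ intros n. unfold s, z. rewrite Rpower_plus, Rpower_1 by apply del_pos. ring. }
assert (Ed : forall n, del n - t * s n = del n * (1 + - z t n)) by (intros n; rewrite Es; ring).
destruct (z_small t) as [N HN].
assert (Pz : forall n, (N <= n)%nat -> 0 < 1 + - z t n).
{ intros n Hn. specialize (HN n Hn). apply Rabs_le_between in HN. lra. }
apply is_lim_seq_ext_loc with (fun n => (g (del n - t * s n) - G (del n - t * s n)) - (g (del n) - G (del n))
  + sum_n (fun k => h k * (Rpower (del n) (- rh k) * (Rpower (1 + - z t n) (- rh k) - 1 - rh k * z t n))) J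
  + ((- t) * (s n * (INR n - sum_n (fun k => h k * rh k * Rpower (del n) (- rh k - 1)) J)) + (- A0) * ln (1 + - z t n))).
- exists N. intros n Hn. specialize (Pz n Hn). assert (Pd := del_pos n).
  (* An exact identity: zeroth-order terms cancel, and the linear ones appear as t s times the
     saddle sum. *)
  assert (EG : G (del n - t * s n) - G (del n) =
    sum_n (fun k => h k * (Rpower (del n) (- rh k) * (Rpower (1 + - z t n) (- rh k) - 1 - rh k * z t n))) J
    + t * s n * sum_n (fun k => h k * rh k * Rpower (del n) (- rh k - 1)) J - A0 * ln (1 + - z t n)).
  { unfold G. rewrite Ed, ln_mult by assumption. rewrite <- sum_n_scal_l_R, <- sum_n_plus_R.
    rewrite (sum_n_ext (fun k => h k * (Rpower (del n) (- rh k) * (Rpower (1 + - z t n) (- rh k) - 1 - rh k * z t n))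
        + t * s n * (h k * rh k * Rpower (del n) (- rh k - 1)))
      (fun k => h k * Rpower (del n * (1 + - z t n)) (- rh k) - h k * Rpower (del n) (- rh k))).
    - rewrite sum_n_minus. ring.
    - intros k. as_R_eq. rewrite <- Rpower_mult_distr by assumption.
      replace (t * s n * (h k * rh k * Rpower (del n) (- rh k - 1))) with (h k * rh k * z t n * (del n * Rpower (del n) (- rh k - 1)))
        by (rewrite Es; ring).
      replace (del n * Rpower (del n) (- rh k - 1)) with (Rpower (del n) (- rh k)).
      + ring.
      + rewrite <- (Rpower_1 (del n)) at 2 by exact Pd. rewrite <- Rpower_plus. f_equal. ring. }
  replace (g (del n - t * s n) - g (del n) - t * s n * INR n) with
    ((g (del n - t * s n) - G (del n - t * s n)) - (g (del n) - G (del n)) + (G (del n - t * s n) - G (del n)) - t * s n * INR n) by ring.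
  rewrite EG. ring.
- replace (Finite (h J * rr * (rr + 1) * (t * t) / 2)) with
    (Finite (0 - 0 + sum_n (fun k => h k * (if Nat.eqb k J then rr * (rr + 1) / 2 * (t * t) else 0)) J + ((- t) * 0 + (- A0) * ln 1))).
  + apply is_lim_seq_plus'; [apply is_lim_seq_plus'; [apply is_lim_seq_minus'|]|apply is_lim_seq_plus'].
    * apply expansion_gap.
      -- exists N. intros n Hn. rewrite Ed. apply Rmult_lt_0_compat; [apply del_pos|apply Pz, Hn].
      -- apply is_lim_seq_ext with (fun n => del n * (1 + - z t n)); [intros n; symmetry; apply Ed|].
         replace 0 with (0 * (1 - 0)) by ring. apply is_lim_seq_mult'; [exact del_lim|].
         apply (is_lim_seq_minus' (fun _ => 1) (z t) 1 0); [apply is_lim_seq_const|apply z_lim].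
    * apply expansion_gap; [exists 0%nat; intros; apply del_pos|exact del_lim].
    * apply (is_lim_seq_sum_n (fun n k => h k * (Rpower (del n) (- rh k) * (Rpower (1 + - z t n) (- rh k) - 1 - rh k * z t n)))
        (fun k => h k * (if Nat.eqb k J then rr * (rr + 1) / 2 * (t * t) else 0)) J).
      intros k Hk. apply is_lim_seq_mult'; [apply is_lim_seq_const|apply second_order_term, Hk].
    * apply is_lim_seq_mult'; [apply is_lim_seq_const|exact saddle].
    * apply is_lim_seq_mult'; [apply is_lim_seq_const|]. apply (is_lim_seq_continuous ln).
      -- apply derivable_continuous_pt. eexists. apply derivable_pt_lim_ln. lra.
      -- replace (Finite 1) with (Finite (1 - 0)) by (f_equal; ring).
         apply (is_lim_seq_minus' (fun _ => 1) (z t) 1 0); [apply is_lim_seq_const|apply z_lim].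
  + f_equal. rewrite ln_1, (sum_n_last_only _ (h J * (rr * (rr + 1) / 2 * (t * t))) J).
    * field.
    * intros k Hk. destruct (Nat.eqb_spec k J); [lia|apply Rmult_0_r].
    * rewrite Nat.eqb_refl. reflexivity.
Qed.
End MgfLimit.

(** * Asymptotics along an approximate saddle point *)

Section Setting.
Variables (a b c d xi : nat -> R) (l0 : nat).
Hypothesis Hset : product_setting a b c d xi.
Hypothesis Hl0 : least_positive_index d l0.
Let L := Lambda a b xi.
Let g x := Series (fun i => L (S i) * exp (- (x * INR (S i)))).
(** The amount by which log |f| drops from the real point exp(-x) to the point of the same modulus
    at angle [th]. *)
Let W x th := Series (fun i => L (S i) * (exp (- (x * INR (S i))) * (1 - cos (INR (S i) * th)))).

Lemma c_radius_ge_1 : Rbar_le 1 (CV_radius c).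
Proof. rewrite (c_radius _ _ _ _ _ Hset). apply Rle_refl. Qed.

Lemma gf_series x : 0 < x -> is_series (fun m => c m * exp (- (x * INR m))) (exp (g x)).
Proof.
intros Hx. assert (E := exp_neg_range x Hx).
assert (Hr : Rabs (exp (- x)) < 1) by (rewrite Rabs_pos_eq; lra).
assert (F := f_exp_log a b c d xi l0 Hset Hl0 (exp (- x)) Hr).
rewrite (PSeries_Lambda a b c d xi l0 Hset Hl0 _ Hr) in F.
replace (exp (g x)) with (PSeries c (exp (- x))).
- apply (is_series_ext (fun m => c m * exp (- x) ^ m)); [intros m; rewrite exp_neg_pow; reflexivity|].
  apply Series_correct. apply ex_series_Rabs, CV_disk_of_radius_ge_1; [apply c_radius_ge_1|exact Hr].
- rewrite F. f_equal. unfold g. apply Series_ext. intros i. rewrite exp_neg_pow. reflexivity.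
Qed.

Lemma L_summable x : 0 < x -> ex_series (fun i => Rabs (L (S i) * exp (- (x * INR (S i))))).
Proof.
intros Hx. assert (E := exp_neg_range x Hx).
apply (ex_series_ext (fun i => Rabs (L (S i) * exp (- x) ^ S i))); [intros i; rewrite exp_neg_pow; reflexivity|].
apply (Lambda_abs_summable a b c d xi l0 Hset Hl0). rewrite Rabs_pos_eq; lra.
Qed.

(** The cosine series centred at [n] is the projection of f onto the direction of angle n th, up to
    normalisation, so the modulus bounds it for every [n]. *)
Lemma char_fun_modulus x th n : 0 < x ->
  Rabs (Series (fun m => c m * exp (- (x * INR m)) / exp (g x) * cos (th * (INR m - INR n)))) <= exp (- W x th).
Proof.
intros Hx. assert (E := exp_neg_range x Hx). assert (Pg := exp_pos (g x)).
assert (Hr : Rabs (exp (- x)) < 1) by (rewrite Rabs_pos_eq; lra).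
assert (CM := circle_modulus c L th (exp (- x)) c_radius_ge_1 (Lambda_radius a b c d xi l0 Hset Hl0)
   (c_zero _ _ _ _ _ Hset) (Lambda_0 a b xi) (f_exp_log a b c d xi l0 Hset Hl0) ltac:(lra)).
set (P := PSeries (fun n => c n * cos (INR n * th)) (exp (- x))) in *.
set (Q := PSeries (fun n => c n * sin (INR n * th)) (exp (- x))) in *.
assert (Dom : forall v : nat -> R, (forall m, Rabs (v m) <= 1) -> ex_series (fun m => c m * v m * exp (- x) ^ m)).
{ intros v Hv. apply ex_series_dom with (fun m => c m * exp (- (x * INR m))); [|eexists; apply gf_series, Hx].
  intros m. rewrite exp_neg_pow, !Rabs_mult, (Rabs_pos_eq (c m)) by apply (c_nonneg _ _ _ _ _ Hset).
  rewrite (Rabs_pos_eq (exp _)) by (apply Rlt_le, exp_pos).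
  assert (0 <= c m * exp (- (x * INR m))) by (apply Rmult_le_pos; [apply (c_nonneg _ _ _ _ _ Hset)|apply Rlt_le, exp_pos]).
  specialize (Hv m). nra. }
assert (DP := Dom (fun m => cos (INR m * th)) (fun m => Rabs_le _ _ (COS_bound _))).
assert (DQ := Dom (fun m => sin (INR m * th)) (fun m => Rabs_le _ _ (SIN_bound _))).
assert (ES : Series (fun m => c m * exp (- (x * INR m)) / exp (g x) * cos (th * (INR m - INR n)))
  = (cos (INR n * th) * P + sin (INR n * th) * Q) / exp (g x)).
{ unfold P, Q, PSeries, Rdiv. rewrite <- !Series_scal_l, <- Series_plus by
    first [exact (ex_series_scal_l (K := R_AbsRing) (cos (INR n * th)) _ DP)|exact (ex_series_scal_l (K := R_AbsRing) (sin (INR n * th)) _ DQ)].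
  rewrite <- Series_scal_r. apply Series_ext. intros m. rewrite exp_neg_pow.
  replace (th * (INR m - INR n)) with (INR m * th - INR n * th) by ring. rewrite cos_minus. ring. }
assert (ED : PSeries (fun n => L n * cos (INR n * th)) (exp (- x)) = g x - W x th).
{ assert (Xg := ex_series_Rabs _ (L_summable x Hx)).
  assert (XW : ex_series (fun i => L (S i) * (exp (- (x * INR (S i))) * (1 - cos (INR (S i) * th))))).
  { apply ex_series_dom with (fun i => 2 * Rabs (L (S i) * exp (- (x * INR (S i))))).
    - intros i. rewrite <- Rmult_assoc, Rabs_mult, Rmult_comm. apply Rmult_le_compat_r; [apply Rabs_pos|].
      generalize (COS_bound (INR (S i) * th)). intros. apply Rabs_le. lra.
    - apply (ex_series_scal_l (K := R_AbsRing) 2 (fun i => Rabs (L (S i) * exp (- (x * INR (S i)))))), L_summable, Hx. }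
  unfold g, W. rewrite <- Series_minus by assumption. unfold PSeries.
  rewrite Series_incr_1_aux by (unfold L; rewrite Lambda_0; ring).
  apply Series_ext. intros i. rewrite exp_neg_pow. ring. }
rewrite ED in CM. rewrite ES.
assert (B : (cos (INR n * th) * P + sin (INR n * th) * Q) * (cos (INR n * th) * P + sin (INR n * th) * Q) <= P * P + Q * Q).
{ assert (T := sin2_cos2 (INR n * th)). unfold Rsqr in T. set (cc := cos (INR n * th)) in *. set (ss := sin (INR n * th)) in *.
  assert (0 <= (cc * Q - ss * P) * (cc * Q - ss * P)) by apply Rle_0_sqr.
  replace (P * P + Q * Q) with ((ss * ss + cc * cc) * (P * P + Q * Q)) by (rewrite T; ring). nra. }
apply Rsqr_incr_0_var; [|apply Rlt_le, exp_pos]. rewrite <- Rsqr_abs. unfold Rsqr.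
replace (exp (- W x th) * exp (- W x th)) with (exp (2 * (g x - W x th)) / (exp (g x) * exp (g x))).
- rewrite CM in B. unfold Rdiv. rewrite Rinv_mult.
  replace ((cos (INR n * th) * P + sin (INR n * th) * Q) * / exp (g x) * ((cos (INR n * th) * P + sin (INR n * th) * Q) * / exp (g x)))
    with ((cos (INR n * th) * P + sin (INR n * th) * Q) * (cos (INR n * th) * P + sin (INR n * th) * Q) * (/ exp (g x) * / exp (g x))) by ring.
  apply Rmult_le_compat_r; [|exact B]. assert (0 < / exp (g x)) by (apply Rinv_0_lt_compat, Pg). nra.
- unfold Rdiv. rewrite <- exp_plus, <- exp_plus, <- exp_Ropp, <- exp_plus. f_equal. ring.
Qed.

Variables (rr : R).
Hypothesis rr_pos : 0 < rr.
Hypothesis Hlow : lower_bound_condition a b L l0 rr.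

(* Near the real axis the pairs [(l0, k)] of the product decide; on the outer arcs the second half of condition (III) does. *)
Lemma char_fun_decay : exists c0 ep d0, 0 < c0 /\ 0 < ep /\ 0 < d0 /\ forall x th, 0 < x < d0 -> 0 <= th <= PI ->
  exp (- W x th) <= exp (- (c0 * (th / Rpower x (1 + rr / 2) * (th / Rpower x (1 + rr / 2)))))
    + (exp (- (c0 * Rpower x (- rr))) + Rpower x (1 + rr / 2 + ep)).
Proof.
destruct Hlow as [[C2 [HC2 HB]] Hout].
destruct (central_lower_bound a b c d xi l0 Hset Hl0 rr C2 HC2 HB) as [c0 [Hc0 HC]].
assert (Out : exists ep d0, 0 < ep /\ 0 < d0 /\ forall x th, 0 < x < d0 -> 0 <= th <= PI -> PI < INR l0 * th ->
   exp (- W x th) <= Rpower x (1 + rr / 2 + ep)).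
{ assert (PP := PI_RGT_0). destruct (le_lt_dec l0 1) as [Hle|Hlt].
  (* For l0 = 1 there is no outer arc, since th <= PI. *)
  - exists 1, 1. split; [lra|split; [lra|]]. intros x th _ Hth Hbig. exfalso.
    assert (INR l0 <= 1) by (apply (le_INR l0 1) in Hle; simpl in Hle; lra). nra.
  - destruct (Hout Hlt) as [ep [d0 [Hep [Hd0 HO]]]]. exists ep, (Rmin d0 1).
    split; [exact Hep|split; [apply Rmin_pos; lra|]]. intros x th Hx Hth Hbig.
    assert (Hx0 : x < d0) by (eapply Rlt_le_trans; [apply Hx|apply Rmin_l]).
    assert (Hx1 : x < 1) by (eapply Rlt_le_trans; [apply Hx|apply Rmin_r]).
    assert (Pl : 0 < INR l0) by (apply lt_0_INR; lia).
    (* alpha = th/(2 PI) turns 2 sin^2(PI k alpha) into 1 - cos(k th). *)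
    specialize (HO x (th / (2 * PI)) ltac:(lra)).
    assert (EW : 2 * Series (fun i => L (S i) * exp (- (INR (S i) * x)) * (sin (PI * INR (S i) * (th / (2 * PI)))) ^ 2) = W x th).
    { rewrite <- Series_scal_l. unfold W. apply Series_ext. intros i.
      replace (INR (S i) * th) with (2 * (PI * INR (S i) * (th / (2 * PI)))) by (field; lra).
      rewrite cos_2a_sin, (Rmult_comm (INR (S i)) x). ring. }
    rewrite EW in HO.
    assert (HA : / (2 * INR l0) <= Rabs (th / (2 * PI)) <= 1 / 2).
    { rewrite Rabs_pos_eq by (apply Rdiv_le_0_compat; lra). split.
      - apply Rle_div_r; [lra|]. apply Rmult_le_reg_l with (INR l0); [exact Pl|].
        replace (INR l0 * (/ (2 * INR l0) * (2 * PI))) with PI by (field; lra). lra.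
      - apply Rle_div_l; lra. }
    specialize (HO HA). unfold Rpower. apply exp_le_compat.
    assert (Hln : ln x < 0) by (rewrite <- ln_1; apply ln_increasing; lra).
    rewrite Rabs_left in HO by exact Hln. lra. }
destruct Out as [ep [d0 [Hep [Hd0 HO]]]]. exists c0, ep, (Rmin d0 1).
split; [exact Hc0|split; [exact Hep|split; [apply Rmin_pos; lra|]]]. intros x th Hx Hth.
assert (Hx0 : x < d0) by (eapply Rlt_le_trans; [apply Hx|apply Rmin_l]).
assert (Hx1 : x < 1) by (eapply Rlt_le_trans; [apply Hx|apply Rmin_r]).
assert (P1 := exp_pos (- (c0 * (th / Rpower x (1 + rr / 2) * (th / Rpower x (1 + rr / 2)))))).
assert (P2 := exp_pos (- (c0 * Rpower x (- rr)))).
assert (P3 : 0 < Rpower x (1 + rr / 2 + ep)) by apply exp_pos.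
destruct (Rle_lt_dec (INR l0 * th) PI) as [Hs|Hb].
- specialize (HC x th ltac:(lra)). rewrite (Rabs_pos_eq th) in HC by lra. specialize (HC Hs). fold L in HC. fold (W x th) in HC.
  assert (Pr : 0 < Rpower x (- rr)) by apply exp_pos.
  (* For th < x the central bound is Gaussian in u = th/x^(1 + rr/2). *)
  assert (Eu : Rpower x (- rr) * (th / x * (th / x)) = th / Rpower x (1 + rr / 2) * (th / Rpower x (1 + rr / 2))).
  { assert (Q : forall q, Rpower x (- (q + q)) * (th / x * (th / x)) = th / Rpower x (1 + q) * (th / Rpower x (1 + q))).
    { intros q. rewrite Rpower_Ropp, !Rpower_plus, Rpower_1 by lra. assert (0 < Rpower x q) by apply exp_pos. field. lra. }
    rewrite <- Q. f_equal. f_equal. field. }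
  destruct (Rle_lt_dec 1 (th / x * (th / x))) as [H1|H1].
  + rewrite Rmin_left in HC by exact H1. assert (exp (- W x th) <= exp (- (c0 * Rpower x (- rr)))) by (apply exp_le_compat; lra). lra.
  + rewrite Rmin_right in HC by lra. rewrite Rmult_assoc, Eu in HC.
    assert (exp (- W x th) <= exp (- (c0 * (th / Rpower x (1 + rr / 2) * (th / Rpower x (1 + rr / 2)))))) by (apply exp_le_compat; lra). lra.
- specialize (HO x th ltac:(lra) Hth Hb). lra.
Qed.

Variables (D : C -> C) (r : nat) (rho A : nat -> R) (C0 : R).
Hypothesis HD : dirichlet_series L D.
Hypothesis HI : poles_condition D r rho A C0.
Hypothesis HII : vertical_growth_condition D C0.
Hypothesis rr_rho : rr = rho r.

Let h k := A (S k) * Gamma (rho (S k) + 1) / rho (S k).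

Lemma h_pos k : (k <= pred r)%nat -> 0 < h k.
Proof.
intros Hk. assert (Hr := r_pos _ _ _ _ _ HI). assert (Pk := rho_pos _ _ _ _ _ (S k) HI ltac:(lia)).
unfold h. rewrite Gamma_gam by lra. apply Rdiv_lt_0_compat; [|exact Pk].
apply Rmult_lt_0_compat; [apply (A_pos _ _ _ _ _ HI); lia|apply gam_pos; lra].
Qed.

(** The formula holds along every null sequence that solves the saddle equation within the
    fluctuation scale, so an explicit approximation can be inserted. *)
Theorem saddle_asymptotics : exists Theta : R,
  filterlim (fun s : C => Cminus (D s) (Cdiv (RtoC (A 0%nat)) s)) (locally' (RtoC 0)) (locally (RtoC Theta)) /\
  forall del : nat -> R, (forall n, 0 < del n) -> is_lim_seq del 0 ->
  is_lim_seq (fun n => Rpower (del n) (1 + rr / 2) * (INR n - sum_n (fun k => h k * rho (S k) * Rpower (del n) (- rho (S k) - 1)) (pred r))) 0 ->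
  is_lim_seq (fun n => c n / (exp (del n * INR n + sum_n (fun k => h k * Rpower (del n) (- rho (S k))) (pred r))
     * (Rpower (del n) (1 + rr / 2 - A 0%nat) * exp (Theta - euler_gamma * A 0%nat))))
     (/ sqrt (2 * PI * (h (pred r) * rr * (rr + 1)))).
Proof.
destruct (log_gf_expansion L D r rho A C0 HD HI HII) as [Theta [HT HG]].
exists Theta. split; [exact HT|]. intros del Hdel Hlim Hsad.
assert (Hr := r_pos _ _ _ _ _ HI).
assert (ErJ : S (pred r) = r) by lia.
set (Th := Theta - euler_gamma * A 0%nat).
set (G := fun x => sum_n (fun k => h k * Rpower x (- rho (S k))) (pred r) - A 0%nat * ln x + Th).
assert (HgG : forall eta, 0 < eta -> exists d0, 0 < d0 /\ forall x, 0 < x < d0 -> Rabs (g x - G x) <= eta).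
{ intros eta He. destruct (HG eta He) as [d0 [Hd0 H]]. exists d0. split; [exact Hd0|]. intros x Hx. specialize (H x Hx).
  replace (g x - G x) with (Series (fun i => L (S i) * exp (- (x * INR (S i)))) -
       (sum_n (fun k => A (S k) * Gamma (rho (S k) + 1) / rho (S k) * Rpower x (- rho (S k))) (pred r) -
        A 0%nat * ln x + Theta - euler_gamma * A 0%nat)); [exact H|].
  unfold g, G, Th, h. ring. }
assert (Hk := h_pos (pred r) (le_n _)).
assert (Hkap : 0 < h (pred r) * rr * (rr + 1)) by (apply Rmult_lt_0_compat; [apply Rmult_lt_0_compat; lra|lra]).
destruct char_fun_decay as [c0 [ep [d0 [Hc0 [Hep [Hd0 Hdec]]]]]].
assert (LL : is_lim_seq (fun n => c n * exp (- (del n * INR n)) / exp (g (del n)) / Rpower (del n) (1 + rr / 2))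
   (/ sqrt (2 * PI * (h (pred r) * rr * (rr + 1))))).
(* The error function collects the central range beyond th = del and the outer arcs; its part del^(1
   + rr/2 + ep) is o(s n) because ep > 0. *)
{ apply (local_limit c g del (fun n => Rpower (del n) (1 + rr / 2))
    (fun n => exp (- (c0 * Rpower (del n) (- rr))) + Rpower (del n) (1 + rr / 2 + ep)) (h (pred r) * rr * (rr + 1)) c0).
  - apply (c_nonneg _ _ _ _ _ Hset).
  - apply gf_series.
  - exact Hdel.
  - intros n. apply exp_pos.
  - exact Hkap.
  - exact Hc0.
  - apply is_lim_seq_Rpower_0; [lra|exact Hdel|exact Hlim].
  - apply is_lim_seq_ext with (fun n => Rpower (del n) (rr / 2)); [|apply is_lim_seq_Rpower_0; [lra|exact Hdel|exact Hlim]].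
    intros n. rewrite Rpower_plus, Rpower_1 by apply Hdel. field. specialize (Hdel n). lra.
  - intros t. apply (mgf_limit g (pred r) h (fun k => rho (S k)) rr (A 0%nat) Th del HgG rr_pos).
    + cbv beta. rewrite ErJ. symmetry. exact rr_rho.
    + intros k Hkk. rewrite rr_rho. apply (rho_incr _ _ _ _ _ HI); lia.
    + exact Hdel.
    + exact Hlim.
    + exact Hsad.
  - intros n. apply Rplus_le_le_0_compat; apply Rlt_le, exp_pos.
  - apply is_lim_seq_ext with (fun n => exp (- (c0 * Rpower (del n) (- rr))) / Rpower (del n) (1 + rr / 2) + Rpower (del n) ep).
    { intros n. rewrite (Rpower_plus (1 + rr / 2)). field. apply Rgt_not_eq, exp_pos. }
    replace (Finite 0) with (Finite (0 + 0)) by (f_equal; ring). apply is_lim_seq_plus'.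
    + apply is_lim_seq_exp_Rpower; try assumption; lra.
    + apply is_lim_seq_Rpower_0; assumption.
  - destruct (proj1 (is_lim_seq_eps _ _) Hlim d0 Hd0) as [N HN]. exists N. intros n Hn u Hu.
    specialize (HN n Hn). rewrite Rminus_0_r, Rabs_pos_eq in HN by (apply Rlt_le, Hdel).
    assert (Ps : 0 < Rpower (del n) (1 + rr / 2)) by apply exp_pos.
    set (sn := Rpower (del n) (1 + rr / 2)) in *.
    rewrite (Series_ext _ (fun m => c m * exp (- (del n * INR m)) / exp (g (del n)) * cos ((u * sn) * (INR m - INR n))))
      by (intros m; f_equal; f_equal; ring).
    eapply Rle_trans; [apply char_fun_modulus, Hdel|].
    assert (B := Hdec (del n) (u * sn) (conj (Hdel n) HN)). fold sn in B.
    replace (u * sn / sn) with u in B by (field; lra). apply B. split; [apply Rmult_le_pos; lra|].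
    apply Rle_div_r; [exact Ps|]. exact (proj2 Hu). }
assert (Lg : is_lim_seq (fun n => exp (g (del n) - G (del n))) 1).
{ rewrite <- exp_0. apply (is_lim_seq_continuous exp); [apply derivable_continuous_pt, derivable_pt_exp|].
  apply (expansion_gap g (pred r) h (fun k => rho (S k)) (A 0%nat) Th HgG); [exists 0%nat; intros; apply Hdel|exact Hlim]. }
assert (LM := is_lim_seq_mult' _ _ _ _ LL Lg). rewrite Rmult_1_r in LM.
refine (is_lim_seq_ext _ _ _ _ LM). intros n. cbv beta.
assert (EG : exp (G (del n)) = exp (sum_n (fun k => h k * Rpower (del n) (- rho (S k))) (pred r)) * (Rpower (del n) (- A 0%nat) * exp Th)).
{ unfold G, Rpower. rewrite <- !exp_plus. f_equal. ring. }
unfold Rminus at 1. rewrite exp_plus, (exp_Ropp (G (del n))), EG, exp_plus, (exp_Ropp (del n * INR n)).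
unfold Rminus at 1. rewrite (Rpower_plus (1 + rr / 2)). fold Th.
assert (Q1 := exp_pos (g (del n))). assert (Q2 := exp_pos (sum_n (fun k => h k * Rpower (del n) (- rho (S k))) (pred r))).
assert (Q3 := exp_pos Th). assert (Q4 := exp_pos (del n * INR n)).
assert (Q5 : 0 < Rpower (del n) (1 + rr / 2)) by apply exp_pos. assert (Q6 : 0 < Rpower (del n) (- A 0%nat)) by apply exp_pos.
field. repeat split; lra.
Qed.
End Setting.

(** * Expansion of the saddle point *)

Section Expansions.
Variables (x : nat -> R) (rr : R) (Lam : R -> Prop).
Hypothesis x_pos : forall n, 0 < x n.
Hypothesis x_lim : is_lim_seq x 0.
Hypothesis rr_pos : 0 < rr.
Hypothesis Lam_add : forall e e', Lam e -> Lam e' -> Lam (e + e').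

(** A generalized polynomial in [x n], stored as coefficient-exponent pairs; exponents are real and
    may repeat. *)
Fixpoint eval (l : list (R * R)) (n : nat) : R :=
  match l with nil => 0 | ce :: l => fst ce * Rpower (x n) (snd ce) + eval l n end.

(** Exponents come from an additively closed set and are positive, so that all terms tend to 0. *)
Definition admissible (l : list (R * R)) : Prop := forall c e, In (c, e) l -> Lam e /\ 0 < e.

(** The exponent of the final formula is x^(-rr) times such an expansion, so the precision o(x^rr)
    becomes o(1) there. *)
Definition expands (f : nat -> R) (f0 : R) : Prop :=
  exists l, admissible l /\ is_lim_seq (fun n => (f n - f0 - eval l n) / Rpower (x n) rr) 0.

Lemma eval_app l l' n : eval (l ++ l') n = eval l n + eval l' n.
Proof. induction l as [|ce l IH]; simpl; [ring|rewrite IH; ring]. Qed.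

Lemma admissible_app l l' : admissible l -> admissible l' -> admissible (l ++ l').
Proof. intros H H' c e Hin. apply in_app_or in Hin. destruct Hin; [apply (H c)|apply (H' c)]; assumption. Qed.

Lemma admissible_cons c e l : admissible ((c, e) :: l) -> Lam e /\ 0 < e /\ admissible l.
Proof.
intros H. split; [apply (H c e), in_eq|split; [apply (H c e), in_eq|]]. intros c' e' Hin. apply (H c'), in_cons, Hin.
Qed.

Definition scale_terms (c0 e0 : R) (l : list (R * R)) := map (fun ce => (c0 * fst ce, e0 + snd ce)) l.

Lemma eval_scale c0 e0 l n : eval (scale_terms c0 e0 l) n = c0 * Rpower (x n) e0 * eval l n.
Proof. induction l as [|ce l IH]; simpl; [ring|]. rewrite IH, Rpower_plus. ring. Qed.

Lemma admissible_scale c0 e0 l : e0 = 0 \/ (Lam e0 /\ 0 < e0) -> admissible l -> admissible (scale_terms c0 e0 l).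
Proof.
intros He H c e Hin. apply in_map_iff in Hin. destruct Hin as [[c1 e1] [E Hin]]. injection E as _ <-. simpl.
destruct (H c1 e1 Hin) as [H1 H2]. destruct He as [->|[H3 H4]].
- rewrite Rplus_0_l. split; assumption.
- split; [apply Lam_add; assumption|lra].
Qed.

Fixpoint mul_terms (l l' : list (R * R)) : list (R * R) :=
  match l with nil => nil | ce :: l => scale_terms (fst ce) (snd ce) l' ++ mul_terms l l' end.

Lemma eval_mul l l' n : eval (mul_terms l l') n = eval l n * eval l' n.
Proof. induction l as [|ce l IH]; simpl; [ring|]. rewrite eval_app, eval_scale, IH. ring. Qed.

Lemma admissible_mul l l' : admissible l -> admissible l' -> admissible (mul_terms l l').
Proof.
induction l as [|[c e] l IH]; intros H H'; [intros ? ? []|]. simpl.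
apply admissible_cons in H. destruct H as [H1 [H2 H3]].
apply admissible_app; [apply admissible_scale; auto|apply IH; assumption].
Qed.

Lemma x_small_1 : exists N, forall n, (N <= n)%nat -> x n <= 1.
Proof.
destruct (proj1 (is_lim_seq_eps _ _) x_lim 1 Rlt_0_1) as [N HN]. exists N. intros n Hn.
specialize (HN n Hn). rewrite Rminus_0_r in HN. generalize (Rle_abs (x n)). lra.
Qed.

Lemma eval_bound l : admissible l -> exists mu K, 0 < mu /\ 0 <= K /\ forall n, x n <= 1 -> Rabs (eval l n) <= K * Rpower (x n) mu.
Proof.
induction l as [|[c e] l IH]; intros H.
- exists 1, 0. split; [lra|split; [lra|]]. intros n _. simpl. rewrite Rabs_R0. lra.
- apply admissible_cons in H. destruct H as [_ [He Hl]]. destruct (IH Hl) as [mu [K [Hmu [HK HB]]]].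
  exists (Rmin e mu), (Rabs c + K). split; [apply Rmin_pos; assumption|split; [generalize (Rabs_pos c); lra|]].
  intros n Hn. specialize (HB n Hn). simpl. eapply Rle_trans; [apply Rabs_triang|].
  rewrite Rabs_mult, (Rabs_pos_eq (Rpower _ _)) by (apply Rlt_le, exp_pos).
  assert (B1 : Rpower (x n) e <= Rpower (x n) (Rmin e mu)) by (apply Rpower_le_base_le_1; [split; [apply x_pos|exact Hn]|apply Rmin_l]).
  assert (B2 : Rpower (x n) mu <= Rpower (x n) (Rmin e mu)) by (apply Rpower_le_base_le_1; [split; [apply x_pos|exact Hn]|apply Rmin_r]).
  assert (Rabs c * Rpower (x n) e <= Rabs c * Rpower (x n) (Rmin e mu)) by (apply Rmult_le_compat_l; [apply Rabs_pos|exact B1]).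
  assert (K * Rpower (x n) mu <= K * Rpower (x n) (Rmin e mu)) by (apply Rmult_le_compat_l; [exact HK|exact B2]).
  lra.
Qed.

(** The rate decides how many terms of a power series matter when functions are composed. *)
Lemma expands_bound f f0 : expands f f0 -> exists mu K N, 0 < mu /\ 0 <= K /\ forall n, (N <= n)%nat -> Rabs (f n - f0) <= K * Rpower (x n) mu.
Proof.
intros [l [Hl Hf]]. destruct (eval_bound l Hl) as [mu [K [Hmu [HK HB]]]]. destruct x_small_1 as [N1 H1].
destruct (proj1 (is_lim_seq_eps _ _) Hf 1 Rlt_0_1) as [N2 H2].
exists (Rmin mu rr), (K + 1), (N1 + N2)%nat. split; [apply Rmin_pos; assumption|split; [lra|]].
intros n Hn. specialize (H1 n ltac:(lia)). specialize (H2 n ltac:(lia)). specialize (HB n H1). rewrite Rminus_0_r in H2.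
assert (Pr : 0 < Rpower (x n) rr) by apply exp_pos.
unfold Rdiv in H2. rewrite Rabs_mult, (Rabs_pos_eq (/ _)) in H2 by (apply Rlt_le, Rinv_0_lt_compat, Pr).
apply Rlt_div_l in H2; [|exact Pr]. rewrite Rmult_1_l in H2.
assert (B1 : Rpower (x n) mu <= Rpower (x n) (Rmin mu rr)) by (apply Rpower_le_base_le_1; [split; [apply x_pos|exact H1]|apply Rmin_l]).
assert (B2 : Rpower (x n) rr <= Rpower (x n) (Rmin mu rr)) by (apply Rpower_le_base_le_1; [split; [apply x_pos|exact H1]|apply Rmin_r]).
assert (K * Rpower (x n) mu <= K * Rpower (x n) (Rmin mu rr)) by (apply Rmult_le_compat_l; [exact HK|exact B1]).
replace (f n - f0) with ((f n - f0 - eval l n) + eval l n) by ring. eapply Rle_trans; [apply Rabs_triang|]. lra.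
Qed.

Lemma expands_lim f f0 : expands f f0 -> is_lim_seq f f0.
Proof.
intros H. destruct (expands_bound f f0 H) as [mu [K [N [Hmu [_ HB]]]]].
apply is_lim_seq_ext with (fun n => (f n - f0) + f0); [intros n; ring|].
replace (Finite f0) with (Finite (0 + f0)) by (f_equal; ring). apply is_lim_seq_plus'; [|apply is_lim_seq_const].
apply is_lim_seq_dom_0 with (fun n => K * Rpower (x n) mu); [exists N; exact HB|].
apply is_lim_seq_scal_0, is_lim_seq_Rpower_0; assumption.
Qed.

Lemma eval_lim l : admissible l -> is_lim_seq (eval l) 0.
Proof.
intros H. destruct (eval_bound l H) as [mu [K [Hmu [_ HB]]]]. destruct x_small_1 as [N HN].
apply is_lim_seq_dom_0 with (fun n => K * Rpower (x n) mu); [exists N; intros n Hn; apply HB, HN, Hn|].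
apply is_lim_seq_scal_0, is_lim_seq_Rpower_0; assumption.
Qed.

Lemma expands_ext f g f0 : (forall n, f n = g n) -> expands f f0 -> expands g f0.
Proof.
intros E [l [Hl Hf]]. exists l. split; [exact Hl|]. apply is_lim_seq_ext with (2 := Hf). intros n. rewrite E. reflexivity.
Qed.

Lemma expands_const c : expands (fun _ => c) c.
Proof.
exists nil. split; [intros ? ? []|]. apply is_lim_seq_ext with (fun _ => 0); [|apply is_lim_seq_const].
intros n. simpl. unfold Rdiv. ring.
Qed.

Lemma expands_monomial e : Lam e -> 0 < e -> expands (fun n => Rpower (x n) e) 0.
Proof.
intros H1 H2. exists ((1, e) :: nil). split.
- intros c e' [E|[]]. injection E as _ <-. split; assumption.
- apply is_lim_seq_ext with (fun _ => 0); [|apply is_lim_seq_const]. intros n. simpl. unfold Rdiv. ring.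
Qed.

Lemma expands_plus f g f0 g0 : expands f f0 -> expands g g0 -> expands (fun n => f n + g n) (f0 + g0).
Proof.
intros [l [Hl Hf]] [l' [Hl' Hg]]. exists (l ++ l'). split; [apply admissible_app; assumption|].
apply is_lim_seq_ext with (fun n => (f n - f0 - eval l n) / Rpower (x n) rr + (g n - g0 - eval l' n) / Rpower (x n) rr).
- intros n. rewrite eval_app. unfold Rdiv. ring.
- replace (Finite 0) with (Finite (0 + 0)) by (f_equal; ring). apply is_lim_seq_plus'; assumption.
Qed.

Lemma expands_mult f g f0 g0 : expands f f0 -> expands g g0 -> expands (fun n => f n * g n) (f0 * g0).
Proof.
intros Ef Eg. assert (Lg := expands_lim _ _ Eg). destruct Ef as [l [Hl Hf]]. destruct Eg as [l' [Hl' Hg]].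
exists (scale_terms f0 0 l' ++ scale_terms g0 0 l ++ mul_terms l l'). split.
- repeat apply admissible_app; [apply admissible_scale; auto|apply admissible_scale; auto|apply admissible_mul; assumption].
(* The error of [f] meets the convergent factor [g], and the error of [g] the convergent main part
   of [f]. *)
- apply is_lim_seq_ext with (fun n => (f n - f0 - eval l n) / Rpower (x n) rr * g n + (f0 + eval l n) * ((g n - g0 - eval l' n) / Rpower (x n) rr)).
  + intros n. rewrite !eval_app, !eval_scale, eval_mul, Rpower_O by apply x_pos. unfold Rdiv. ring.
  + replace (Finite 0) with (Finite (0 * g0 + (f0 + 0) * 0)) by (f_equal; ring). apply is_lim_seq_plus'.
    * apply is_lim_seq_mult'; assumption.
    * apply is_lim_seq_mult'; [|exact Hg]. apply is_lim_seq_plus'; [apply is_lim_seq_const|apply eval_lim, Hl].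
Qed.

Lemma expands_sum_n (F : nat -> nat -> R) (v : nat -> R) J : (forall k, (k <= J)%nat -> expands (F k) (v k)) ->
  expands (fun n => sum_n (fun k => F k n) J) (sum_n v J).
Proof.
induction J as [|J IH]; intros H.
- rewrite sum_O. apply expands_ext with (F 0%nat); [intros n; rewrite sum_O; reflexivity|apply H; lia].
- rewrite sum_n_succ. apply expands_ext with (fun n => sum_n (fun k => F k n) J + F (S J) n).
  + intros n. rewrite sum_n_succ. reflexivity.
  + apply expands_plus; [apply IH; intros; apply H; lia|apply H; lia].
Qed.

Lemma expands_pow f f0 k : expands f f0 -> expands (fun n => f n ^ k) (f0 ^ k).
Proof.
intros H. induction k as [|k IH]; [exact (expands_const 1)|]. exact (expands_mult f (fun n => f n ^ k) f0 (f0 ^ k) H IH).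
Qed.

Lemma expands_binom_sum f f0 p M : expands f f0 -> expands (fun n => binom_sum p M (f n)) (binom_sum p M f0).
Proof.
intros H. induction M as [|M IH]; [exact (expands_const 0)|].
apply (expands_plus (fun n => binom_sum p M (f n)) (fun n => gbinom p M * f n ^ M)); [exact IH|].
apply (expands_mult (fun _ => gbinom p M) (fun n => f n ^ M)); [apply expands_const|apply expands_pow, H].
Qed.

Lemma expands_perturb f g f0 : expands f f0 -> is_lim_seq (fun n => (g n - f n) / Rpower (x n) rr) 0 -> expands g f0.
Proof.
intros [l [Hl Hf]] Hg. exists l. split; [exact Hl|].
apply is_lim_seq_ext with (fun n => (g n - f n) / Rpower (x n) rr + (f n - f0 - eval l n) / Rpower (x n) rr).
- intros n. unfold Rdiv. ring.
- replace (Finite 0) with (Finite (0 + 0)) by (f_equal; ring). apply is_lim_seq_plus'; assumption.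
Qed.

(** After normalising to 1 + y with y = O(x^mu), the binomial series is cut after a degree [M] with
    M mu > rr, which leaves finitely many sums and products. *)
Theorem expands_Rpower f f0 p : 0 < f0 -> (forall n, 0 < f n) -> expands f f0 -> expands (fun n => Rpower (f n) p) (Rpower f0 p).
Proof.
intros Hf0 Hf H.
assert (Hy : expands (fun n => f n / f0 - 1) 0).
{ replace 0 with (f0 * / f0 + -1) by (field; lra). apply (expands_plus (fun n => f n * / f0) (fun _ => -1)); [|apply expands_const].
  apply (expands_mult f (fun _ => / f0)); [exact H|apply expands_const]. }
set (y := fun n => f n / f0 - 1) in *.
destruct (expands_bound y 0 Hy) as [mu [K [N [Hmu [HK HB]]]]].
destruct (INR_unbounded (rr / mu)) as [M HM]. apply Rlt_div_l in HM; [|exact Hmu].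
destruct (binom_taylor (S M) p) as [KT [HKT HT]].
assert (E0 : expands (fun n => binom_sum p (S M) (y n)) 1) by (rewrite <- (binom_sum_at_0 p M); apply expands_binom_sum, Hy).
assert (E1 : expands (fun n => Rpower (1 + y n) p) 1).
{ apply expands_perturb with (1 := E0).
  apply is_lim_seq_dom_0 with (fun n => KT * K ^ S M * Rpower (x n) (INR (S M) * mu - rr)).
  - assert (Ly := expands_lim y 0 Hy). destruct (proj1 (is_lim_seq_eps _ _) Ly (1 / 2)) as [N2 H2]; [lra|].
    exists (N + N2)%nat. intros n Hn. specialize (HB n ltac:(lia)). specialize (H2 n ltac:(lia)). rewrite Rminus_0_r in *.
    unfold Rdiv. rewrite Rabs_mult, (Rabs_pos_eq (/ _)) by (apply Rlt_le, Rinv_0_lt_compat, exp_pos).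
    unfold Rminus at 2. rewrite Rpower_plus, Rpower_Ropp, <- Rmult_assoc.
    apply Rmult_le_compat_r; [apply Rlt_le, Rinv_0_lt_compat, exp_pos|].
    eapply Rle_trans; [apply HT; lra|]. rewrite Rmult_assoc. apply Rmult_le_compat_l; [exact HKT|].
    eapply Rle_trans; [apply pow_incr; split; [apply Rabs_pos|exact HB]|]. right. rewrite Rpow_mult_distr. f_equal.
    rewrite <- Rpower_pow by apply exp_pos. rewrite Rpower_mult. f_equal. ring.
  - apply is_lim_seq_scal_0, is_lim_seq_Rpower_0; [|exact x_pos|exact x_lim]. rewrite S_INR. lra. }
replace (Rpower f0 p) with (Rpower f0 p * 1) by ring.
apply expands_ext with (fun n => Rpower f0 p * Rpower (1 + y n) p); [|apply (expands_mult (fun _ => Rpower f0 p)); [apply expands_const|exact E1]].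
intros n. unfold y. replace (1 + (f n / f0 - 1)) with (f n / f0) by ring.
rewrite Rpower_mult_distr by first [exact Hf0|apply Rdiv_lt_0_compat; [apply Hf|exact Hf0]].
f_equal. field. lra.
Qed.
End Expansions.

(** Uniform in the exponent as well, since several powers occur together in the saddle equation. *)
Lemma Rpower_lipschitz P m M : 0 <= P -> 0 < m <= M -> exists C, 0 <= C /\ forall p u v, Rabs p <= P -> m <= u <= M -> m <= v <= M ->
  Rabs (Rpower u p - Rpower v p) <= C * Rabs (u - v).
Proof.
intros HP Hm. set (B := Rabs (ln m) + Rabs (ln M)). exists (P * exp ((P + 1) * B)).
split; [apply Rmult_le_pos; [exact HP|apply Rlt_le, exp_pos]|]. intros p u v Hp Hu Hv.
assert (Rng : forall z, Rmin v u <= z <= Rmax v u -> m <= z <= M).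
{ intros z. unfold Rmin, Rmax. destruct (Rle_dec v u); lra. }
destruct (MVT_gen (fun z => Rpower z p) v u (fun z => p * Rpower z (p - 1))) as [c [Hc E]].
- intros z Hz. apply is_derive_Reals, derivable_pt_lim_power. specialize (Rng z). lra.
- intros z Hz. apply derivable_continuous_pt. eexists. apply derivable_pt_lim_power. specialize (Rng z). lra.
- rewrite E, Rabs_mult. apply Rmult_le_compat_r; [apply Rabs_pos|]. rewrite Rabs_mult.
  apply Rmult_le_compat; [apply Rabs_pos|apply Rabs_pos|exact Hp|].
  rewrite Rabs_pos_eq by (apply Rlt_le, exp_pos). unfold Rpower. apply exp_le_compat.
  eapply Rle_trans; [apply Rle_abs|]. rewrite Rabs_mult. specialize (Rng c Hc).
  apply Rmult_le_compat; [apply Rabs_pos|apply Rabs_pos| |].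
  + eapply Rle_trans; [apply Rabs_triang|]. rewrite Rabs_Ropp, Rabs_R1. lra.
  + assert (L1 : ln m <= ln c) by (apply ln_le; lra). assert (L2 : ln c <= ln M) by (apply ln_le; lra).
    unfold B. assert (Q1 := Rle_abs (- ln m)). rewrite Rabs_Ropp in Q1. assert (Q2 := Rle_abs (ln M)).
    assert (Q3 := Rabs_pos (ln m)). assert (Q4 := Rabs_pos (ln M)). apply Rabs_le. lra.
Qed.

(** * Fixed-point iteration for the saddle point *)

Section Saddle.
Variables (x : nat -> R) (J : nat) (h rh : nat -> R) (rr mu : R) (Lam : R -> Prop).
Hypothesis x_pos : forall n, 0 < x n.
Hypothesis x_lim : is_lim_seq x 0.
Hypothesis x_n : forall n, (1 <= n)%nat -> INR n = Rpower (x n) (- (rr + 1)).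
Hypothesis rr_pos : 0 < rr.
Hypothesis h_pos : forall k, (k <= J)%nat -> 0 < h k.
Hypothesis rh_pos : forall k, (k <= J)%nat -> 0 < rh k.
Hypothesis rh_last : rh J = rr.
Hypothesis mu_pos : 0 < mu.
Hypothesis rh_gap : forall k, (k < J)%nat -> mu <= rr - rh k.
Hypothesis Lam_add : forall e e', Lam e -> Lam e' -> Lam (e + e').
Hypothesis Lam_gen : forall k, (k < J)%nat -> Lam (rr - rh k).

Let F n w := sum_n (fun k => h k * rh k * (Rpower (x n) (rr - rh k) * Rpower w (rr - rh k))) J.
(** The solution of the limiting equation w^(rr+1) = h_J rr, in which only k = J is left. *)
Let w0 := Rpower (h J * rr) (/ (rr + 1)).

Fixpoint saddle_iter (j n : nat) : R :=
  match j with O => w0 | S j => Rpower (F n (saddle_iter j n)) (/ (rr + 1)) end.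

Lemma saddle_iter_pos j n : 0 < saddle_iter j n.
Proof. destruct j; apply exp_pos. Qed.

Lemma saddle_rhs_pos n w : 0 < F n w.
Proof.
assert (Q : forall k, (k <= J)%nat -> 0 < h k * rh k * (Rpower (x n) (rr - rh k) * Rpower w (rr - rh k))).
{ intros k Hk. apply Rmult_lt_0_compat; [apply Rmult_lt_0_compat; auto|apply Rmult_lt_0_compat; apply exp_pos]. }
unfold F. destruct J as [|J']; [rewrite sum_O; apply Q; lia|]. rewrite sum_n_succ.
apply Rplus_le_lt_0_compat; [|apply Q; lia]. apply sum_n_nonneg. intros k Hk. apply Rlt_le, Q. lia.
Qed.

(** For k = J the exponent is 0 and the monomial is a constant, since only positive exponents are
    admissible. *)
Let monomial k : (k <= J)%nat -> expands x rr Lam (fun n => Rpower (x n) (rr - rh k)) (if Nat.eqb k J then 1 else 0).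
Proof.
intros Hk. destruct (Nat.eqb_spec k J) as [E|E].
- apply expands_ext with (fun _ => 1); [|apply expands_const]. intros n. subst k. rewrite rh_last, Rminus_diag, Rpower_O; auto.
- apply expands_monomial; [apply Lam_gen; lia|]. generalize (rh_gap k ltac:(lia)). lra.
Qed.

Lemma saddle_iter_expands j : expands x rr Lam (saddle_iter j) w0.
Proof.
induction j as [|j IH]; [exact (expands_const x rr Lam w0)|].
assert (Hw0 : 0 < w0) by apply exp_pos.
assert (P : 0 < h J * rr) by (apply Rmult_lt_0_compat; auto).
apply (expands_Rpower x rr Lam x_pos x_lim rr_pos Lam_add (fun n => F n (saddle_iter j n)) (h J * rr) (/ (rr + 1))).
- exact P.
- intros n. apply saddle_rhs_pos.
- replace (h J * rr) with (sum_n (fun k => h k * rh k * ((if Nat.eqb k J then 1 else 0) * Rpower w0 (rr - rh k))) J).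
  + apply (expands_sum_n x rr Lam (fun k n => h k * rh k * (Rpower (x n) (rr - rh k) * Rpower (saddle_iter j n) (rr - rh k)))).
    intros k Hk. apply (expands_mult x rr Lam x_pos x_lim rr_pos Lam_add (fun _ => h k * rh k)); [apply expands_const|].
    apply (expands_mult x rr Lam x_pos x_lim rr_pos Lam_add (fun n => Rpower (x n) (rr - rh k))); [apply monomial, Hk|].
    apply (expands_Rpower x rr Lam x_pos x_lim rr_pos Lam_add); [exact Hw0|apply saddle_iter_pos|exact IH].
  + apply sum_n_last_only.
    * intros k Hk. destruct (Nat.eqb_spec k J); [lia|ring].
    * rewrite Nat.eqb_refl, rh_last, Rminus_diag, Rpower_O by exact Hw0. ring.
Qed.

Lemma saddle_iter_range j : exists N, forall n, (N <= n)%nat -> w0 / 2 <= saddle_iter j n <= 2 * w0.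
Proof.
assert (Hw0 : 0 < w0) by apply exp_pos.
assert (L := expands_lim x rr Lam x_pos x_lim rr_pos _ _ (saddle_iter_expands j)).
destruct (proj1 (is_lim_seq_eps _ _) L (w0 / 2)) as [N HN]; [lra|]. exists N. intros n Hn. specialize (HN n Hn).
apply Rabs_def2 in HN. lra.
Qed.

(** The term k = J does not depend on w; all others carry a factor x^(rr - rh k), which is at most
    x^mu. *)
Lemma saddle_rhs_lipschitz : exists C, 0 <= C /\ forall n u v, x n <= 1 -> w0 / 2 <= u <= 2 * w0 -> w0 / 2 <= v <= 2 * w0 ->
  Rabs (F n u - F n v) <= C * Rpower (x n) mu * Rabs (u - v).
Proof.
assert (Hw0 : 0 < w0) by apply exp_pos.
destruct (Rpower_lipschitz rr (w0 / 2) (2 * w0)) as [C [HC HL]]; [lra|lra|].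
exists (sum_n (fun k => h k * rh k) J * C). split.
- apply Rmult_le_pos; [|exact HC]. apply sum_n_nonneg. intros k Hk. apply Rlt_le, Rmult_lt_0_compat; auto.
- intros n u v Hx Hu Hv. unfold F. rewrite <- sum_n_minus. eapply Rle_trans; [apply sum_n_Rabs|].
  replace (sum_n (fun k => h k * rh k) J * C * Rpower (x n) mu * Rabs (u - v))
    with (C * Rpower (x n) mu * Rabs (u - v) * sum_n (fun k => h k * rh k) J) by ring.
  rewrite <- sum_n_scal_l_R. apply sum_n_le_compat. intros k Hk.
  replace (h k * rh k * (Rpower (x n) (rr - rh k) * Rpower u (rr - rh k)) - h k * rh k * (Rpower (x n) (rr - rh k) * Rpower v (rr - rh k)))
    with (h k * rh k * (Rpower (x n) (rr - rh k) * (Rpower u (rr - rh k) - Rpower v (rr - rh k)))) by ring.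
  assert (Q : 0 < h k * rh k) by (apply Rmult_lt_0_compat; auto).
  rewrite Rabs_mult, (Rabs_pos_eq (h k * rh k)) by lra. rewrite (Rmult_comm _ (h k * rh k)).
  apply Rmult_le_compat_l; [lra|].
  destruct (le_lt_eq_dec k J Hk) as [L|E].
  + rewrite Rabs_mult, Rabs_pos_eq by (apply Rlt_le, exp_pos). rewrite Rmult_assoc, (Rmult_comm C), Rmult_assoc, (Rmult_comm (Rabs _)).
    apply Rmult_le_compat; [apply Rlt_le, exp_pos|apply Rabs_pos| |].
    * apply Rpower_le_base_le_1; [split; [apply x_pos|exact Hx]|apply rh_gap, L].
    * apply HL; [|exact Hu|exact Hv]. specialize (rh_pos k Hk). specialize (rh_gap k L). rewrite Rabs_pos_eq; lra.
  + subst k. rewrite rh_last, Rminus_diag, !Rpower_O by first [apply x_pos|lra]. rewrite Rminus_diag, Rmult_0_r, Rabs_R0.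
    apply Rmult_le_pos; [apply Rmult_le_pos; [exact HC|apply Rlt_le, exp_pos]|apply Rabs_pos].
Qed.

(** Each iteration gains a factor x^mu. The first step uses only that the iterates stay near
    [w0]. *)
Lemma saddle_iter_contraction j : exists K N, 0 <= K /\ forall n, (N <= n)%nat ->
  Rabs (saddle_iter (S j) n - saddle_iter j n) <= K * Rpower (x n) (INR j * mu).
Proof.
assert (Hw0 : 0 < w0) by apply exp_pos.
assert (P : 0 < h J * rr) by (apply Rmult_lt_0_compat; auto).
destruct (x_small_1 x x_lim) as [N0 H0].
induction j as [|j IH].
- destruct (saddle_iter_range 1) as [N HN]. exists (2 * w0), N. split; [lra|]. intros n Hn. specialize (HN n Hn).
  simpl INR. rewrite Rmult_0_l, Rpower_O, Rmult_1_r by apply x_pos. change (saddle_iter 0 n) with w0. apply Rabs_le. lra.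
- destruct IH as [K [N [HK HN]]]. destruct saddle_rhs_lipschitz as [C [HC HL]].
  destruct (saddle_iter_range j) as [N1 H1]. destruct (saddle_iter_range (S j)) as [N2 H2]. destruct (saddle_iter_range (S (S j))) as [N3 H3].
  (* The range of [F] at the iterates, bounded away from 0, where the root of order rr + 1 is
     Lipschitz. *)
  set (lo := Rpower (w0 / 2) (rr + 1)). set (hi := Rpower (2 * w0) (rr + 1)).
  assert (Hlo : 0 < lo) by apply exp_pos.
  assert (Inv : forall i n, F n (saddle_iter i n) = Rpower (saddle_iter (S i) n) (rr + 1)).
  { intros i n. simpl. rewrite Rpower_mult, Rinv_l by lra. symmetry. apply Rpower_1, saddle_rhs_pos. }
  assert (Rg : forall i n, w0 / 2 <= saddle_iter (S i) n <= 2 * w0 -> lo <= F n (saddle_iter i n) <= hi).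
  { intros i n Hi. rewrite Inv. split; apply Rle_Rpower_l; lra. }
  assert (Hlh : lo <= hi) by (apply Rle_Rpower_l; lra).
  destruct (Rpower_lipschitz 1 lo hi) as [C' [HC' HL']]; [lra|lra|].
  exists (C' * C * K), (N0 + N + N1 + N2 + N3)%nat. split; [apply Rmult_le_pos; [apply Rmult_le_pos|]; assumption|].
  intros n Hn. change (saddle_iter (S (S j)) n) with (Rpower (F n (saddle_iter (S j) n)) (/ (rr + 1))).
  change (saddle_iter (S j) n) with (Rpower (F n (saddle_iter j n)) (/ (rr + 1))) at 2.
  eapply Rle_trans; [apply HL'|].
  + rewrite Rabs_pos_eq by (apply Rlt_le, Rinv_0_lt_compat; lra). rewrite <- Rinv_1. apply Rinv_le_contravar; lra.
  + apply Rg, H3. lia.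
  + apply Rg, H2. lia.
  + rewrite !Rmult_assoc. apply Rmult_le_compat_l; [exact HC'|].
    eapply Rle_trans; [apply HL; [apply H0; lia|apply H2; lia|apply H1; lia]|].
    rewrite Rmult_assoc. apply Rmult_le_compat_l; [exact HC|]. rewrite S_INR, Rmult_plus_distr_r, Rmult_1_l, Rpower_plus.
    replace (K * (Rpower (x n) (INR j * mu) * Rpower (x n) mu)) with (Rpower (x n) mu * (K * Rpower (x n) (INR j * mu))) by ring.
    apply Rmult_le_compat_l; [apply Rlt_le, exp_pos|]. apply HN. lia.
Qed.

(** [w] is an iterate of fixed order, so its expansion is finite. Its saddle-point defect is
    governed by the difference of consecutive iterates, scaled by x^(-rr/2). *)
Theorem approximate_saddle : exists w l, (forall n, 0 < w n) /\ is_lim_seq w w0 /\ admissible Lam l /\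
  let del := fun n => x n * w n in
  is_lim_seq (fun n => Rpower (del n) (1 + rr / 2) * (INR n - sum_n (fun k => h k * rh k * Rpower (del n) (- rh k - 1)) J)) 0 /\
  is_lim_seq (fun n => del n * INR n + sum_n (fun k => h k * Rpower (del n) (- rh k)) J
     - Rpower (x n) (- rr) * (w0 + h J * Rpower w0 (- rr) + eval x l n)) 0.
Proof.
assert (Hw0 : 0 < w0) by apply exp_pos.
(* Enough iterations for x^(j mu) to beat x^(rr/2). *)
destruct (INR_unbounded (rr / mu)) as [j Hj]. apply Rlt_div_l in Hj; [|exact mu_pos].
set (w := saddle_iter j). assert (Pw : forall n, 0 < w n) by apply saddle_iter_pos.
assert (Ew : expands x rr Lam w w0) by apply saddle_iter_expands.
assert (Lw := expands_lim x rr Lam x_pos x_lim rr_pos _ _ Ew).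
assert (EB : expands x rr Lam (fun n => w n + sum_n (fun k => h k * (Rpower (x n) (rr - rh k) * Rpower (w n) (- rh k))) J)
   (w0 + h J * Rpower w0 (- rr))).
{ apply (expands_plus x rr Lam w); [exact Ew|].
  replace (h J * Rpower w0 (- rr)) with (sum_n (fun k => h k * ((if Nat.eqb k J then 1 else 0) * Rpower w0 (- rh k))) J).
  - apply (expands_sum_n x rr Lam (fun k n => h k * (Rpower (x n) (rr - rh k) * Rpower (w n) (- rh k)))).
    intros k Hk. apply (expands_mult x rr Lam x_pos x_lim rr_pos Lam_add (fun _ => h k)); [apply expands_const|].
    apply (expands_mult x rr Lam x_pos x_lim rr_pos Lam_add (fun n => Rpower (x n) (rr - rh k))); [apply monomial, Hk|].
    apply (expands_Rpower x rr Lam x_pos x_lim rr_pos Lam_add); [exact Hw0|exact Pw|exact Ew].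
  - apply sum_n_last_only.
    + intros k Hk. destruct (Nat.eqb_spec k J); [lia|ring].
    + rewrite Nat.eqb_refl, rh_last. ring. }
destruct EB as [l [Hl HB]].
exists w, l. split; [exact Pw|split; [exact Lw|split; [exact Hl|]]]. cbv zeta. split.
- destruct (saddle_iter_contraction j) as [K [N [HK HN]]].
  destruct (saddle_iter_range j) as [N1 H1]. destruct (saddle_iter_range (S j)) as [N2 H2].
  destruct (Rpower_lipschitz (rr + 1) (w0 / 2) (2 * w0)) as [C [HC HL]]; [lra|lra|].
  set (V := Rpower (w0 / 2) (- rr / 2)).
  apply is_lim_seq_dom_0 with (fun n => V * C * K * Rpower (x n) (INR j * mu - rr / 2)).
  + exists (1 + N + N1 + N2)%nat. intros n Hn.
    (* Factoring del^(-(rr+1)) out of the saddle sum leaves [F n (w n)], and n itself is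
       x^(-(rr+1)). *)
    assert (E : Rpower (x n * w n) (1 + rr / 2) * (INR n - sum_n (fun k => h k * rh k * Rpower (x n * w n) (- rh k - 1)) J)
      = Rpower (w n) (- rr / 2) * Rpower (x n) (- rr / 2) * (Rpower (w n) (rr + 1) - Rpower (saddle_iter (S j) n) (rr + 1))).
    { replace (Rpower (saddle_iter (S j) n) (rr + 1)) with (F n (w n))
        by (simpl; rewrite Rpower_mult, Rinv_l by lra; symmetry; apply Rpower_1, saddle_rhs_pos).
      assert (ES : sum_n (fun k => h k * rh k * Rpower (x n * w n) (- rh k - 1)) J = Rpower (x n * w n) (- (rr + 1)) * F n (w n)).
      { unfold F. rewrite <- sum_n_scal_l_R. apply sum_n_ext. intros k. as_R_eq. rewrite Rpower_mult_distr by auto.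
        replace (- rh k - 1) with (- (rr + 1) + (rr - rh k)) by ring. rewrite Rpower_plus. ring. }
      rewrite ES, x_n by lia.
      replace (Rpower (x n) (- (rr + 1))) with (Rpower (x n * w n) (- (rr + 1)) * Rpower (w n) (rr + 1)).
      - replace (- rr / 2) with (1 + rr / 2 + - (rr + 1)) by field. rewrite (Rmult_comm (Rpower (w n) _) (Rpower (x n) _)).
        rewrite Rpower_mult_distr by auto. rewrite !(Rpower_plus (1 + rr / 2)). ring.
      - rewrite <- Rpower_mult_distr by auto. rewrite Rmult_assoc, <- Rpower_plus, Rplus_opp_l, Rpower_O by auto. ring. }
    rewrite E. specialize (HN n ltac:(lia)). specialize (H1 n ltac:(lia)). specialize (H2 n ltac:(lia)). fold w in H1. fold w in HN.
    rewrite !Rabs_mult, !Rabs_pos_eq by (apply Rlt_le, exp_pos).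
    replace (V * C * K * Rpower (x n) (INR j * mu - rr / 2)) with (V * Rpower (x n) (- rr / 2) * (C * (K * Rpower (x n) (INR j * mu)))).
    * apply Rmult_le_compat.
      -- apply Rmult_le_pos; apply Rlt_le, exp_pos.
      -- apply Rabs_pos.
      -- apply Rmult_le_compat_r; [apply Rlt_le, exp_pos|]. unfold V.
         replace (- rr / 2) with (- (rr / 2)) by field. rewrite !Rpower_Ropp. apply Rinv_le_contravar; [apply exp_pos|].
         apply Rle_Rpower_l; lra.
      -- eapply Rle_trans; [apply HL; [rewrite Rabs_pos_eq; lra|exact H1|exact H2]|].
         apply Rmult_le_compat_l; [exact HC|]. rewrite Rabs_minus_sym. exact HN.
    * replace (INR j * mu - rr / 2) with (- rr / 2 + INR j * mu) by field. rewrite Rpower_plus. ring.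
  + apply is_lim_seq_scal_0, is_lim_seq_Rpower_0; [lra|exact x_pos|exact x_lim].
- apply is_lim_seq_ext_loc with (2 := HB). exists 1%nat. intros n Hn.
  assert (ES : sum_n (fun k => h k * Rpower (x n * w n) (- rh k)) J =
     Rpower (x n) (- rr) * sum_n (fun k => h k * (Rpower (x n) (rr - rh k) * Rpower (w n) (- rh k))) J).
  { rewrite <- sum_n_scal_l_R. apply sum_n_ext. intros k. as_R_eq. rewrite <- Rpower_mult_distr by auto.
    replace (- rh k) with (- rr + (rr - rh k)) at 1 by ring. rewrite Rpower_plus. ring. }
  rewrite ES, x_n by exact Hn.
  replace (x n * w n * Rpower (x n) (- (rr + 1))) with (Rpower (x n) (- rr) * w n).
  + unfold Rdiv. rewrite (Rpower_Ropp (x n) rr). ring.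
  + replace (- rr) with (1 + - (rr + 1)) at 1 by ring. rewrite Rpower_plus, Rpower_1 by auto. ring.
Qed.
End Saddle.

(** * The finite set of exponents *)

Lemma finite_set_max (l : list R) : forall U : R -> Prop, (forall x, U x -> In x l) -> (exists x, U x) ->
  exists m, U m /\ forall x, U x -> x <= m.
Proof.
induction l as [|a l IH]; intros U HU [x0 Hx0]; [destruct (HU x0 Hx0)|].
destruct (classic (exists x, U x /\ x <> a)) as [[x1 [H1 N1]]|HN].
- destruct (IH (fun x => U x /\ x <> a)) as [m [[Hm _] HM]].
  + intros x [Hx Nx]. destruct (HU x Hx) as [E|E]; [congruence|exact E].
  + exists x1. split; assumption.
  + destruct (classic (U a)) as [Ha|Ha].
    * destruct (Rle_lt_dec m a) as [L|L].
      -- exists a. split; [exact Ha|]. intros x Hx. destruct (Req_dec x a) as [->|N]; [lra|]. specialize (HM x (conj Hx N)). lra.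
      -- exists m. split; [exact Hm|]. intros x Hx. destruct (Req_dec x a) as [->|N]; [lra|]. apply HM. split; assumption.
    * exists m. split; [exact Hm|]. intros x Hx. apply HM. split; [exact Hx|]. intros ->. apply Ha, Hx.
- exists x0. split; [exact Hx0|]. intros x Hx.
  assert (E : forall y, U y -> y = a) by (intros y Hy; apply NNPP; intros N; apply HN; exists y; split; assumption).
  rewrite (E x Hx), (E x0 Hx0). lra.
Qed.

(** The maximum is split off and placed last. [U] is only a predicate contained in the list, so the
    case distinctions are classical. *)
Lemma finite_set_enumeration n : forall (l : list R) (U : R -> Prop), (length l <= n)%nat -> (forall x, U x -> In x l) ->
  exists N lambda, increasing_enumeration U N lambda.
Proof.
induction n as [|n IH]; intros l U Hlen HU.
- exists 0%nat, (fun _ => 0). split; [intros; lia|]. intros x. split; [|intros [s [Hs _]]; lia].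
  intros Hx. destruct l; [destruct (HU x Hx)|simpl in Hlen; lia].
- destruct (classic (exists x, U x)) as [Hex|Hno].
  + destruct (finite_set_max l U HU Hex) as [m [Hm HM]].
    destruct (IH (remove Req_dec_T m l) (fun x => U x /\ x <> m)) as [N [lam [H1 H2]]].
    * generalize (remove_length_lt Req_dec_T l m (HU m Hm)). lia.
    * intros x [Hx Nx]. apply in_in_remove; [exact Nx|apply HU, Hx].
    * assert (Below : forall s, (1 <= s <= N)%nat -> lam s < m).
      { intros s Hs. assert (Q : U (lam s) /\ lam s <> m) by (apply H2; exists s; split; [exact Hs|reflexivity]).
        destruct Q as [Q1 Q2]. specialize (HM _ Q1). lra. }
      exists (S N), (fun s => if Nat.eq_dec s (S N) then m else lam s). split.
      -- intros i j Hi Hij Hj. destruct (Nat.eq_dec i (S N)); [lia|]. destruct (Nat.eq_dec j (S N)); [apply Below; lia|apply H1; lia].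
      -- intros x. split.
         ++ intros Hx. destruct (Req_dec x m) as [->|Nx].
            ** exists (S N). split; [lia|]. destruct (Nat.eq_dec (S N) (S N)); [reflexivity|lia].
            ** destruct (proj1 (H2 x) (conj Hx Nx)) as [s [Hs E]]. exists s. split; [lia|].
               destruct (Nat.eq_dec s (S N)); [lia|exact E].
         ++ intros [s [Hs E]]. destruct (Nat.eq_dec s (S N)) as [Es|Es]; [subst; exact Hm|].
            apply (H2 x). exists s. split; [lia|exact E].
  + exists 0%nat, (fun _ => 0). split; [intros; lia|]. intros x. split; [|intros [s [Hs _]]; lia].
    intros Hx. exfalso. apply Hno. exists x. exact Hx.
Qed.

Lemma bounded_combinations_finite (g : nat -> R) (M J : nat) : exists l, forall m : nat -> nat,
  (forall k, (k <= J)%nat -> (m k <= M)%nat) -> In (sum_n (fun k => INR (m k) * g k) J) l.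
Proof.
induction J as [|J [l IH]].
- exists (map (fun i => INR i * g 0%nat) (seq 0 (S M))). intros m Hm. rewrite sum_O.
  apply (in_map (fun i => INR i * g 0%nat)), in_seq. specialize (Hm 0%nat (le_n _)). lia.
- exists (flat_map (fun v => map (fun i => v + INR i * g (S J)) (seq 0 (S M))) l). intros m Hm. rewrite sum_n_succ.
  apply in_flat_map. exists (sum_n (fun k => INR (m k) * g k) J). split; [apply IH; intros; apply Hm; lia|].
  apply (in_map (fun i => sum_n (fun k => INR (m k) * g k) J + INR i * g (S J))), in_seq. specialize (Hm (S J) (le_n _)). lia.
Qed.

(** Total multiplicity at least two, zero, or one: the combinations of [Upsilon_tilde], the exponent
    0, and a single gap. *)
Lemma sum_n_INR_cases (m : nat -> nat) J : 2 <= sum_n (fun k => INR (m k)) J \/ (forall k, (k <= J)%nat -> m k = 0%nat) \/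
  exists k0, (k0 <= J)%nat /\ m k0 = 1%nat /\ forall k, (k <= J)%nat -> k <> k0 -> m k = 0%nat.
Proof.
assert (Pm : forall k, 0 <= INR (m k)) by (intros; apply pos_INR).
induction J as [|J IH].
- rewrite sum_O. destruct (m 0%nat) as [|[|i]] eqn:E.
  + right. left. intros k Hk. replace k with 0%nat by lia. exact E.
  + right. right. exists 0%nat. split; [lia|split; [exact E|]]. intros k Hk N. lia.
  + left. rewrite !S_INR. generalize (pos_INR i). lra.
- rewrite sum_n_succ. specialize (Pm (S J)) as PS.
  assert (PJ : 0 <= sum_n (fun k => INR (m k)) J) by (apply sum_n_nonneg; intros; apply Pm).
  destruct IH as [IH|[IH|[k0 [Hk0 [E0 IH]]]]]; [left; lra| |].
  + destruct (m (S J)) as [|[|i]] eqn:E.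
    * right. left. intros k Hk. destruct (Nat.eq_dec k (S J)) as [->|N]; [exact E|apply IH; lia].
    * right. right. exists (S J). split; [lia|split; [exact E|]]. intros k Hk N. apply IH. lia.
    * left. rewrite !S_INR. generalize (pos_INR i). lra.
  + destruct (m (S J)) as [|i] eqn:E.
    * right. right. exists k0. split; [lia|split; [exact E0|]]. intros k Hk N.
      destruct (Nat.eq_dec k (S J)) as [->|N2]; [exact E|apply IH; lia].
    * left. rewrite S_INR. assert (Q := term_le_sum_n (fun k => INR (m k)) k0 J Pm Hk0). cbv beta in Q. rewrite E0 in Q. simpl in Q.
      generalize (pos_INR i). lra.
Qed.

Section Exponents.
Variables (D : C -> C) (r : nat) (rho A : nat -> R) (C0 : R).
Hypothesis HI : poles_condition D r rho A C0.

Lemma rho_gap_pos k : (k <= pred r)%nat -> 0 < rho r - rho k.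
Proof.
intros Hk. assert (Hr := r_pos _ _ _ _ _ HI). generalize (rho_incr _ _ _ _ _ HI k r ltac:(lia) (le_n _)). lra.
Qed.

Lemma rho_gap_min k : (k <= pred r)%nat -> rho r - rho (pred r) <= rho r - rho k.
Proof.
intros Hk. assert (Hr := r_pos _ _ _ _ _ HI). destruct (Nat.eq_dec k (pred r)) as [->|N]; [lra|].
generalize (rho_incr _ _ _ _ _ HI k (pred r) ltac:(lia) ltac:(lia)). lra.
Qed.

Lemma Upsilon_enumeration : exists N lambda, increasing_enumeration (Upsilon r rho) N lambda.
Proof.
assert (Hr := r_pos _ _ _ _ _ HI).
assert (Hmu := rho_gap_pos (pred r) (le_n _)). set (mu := rho r - rho (pred r)) in *.
(* Every gap is at least [mu], so an exponent up to rho_r + 1 uses each gap at most [M] times. *)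
destruct (INR_unbounded ((rho r + 1) / mu)) as [M HM]. apply Rlt_div_l in HM; [|exact Hmu].
destruct (bounded_combinations_finite (fun k => rho r - rho k) M (pred r)) as [l Hl].
apply (finite_set_enumeration (length (l ++ map (fun k => rho r - rho k) (seq 0 r))) (l ++ map (fun k => rho r - rho k) (seq 0 r))); [apply le_n|].
intros x [[[m [E _]] Hx]|[k [Hk E]]]; apply in_or_app.
- left. rewrite E. apply Hl. intros k Hk. destruct (le_lt_dec (m k) M) as [L|L]; [exact L|exfalso].
  assert (T0 : forall i, (i <= pred r)%nat -> 0 <= INR (m i) * (rho r - rho i)).
  { intros i Hi. apply Rmult_le_pos; [apply pos_INR|apply Rlt_le, rho_gap_pos, Hi]. }
  assert (T : INR (m k) * (rho r - rho k) <= x).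
  { rewrite E. clear - T0 Hk. induction (pred r) as [|J IH].
    - rewrite sum_O. replace k with 0%nat by lia. lra.
    - rewrite sum_n_succ. destruct (Nat.eq_dec k (S J)) as [->|N].
      + assert (Q := sum_n_nonneg (fun i => INR (m i) * (rho r - rho i)) J ltac:(intros; apply T0; lia)). lra.
      + specialize (IH ltac:(lia) ltac:(intros; apply T0; lia)). specialize (T0 (S J) (le_n _)). lra. }
  assert (G := rho_gap_min k Hk). fold mu in G. apply lt_INR in L.
  assert (INR M * mu <= INR (m k) * (rho r - rho k)) by (apply Rmult_le_compat; [apply pos_INR|lra|lra|exact G]). lra.
- right. rewrite E. apply (in_map (fun k => rho r - rho k)), in_seq. lia.
Qed.

(** All combinations of gaps, 0 included; closed under addition, unlike the bounded set
    [Upsilon]. *)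
Definition exponent_semigroup (e : R) : Prop := exists m : nat -> nat, e = sum_n (fun k => INR (m k) * (rho r - rho k)) (pred r).

Lemma exponent_semigroup_add e e' : exponent_semigroup e -> exponent_semigroup e' -> exponent_semigroup (e + e').
Proof.
intros [m ->] [m' ->]. exists (fun k => (m k + m' k)%nat). rewrite <- sum_n_plus_R. apply sum_n_ext. intros k. rewrite plus_INR. as_R_eq. ring.
Qed.

Lemma exponent_semigroup_gen k : (k <= pred r)%nat -> exponent_semigroup (rho r - rho k).
Proof.
intros Hk. exists (fun i => if Nat.eq_dec i k then 1%nat else 0%nat). symmetry.
induction (pred r) as [|J IH].
- rewrite sum_O. replace k with 0%nat by lia. simpl. as_R_eq. ring.
- rewrite sum_n_succ. destruct (Nat.eq_dec (S J) k) as [E|E].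
  + rewrite (sum_n_ext_loc _ (fun _ => 0)).
    * rewrite sum_n_const, Rmult_0_r, E. simpl. as_R_eq. ring.
    * intros i Hi. destruct (Nat.eq_dec i k); [lia|]. simpl. as_R_eq. ring.
  + rewrite IH by lia. simpl. as_R_eq. ring.
Qed.

Lemma exponent_in_Upsilon e : exponent_semigroup e -> 0 < e <= rho r -> Upsilon r rho e.
Proof.
intros [m E] He. assert (Hr := r_pos _ _ _ _ _ HI). destruct (sum_n_INR_cases m (pred r)) as [H2|[H0|[k0 [Hk0 [E0 H1]]]]].
- left. split; [exists m; split; assumption|lra].
- exfalso. rewrite (sum_n_ext_loc _ (fun _ => 0)) in E.
  + rewrite sum_n_const in E. lra.
  + intros k Hk. rewrite H0 by exact Hk. simpl. as_R_eq. ring.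
- right. exists k0. split; [lia|]. rewrite E. clear - Hk0 E0 H1. induction (pred r) as [|J IH].
  + rewrite sum_O. replace k0 with 0%nat in * by lia. rewrite E0. simpl. as_R_eq. ring.
  + rewrite sum_n_succ. destruct (Nat.eq_dec k0 (S J)) as [Ek|Ek].
    * rewrite (sum_n_ext_loc _ (fun _ => 0)).
      -- rewrite sum_n_const, <- Ek, E0. simpl. as_R_eq. ring.
      -- intros k Hk. rewrite H1 by lia. simpl. as_R_eq. ring.
    * rewrite IH by (try lia; intros; apply H1; lia). rewrite (H1 (S J)) by lia. simpl. as_R_eq. ring.
Qed.
End Exponents.

Lemma sum_n_m_single (f : nat -> R) s0 N : (1 <= s0 <= N)%nat -> (forall s, (1 <= s <= N)%nat -> s <> s0 -> f s = 0) ->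
  sum_n_m f 1 N = f s0.
Proof.
assert (Z : forall M, (forall s, (1 <= s <= M)%nat -> f s = 0) -> sum_n_m f 1 M = 0).
{ induction M as [|M IH]; intros H; [exact (sum_n_m_zero (G := R_AbelianMonoid) f 1 0 Nat.lt_0_1)|].
  rewrite sum_n_Sm by lia. rewrite IH by (intros; apply H; lia). rewrite H by lia. apply Rplus_0_l. }
induction N as [|N IH]; intros Hs H; [lia|]. rewrite sum_n_Sm by lia.
destruct (Nat.eq_dec s0 (S N)) as [->|Ns].
- rewrite Z by (intros; apply H; lia). apply Rplus_0_l.
- rewrite IH by (try lia; intros; apply H; lia). rewrite (H (S N)) by lia. apply Rplus_0_r.
Qed.

(** Merges repeated exponents, as a list may contain the same exponent several times. *)
Fixpoint coefficient (l : list (R * R)) (e : R) : R :=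
  match l with nil => 0 | ce :: l => (if Req_EM_T (snd ce) e then fst ce else 0) + coefficient l e end.

Fixpoint truncated_sum (rr : R) (v : R -> R) (l : list (R * R)) : R :=
  match l with nil => 0 | ce :: l => (if Rle_dec (snd ce) rr then fst ce * v (snd ce) else 0) + truncated_sum rr v l end.

(** The enumeration is strictly increasing, so each retained exponent of the list is met by exactly
    one index. *)
Lemma sum_over_enumeration (U : R -> Prop) N lambda rr v l : increasing_enumeration U N lambda ->
  (forall c e, In (c, e) l -> e <= rr -> U e) ->
  sum_n_m (fun s => if Rle_dec (lambda s) rr then coefficient l (lambda s) * v (lambda s) else 0) 1 N = truncated_sum rr v l.
Proof.
intros [Hincr HU]. induction l as [|[c e] l IH]; intros Hl.
- simpl. rewrite (sum_n_m_ext _ (fun _ => 0)); [|intros s; destruct (Rle_dec (lambda s) rr); [as_R_eq; ring|reflexivity]].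
  rewrite sum_n_m_const. apply Rmult_0_r.
- simpl. rewrite <- IH by (intros c' e' Hin; apply (Hl c'), in_cons, Hin).
  rewrite (sum_n_m_ext _ (fun s => plus ((fun s => if Rle_dec (lambda s) rr then (if Req_EM_T e (lambda s) then c else 0) * v (lambda s) else 0) s)
     ((fun s => if Rle_dec (lambda s) rr then coefficient l (lambda s) * v (lambda s) else 0) s))).
  + rewrite sum_n_m_plus. unfold plus at 1; simpl. f_equal.
    destruct (Rle_dec e rr) as [L|L].
    * destruct (proj1 (HU e) (Hl c e (in_eq _ _) L)) as [s0 [Hs0 E0]].
      rewrite (sum_n_m_single _ s0 N Hs0).
      -- rewrite <- E0. destruct (Rle_dec e rr); [|contradiction]. destruct (Req_EM_T e e); [reflexivity|congruence].
      -- intros s Hs Ns. destruct (Rle_dec (lambda s) rr); [|reflexivity]. destruct (Req_EM_T e (lambda s)) as [Q|Q]; [exfalso|ring].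
         destruct (lt_eq_lt_dec s s0) as [[G|G]|G]; [|lia|].
         ++ generalize (Hincr s s0 ltac:(lia) G ltac:(lia)). lra.
         ++ generalize (Hincr s0 s ltac:(lia) G ltac:(lia)). lra.
    * rewrite (sum_n_m_ext _ (fun _ => 0)); [rewrite sum_n_m_const; apply Rmult_0_r|].
      intros s. destruct (Rle_dec (lambda s) rr) as [Q|Q]; [|reflexivity]. destruct (Req_EM_T e (lambda s)); [exfalso; lra|as_R_eq; ring].
  + intros s. destruct (Rle_dec (lambda s) rr); unfold plus; simpl; as_R_eq; ring.
Qed.

(** A dropped term has e > rr and tends to 0 even after multiplication by x^(-rr). *)
Lemma truncation_error (x : nat -> R) rr l : (forall n, 0 < x n) -> is_lim_seq x 0 ->
  is_lim_seq (fun n => Rpower (x n) (- rr) * eval x l n - truncated_sum rr (fun e => Rpower (x n) (e - rr)) l) 0.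
Proof.
intros Hx Hl. induction l as [|[c e] l IH].
- apply is_lim_seq_ext with (fun _ => 0); [intros n; simpl; ring|apply is_lim_seq_const].
- apply is_lim_seq_ext with (fun n => (c * Rpower (x n) (e - rr) - (if Rle_dec e rr then c * Rpower (x n) (e - rr) else 0))
    + (Rpower (x n) (- rr) * eval x l n - truncated_sum rr (fun e => Rpower (x n) (e - rr)) l)).
  + intros n. simpl. unfold Rminus at 2. rewrite Rpower_plus. unfold Rminus. rewrite !Rpower_plus. ring.
  + replace (Finite 0) with (Finite (0 + 0)) by (f_equal; ring). apply is_lim_seq_plus'; [|exact IH].
    destruct (Rle_dec e rr) as [L|L].
    * apply is_lim_seq_ext with (fun _ => 0); [intros n; ring|apply is_lim_seq_const].
    * apply is_lim_seq_ext with (fun n => c * Rpower (x n) (e - rr)); [intros n; ring|].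
      apply is_lim_seq_scal_0, is_lim_seq_Rpower_0; [lra|exact Hx|exact Hl].
Qed.

Lemma root_scale_lim a : 0 < a -> is_lim_seq (fun n => Rpower (INR n) (- a)) 0.
Proof.
intros Ha. apply is_lim_seq_incr_1.
apply is_lim_seq_ext with (fun n => Rpower (/ INR (S n)) a).
- intros n. apply Rpower_inv_base, lt_0_INR. lia.
- apply is_lim_seq_Rpower_0; [exact Ha| |apply is_lim_seq_inv_INR].
  intros n. apply Rinv_0_lt_compat, lt_0_INR. lia.
Qed.

(* With [h 1 = B / rho 1], the constants of the general formula collapse to powers of [B]. *)
Lemma one_pole_constants (B p A0 : R) : 0 < B -> 0 < p ->
  Rpower B (/ (p + 1)) + B / p * Rpower (Rpower B (/ (p + 1))) (- p) = (1 + 1 / p) * Rpower B (1 / (p + 1)) /\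
  Rpower (Rpower B (/ (p + 1))) (1 + p / 2 - A0) * / sqrt (2 * PI * (B / p * p * (p + 1)))
    = Rpower (2 * PI * (1 + p)) (- (1 / 2)) * Rpower B ((1 - 2 * A0) / (2 * (p + 1))).
Proof.
intros HB Hp. assert (PP := PI_RGT_0). split.
- replace (1 / (p + 1)) with (/ (p + 1)) by (field; lra). rewrite Rpower_mult.
  replace (Rpower B (/ (p + 1))) with (Rpower B (/ (p + 1) * - p) * B) at 1.
  + replace (Rpower B (/ (p + 1))) with (Rpower B (/ (p + 1) * - p) * B).
    * field. lra.
    * rewrite <- (Rpower_1 B) at 2 by exact HB. rewrite <- Rpower_plus. f_equal. field. lra.
  + rewrite <- (Rpower_1 B) at 2 by exact HB. rewrite <- Rpower_plus. f_equal. field. lra.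
- replace (2 * PI * (B / p * p * (p + 1))) with (2 * PI * (1 + p) * B) by (field; lra).
  assert (P1 : 0 < 2 * PI * (1 + p)) by (apply Rmult_lt_0_compat; lra).
  rewrite <- Rpower_sqrt by (apply Rmult_lt_0_compat; assumption). rewrite <- Rpower_Ropp, <- Rpower_mult_distr by assumption.
  rewrite Rpower_mult. replace (- / 2) with (- (1 / 2)) by field.
  replace ((1 - 2 * A0) / (2 * (p + 1))) with (/ (p + 1) * (1 + p / 2 - A0) + - (1 / 2)) by (field; lra).
  rewrite Rpower_plus. ring.
Qed.

Theorem theorem1
  (a b c d xi : nat -> R) (l0 : nat) (D : C -> C)
  (r : nat) (rho A : nat -> R) (C0 : R)
  (Hsetting : product_setting a b c d xi)
  (Hl0 : least_positive_index d l0)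
  (HD : dirichlet_series (Lambda a b xi) D)
  (HI : poles_condition D r rho A C0)
  (HII : vertical_growth_condition D C0)
  (HIII : lower_bound_condition a b (Lambda a b xi) l0 (rho r))
  (Hconvex : forall delta : R, 0 < delta ->
     0 < Derive_n (fun x => ln (PSeries d (exp (- x)))) 2 delta) :
  exists (N : nat) (lambda : nat -> R),
    increasing_enumeration (Upsilon r rho) N lambda /\
    exists (H : R) (P h : nat -> R) (K : nat -> nat -> R),
      asymp_equiv c (asymptotic_form r rho (A 0%nat) N lambda H P h K) /\
      (r = 1%nat ->
         (forall s l, K s l = 0) /\
         P 0%nat = 0 /\
         P 1%nat = (1 + 1 / rho 1%nat) *
                   Rpower (A 1%nat * Gamma (rho 1%nat + 1)) (1 / (rho 1%nat + 1)) /\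
         exists Theta : R,
           filterlim (fun s : C => Cminus (D s) (Cdiv (RtoC (A 0%nat)) s))
                     (locally' (RtoC 0)) (locally (RtoC Theta)) /\
           H = exp (Theta - euler_gamma * A 0%nat) *
               Rpower (2 * PI * (1 + rho 1%nat)) (- (1 / 2)) *
               Rpower (A 1%nat * Gamma (rho 1%nat + 1))
                      ((1 - 2 * A 0%nat) / (2 * (rho 1%nat + 1)))).
Proof.
assert (Hr := r_pos _ _ _ _ _ HI). assert (HrJ : S (pred r) = r) by lia.
assert (rr_pos := rho_pos _ _ _ _ _ r HI ltac:(lia)). assert (PP := PI_RGT_0).
destruct (Upsilon_enumeration D r rho A C0 HI) as [N [lambda Henum]]. exists N, lambda. split; [exact Henum|].
destruct (saddle_asymptotics a b c d xi l0 Hsetting Hl0 (rho r) rr_pos HIII D r rho A C0 HD HI HII eq_refl) as [Theta [HTheta HS]].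
set (hh := fun k => A (S k) * Gamma (rho (S k) + 1) / rho (S k)) in *.
set (rr := rho r) in *. set (J := pred r) in *.
assert (hh_pos : forall k, (k <= J)%nat -> 0 < hh k) by (intros k Hk; apply (h_pos D r rho A C0 HI k Hk)).
set (x := fun n => Rpower (INR n) (- / (rr + 1))).
assert (x_pos : forall n, 0 < x n) by (intros; apply exp_pos).
assert (x_lim : is_lim_seq x 0) by (apply root_scale_lim, Rinv_0_lt_compat; lra).
assert (x_pow : forall n e, Rpower (x n) (- e) = Rpower (INR n) (e / (rr + 1))).
{ intros n e. unfold x. rewrite Rpower_mult. f_equal. field. lra. }
(* For r = 1 there are no gaps between positive poles, so no exponent is generated; the guard then
   forces the list [l] to be empty, and all K vanish. *)
set (Lam := fun e => r <> 1%nat /\ exponent_semigroup r rho e).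
(* [rho J] is rho_(r-1), which is 0 if r = 1, so rr - rho J is the smallest gap. *)
destruct (approximate_saddle x J hh (fun k => rho (S k)) rr (rr - rho J) Lam) as [w [l [w_pos [w_lim [Hl [Hsad HE]]]]]].
- exact x_pos.
- exact x_lim.
- intros n Hn. rewrite x_pow. replace ((rr + 1) / (rr + 1)) with 1 by (field; lra). symmetry. apply Rpower_1, lt_0_INR. lia.
- exact rr_pos.
- exact hh_pos.
- intros k Hk. apply (rho_pos _ _ _ _ _ _ HI). lia.
- unfold rr. rewrite HrJ. reflexivity.
- apply (rho_gap_pos D r rho A C0 HI). apply le_n.
- intros k Hk. apply (rho_gap_min D r rho A C0 HI). exact Hk.
- intros e e' [H1 H2] [_ H3]. split; [exact H1|apply exponent_semigroup_add; assumption].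
- intros k Hk. split; [lia|apply exponent_semigroup_gen; exact Hk].
- set (w0 := Rpower (hh J * rr) (/ (rr + 1))) in *.
  assert (Hw0 : 0 < w0) by apply exp_pos.
  set (B0 := w0 + hh J * Rpower w0 (- rr)) in *.
  set (del := fun n => x n * w n) in *.
  assert (del_pos : forall n, 0 < del n) by (intros; apply Rmult_lt_0_compat; auto).
  assert (del_lim : is_lim_seq del 0).
  { replace (Finite 0) with (Finite (0 * w0)) by (f_equal; ring). apply is_lim_seq_mult'; assumption. }
  specialize (HS del del_pos del_lim Hsad).
  set (q := 1 + rr / 2 - A 0%nat) in *. set (Th := Theta - euler_gamma * A 0%nat) in *.
  set (V := / sqrt (2 * PI * (hh J * rr * (rr + 1)))) in *.
  assert (HV : 0 < V).
  { apply Rinv_0_lt_compat, sqrt_lt_R0. specialize (hh_pos J (le_n _)).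
    repeat first [assumption|lra|apply Rmult_lt_0_compat]. }
  set (E := fun n => del n * INR n + sum_n (fun k => hh k * Rpower (del n) (- rho (S k))) J) in *.
  (* The constant factors of [saddle_asymptotics], with del^q split into x^q w^q and w tending to
     [w0]. *)
  set (H := exp Th * Rpower w0 q * V).
  assert (HH : 0 < H) by (repeat first [assumption|apply exp_pos|apply Rmult_lt_0_compat]).
  set (P := fun i => if Nat.eq_dec i r then B0 else 0).
  set (h := fun i => if Nat.eq_dec i r then 1 else 0).
  (* Independent of the second index, because the weight [h] vanishes except at r. *)
  set (K := fun s (i : nat) => coefficient l (lambda s)).
  exists H, P, h, K. split.
  (* The exponent of the claimed form, in which terms with exponents beyond rr are already
     dropped. *)
  + set (M := fun n => Rpower (x n) (- rr) * B0 + truncated_sum rr (fun e => Rpower (x n) (e - rr)) l).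
    assert (EF : forall n, asymptotic_form r rho (A 0%nat) N lambda H P h K n = H * Rpower (x n) q * exp (M n)).
    { intros n. unfold asymptotic_form. fold rr. f_equal; [f_equal|f_equal].
      - replace q with (- - q) by ring. rewrite x_pow. f_equal. unfold q. field. lra.
      - unfold M. f_equal.
        + apply sum_n_last_only.
          * intros k Hk. unfold P. destruct (Nat.eq_dec k r); [lia|ring].
          * unfold P. destruct (Nat.eq_dec r r); [|lia]. fold rr. rewrite x_pow. ring.
        + apply sum_n_last_only.
          * intros k Hk. unfold h. destruct (Nat.eq_dec k r); [lia|ring].
          * unfold h. destruct (Nat.eq_dec r r); [|lia]. fold rr. rewrite Rmult_1_l.
            rewrite <- (sum_over_enumeration (Upsilon r rho) N lambda rr (fun e => Rpower (x n) (e - rr)) l Henum).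
            -- apply sum_n_m_ext. intros s. unfold K. destruct (Rle_dec (lambda s) rr); [|reflexivity].
               replace (lambda s - rr) with (- (rr - lambda s)) by ring. rewrite x_pow. reflexivity.
            -- intros c0 e0 Hin Hle. destruct (Hl c0 e0 Hin) as [[_ H1] H2]. apply (exponent_in_Upsilon D r rho A C0 HI e0 H1). split; [exact H2|exact Hle]. }
    assert (LE : is_lim_seq (fun n => exp (E n - M n)) 1).
    { rewrite <- exp_0. apply (is_lim_seq_continuous exp); [apply derivable_continuous_pt, derivable_pt_exp|].
      apply is_lim_seq_ext with (fun n => (E n - Rpower (x n) (- rr) * (B0 + eval x l n))
        + (Rpower (x n) (- rr) * eval x l n - truncated_sum rr (fun e => Rpower (x n) (e - rr)) l)).
      - intros n. unfold M. ring.
      - replace (Finite 0) with (Finite (0 + 0)) by (f_equal; ring). apply is_lim_seq_plus'; [exact HE|].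
        apply truncation_error; assumption. }
    assert (LW : is_lim_seq (fun n => Rpower (w n) q) (Rpower w0 q)).
    { apply (is_lim_seq_continuous (fun z => Rpower z q)); [|exact w_lim].
      apply derivable_continuous_pt. eexists. apply derivable_pt_lim_power, Hw0. }
    assert (LL := is_lim_seq_mult' _ _ _ _ (is_lim_seq_mult' _ _ _ _ HS LE)
      (is_lim_seq_mult' _ _ _ _ LW (is_lim_seq_const (exp Th / H)))).
    unfold asymp_equiv. replace (Finite 1) with (Finite (V * 1 * (Rpower w0 q * (exp Th / H)))).
    * refine (is_lim_seq_ext _ _ _ _ LL). intros n. cbv beta. rewrite EF.
      change (c n / (exp (E n) * (Rpower (del n) q * exp Th)) * exp (E n - M n) * (Rpower (w n) q * (exp Th / H))
        = c n / (H * Rpower (x n) q * exp (M n))).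
      unfold Rminus. rewrite (exp_plus (E n)), exp_Ropp. unfold del. rewrite <- Rpower_mult_distr by auto.
      assert (Q1 := exp_pos (E n)). assert (Q2 := exp_pos (M n)). assert (Q3 : 0 < Rpower (x n) q) by apply exp_pos.
      assert (Q4 : 0 < Rpower (w n) q) by apply exp_pos. assert (Q5 := exp_pos Th). field. repeat split; lra.
    * f_equal. unfold H. assert (Q1 := exp_pos Th). assert (Q2 : 0 < Rpower w0 q) by apply exp_pos. field. repeat split; lra.
  + intros Hr1. assert (Hl_nil : l = nil).
    { destruct l as [|[c0 e] l]; [reflexivity|]. destruct (Hl c0 e (in_eq _ _)) as [[Hne _] _]. contradiction. }
    assert (Err : rr = rho 1%nat) by (unfold rr; rewrite Hr1; reflexivity).
    assert (EJ : J = 0%nat) by (unfold J; rewrite Hr1; reflexivity).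
    assert (HB : 0 < A 1%nat * Gamma (rho 1%nat + 1)).
    { apply Rmult_lt_0_compat; [apply (A_pos _ _ _ _ _ HI); lia|]. rewrite Gamma_gam by lra. apply gam_pos. lra. }
    destruct (one_pole_constants _ (rho 1%nat) (A 0%nat) HB ltac:(lra)) as [K1 K2].
    assert (Eh : hh J = A 1%nat * Gamma (rho 1%nat + 1) / rho 1%nat) by (rewrite EJ; reflexivity).
    assert (Ew0 : w0 = Rpower (A 1%nat * Gamma (rho 1%nat + 1)) (/ (rho 1%nat + 1))).
    { unfold w0. rewrite Eh, Err. f_equal. field. lra. }
    repeat split.
    * intros s i. unfold K. rewrite Hl_nil. reflexivity.
    * unfold P. destruct (Nat.eq_dec 0 r); [lia|reflexivity].
    * unfold P. destruct (Nat.eq_dec 1 r); [|lia]. unfold B0. rewrite Eh, Ew0, Err. exact K1.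
    * exists Theta. split; [exact HTheta|]. unfold H, V, q, Th. rewrite Eh, Ew0, Err.
      rewrite Rmult_assoc, K2. ring.
Qed.
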